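(* Let $p$ be a prime, let $k$ be a field of characteristic $p$, and let $G$ be a finite $p$-group which does not have the elementary abelian $p$-group of order $p^2$ as a direct factor. Denote by $C$ the largest central elementary abelian subgroup of $G$. Suppose that $\zeta_1,\ldots,\zeta_d$ are homogeneous elements of $H^*(G,k)$ such that the restrictions $\operatorname{Res}_C(\zeta_1),\ldots,\operatorname{Res}_C(\zeta_d)$ form a homogeneous system of parameters for $H^*(C,k)$. Then the essential ideal $\operatorname{Ess}(G)$ in $H^*(G,k)$ is free and finitely generated as a module over the polynomial algebra $k[\zeta_1,\ldots,\zeta_d]$.
   Context: $H^*(G,k)$ denotes the (graded commutative) cohomology ring of $G$ with coefficients in the trivial module $k$, and $\operatorname{Res}_C\colon H^*(G,k)\to H^*(C,k)$ is restriction. The essential ideal $\operatorname{Ess}(G) \subseteq H^*(G,k)$ consists of those cohomology classes whose restriction to every proper subgroup of $G$ is zero. A homogeneous system of parameters for a finitely generated connected graded commutative $k$-algebra $T$ is a sequence of homogeneous elements of $T$ which are algebraically independent over $k$ and such that $T$ is a finitely generated module over the polynomial subalgebra they generate. *)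

(* Defs.v *)
From HB Require Import structures.
From mathcomp Require Import all_boot all_order all_algebra all_fingroup all_solvable.
From mathcomp Require Import finmap generic_quotient ring_quotient boolp ring zify.
From mathcomp.multinomials Require mpoly.
From mathcomp.multinomials Require Import monalg.

Set Implicit Arguments.
Unset Strict Implicit.
Unset Printing Implicit Defensive.

Import GRing.Theory.
Local Open Scope quotient_scope.
Local Open Scope ring_scope.

(* Group cohomology via inhomogeneous (bar) cochains. Since gT is finite, the
   total complex \bigoplus_n Fun(gT^n, k) is the space of finitely supported
   functions on words in gT, where C^n = Fun(gT^n, k) is the part supported on
   words of length n. Under concatenation of words, the convolution product of
   {malg k[bar gT]} is the cup product of cochains: see cupE. *)
Definition bar (gT : Type) := seq gT.

Section BarMonoid.
Variable gT : finGroupType.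
HB.instance Definition _ := Choice.on (bar gT).

Lemma bar_unit (x y : bar gT) : x ++ y = [::] -> x = [::] /\ y = [::].
Proof. by case: x y => [|? ?] [|? ?]. Qed.

HB.instance Definition _ := Choice_isMonomialDef.Build (bar gT)
  (@catA gT) (@cat0s gT) (@cats0 gT) bar_unit.
End BarMonoid.

Notation cochain k gT := {malg k[bar gT]}.

(* On w = [g_1|...|g_n] (n > 0): face 0 drops g_1, face i (0 < i < n) replaces
   g_i, g_(i+1) by their product, and face n drops g_n. Only used for i <= n. *)
Fixpoint face (gT : finGroupType) (i : nat) (w : seq gT) {struct w} : seq gT :=
  match i, w with
  | _, [::] => [::]
  | 0, _ :: v => v
  | 1, [:: x] => [::]
  | 1, x :: y :: v => (x * y)%g :: v
  | j.+1, x :: v => x :: face j v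
  end.

Section Face.
Variable gT : finGroupType.
Implicit Types (w : seq gT) (i j : nat).

Lemma face0 w : face 0 w = behead w.
Proof. by case: w. Qed.

Lemma face_last w : face (size w) w = take (size w).-1 w.
Proof.
elim: w => [|x [|y w] IH] //=.
by move: IH => /= ->.
Qed.

Lemma face_le i j w : (i <= j)%N -> (j < size w)%N ->
  take j (face i w) = face i (take j.+1 w) /\ drop j (face i w) = drop j.+1 w.
Proof.
elim: w i j => [|x w IH] [|[|i]] [|j] //=.
- by case: w {IH}.
- rewrite !ltnS => le_ij lt_j; have [] := IH i.+1 j le_ij lt_j.
  by case: w {IH} lt_j => //= y w lt_j -> ->.
Qed.

Lemma face_gt i j w : (j < i)%N -> (i <= size w)%N ->
  take j (face i w) = take j w /\ drop j (face i w) = face (i - j) (drop j w).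
Proof.
elim: w i j => [|x w IH] [|[|i]] [|j] //=; rewrite ?take0 ?drop0 //.
rewrite !ltnS => lt_j le_i; have [//|//|-> ->] := IH i.+1 j.
by rewrite !subSS.
Qed.

Lemma size_face i w : (i <= size w)%N -> size (face i w) = (size w).-1.
Proof.
elim: w i => [|x w IH] [|[|i]] //=; first by case: w {IH}.
by case: w IH => // y w IH; rewrite ltnS => /IH ->.
Qed.

End Face.

Arguments face : simpl never.

Section Cochains.
Variables (k : fieldType) (gT : finGroupType).
Implicit Types (f g : cochain k gT) (w : seq gT).

Definition deg_bound f : nat := \max_(w <- msupp f) size w.

(* The coboundary with trivial coefficients: on C^n it is
   (df)(g_1, ..., g_(n+1)) = \sum_(i <= n+1) (-1)^i f(face i (g_1, ..., g_(n+1))).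
   The words of length 0 are left out: d maps into positive degrees. The bound
   on n only serves to make the sum finite: see codiffE. *)
Definition codiff f : cochain k gT :=
  \sum_(n < (deg_bound f).+1) \sum_(t : n.+1.-tuple gT)
     << \sum_(i < n.+2) (-1) ^+ i * f@_(face i t : bar gT) *g (tval t : bar gT) >>.

Lemma deg_boundP f w : (deg_bound f < size w)%N -> f@_(w : bar gT) = 0.
Proof.
move=> lt_w; apply/eqP; rewrite mcoeff_eq0; apply: contraL lt_w => w_in.
by rewrite -leqNgt /deg_bound (big_rem w) //= leq_maxl.
Qed.

Lemma mcoeff_words n (E : seq gT -> k) w :
  (\sum_(t : n.-tuple gT) << E t *g (tval t : bar gT) >>)@_(w : bar gT)
   = if size w == n then E w else 0.
Proof.
rewrite raddf_sum /=; case: eqP => [sz_w|ne_w].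
  move: E; rewrite -sz_w => E.
  rewrite (bigD1 (in_tuple w)) //= mcoeffUU big1 ?addr0 // => t.
  by rewrite mcoeffU -val_eqE /= => /negbTE ->.
rewrite big1 // => t _; rewrite mcoeffU; case: eqP => // eq_w.
by case: ne_w; rewrite -eq_w size_tuple.
Qed.

Lemma codiffE f w : (codiff f)@_(w : bar gT) =
  if w is [::] then 0
  else \sum_(0 <= i < (size w).+1) (-1) ^+ i * f@_(face i w : bar gT).
Proof.
rewrite raddf_sum /=.
under eq_bigr => n _ do rewrite (mcoeff_words n.+1
  (fun t => \sum_(i < n.+2) (-1) ^+ i * f@_(face i t : bar gT))).
case: w => [|x w]; first by rewrite big1.
rewrite -big_mkcond /=.
have [le_n|gt_n] := leqP (size w) (deg_bound f).
  rewrite (big_pred1 (Ordinal (le_n : size w < (deg_bound f).+1)%N)).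
    by rewrite big_mkord.
  by move=> i; rewrite /= eqSS eq_sym -val_eqE.
rewrite big1 => [|i /eqP[eq_i]]; last by have := ltn_ord i; rewrite -eq_i; lia.
rewrite big1_seq // => i; rewrite mem_index_iota => /andP[_ /andP[_ lt_i]].
by rewrite deg_boundP ?mulr0 // size_face.
Qed.

Lemma codiffE_gt0 f w : (0 < size w)%N -> (codiff f)@_(w : bar gT) =
  \sum_(0 <= i < (size w).+1) (-1) ^+ i * f@_(face i w : bar gT).
Proof. by rewrite codiffE; case: w. Qed.

Lemma codiff_is_linear : linear codiff.
Proof.
move=> a f g; apply/malgP => w; rewrite mcoeffD mcoeffZ !codiffE.
case: w => [|x w]; first by rewrite mulr0 addr0.
rewrite mulr_sumr -big_split; apply: eq_bigr => i _.
by rewrite mcoeffD mcoeffZ mulrDr mulrCA.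
Qed.
HB.instance Definition _ :=
  GRing.isLinear.Build k (cochain k gT) (cochain k gT) *:%R codiff codiff_is_linear.

Lemma cupE f g w : (f * g)@_(w : bar gT) =
  \sum_(0 <= j < (size w).+1) f@_(take j w : bar gT) * g@_(drop j w : bar gT).
Proof.
have expand (h : cochain k gT) (v : bar gT) : h@_v = \sum_(u <- msupp h) h@_u *+ (u == v).
  rewrite [LHS](congr1 (mcoeff _) (monalgE h)) raddf_sum /=.
  by apply: eq_bigr => u _; rewrite mcoeffU.
rewrite mcoeffMl [RHS](eq_bigr (fun j => \sum_(u <- msupp f) \sum_(v <- msupp g)
  (f@_u * g@_v) *+ ((u == take j w) && (v == drop j w)))); last first.
  move=> j _; rewrite (expand f) (expand g) mulr_suml; apply: eq_bigr => u _.
  rewrite mulr_sumr; apply: eq_bigr => v _.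
  by rewrite mulrnAl mulrnAr -mulrnA mulnb andbC.
rewrite [RHS]exchange_big; apply: eq_bigr => u _.
rewrite [RHS]exchange_big; apply: eq_bigr => v _ /=.
case: eqP => [<-|ne_w].
  rewrite -[mmul u v]/(u ++ v) (bigD1_seq (size u)) ?iota_uniq //=; last first.
    by rewrite mem_index_iota size_cat; lia.
  rewrite take_size_cat // drop_size_cat // !eqxx big1_seq ?addr0 // => j.
  rewrite mem_index_iota /= => /andP[ne_j le_j]; case: andP => // -[/eqP eq_u _].
  by case/eqP: ne_j; rewrite eq_u size_takel.
rewrite big1 // => j _; case: andP => // -[/eqP eq_u /eqP eq_v].
by case: ne_w; rewrite -[mmul u v]/(u ++ v) eq_u eq_v cat_take_drop.
Qed.

(* The grading involution, (-1)^n on C^n, giving the sign in the Leibniz rule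
   codiffM. *)
Definition grsign f : cochain k gT :=
  \sum_(w <- msupp f) << (-1) ^+ size w * f@_w *g w >>.

Lemma grsignE f w : (grsign f)@_(w : bar gT) = (-1) ^+ size w * f@_(w : bar gT).
Proof.
rewrite raddf_sum /= [in RHS](monalgE f) raddf_sum /= mulr_sumr.
by apply: eq_bigr => v _; rewrite !mcoeffU; case: eqP => [->|_]; rewrite ?mulr0.
Qed.

Lemma grsignK : involutive grsign.
Proof. by move=> f; apply/malgP => w; rewrite !grsignE signrMK. Qed.

Lemma codiff_grsign f : codiff (grsign f) = - grsign (codiff f).
Proof.
apply/malgP => w; rewrite mcoeffN grsignE !codiffE.
case: w => [|x w]; first by rewrite mulr0 oppr0.
rewrite mulr_sumr -sumrN; apply: eq_big_nat => i /andP[_ lt_i].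
rewrite grsignE size_face //= [in RHS]exprS; ring.
Qed.

Lemma codiffM f g : codiff (f * g) = codiff f * g + grsign f * codiff g.
Proof.
apply/malgP => w; rewrite mcoeffD !cupE codiffE.
case: w => [|x w]; first by rewrite !big_nat1 !codiffE mul0r mulr0 addr0.
set v := x :: w; set n := size w.
have szv : size v = n.+1 by [].
clearbody v n => {x w}.
pose T j i : k := f@_(face i (take j.+1 v) : bar gT) * g@_(drop j.+1 v : bar gT).
pose U j i : k := f@_(take j v : bar gT) * g@_(face i (drop j v) : bar gT).
transitivity (\sum_(0 <= j < n.+1)
  (\sum_(0 <= i < j.+1) (-1) ^+ i * T j i
   + \sum_(1 <= i < (n.+1 - j).+1) (-1) ^+ (i + j) * U j i)).
  transitivity (\sum_(0 <= j < n.+1) \sum_(0 <= i < n.+2)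
     (-1) ^+ i * (f@_(take j (face i v) : bar gT) * g@_(drop j (face i v) : bar gT))).
    rewrite szv exchange_big_nat; apply: eq_big_nat => i /andP[_ lt_i].
    by rewrite cupE size_face szv ?mulr_sumr.
  apply: eq_big_nat => j /andP[_ lt_j].
  rewrite (big_cat_nat _ (n := j.+1)) //=; last by lia.
  congr (_ + _).
    apply: eq_big_nat => i /andP[_ lt_i].
    by have [|| -> ->] := @face_le gT i j v; rewrite // szv.
  have -> : n.+2 = ((n.+1 - j).+1 + j)%N by lia.
  rewrite -[j.+1]add1n big_addn addnK; apply: eq_big_nat => i /andP[gt_i lt_i].
  by have [|| -> ->] := @face_gt gT (i + j) j v; rewrite ?szv ?addnK //; lia.
rewrite szv [X in _ = X + _]big_nat_recl //= [X in _ = _ + X]big_nat_recr //=.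
rewrite -szv take_size drop_size take0 !codiffE mul0r mulr0 add0r addr0 szv.
rewrite -big_split /=; apply: eq_big_nat => j /andP[_ lt_j].
have sz_take : size (take j.+1 v) = j.+1 by rewrite size_take szv; case: ifP => //; lia.
have sz_drop : size (drop j v) = (n.+1 - j)%N by rewrite size_drop szv.
rewrite !codiffE_gt0 ?sz_take ?sz_drop ?subn_gt0 //.
have face_tk : face j.+1 (take j.+1 v) = take j v.
  by have := face_last (take j.+1 v); rewrite sz_take take_takel.
rewrite [in RHS]big_nat_recr //= face_tk.
rewrite [X in _ = _ + _ * X]big_nat_recl //= face0 -drop1 drop_drop add1n.
rewrite grsignE size_takel ?szv 1?ltnW // expr0 mul1r exprS.
rewrite mulrDl mulrDr -!addrA; congr (_ + _).
  by rewrite mulr_suml; apply: eq_bigr => i _; rewrite mulrA.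
rewrite mulN1r !mulNr addKr big_add1 /= mulr_sumr.
by apply: eq_bigr => i _; rewrite /U exprD; ring.
Qed.


Lemma codiff1 : codiff (1 : cochain k gT) = 0.
Proof.
apply/malgP => w; rewrite codiffE mcoeff0.
case: w => [//|x [|y w]].
  rewrite [size _]/= big_nat_recl // big_nat1 !face0 expr1 expr0 mcoeff1.
  by rewrite mul1r mulN1r subrr.
rewrite big1_seq // => i; rewrite mem_index_iota ltnS => /andP[_ /andP[_ le_i]].
rewrite mcoeff1; case: eqP => [eq_w|_]; last by rewrite mulr0.
by have := size_face le_i; rewrite eq_w.
Qed.

Lemma codiffK f : codiff (codiff f) = 0.
Proof.
have codiffKM g h : codiff (codiff (g * h)) =
    codiff (codiff g) * h + g * codiff (codiff h).
  rewrite codiffM linearD /= !codiffM codiff_grsign grsignK mulNr addrA.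
  by rewrite addrK.
have codiffKU x : codiff (codiff (<< [:: x] >> : cochain k gT)) = 0.
  apply/malgP => w; rewrite mcoeff0.
  have [w3|ne_w3] := eqVneq (size w) 3.
    case: w w3 => [|a [|b [|c []]]] // _.
    rewrite codiffE_gt0 // [size _]/= !(big_nat_recl, big_geq) //.
    rewrite !codiffE_gt0 // [face _ _]/face ![size _]/= !(big_nat_recl, big_geq) //.
    by rewrite /face mulgA; ring.
  case: w ne_w3 => [|a w] ne_w3; first by rewrite codiffE.
  rewrite codiffE_gt0 // big1_seq // => i.
  rewrite mem_index_iota ltnS => /andP[_ /andP[_ le_i]].
  have sz_i := size_face le_i; rewrite codiffE.
  case E: (face i _) => [|y v]; rewrite ?mulr0 // -E.
  rewrite big1_seq ?mulr0 // => j; rewrite mem_index_iota ltnS => /andP[_ /andP[_ le_j]].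
  rewrite mcoeffU1; case: eqP => [eq_x|_]; last by rewrite mulr0.
  have := size_face le_j; rewrite -eq_x sz_i; move: ne_w3 => /=; case: (size w) => [|[|[]]] //.
have codiffKw (w : bar gT) : codiff (codiff (<< w >> : cochain k gT)) = 0.
  elim: w => [|x w IH]; first by rewrite codiff1 linear0.
  have -> : << (x :: w : bar gT) >> = << ([:: x] : bar gT) >> * << w >> :> cochain k gT.
    by rewrite malgM_def fgmulUU mulr1.
  by rewrite codiffKM codiffKU IH mul0r mulr0 addr0.
transitivity (\sum_(w <- msupp f) codiff (codiff << f@_w *g w >>)).
  by rewrite -!linear_sum -monalgE.
rewrite big1 // => w _.
have -> : << f@_w *g w >> = f@_w *: << w >> :> cochain k gT.
  by apply/malgP => v; rewrite mcoeffZ !mcoeffU mulrnAr mulr1.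
by rewrite !linearZ /= codiffKw scaler0.
Qed.

End Cochains.

Section Cohomology.
Variables (k : fieldType) (gT : finGroupType).

Definition is_cocycle : {pred cochain k gT} := [pred f | codiff f == 0].

Lemma is_cocycle_subalg : subalg_closed is_cocycle.
Proof.
split=> [|a f g /eqP df /eqP dg|f g /eqP df /eqP dg]; rewrite !inE.
- by rewrite codiff1.
- by rewrite linearP /= df dg scaler0 addr0.
- by rewrite codiffM df dg mul0r mulr0 addr0.
Qed.
HB.instance Definition _ := GRing.isSubalgClosed.Build k (cochain k gT) is_cocycle
  is_cocycle_subalg.

Record cocycle := Cocycle { cocycle_val : cochain k gT; _ : cocycle_val \in is_cocycle }.
HB.instance Definition _ := [isSub for cocycle_val].
HB.instance Definition _ := [Choice of cocycle by <:].
HB.instance Definition _ := [SubChoice_isSubLalgebra of cocycle by <:].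

Definition is_coboundary : {pred cocycle} :=
  fun z => `[< exists f : cochain k gT, codiff f = \val z >].

Lemma is_coboundary_zmod : zmod_closed is_coboundary.
Proof.
split=> [|x y /asboolP[f df] /asboolP[g dg]]; apply/asboolP.
  by exists 0; rewrite linear0 raddf0.
by exists (f - g); rewrite linearB raddfB /= df dg.
Qed.
HB.instance Definition _ := GRing.isZmodClosed.Build cocycle is_coboundary
  is_coboundary_zmod.

Lemma is_coboundaryMl (z b : cocycle) : b \in is_coboundary -> z * b \in is_coboundary.
Proof.
case/asboolP=> f df; apply/asboolP; exists (grsign (\val z) * f).
have /eqP dz := valP z.
have grsign0 : grsign 0 = 0 :> cochain k gT.
  by apply/malgP => w; rewrite grsignE mcoeff0 mulr0.
by rewrite codiffM codiff_grsign dz grsign0 oppr0 mul0r add0r grsignK df rmorphM.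
Qed.

Lemma is_coboundaryMr (z b : cocycle) : b \in is_coboundary -> b * z \in is_coboundary.
Proof.
case/asboolP=> f df; apply/asboolP; exists (f * \val z).
have /eqP dz := valP z.
by rewrite codiffM dz mulr0 addr0 df rmorphM.
Qed.

Lemma is_coboundaryZ (a : k) (b : cocycle) : b \in is_coboundary -> a *: b \in is_coboundary.
Proof.
case/asboolP=> f df; apply/asboolP; exists (a *: f).
by rewrite !linearZ /= df.
Qed.

Lemma one_not_coboundary : (1 : cocycle) \notin is_coboundary.
Proof.
apply/negP => /asboolP[f /(congr1 (mcoeff ([::] : bar gT)))].
rewrite codiffE (_ : \val (1 : cocycle) = 1) // mcoeff1 eqxx => /eqP.
by rewrite eq_sym oner_eq0.
Qed.

(* The total cohomology ring, ker d / im d. *)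
Definition cohomology := Quotient.quot is_coboundary.
HB.instance Definition _ := Choice.on cohomology.
HB.instance Definition _ := GRing.Zmodule.on cohomology.
HB.instance Definition _ := EqQuotient.on cohomology.
HB.instance Definition _ := ZmodQuotient.on cohomology.

Definition coh_class (z : cocycle) : cohomology := \pi_cohomology z.

Lemma class_eq z z' : (coh_class z == coh_class z') = (z - z' \in is_coboundary).
Proof. by rewrite Quotient.idealrBE. Qed.

Lemma classP x : exists z, x = coh_class z.
Proof. by exists (repr x); rewrite /coh_class reprK. Qed.

Lemma class_is_additive : zmod_morphism coh_class.
Proof. exact: raddfB. Qed.
HB.instance Definition _ := GRing.isZmodMorphism.Build cocycle cohomology coh_class
  class_is_additive.

(* Defined on chosen representatives; see classM and classZ. *)
Definition cup (x y : cohomology) : cohomology := coh_class (repr x * repr y).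
Definition scale_class (a : k) (x : cohomology) : cohomology := coh_class (a *: repr x).

Lemma repr_class z : repr (coh_class z) - z \in is_coboundary.
Proof. by rewrite -class_eq /coh_class reprK. Qed.

Lemma class_mul z z' : cup (coh_class z) (coh_class z') = coh_class (z * z').
Proof.
apply/eqP; rewrite class_eq.
rewrite -[_ - _](subrKA (z * repr (coh_class z'))) -mulrBl -mulrBr.
by apply: rpredD; [apply: is_coboundaryMr|apply: is_coboundaryMl]; apply: repr_class.
Qed.

Lemma class_scale a z : scale_class a (coh_class z) = coh_class (a *: z).
Proof. by apply/eqP; rewrite class_eq -scalerBr; apply/is_coboundaryZ/repr_class. Qed.

Lemma cupA : associative cup.
Proof.
move=> x y z; have [u ->] := classP x; have [v ->] := classP y; have [w ->] := classP z.
by rewrite !class_mul mulrA.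
Qed.

Lemma cup1x : left_id (coh_class 1) cup.
Proof. by move=> x; have [u ->] := classP x; rewrite class_mul mul1r. Qed.

Lemma cupx1 : right_id (coh_class 1) cup.
Proof. by move=> x; have [u ->] := classP x; rewrite class_mul mulr1. Qed.

Lemma cupDl : left_distributive cup +%R.
Proof.
move=> x y z; have [u ->] := classP x; have [v ->] := classP y; have [w ->] := classP z.
by rewrite -raddfD !class_mul -raddfD mulrDl.
Qed.

Lemma cupDr : right_distributive cup +%R.
Proof.
move=> x y z; have [u ->] := classP x; have [v ->] := classP y; have [w ->] := classP z.
by rewrite -raddfD !class_mul -raddfD mulrDr.
Qed.

Lemma class1_neq0 : coh_class 1 != 0.
Proof. by rewrite -(raddf0 coh_class) class_eq subr0 one_not_coboundary. Qed.

HB.instance Definition _ := GRing.Zmodule_isNzRing.Build cohomology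
  cupA cup1x cupx1 cupDl cupDr class1_neq0.

Lemma scale_classA a b x : scale_class a (scale_class b x) = scale_class (a * b) x.
Proof. by have [u ->] := classP x; rewrite !class_scale scalerA. Qed.

Lemma scale_class1 : left_id 1 scale_class.
Proof. by move=> x; have [u ->] := classP x; rewrite class_scale scale1r. Qed.

Lemma scale_classDr : right_distributive scale_class +%R.
Proof.
move=> a x y; have [u ->] := classP x; have [v ->] := classP y.
by rewrite -raddfD !class_scale -raddfD scalerDr.
Qed.

Lemma scale_classDl x : {morph scale_class^~ x : a b / a + b}.
Proof.
by move=> a b; have [u ->] := classP x; rewrite !class_scale -raddfD scalerDl.
Qed.

HB.instance Definition _ := GRing.Zmodule_isLmodule.Build k cohomology
  scale_classA scale_class1 scale_classDr scale_classDl.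

Lemma classM z z' : coh_class (z * z') = coh_class z * coh_class z'.
Proof. by rewrite -class_mul. Qed.

Lemma classZ a z : coh_class (a *: z) = a *: coh_class z.
Proof. by rewrite -class_scale. Qed.

Lemma scale_cupAl a (x y : cohomology) : a *: (x * y) = (a *: x) * y.
Proof.
have [u ->] := classP x; have [v ->] := classP y.
by rewrite -classM -!classZ -classM scalerAl.
Qed.
HB.instance Definition _ := GRing.Lmodule_isLalgebra.Build k cohomology scale_cupAl.

Lemma scale_cupAr a (x y : cohomology) : a *: (x * y) = x * (a *: y).
Proof.
have [u ->] := classP x; have [v ->] := classP y.
rewrite -classM -!classZ -classM.
congr coh_class; apply/val_inj/malgP => w.
have valM (s t : cocycle) : \val (s * t) = \val s * \val t by [].
have valZ (s : cocycle) : \val (a *: s) = a *: \val s by [].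
rewrite valM !valZ valM mcoeffZ !cupE mulr_sumr; apply: eq_bigr => i _.
by rewrite mcoeffZ mulrCA.
Qed.
HB.instance Definition _ := GRing.Lalgebra_isAlgebra.Build k cohomology scale_cupAr.

Lemma class_is_monoid_morphism : monoid_morphism coh_class.
Proof. by split=> // z z'; apply: classM. Qed.
HB.instance Definition _ := GRing.isMonoidMorphism.Build cocycle cohomology coh_class
  class_is_monoid_morphism.

Lemma class_is_scalable : scalable coh_class.
Proof. exact: classZ. Qed.
HB.instance Definition _ := GRing.isScalable.Build k cocycle cohomology *:%R coh_class
  class_is_scalable.

Definition cochain_homogeneous (n : nat) (f : cochain k gT) : Prop :=
  forall w : bar gT, w \in msupp f -> size w = n.

Definition homogeneous (x : cohomology) : Prop :=
  exists n (z : cocycle), cochain_homogeneous n (\val z) /\ x = coh_class z.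

End Cohomology.

Arguments is_cocycle {k gT}.
Arguments is_coboundary {k gT}.

Section Functoriality.
Variables (k : fieldType) (aT rT : finGroupType) (phi : aT -> rT).
Hypothesis phiM : {morph phi : x y / (x * y)%g}.
Implicit Type f g : cochain k rT.

Definition cochain_pullback f : cochain k aT :=
  \sum_(n < (deg_bound f).+1) \sum_(t : n.-tuple aT)
    << f@_(map phi t : bar rT) *g (tval t : bar aT) >>.

Lemma cochain_pullbackE f (w : seq aT) :
  (cochain_pullback f)@_(w : bar aT) = f@_(map phi w : bar rT).
Proof.
rewrite raddf_sum /=.
under eq_bigr => n _ do rewrite (mcoeff_words n (fun t => f@_(map phi t : bar rT))).
rewrite -big_mkcond /=; have [le_n|gt_n] := leqP (size w) (deg_bound f).
  by rewrite (big_pred1 (Ordinal (le_n : size w < (deg_bound f).+1)%N)).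
rewrite big1 ?deg_boundP ?size_map // => i /eqP eq_i.
Qed.

Lemma map_face i (w : seq aT) : map phi (face i w) = face i (map phi w).
Proof.
elim: w i => [|x w IH] [|[|i]] //; first by case: w {IH} => //= y w; rewrite /face phiM.
exact: (congr1 (cons (phi x)) (IH i.+1)).
Qed.

Lemma cochain_pullback_codiff f :
  cochain_pullback (codiff f) = codiff (cochain_pullback f).
Proof.
apply/malgP => w; rewrite cochain_pullbackE !codiffE; case: w => [//|x w] /=.
rewrite size_map; apply: eq_bigr => i _.
by rewrite cochain_pullbackE map_face.
Qed.

Lemma cochain_pullback_is_linear : linear cochain_pullback.
Proof.
by move=> a f g; apply/malgP => w; rewrite !(mcoeffD, mcoeffZ, cochain_pullbackE).
Qed.
HB.instance Definition _ := GRing.isLinear.Build k (cochain k rT) (cochain k aT)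
  *:%R cochain_pullback cochain_pullback_is_linear.

Lemma cochain_pullback_is_monoid_morphism : monoid_morphism cochain_pullback.
Proof.
split=> [|f g]; apply/malgP => w.
  by rewrite cochain_pullbackE !mcoeff1; case: w.
rewrite cochain_pullbackE !cupE size_map; apply: eq_bigr => i _.
by rewrite !cochain_pullbackE map_take map_drop.
Qed.

Lemma cochain_pullback_cocycle f :
  f \in is_cocycle -> cochain_pullback f \in is_cocycle.
Proof.
by move/eqP=> df; apply/eqP; rewrite -cochain_pullback_codiff df linear0.
Qed.

Definition cocycle_pullback (z : cocycle k rT) : cocycle k aT :=
  Cocycle (cochain_pullback_cocycle (valP z)).

(* Defined on chosen representatives; see cohomology_pullbackE. *)
Definition cohomology_pullback (x : cohomology k rT) : cohomology k aT :=
  coh_class (cocycle_pullback (repr x)).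

Lemma cohomology_pullbackE z :
  cohomology_pullback (coh_class z) = coh_class (cocycle_pullback z).
Proof.
apply/eqP; rewrite class_eq; have /asboolP[f df] := repr_class z.
apply/asboolP; exists (cochain_pullback f).
by rewrite -cochain_pullback_codiff df !raddfB.
Qed.

Lemma cohomology_pullback_is_linear : linear cohomology_pullback.
Proof.
move=> a x y; have [u ->] := classP x; have [v ->] := classP y.
rewrite -classZ -raddfD !cohomology_pullbackE -classZ -raddfD; congr coh_class.
by apply/val_inj; exact: cochain_pullback_is_linear.
Qed.
HB.instance Definition _ := GRing.isLinear.Build k (cohomology k rT)
  (cohomology k aT) *:%R cohomology_pullback cohomology_pullback_is_linear.

Lemma cohomology_pullback_is_monoid_morphism : monoid_morphism cohomology_pullback.
Proof.
have [pullback1 pullbackM] := cochain_pullback_is_monoid_morphism.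
split=> [|x y].
  by rewrite [LHS]cohomology_pullbackE; congr coh_class; apply/val_inj.
have [u ->] := classP x; have [v ->] := classP y.
rewrite -classM !cohomology_pullbackE -classM; congr coh_class.
by apply/val_inj; exact: pullbackM.
Qed.
HB.instance Definition _ := GRing.isMonoidMorphism.Build (cohomology k rT)
  (cohomology k aT) cohomology_pullback cohomology_pullback_is_monoid_morphism.

End Functoriality.

(* A subgroup is a group in its own right through its subtype. *)
Notation "''H^*' ( G , k )" := (cohomology k (subg_of G))
  (at level 8, format "''H^*' ( G ,  k )") : type_scope.

Section Subgroups.
Variables (k : fieldType) (gT : finGroupType).
Implicit Types G H C D E : {group gT}.

(* subg G maps the elements outside G to 1, so this is the inclusion of H in G
   when H \subset G. *)
Definition subg_incl G H (u : subg_of H) : subg_of G := subg G (sgval u).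
Arguments subg_incl : clear implicits.

Lemma subg_inclM G H : H \subset G -> {morph subg_incl G H : u v / (u * v)%g}.
Proof.
by move=> /subsetP sHG u v; rewrite /subg_incl -morphM //; apply/sHG/subgP.
Qed.

Definition Res G H (sHG : H \subset G) : 'H^*(G, k) -> 'H^*(H, k) :=
  cohomology_pullback (subg_inclM sHG).
HB.instance Definition _ G H (sHG : H \subset G) := GRing.LRMorphism.on (Res sHG).

Definition Ess G (x : 'H^*(G, k)) : Prop :=
  forall H (prHG : H \proper G), Res (proper_sub prHG) x = 0.

Lemma Ess_ideal G : [/\ Ess (0 : 'H^*(G, k)),
  forall x y : 'H^*(G, k), Ess x -> Ess y -> Ess (x + y)
  & forall a x : 'H^*(G, k), Ess x -> Ess (a * x) /\ Ess (x * a)].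
Proof.
split=> [H prHG|x y Ex Ey H prHG|a x Ex]; first exact: raddf0.
  by rewrite raddfD /= Ex Ey addr0.
by split=> H prHG; rewrite rmorphM /= Ex ?mulr0 ?mul0r.
Qed.

Local Open Scope group_scope.

Definition largest_central_abelem (p : nat) G C : Prop :=
  [/\ p.-abelem C, C \subset 'Z(G)
    & forall D, p.-abelem D -> D \subset 'Z(G) -> D \subset C].

Lemma largest_central_abelem_sub p G C : largest_central_abelem p G C -> C \subset G.
Proof. by case=> _ sCZ _; apply: subset_trans sCZ (center_sub G). Qed.

Definition has_abelem_p2_factor (p : nat) G : Prop :=
  exists D E, [/\ D \x E = G, p.-abelem D & #|D| = (p ^ 2)%N].

End Subgroups.

(* monalg reuses this notation for a different construction. *)
Notation "{ 'mpoly' R [ n ] }" := (mpoly.mpoly n R) : type_scope.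

Section PolynomialModules.
Variables (k : fieldType) (T : algType k) (d : nat).
Implicit Types (x : 'I_d -> T) (M : T -> Prop).

(* The value of P at x, the monomials being evaluated as ordered products. It is
   the usual substitution morphism as soon as the x i commute. For homogeneous
   x i in a graded commutative algebra, injectivity of mpeval x implies that
   they do: outside characteristic 2 an element of odd degree squares to 0. *)
Definition mpeval x (P : {mpoly k[d]}) : T := mpoly.mmap (in_alg T) x P.

Definition alg_independent x : Prop := injective (mpeval x).

(* Here M is a submodule of T over the subalgebra generated by x: M is generated by
   finitely many e i (fg_module), or has a finite basis of e i over the polynomial
   algebra acting through x (free_fg_module). *)
Definition fg_module x M : Prop :=
  exists r (e : 'I_r -> T), (forall i, M (e i)) /\
    forall y, M y -> exists c : {ffun 'I_r -> {mpoly k[d]}},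
      y = \sum_i mpeval x (c i) * e i.

Definition free_fg_module x M : Prop :=
  exists r (e : 'I_r -> T), (forall i, M (e i)) /\
    forall y, M y -> exists! c : {ffun 'I_r -> {mpoly k[d]}},
      y = \sum_i mpeval x (c i) * e i.

Definition hsop (homog : T -> Prop) x : Prop :=
  [/\ forall i, homog (x i), alg_independent x & fg_module x (fun=> True)].

End PolynomialModules.

(* Main.v *)
Require Import Defs.
From HB Require Import structures.
From mathcomp Require Import all_boot all_order all_algebra all_fingroup all_solvable.
From mathcomp Require Import zify.
From mathcomp.multinomials Require mpoly.

(** Write H(L) for the cohomology of a group L over k, E for Ess(G) and r for the rank of C. A
    finitely generated graded module over k[zeta] is free once its first Koszul homology vanishes
    ([free_of_syzygies]): a relation between minimal generators has no constant term, and the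
    vanishing of H_1 allows it to be divided by the variables again and again, so that it is zero.
    Hence two facts are wanted: E is finitely generated over k[zeta], and H_1 of its Koszul complex
    is zero. Vanishing of H_1. There are r classes xi of even positive degree that form a regular
    sequence on E ([xi_sequence]). Koszul homology of a finitely generated module is bounded in
    degree, so it is killed by a power of xi, and regularity of xi turns a nonzero H_i(M) into a
    nonzero H_(i+1)(M/xi M) ([nz_step]). A nonzero H_1(E) would thus lead to homology in degree r +
    1; but the complex stops at d, and d <= r because H(C) grows no faster than a polynomial ring in
    r variables ([growth]). The regular sequence. For c central of order p, multiplication G × <c>
    -> G induces a coaction on H(G) with values in H(G × <c>), which is free over H(G) on 1, y, z,
    yz, z^2, ... A class that is nonzero on <c> has a monic image, and monic elements can be
    cancelled ([monic_cancel], [reg_first]). If c lies in Phi(G), every maximal subgroup contains c,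
    the coaction sends E to combinations with coefficients in E ([mu_ess]), and the cancellation
    also works modulo the multiples in E of classes inflated from quotients in which c dies
    ([reg_next]). The hypothesis on direct factors says that C meets Phi(G) in a subgroup of index
    at most p in C ([no_p2_factor]); the class for the one remaining direction is put first. Finite
    generation. For C <= L <= G, H(L) is noetherian over k[zeta] enlarged by finitely many transfers
    from proper subgroups to G ([noeth_all]). By Frobenius reciprocity these transfers annihilate E
    ([trf_good]), so E, an ideal of H(G), is finitely generated over k[zeta] alone ([ess_fg]). The
    proof is an induction on L. If L is elementary abelian and central, then L = C and the
    hypothesis on zeta applies. If L is elementary abelian and not central, the restrictions of
    transfers to L generate an ideal that contains a product of Bockstein classes of characters
    trivial on C, and this reduces L to the kernels of these characters ([abelem_transfers],
    [noeth_abelem_step]). Otherwise there is a central z of order p in Phi(L). Then L × <z> acts on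
    a sphere, a join of polygons ([polygon_complex]), and the isotropy groups of nonempty cells
    project isomorphically onto proper subgroups of L containing C. So H(L × <z>) modulo the Euler
    class is noetherian ([noeth_multiples]), and H(L) embeds into this quotient because the Euler
    class is monic ([noeth_nonabelem]). *)

Module Polynomials.
Import mpoly Defs.
Set Implicit Arguments.
Unset Strict Implicit.
Unset Printing Implicit Defensive.

Import GRing.Theory.
Local Open Scope ring_scope.

(** * Polynomials: induction on the variables, order, evaluation *)

Section Poly.
Variables (k : fieldType) (d : nat).
Implicit Types (P Q : {mpoly k[d]}) (m : 'X_{1..d}) (j : 'I_d).

Definition vX (j : 'I_d) : {mpoly k[d]} := 'X_j.
Definition cterm (P : {mpoly k[d]}) : k := P@_0.
(** Membership in the n-th power of the ideal generated by the variables. *)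
Definition ordp n (P : {mpoly k[d]}) := forall m, (mdeg m < n)%N -> P@_m = 0.

Lemma mnm_split m : m != 0%MM -> exists2 j, (m j != 0)%N & m = (U_(j) + (m - U_(j)))%MM.
move=> m0;have [j mj|all0] := pickP (fun j => m j != 0)%N.
 by exists j => //;rewrite addmC submK // lep1mP.
by case/negP: m0;apply/eqP/mnmP => i;rewrite mnm0E;apply/eqP;rewrite -[_ == _]negbK all0.
Qed.
(** Evaluations are handled through this principle alone, one variable at a time, instead of by
    computing with monomials. *)
Lemma mpoly_vX_ind (Pm : {mpoly k[d]} -> Prop) : Pm 1 -> (forall j Q, Pm Q -> Pm (vX j * Q)) ->
 (forall a P Q, Pm P -> Pm Q -> Pm (a *: P + Q)) -> forall P, Pm P.
move=> P1 PX PL;have P0: Pm 0 by rewrite -(addNr 1) -scaleN1r;apply: PL.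
have Pmon n m : (mdeg m = n)%N -> Pm 'X_[m].
 elim: n m => [|n IH] m.
  by move/eqP;rewrite mdeg_eq0 => /eqP ->;rewrite mpolyX0.
 move=> e;have [|j mj em] := @mnm_split m;first by rewrite -mdeg_eq0 e.
 by rewrite em mpolyXD;apply: PX;apply: IH;move: e;rewrite {1}em mdegD mdeg1 => -[].
move=> P;rewrite [P]mpolyE;elim/big_rec: _ => // m Q _ PQ;apply: PL => //;exact: Pmon.
Qed.
Lemma cterm1 : cterm 1 = 1. Proof. by rewrite /cterm mcoeff1 eqxx. Qed.
Lemma ctermL a P Q : cterm (a *: P + Q) = a * cterm P + cterm Q.
by rewrite /cterm mcoeffD mcoeffZ. Qed.
Lemma vX_coef j Q m : (vX j * Q)@_m = if (m j == 0)%N then 0 else Q@_(m - U_(j)).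
case: eqP => [mj|/eqP mj];last by rewrite -{1}(submK (_ : U_(j) <= m)%MM) ?lep1mP // mulrC addmC mcoeffMX.
rewrite mulrC mcoeffM big1 // => -[a b] /= /eqP e;rewrite mcoeffX.
case: eqP => [eb|_];last by rewrite mulr0.
have := congr1 (fun t : 'X_{1..d} => t j) e;rewrite /= mj mnmDE -eb mnm1E eqxx;lia.
Qed.
Lemma ctermX j Q : cterm (vX j * Q) = 0.
by rewrite /cterm vX_coef mnm0E eqxx. Qed.
Lemma divX P : cterm P = 0 -> exists Q : 'I_d -> {mpoly k[d]}, P = \sum_j vX j * Q j.
suff H R : exists Q : 'I_d -> {mpoly k[d]}, R = cterm R *: 1 + \sum_j vX j * Q j.
 by have [Q eQ] := H P => c0;exists Q;rewrite {1}eQ c0 scale0r add0r.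
elim/mpoly_vX_ind: R => [|j Q _|a R Q [QR eR] [QQ eQ]].
- by exists (fun=> 0);rewrite cterm1 scale1r big1 ?addr0 // => i _;rewrite mulr0.
- exists (fun i => if i == j then Q else 0);rewrite ctermX scale0r add0r (bigD1 j) //= eqxx.
 by rewrite big1 ?addr0 // => i /negbTE ->;rewrite mulr0.
exists (fun j => a *: QR j + QQ j);rewrite {1}eR {1}eQ ctermL scalerDr addrACA scalerDl scalerA;congr (_ + _).
by rewrite scaler_sumr -big_split;apply: eq_bigr => j _;rewrite mulrDr scalerAr.
Qed.
Lemma ordp_all P : (forall n, ordp n P) -> P = 0.
by move=> h;apply/mpolyP => m;rewrite mcoeff0 (h (mdeg m).+1). Qed.
Lemma ordpX n j Q : ordp n Q -> ordp n.+1 (vX j * Q).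
move=> h m lm;rewrite vX_coef;case: eqP => // /eqP mj;apply: h.
by move: lm;rewrite -{1}(submK (_ : U_(j) <= m)%MM) ?lep1mP // mdegD mdeg1 addn1.
Qed.
Lemma ordp_sum n (I : finType) (F : I -> {mpoly k[d]}) : (forall i, ordp n (F i)) -> ordp n (\sum_i F i).
by move=> h m lm;rewrite raddf_sum big1 // => i _;apply: h. Qed.

Section Eval.
Variables (T : algType k) (x : 'I_d -> T).
Hypothesis xC : forall j y, x j * y = y * x j.
Lemma mpeval_monom m : mpeval x 'X_[m] = mmap1 x m.
by rewrite /mpeval mmapX. Qed.
Lemma mpevalL a P Q : mpeval x (a *: P + Q) = a *: mpeval x P + mpeval x Q.
by rewrite /mpeval mmapD mmapZ /= mulr_algl. Qed.
Lemma mpeval0 : mpeval x 0 = 0.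
by have := mpevalL (-1) 1 1;rewrite !scaleN1r !addNr. Qed.
Lemma mpeval1 : mpeval x 1 = 1.
by rewrite -mpolyX0 mpeval_monom mmap11. Qed.
Lemma mpevalX j Q : mpeval x (vX j * Q) = x j * mpeval x Q.
have xc (i : 'I_d) (y : T) : GRing.comm y (x i) by rewrite /GRing.comm xC.
have e0 P : mpeval x P = \sum_(m <- msupp P) P@_m *: mmap1 x m.
 rewrite {1}[P]mpolyE;elim: (msupp P) => [|m s IH];first by rewrite !big_nil mpeval0.
 by rewrite !big_cons mpevalL IH mpeval_monom.
rewrite (e0 Q) mulr_sumr {1}[Q]mpolyE mulr_sumr.
elim: (msupp Q) => [|m s IH];first by rewrite !big_nil mpeval0.
by rewrite !big_cons -scalerAr mpevalL IH -scalerAr -mpolyXD mpeval_monom commr_mmap1_M // mmap1U.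
Qed.
End Eval.

(** Monomials with all exponents below N, indexed by a finite type of known cardinal so that they
    can be counted in [growth]. *)
Definition monoX N (m : {ffun 'I_d -> 'I_N}) : {mpoly k[d]} := 'X_[[multinom (m i : nat) | i < d]].

Lemma mono_inj N (m m' : {ffun 'I_d -> 'I_N}) :
 ([multinom (m i : nat) | i < d] == [multinom (m' i : nat) | i < d]) = (m == m').
apply/eqP/eqP => [e|-> //];apply/ffunP => i;apply: val_inj => /=.
by have := congr1 (fun t : 'X_{1..d} => t i) e;rewrite !mnmE.
Qed.
Lemma monoX_indep N (c : {ffun 'I_d -> 'I_N} -> k) :
 \sum_(m : {ffun 'I_d -> 'I_N}) c m *: monoX m = 0 -> forall m : {ffun 'I_d -> 'I_N}, c m = 0.
move=> e m;have := congr1 (fun P => P@_[multinom (m i : nat) | i < d]) e.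
rewrite mcoeff0 raddf_sum (bigD1 m) //= mcoeffZ mcoeffX eqxx mulr1 big1 ?addr0 // => m' ne.
by rewrite mcoeffZ mcoeffX mono_inj (negbTE ne) mulr0.
Qed.
Lemma monoX_ind N (Pm : nat -> {mpoly k[d]} -> Prop) : (forall j n Q, Pm n Q -> Pm n.+1 (vX j * Q)) -> Pm 0 1 ->
 forall m : {ffun 'I_d -> 'I_N}, exists2 n, (n <= d * N)%N & Pm n (monoX m).
move=> PX P0 m;rewrite /monoX;set mm := [multinom _ | _ < _].
have Pmon n m' : (mdeg m' = n)%N -> Pm n 'X_[m'].
 elim: n m' => [|n IH] m'.
  by move/eqP;rewrite mdeg_eq0 => /eqP ->;rewrite mpolyX0.
 move=> e;have [|j mj em] := @mnm_split m';first by rewrite -mdeg_eq0 e.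
 by rewrite em mpolyXD;apply: PX;apply: IH;move: e;rewrite {1}em mdegD mdeg1 => -[].
exists (mdeg mm);last exact: Pmon.
rewrite mdegE -[d in (_ <= d * _)%N]card_ord -sum_nat_const;apply: leq_sum => i _.
by rewrite mnmE;apply: ltnW.
Qed.
Lemma mpeval_vX (T : algType k) (x : 'I_d -> T) j : mpeval x (vX j) = x j.
by rewrite /vX mpeval_monom mmap1U. Qed.
Lemma vX_neq j a : vX j <> a *: 1.
move=> /(congr1 (fun P => P@_(U_(j))));rewrite mcoeffXU eqxx mcoeffZ mcoeff1 -mdeg_eq0 mdeg1 mulr0.
by move/eqP;rewrite oner_eq0.
Qed.
Lemma mpeval_vX2 (T : algType k) (x : 'I_d -> T) j : x j * x j = 0 -> exists2 P, P <> 0 & mpeval x P = 0.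
move=> xx;exists 'X_[(U_(j) + U_(j))].
 move=> /(congr1 (fun P => P@_(U_(j) + U_(j))));rewrite mcoeffX eqxx mcoeff0.
 by move/eqP;rewrite oner_eq0.
rewrite mpeval_monom /mmap1 (eq_bigr (fun i => if i == j then x j ^+ 2 else 1)).
 by rewrite -big_mkcond big_pred1_eq expr2.
move=> i _;rewrite mnmDE mnm1E eq_sym;case: eqP => [->|//];by rewrite ?expr0.
Qed.
Definition lowdeg n P := forall m, (n < mdeg m)%N -> P@_m = 0.
Lemma lowdeg1 n : lowdeg n 1.
by move=> m lm;rewrite mcoeff1 -mdeg_eq0;case: eqP => // e;rewrite e in lm. Qed.
Lemma lowdegL n a P Q : lowdeg n P -> lowdeg n Q -> lowdeg n (a *: P + Q).
by move=> h h' m lm;rewrite mcoeffD mcoeffZ h // h' // mulr0 addr0. Qed.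
Lemma lowdegX n j Q : lowdeg n Q -> lowdeg n.+1 (vX j * Q).
move=> h m lm;rewrite vX_coef;case: eqP => // /eqP mj;apply: h.
by move: lm;rewrite -{1}(submK (_ : U_(j) <= m)%MM) ?lep1mP // mdegD mdeg1 addn1.
Qed.
Lemma lowdeg_mono n P : lowdeg n P -> exists c : {ffun 'I_d -> 'I_n.+1} -> k, P = \sum_(m : {ffun 'I_d -> 'I_n.+1}) c m *: monoX m.
move=> h;exists (fun m : {ffun 'I_d -> 'I_n.+1} => P@_[multinom (m i : nat) | i < d]);apply/mpolyP => m;rewrite raddf_sum /=.
have [le|lt] := leqP (mdeg m) n;last first.
 rewrite h // big1 // => m' _;rewrite mcoeffZ mcoeffX;case: eqP => [e|_];last by rewrite mulr0.
 by rewrite e h ?mul0r.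
have lm i : (m i < n.+1)%N by rewrite ltnS;apply: leq_trans le;rewrite mdegE (bigD1 i) //= leq_addr.
pose m0 : {ffun 'I_d -> 'I_n.+1} := [ffun i => Ordinal (lm i)].
have em: [multinom (m0 i : nat) | i < d] = m by apply/mnmP => i;rewrite mnmE ffunE.
rewrite (bigD1 m0) //= mcoeffZ mcoeffX em eqxx mulr1 big1 ?addr0 // => m' ne.
by rewrite mcoeffZ mcoeffX -em mono_inj (negbTE ne) mulr0.
Qed.
End Poly.
End Polynomials.

From mathcomp.multinomials Require Import monalg.
From mathcomp Require Import boolp functions ring zify.
From mathcomp Require finmap generic_quotient.
Import Defs Polynomials.

Module Essential.
Set Implicit Arguments.
Unset Strict Implicit.
Unset Printing Implicit Defensive.

Import GRing.Theory.
Local Open Scope ring_scope.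

(** * Cochains on an action groupoid and the gauge homotopy *)

Section Bar.
Variables (k : fieldType) (gT : finGroupType).
Implicit Types (phi psi : seq gT -> k) (w : seq gT) (L : {set gT}).

                                                                         
                                                                                 
(** The alternating sum of phi over all faces of the word g :: w except face 0, with face 1 counted
    positively. Recursion on w reduces identities between faces to ring identities. *)
Fixpoint rest phi (g : gT) w : k :=
 if w is h :: v then phi ((g * h)%g :: v) - rest (fun u => phi (g :: u)) h v
 else phi [::].

Lemma eq_rest L phi psi g w : g \in L -> all [in L] w -> {in L &, forall x y, x * y \in L}%g ->
 (forall u : seq gT, all [in L] u -> size u = size w -> phi u = psi u) ->
 rest phi g w = rest psi g w.
elim: w g phi psi => [|h w IH] g phi psi Lg /= Lw LM E;first exact: E.
case/andP: Lw => Lh Lw;rewrite E ?(IH _ _ (fun u => psi (g :: u))) //=.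
- by move=> u Lu szu;apply: E;rewrite /= ?Lg ?szu.
- by rewrite LM.
Qed.
Lemma all_inT w : all [in [set: gT]] w.
by elim: w => //= g w ->;rewrite inE. Qed.
Lemma rest_ext phi psi g w : phi =1 psi -> rest phi g w = rest psi g w.

move=> E;apply: (@eq_rest setT) => [||x y _ _|u _ _];rewrite ?in_setT ?all_inT //.
Qed.
Lemma rest_lin a phi psi g w :
 rest (fun u => a * phi u + psi u) g w = a * rest phi g w + rest psi g w.
by elim: w g phi psi => //= h w IH g phi psi;rewrite IH;ring. Qed.
Lemma restB phi psi g w :
 rest (fun u => phi u - psi u) g w = rest phi g w - rest psi g w.
by elim: w g phi psi => //= h w IH g phi psi;rewrite IH;ring. Qed.
Lemma restZ a phi g w : rest (fun u => a * phi u) g w = a * rest phi g w.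
by elim: w g phi => //= h w IH g phi;rewrite IH;ring. Qed.
Lemma rest0 g w : rest (fun _ => 0) g w = 0.
by elim: w g => //= h w IH g;rewrite IH subrr. Qed.
Lemma rest_sum (I : finType) (P : pred I) (E : I -> seq gT -> k) g w :
 rest (fun u => \sum_(i | P i) E i u) g w = \sum_(i | P i) rest (E i) g w.
by elim: w g E => //= h w IH g E;rewrite IH sumrB. Qed.
(** The simplicial identities in recursive form; this is what makes the differential square to zero
    in [dQK]. *)
Lemma rest_rest phi g h w : rest (rest phi g) h w = rest phi (g * h)%g w.
elim: w g h phi => //= x w IH g h phi;rewrite -mulgA.
rewrite (restB (fun u => phi ((g * h)%g :: u))).
rewrite (IH _ _ (fun u => phi (g :: u)));ring.
Qed.

Section Groupoid.
Variables (Q : Type) (act : Q -> gT -> Q).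
Hypothesis actM : forall q g h, act (act q g) h = act q (g * h)%g.
Implicit Types (F H B : Q -> seq gT -> k) (q : Q).

                                                                        
                                               
(** The coboundary with coefficients in the functions on Q, seen as cochains on the action groupoid:
    F q w is the value on the path that starts at q and is labelled by w, and face 0 moves the
    starting point to act q g. *)
Definition dQ F q w : k := if w is g :: v then F (act q g) v - rest (F q) g v else 0.

Lemma dQ_lin a F H q w :
 dQ (fun q w => a * F q w + H q w) q w = a * dQ F q w + dQ H q w.
by case: w => [|g w] /=;rewrite ?rest_lin;ring. Qed.
Lemma dQB F H q w : dQ (fun q w => F q w - H q w) q w = dQ F q w - dQ H q w.
by case: w => [|g w] /=;rewrite ?restB;ring. Qed.
Lemma dQZ a F q w : dQ (fun q w => a * F q w) q w = a * dQ F q w.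
by case: w => [|g w] /=;rewrite ?restZ;ring. Qed.
Lemma dQ0 q w : dQ (fun _ _ => 0) q w = 0.
by case: w => //= g w;rewrite rest0 subrr. Qed.
Lemma dQK F q w : dQ (dQ F) q w = 0.
case: w => [|g [|h w]] //=;first by rewrite subrr.
by rewrite actM (restB (fun u => F (act q g) u)) rest_rest;ring.
Qed.
Lemma eq_dQ L (D : Q -> Prop) F H q w : {in L &, forall x y, x * y \in L}%g ->
 (forall q g, D q -> g \in L -> D (act q g)) -> D q -> all [in L] w ->
 (forall q (u : seq gT), D q -> all [in L] u -> (size u).+1 = size w -> F q u = H q u) ->
 dQ F q w = dQ H q w.
case: w => //= g w LM DL Dq /andP[Lg Lw] E;rewrite E //;last exact: DL.
by congr (_ - _);apply: (@eq_rest L) => // u Lu szu;rewrite E ?szu.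
Qed.

(** The cup product of phi and B, with B evaluated at the end point of the first m letters; [ccupE]
    is the closed form and the recursive form serves inductions. *)
Fixpoint ccup B m phi q w : k :=
 match m, w with
 | 0, _ => phi [::] * B q w
 | j.+1, g :: v => ccup B j (fun u => phi (g :: u)) (act q g) v
 | _, _ => 0
 end.

Lemma ccupE B m phi q w : (m <= size w)%N ->
 ccup B m phi q w = phi (take m w) * B (foldl act q (take m w)) (drop m w).
by elim: m w phi q => [|m IH] [|g w] phi q //=;rewrite ?take0 ?drop0 // ltnS => /IH ->.
Qed.
Lemma ccupB B m phi psi q w :
 ccup B m (fun u => phi u - psi u) q w = ccup B m phi q w - ccup B m psi q w.
by elim: m w phi psi q => [|m IH] [|g w] phi psi q //=;rewrite ?mulrBl ?subrr.
Qed.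
Lemma rest_ccup B m phi q g w : (m <= size w)%N ->
 rest (ccup B m phi q) g w = ccup B m (rest phi g) (act q g) w
  - (-1) ^+ m * ccup (dQ B) m phi q (g :: w).
elim: m w phi q g => [|m IH] w phi q g /= szw.
 by rewrite restZ;ring.
case: w szw => //= h w szw;rewrite IH // (ccupB _ _ (fun u => phi ((g * h)%g :: u))).
by rewrite actM exprS;ring.
Qed.
(** Only the degree e of the right factor is given; the degree of F is read off from the length of
    the word. *)
Definition rcup e B F q w : k :=
 if (e <= size w)%N then ccup B (size w - e) (F q) q w else 0.

Lemma dQ_rcup e B F q w : (e < size w)%N ->
 dQ (rcup e B F) q w = rcup e B (dQ F) q w
  + (-1) ^+ (size w - e.+1) * ccup (dQ B) (size w - e.+1) (F q) q w.
case: w => //= g w;rewrite ltnS => szw.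
rewrite /rcup szw (leq_trans szw (leqnSn _)).
have -> : ((size w).+1 - e = (size w - e).+1)%N by lia.
have -> : ((size w).+1 - e.+1 = size w - e)%N by lia.
rewrite (@eq_rest setT _ (ccup B (size w - e) (F q) q)).
- rewrite rest_ccup ?leq_subr // [in RHS]/= (ccupB _ _ (F (act q g)));ring.
- exact: in_setT.
- exact: all_inT.
- by move=> x y _ _;rewrite in_setT.
- by move=> u _ szu;rewrite szu szw.
Qed.

Section Gauge.
Variable tau : Q -> gT.

(** Moving each base point q to act q (tau q) conjugates the arrows; [gauge] is the pullback of
    cochains along this functor, which is naturally isomorphic to the identity. *)
Fixpoint gauge_word q w : seq gT :=
 if w is g :: v then ((tau q)^-1 * g * tau (act q g))%g :: gauge_word (act q g) v
 else [::].

Definition gauge F q w : k := F (act q (tau q)) (gauge_word q w).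

(** The prism operator: the alternating sum over the position at which a path crosses, through tau,
    from the original word to the gauged one. *)
Fixpoint prism phi q w : k :=
 if w is g :: v then
  phi (tau q :: gauge_word q w) - prism (fun u => phi (g :: u)) (act q g) v
 else phi [:: tau q].

Lemma size_gauge_word q w : size (gauge_word q w) = size w.
by elim: w q => //= g w IH q;rewrite IH. Qed.
Lemma gauge_word_in L q w (D : Q -> Prop) :
 {in L &, forall x y, x * y \in L}%g -> {in L, forall x, x^-1 \in L}%g ->
 (forall q g, D q -> g \in L -> D (act q g)) -> (forall q, D q -> tau q \in L) ->
 D q -> all [in L] w -> all [in L] (gauge_word q w).
move=> LM LV DL Dt;elim: w q => //= g w IH q Dq /andP[Lg Lw].
have Dqg := DL _ _ Dq Lg.
by rewrite IH ?andbT // LM ?LM ?LV ?Dt.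
Qed.
Lemma eq_prism L phi psi q w (D : Q -> Prop) :
 {in L &, forall x y, x * y \in L}%g -> {in L, forall x, x^-1 \in L}%g ->
 (forall q g, D q -> g \in L -> D (act q g)) -> (forall q, D q -> tau q \in L) ->
 D q -> all [in L] w ->
 (forall u : seq gT, all [in L] u -> size u = (size w).+1 -> phi u = psi u) ->
 prism phi q w = prism psi q w.
move=> LM LV DL Dt;elim: w q phi psi => [|g w IH] q phi psi Dq Lw E /=.
 by apply: E;rewrite //= Dt.
have [Lg Lw'] := andP Lw.
rewrite (IH _ _ (fun u => psi (g :: u))) //;last first.
- by move=> u Lu szu;rewrite E //= ?Lg // szu.
- exact: DL.
congr (_ - _);apply: E => /=;last by rewrite size_gauge_word.
by have /= := gauge_word_in LM LV DL Dt Dq Lw;rewrite Dt.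
Qed.
Lemma prism0 q w : prism (fun _ => 0) q w = 0.
by elim: w q => //= g w IH q;rewrite IH subrr. Qed.
Lemma prismB phi psi q w :
 prism (fun u => phi u - psi u) q w = prism phi q w - prism psi q w.
by elim: w q phi psi => //= g w IH q phi psi;rewrite IH;ring. Qed.
Lemma rest_gauge_word chi q x w :
 rest (fun u => chi (gauge_word q u)) x w =
 rest chi ((tau q)^-1 * x * tau (act q x))%g (gauge_word (act q x) w).
elim: w q x chi => //= h w IH q x chi.
rewrite -!actM (IH _ _ (fun u => chi (((tau q)^-1 * x * tau (act q x))%g :: u))).
by rewrite !mulgA mulgK.
Qed.
Lemma prism_rest phi q g w :
 rest (prism phi q) g w + rest phi (tau q) (gauge_word q (g :: w))
  - prism (rest phi g) (act q g) w = phi (g :: w).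
elim: w q g phi => [|x w IH] q g phi /=.
 by rewrite !mulgA mulgV mul1g;ring.
rewrite (restB (fun u => phi (tau q :: _ :: gauge_word (act q g) u))).
rewrite (rest_gauge_word (fun u => phi (tau q :: _ :: u))) -!actM.
have := IH (act q g) x (fun u => phi (g :: u)).
rewrite /= (prismB (fun u => phi ((g * x)%g :: u))) !mulgA mulgK !mulgV !mul1g => <-.
by ring.
Qed.
(** Naturally isomorphic functors agree in cohomology, with [prism] as the chain homotopy. *)
Lemma prism_homotopy F q w :
 dQ (fun q => prism (F q) q) q w + prism (dQ F q) q w = gauge F q w - F q w.
case: w => [|g w] /=;first by rewrite add0r.
have E := prism_rest (F q) q g w;rewrite -[in RHS]E /gauge.
have -> : prism (fun u => F (act q g) u - rest (F q) g u) (act q g) w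
 = prism (F (act q g)) (act q g) w - prism (rest (F q) g) (act q g) w.
 by rewrite -prismB.
by rewrite /=;ring.
Qed.

End Gauge.
End Groupoid.
End Bar.

Lemma list_choice (A A' : Type) (R : A -> A' -> Prop) (s : seq A) :
 (forall x, List.In x s -> exists y, R x y) ->
 exists s', (forall x, List.In x s -> exists2 y, List.In y s' & R x y) /\
  (forall y, List.In y s' -> exists2 x, List.In x s & R x y).
elim: s => [|x s IH] h;first by exists [::].
have [|s' [h1 h2]] := IH;first by move=> y ys;apply: h;right.
have [|y Rxy] := h x;first by left.
exists (y :: s');split=> [z [<-|/h1[y' ? ?]]|z [<-|/h2[x' ? ?]]].
- by exists y => //;left.
- by exists y' => //;right.
- by exists x => //;left.
- by exists x' => //;right.
Qed.

(** * Noetherian subquotients of graded modules over a list of operators *)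

Section Graded.
Variable k : fieldType.

Section Def.
Variable U : lmodType k.
Implicit Types (ops : seq (nat * (U -> U))) (N Z B : nat -> U -> Prop) (s : seq (nat * U)).

Record gsub ops N : Prop := GSub {
 gsub0 : forall n, N n 0;
 gsubD : forall n u v, N n u -> N n v -> N n (u + v);
 gsubZ : forall n a u, N n u -> N n (a *: u);
 gsubO : forall o n u, List.In o ops -> N n u -> N (n + o.1)%N (o.2 u) }.

(** The graded submodule generated by s together with B; working modulo B by a predicate avoids
    building quotient modules. *)
Inductive gen ops B s : nat -> U -> Prop :=
| gen_base n u of B n u : gen ops B s n u
| gen_mem n u of List.In (n, u) s : gen ops B s n u
| gen_add n u v of gen ops B s n u & gen ops B s n v : gen ops B s n (u + v)
| gen_scale n a u of gen ops B s n u : gen ops B s n (a *: u)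
| gen_op o n u of List.In o ops & gen ops B s n u : gen ops B s (n + o.1)%N (o.2 u).

                                                                             
(** The subquotient Z/B is noetherian as a graded module over the operators; the typical case is
    cocycles modulo coboundaries. *)
Definition noeth ops Z B := forall N, gsub ops N ->
 (forall n u, B n u -> N n u) -> (forall n u, N n u -> Z n u) ->
 exists s, (forall n u, List.In (n, u) s -> N n u) /\
  forall n u, N n u -> gen ops B s n u.

Definition op_linear (f : U -> U) := forall a u v, f (a *: u + v) = a *: f u + f v.
Definition ops_linear ops := forall o, List.In o ops -> op_linear o.2.

Lemma op_linearB f u v : op_linear f -> f (u - v) = f u - f v.
by move=> fL;rewrite addrC -scaleN1r fL scaleN1r addrC. Qed.
Lemma op_linear0 f : op_linear f -> f 0 = 0.
by move=> fL;rewrite -[X in f X](subrr 0) op_linearB // subrr. Qed.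
Lemma op_linearD f u v : op_linear f -> f (u + v) = f u + f v.
by move=> fL;rewrite -[in LHS](scale1r u) fL scale1r. Qed.
Lemma op_linearZ f a u : op_linear f -> f (a *: u) = a *: f u.
by move=> fL;rewrite -[in LHS](addr0 (a *: u)) fL op_linear0 ?addr0. Qed.
Lemma op_linearN f u : op_linear f -> f (- u) = - f u.
by move=> fL;rewrite -[in LHS]scaleN1r op_linearZ // scaleN1r. Qed.
Lemma gsubN ops N n u : gsub ops N -> N n u -> N n (- u).
by move=> sN Nu;rewrite -scaleN1r;apply: (gsubZ sN). Qed.
Lemma gsubB ops N n u v : gsub ops N -> N n u -> N n v -> N n (u - v).
by move=> sN Nu Nv;rewrite -scaleN1r;apply: (gsubD sN) => //;apply: (gsubZ sN). Qed.
Lemma gsub_sub ops ops' N : (forall o, List.In o ops' -> List.In o ops) ->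
 gsub ops N -> gsub ops' N.
by move=> sub [h0 hD hZ hO];split=> // o n u /sub;apply: hO. Qed.
Lemma gen_gsub ops B s : gsub ops B -> gsub ops (gen ops B s).
move=> sB;split=> [n|n u v|n a u|o n u].
- exact/gen_base/(gsub0 sB).
- exact: gen_add.
- exact: gen_scale.
- exact: gen_op.
Qed.
Lemma gen_min ops B s N : gsub ops N -> (forall n u, B n u -> N n u) ->
 (forall n u, List.In (n, u) s -> N n u) -> forall n u, gen ops B s n u -> N n u.
move=> sN BN sNs n u;elim=> {n u} [n u /BN|n u /sNs|n u v _ Nu _ Nv|n a u _ Nu|o n u oin _ Nu] //.
- exact: (gsubD sN).
- exact: (gsubZ sN).
- exact: (gsubO sN).
Qed.
Lemma noeth_mono ops Z Z' B B' : gsub ops B' ->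
 (forall n u, Z' n u -> Z n u) -> (forall n u, B n u -> B' n u) ->
 noeth ops Z B -> noeth ops Z' B'.
move=> sB' ZZ BB nZ N sN BN NZ.
have [||s [sNs Ns]] := nZ N sN;[by move=> n u /BB;apply: BN|by move=> n u /NZ;apply: ZZ|].
exists s;split=> // n u /Ns;apply: gen_min;first exact: gen_gsub.
- by move=> m v /BB;apply: gen_base.
- by move=> m v;apply: gen_mem.
Qed.
Lemma noeth_triv ops Z B : (forall n u, Z n u -> B n u) -> noeth ops Z B.
by move=> ZB N _ _ NZ;exists [::];split=> // n u /NZ /ZB;apply: gen_base. Qed.
(** Extensions of noetherian modules are noetherian: generators are found separately for the
    intersection of N with Z' and for the image of N modulo Z'. *)
Lemma noeth_ext ops Z Z' B : ops_linear ops -> gsub ops Z' -> gsub ops B ->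
 (forall n u, B n u -> Z' n u) ->
 noeth ops Z' B -> noeth ops Z Z' -> (forall n u, Z' n u -> Z n u) -> gsub ops Z ->
 noeth ops Z B.
move=> lin sZ' sB BZ' nZ' nZ Z'Z sZ N sN BN NZ.
have [|||s1 [s1N s1P]] := nZ' (fun n u => N n u /\ Z' n u).
- split=> [n|n u v [? ?] [? ?]|n a u [? ?]|o n u oin [? ?]].
 + by split;[exact: (gsub0 sN)|exact: (gsub0 sZ')].
 + by split;[exact: (gsubD sN)|exact: (gsubD sZ')].
 + by split;[exact: (gsubZ sN)|exact: (gsubZ sZ')].
 + by split;[exact: (gsubO sN)|exact: (gsubO sZ')].
- by move=> n u Bu;split;[exact: BN|exact: BZ'].
- by move=> n u [].
have [|||s2 [s2N s2P]] := nZ (fun n u => exists2 v, N n v & Z' n (u - v)).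
- split=> [n|n u v [u' Nu Zu] [v' Nv Zv]|n a u [u' Nu Zu]|o n u oin [u' Nu Zu]].
 + by exists 0;rewrite ?subr0;[exact: (gsub0 sN)|exact: (gsub0 sZ')].
 + by exists (u' + v');[exact: (gsubD sN)|rewrite opprD addrACA;apply: (gsubD sZ')].
 + by exists (a *: u');[exact: (gsubZ sN)|rewrite -scalerBr;exact: (gsubZ sZ')].
 + exists (o.2 u');first exact: (gsubO sN).
  by rewrite -op_linearB;[exact: (gsubO sZ')|exact: lin].
- by move=> n u Zu;exists 0;[exact: (gsub0 sN)|rewrite subr0].
- move=> n u [v Nv Zv];rewrite -(subrK v u).
 by apply: (gsubD sZ);[exact: Z'Z|exact: NZ].
have [|s3 [s23 s32]] := @list_choice _ _
 (fun x y : nat * U => [/\ x.1 = y.1, N y.1 y.2 & Z' x.1 (x.2 - y.2)]) s2.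
 by case=> n u /s2N[v Nv Zv];exists (n, v).
have key n u : gen ops Z' s2 n u -> exists2 v, gen ops B s3 n v & Z' n (u - v).
 elim=> {n u} [n u Zu|n u /s23[[m v] in3 /= [-> Nv Zv]]|n u v _ [u' gu Zu] _ [v' gv Zv]|n a u _ [v gv Zv]|o n u oin _ [v gv Zv]].
 - by exists 0;[exact/gen_base/(gsub0 sB)|rewrite subr0].
 - by exists v => //;apply: gen_mem.
 - by exists (u' + v');[exact: gen_add|rewrite opprD addrACA;apply: (gsubD sZ')].
 - by exists (a *: v);[exact: gen_scale|rewrite -scalerBr;exact: (gsubZ sZ')].
 - exists (o.2 v);first exact: gen_op.
  by rewrite -op_linearB;[exact: (gsubO sZ')|exact: lin].
exists (s1 ++ s3);split.
 move=> n u /(List.in_app_or s1 s3)[/s1N[]//|/s32[[m v] _ /= [_ //]]].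
have sub1 s' n u : gen ops B s' n u -> forall s'', (forall x, List.In x s' -> List.In x s'') ->
  gen ops B s'' n u.
 move=> g s'' ss;apply: gen_min g;first exact: gen_gsub.
 - by move=> *;apply: gen_base.
 - by move=> m v /ss;apply: gen_mem.
move=> n u Nu;have [|v gv Zv] := key n u.
 by apply: s2P;exists u => //;rewrite subrr;apply: (gsub0 sZ').
have Nv: N n v.
 by apply: gen_min gv => // m w /s32[[m' w'] _ /= []].
rewrite -(subrK v u);apply: gen_add;last first.
 by apply: sub1 gv _ _ => x ?;apply: List.in_or_app;right.
apply: (sub1 s1) => [|x ?];last by apply: List.in_or_app;left.
by apply: s1P;split=> //;apply: (gsubB sN).
Qed.

End Def.
End Graded.

Section Transport.
Variables (k : fieldType) (U1 U2 : lmodType k) (phi : U1 -> U2).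
Variables (ops1 : seq (nat * (U1 -> U1))) (ops2 : seq (nat * (U2 -> U2))).
Hypothesis phi_lin : forall a u v, phi (a *: u + v) = a *: phi u + phi v.

Definition ops_match := (forall o1, List.In o1 ops1 -> exists2 o2, List.In o2 ops2 &
  o1.1 = o2.1 /\ forall u, phi (o1.2 u) = o2.2 (phi u)) /\
 (forall o2, List.In o2 ops2 -> exists2 o1, List.In o1 ops1 &
  o1.1 = o2.1 /\ forall u, phi (o1.2 u) = o2.2 (phi u)).
Hypothesis match12 : ops_match.
Hypothesis lin2 : ops_linear ops2.

Let phiB u v : phi (u - v) = phi u - phi v.
by rewrite addrC -scaleN1r phi_lin scaleN1r addrC. Qed.
Let phi0 : phi 0 = 0.
by rewrite -[X in phi X](subrr 0) phiB subrr. Qed.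
Let phiD u v : phi (u + v) = phi u + phi v.
by rewrite -[in LHS](scale1r u) phi_lin scale1r. Qed.
Let phiZ a u : phi (a *: u) = a *: phi u.
by rewrite -[in LHS](addr0 (a *: u)) phi_lin phi0 addr0. Qed.

Variables (Z1 B1 : nat -> U1 -> Prop) (Z2 B2 : nat -> U2 -> Prop) (a b : nat).
Hypotheses (sZ1 : gsub ops1 Z1) (sB1 : gsub ops1 B1) (sZ2 : gsub ops2 Z2) (sB2 : gsub ops2 B2).
Hypothesis BZ1 : forall n u, B1 n u -> Z1 n u.
Hypothesis BZ2 : forall m v, B2 m v -> Z2 m v.

(** Submodules of noetherian modules are noetherian: phi embeds Z1/B1 into Z2/B2. The degree shift
    is written n + a = m + b so that it may go either way without subtraction; degrees without a
    partner must be trivial. *)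
Lemma noeth_inj :
 (forall n u, Z1 n u -> B1 n u \/ exists m, (n + a = m + b)%N) ->
 (forall n m u, (n + a = m + b)%N -> Z1 n u -> Z2 m (phi u)) ->
 (forall n m u, (n + a = m + b)%N -> Z1 n u -> B2 m (phi u) -> B1 n u) ->
 noeth ops2 Z2 B2 -> noeth ops1 Z1 B1.
move=> triv ZZ BB nZ N sN BN NZ.
have [|||s2 [s2N s2P]] := nZ (fun m v => Z2 m v /\
  (B2 m v \/ exists n u, [/\ n + a = m + b, N n u & B2 m (v - phi u)])%N).
- split=> [m|m u v [Zu hu] [Zv hv]|m c u [Zu hu]|o m u oin [Zu hu]].
 + by split;[exact: (gsub0 sZ2)|left;exact: (gsub0 sB2)].
 + split;first exact: (gsubD sZ2).
  case: hu hv => [Bu|[n [u' [e Nu Bu]]]] [Bv|[n' [v' [e' Nv Bv]]]].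
  * by left;apply: (gsubD sB2).
  * by right;exists n', v';split;rewrite // -addrA;apply: (gsubD sB2).
  * by right;exists n, u';split;rewrite // addrAC;apply: (gsubD sB2).
  * have en: n = n' by lia.
   rewrite -en in Nv;right;exists n, (u' + v');split=> //;first exact: (gsubD sN).
   by rewrite phiD opprD addrACA;apply: (gsubD sB2).
 + split;first exact: (gsubZ sZ2).
  case: hu => [Bu|[n [u' [e Nu Bu]]]];first by left;apply: (gsubZ sB2).
  right;exists n, (c *: u');split=> //;first exact: (gsubZ sN).
  by rewrite phiZ -scalerBr;apply: (gsubZ sB2).
 + split;first exact: (gsubO sZ2).
  case: hu => [Bu|[n [u' [e Nu Bu]]]];first by left;apply: (gsubO sB2).
  have [o1 o1in [eo ho]] := match12.2 _ oin.
  right;exists (n + o.1)%N, (o1.2 u');split=> //;[by lia|by rewrite -eo;exact: (gsubO sN)|].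
  by rewrite ho -op_linearB;[exact: (gsubO sB2)|exact: lin2].
- by move=> m v Bv;split;[exact: BZ2|left].
- by move=> m v [].
have [|s1 [s21 s12]] := @list_choice _ _ (fun (x : nat * U2) (y : nat * U1) => B2 x.1 x.2 \/
  [/\ y.1 + a = x.1 + b, N y.1 y.2 & B2 x.1 (x.2 - phi y.2)]%N) s2.
 case=> m v /s2N[_ [Bv|[n [u h]]]];first by exists (0%N, 0);left.
 by exists (n, u);right.
(* A generator that already lies in B2 has a meaningless partner in s1; the filter keeps only
   partners that belong to N. *)
exists [seq y <- s1 | `[< N y.1 y.2 >] ];split.
 by move=> n u /List.filter_In[_ /asboolP].
have key m v : gen ops2 B2 s2 m v -> B2 m v \/
  exists n u, [/\ n + a = m + b, gen ops1 B1 [seq y <- s1 | `[< N y.1 y.2 >] ] n u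
   & B2 m (v - phi u)]%N.
 elim=> {m v} [m v Bv|m v /s21[[n u] in1 /= [Bv|[e Nu Bu]]]|m u v _ hu _ hv|m c u _ hu|o m u oin _ hu];
  try by left.
 - right;exists n, u;split=> //;apply/gen_mem/List.filter_In;split=> //=.
  exact/asboolP.
 - case: hu hv => [Bu|[n [u' [e gu Bu]]]] [Bv|[n' [v' [e' gv Bv]]]].
  + by left;apply: (gsubD sB2).
  + by right;exists n', v';split;rewrite // -addrA;apply: (gsubD sB2).
  + by right;exists n, u';split;rewrite // addrAC;apply: (gsubD sB2).
  + have en: n = n' by lia.
   rewrite -en in gv;right;exists n, (u' + v');split=> //;first exact: gen_add.
   by rewrite phiD opprD addrACA;apply: (gsubD sB2).
 - case: hu => [Bu|[n [u' [e Nu Bu]]]];first by left;apply: (gsubZ sB2).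
  right;exists n, (c *: u');split=> //;first exact: gen_scale.
  by rewrite phiZ -scalerBr;apply: (gsubZ sB2).
 - case: hu => [Bu|[n [u' [e Nu Bu]]]];first by left;apply: (gsubO sB2).
  have [o1 o1in [eo ho]] := match12.2 _ oin.
  right;exists (n + o.1)%N, (o1.2 u');split=> //;[by lia|by rewrite -eo;exact: gen_op|].
  by rewrite ho -op_linearB;[exact: (gsubO sB2)|exact: lin2].
move=> n u Nu;have Zu := NZ _ _ Nu.
case: (triv _ _ Zu) => [Bu|[m e]];first exact: gen_base.
have [|Bu|[n' [u' [e' gu' Bu]]]] := key m (phi u).
- apply: s2P;split;first exact: ZZ e _.
 by right;exists n, u;split=> //;rewrite subrr;exact: (gsub0 sB2).
- by apply/gen_base/(BB n m).
have en: n' = n by lia.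
rewrite en in gu';rewrite -(subrK u' u);apply: gen_add => //.
apply/gen_base/(BB _ m) => //;last by rewrite phiB.
apply: (gsubB sZ1) => //;apply: gen_min gu' => // x y.
by move=> /List.filter_In[_ /asboolP /NZ].
Qed.
(** Quotients of noetherian modules are noetherian: modulo B2, all of Z2 is reached by phi, which
    raises degrees by a. *)
Lemma noeth_surj :
 (forall n u, Z1 n u -> Z2 (n + a)%N (phi u)) ->
 (forall n u, B1 n u -> B2 (n + a)%N (phi u)) ->
 (forall m v, Z2 m v -> B2 m v \/
  exists n u, [/\ m = n + a, Z1 n u & B2 m (v - phi u)]%N) ->
 noeth ops1 Z1 B1 -> noeth ops2 Z2 B2.
move=> ZZ BB sur nZ N sN BN NZ.
have [|||s1 [s1N s1P]] := nZ (fun n u => Z1 n u /\ N (n + a)%N (phi u)).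
- split=> [m|m u v [Zu hu] [Zv hv]|m c u [Zu hu]|o m u oin [Zu hu]].
 + by split;[exact: (gsub0 sZ1)|rewrite phi0;exact: (gsub0 sN)].
 + by split;[exact: (gsubD sZ1)|rewrite phiD;exact: (gsubD sN)].
 + by split;[exact: (gsubZ sZ1)|rewrite phiZ;exact: (gsubZ sN)].
 + split;first exact: (gsubO sZ1).
  have [o2 o2in [eo ho]] := match12.1 _ oin.
  by rewrite ho eo addnAC;exact: (gsubO sN).
- by move=> n u Bu;split;[exact: BZ1|exact/BN/BB].
- by move=> n u [].
exists [seq (x.1 + a, phi x.2)%N | x <- s1];split.
 by move=> m v /List.in_map_iff[[n u] [[<- <-] /s1N[]]].
have key n u : gen ops1 B1 s1 n u ->
  gen ops2 B2 [seq (x.1 + a, phi x.2)%N | x <- s1] (n + a)%N (phi u).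
 elim=> {n u} [n u /BB|n u in1|n u v _ hu _ hv|n c u _ hu|o n u oin _ hu].
 - exact: gen_base.
 - by apply: gen_mem;apply/List.in_map_iff;exists (n, u).
 - by rewrite phiD;apply: gen_add.
 - by rewrite phiZ;apply: gen_scale.
 - have [o2 o2in [eo ho]] := match12.1 _ oin.
  by rewrite ho eo addnAC;exact: gen_op.
move=> m v Nv;case: (sur _ _ (NZ _ _ Nv)) => [|[n [u [em Zu Bu]]]];first exact: gen_base.
subst m;rewrite -(subrK (phi u) v);apply: gen_add;first exact: gen_base.
apply/key/s1P;split=> //.
have -> : phi u = v - (v - phi u) by rewrite opprB addrC subrK.
by apply: (gsubB sN);last exact: BN.
Qed.
End Transport.

(** * Hilbert's basis theorem for operators of positive degree *)

Section Hilbert.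
Variables (k : fieldType) (U : lmodType k).
Implicit Types (ops : seq (nat * (U -> U))) (Z B : nat -> U -> Prop) (t : nat * (U -> U)).

(** The submodule B + tZ; the alternative v = 0 covers degrees below that of t. *)
Definition addop t Z B n u := exists2 v, (v = 0 \/ exists2 m, n = (m + t.1)%N & Z m v)
 & B n (u - t.2 v).

(** Commutation holds modulo B only, since cocycles commute up to coboundaries. *)
Definition ops_comm ops Z B := forall o o', List.In o ops -> List.In o' ops ->
 forall n u m, Z n u -> m = (n + o.1 + o'.1)%N -> B m (o'.2 (o.2 u) - o.2 (o'.2 u)).

Lemma gsub_addop ops t Z B : ops_linear (t :: ops) -> gsub (t :: ops) Z ->
 gsub (t :: ops) B -> ops_comm (t :: ops) Z B -> gsub ops (addop t Z B).
move=> lin sZ sB com;have lt: op_linear t.2 by apply: lin;left.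
have sB' : gsub ops B by apply: gsub_sub sB => o;right.
have sZ' : gsub ops Z by apply: gsub_sub sZ => o;right.
split=> [n|n u v [u' hu Bu] [v' hv Bv]|n c u [u' hu Bu]|o n u oin [u' hu Bu]].
- by exists 0;[left|rewrite op_linear0 // subrr;exact: (gsub0 sB)].
- exists (u' + v');last by rewrite op_linearD // opprD addrACA;apply: (gsubD sB).
 case: hu hv => [->|[m e Zu]] [->|[m' e' Zv]];rewrite ?add0r ?addr0;[by left| | |];
  right;try by [exists m'|exists m].
 have en: m = m' by lia.
 by rewrite -en in Zv;exists m => //;apply: (gsubD sZ).
- exists (c *: u');last by rewrite op_linearZ // -scalerBr;apply: (gsubZ sB).
 case: hu => [->|[m e Zu]];first by left;rewrite scaler0.
 by right;exists m => //;apply: (gsubZ sZ).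
- have lo: op_linear o.2 by apply: lin;right.
 exists (o.2 u').
  case: hu => [->|[m e Zu]];first by left;rewrite op_linear0.
  by right;exists (m + o.1)%N;[lia|apply: (gsubO sZ')].
 have -> : o.2 u - t.2 (o.2 u') = o.2 (u - t.2 u') + (o.2 (t.2 u') - t.2 (o.2 u')).
  by rewrite (op_linearB _ _ lo) subrKA.
 apply: (gsubD sB);first by apply: (gsubO sB').
 case: hu => [->|[m e Zu]];first by rewrite (op_linear0 lt) (op_linear0 lo) (op_linear0 lt) subrr;exact: (gsub0 sB).
 by apply: com Zu _;[left|right|lia].
Qed.
Lemma sub_addop t Z B : op_linear t.2 -> forall n u, B n u -> addop t Z B n u.
by move=> lt n u Bu;exists 0;[left|rewrite op_linear0 ?subr0]. Qed.
(** Hilbert's argument. The modules W j of leading coefficients of the elements of N of order j in t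
    increase with j and are finitely generated modulo B + tZ; so is their union, hence they stop
    growing at some J, and lifts of generators of W 0, ..., W J generate N. Since t has positive
    degree, the successive approximation terminates. *)
Lemma noeth_step ops t Z B : ops_linear (t :: ops) -> gsub (t :: ops) Z ->
 gsub (t :: ops) B -> (forall n u, B n u -> Z n u) -> ops_comm (t :: ops) Z B -> (0 < t.1)%N ->
 noeth ops Z (addop t Z B) -> noeth (t :: ops) Z B.
move=> lin sZ sB BZ com t_gt0 nZ N sN BN NZ.
have lt: op_linear t.2 by apply: lin;left.
have sB' : gsub ops B by apply: gsub_sub sB => o;right.
have sZ' : gsub ops Z by apply: gsub_sub sZ => o;right.
have sN' : gsub ops N by apply: gsub_sub sN => o;right.
have tin: List.In t (t :: ops) by left.
set e := t.1 in t_gt0 *;set T := fun j => iter j t.2.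
have ltT j : op_linear (T j).
 by elim: j => // j IH a u v;rewrite /T !iterS -!/(T j _) IH lt.
have TB j n u : B n u -> B (n + j * e)%N (T j u).
 elim: j => [|j IH] Bu;first by rewrite addn0.
 by rewrite mulSn addnCA addnC;apply: (gsubO sB tin);exact: IH.
have TZ j n u : Z n u -> Z (n + j * e)%N (T j u).
 elim: j => [|j IH] Bu;first by rewrite addn0.
 by rewrite mulSn addnCA addnC;apply: (gsubO sZ tin);exact: IH.
pose near n v := v = 0 \/ exists2 m, n = (m + e)%N & Z m v.
have nearD n u v : near n u -> near n v -> near n (u + v).
 case=> [->|[m em Zu]] [->|[m' em' Zv]];rewrite ?add0r ?addr0;[by left| | |];
  right;try by [exists m'|exists m].
 have en: m = m' by lia.
 by rewrite -en in Zv;exists m => //;apply: (gsubD sZ).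
have nearZ n c u : near n u -> near n (c *: u).
 case=> [->|[m em Zu]];first by left;rewrite scaler0.
 by right;exists m => //;apply: (gsubZ sZ).
have nearO o n u : List.In o ops -> near n u -> near (n + o.1)%N (o.2 u).
 move=> oin [->|[m em Zu]];first by left;rewrite op_linear0 //;apply: lin;right.
 by right;exists (m + o.1)%N;[lia|apply: (gsubO sZ')].
have comT j o n u m : List.In o ops -> Z n u -> m = (n + j * e + o.1)%N ->
  B m (o.2 (T j u) - T j (o.2 u)).
 move=> oin Zu;elim: j m => [|j IH] m ->.
  by rewrite subrr;apply: (gsub0 sB).
 have lo: op_linear o.2 by apply: lin;right.
 have -> : o.2 (T j.+1 u) - T j.+1 (o.2 u) = (o.2 (t.2 (T j u)) - t.2 (o.2 (T j u)))
  + t.2 (o.2 (T j u) - T j (o.2 u)).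
  by rewrite (op_linearB _ _ lt) subrKA.
 apply: (gsubD sB).
  by apply: (com _ _ _ _ _ _ _ (TZ j _ _ Zu));[|right|rewrite -/e;lia].
 have -> : (n + j.+1 * e + o.1 = (n + j * e + o.1) + t.1)%N by rewrite -/e;lia.
 by apply: (gsubO sB tin);exact: IH.
(* u is t^j v up to a multiple of t^(j+1) and B, so that v is a leading coefficient of u. *)
pose rel j n v u := exists2 v', near n v' & B (n + j * e)%N (u - T j v - T j.+1 v').
pose W j n v := Z n v /\ exists2 u, N (n + j * e)%N u & rel j n v u.
have relD j n v v' u u' : rel j n v u -> rel j n v' u' -> rel j n (v + v') (u + u').
 move=> [x nx Bx] [y ny By];exists (x + y);first exact: nearD.
 rewrite !(op_linearD _ _ (ltT _)) (_ : _ - _ = (u - T j v - T j.+1 x) + (u' - T j v' - T j.+1 y)).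
  exact: (gsubD sB).
 by rewrite !opprD [u + u' + _]addrACA [LHS]addrACA.
have relZ j n c v u : rel j n v u -> rel j n (c *: v) (c *: u).
 move=> [x nx Bx];exists (c *: x);first exact: nearZ.
 by rewrite !(op_linearZ _ _ (ltT _)) -!scalerBr;apply: (gsubZ sB).
have relO j o n v u : List.In o ops -> Z n v -> rel j n v u -> rel j (n + o.1)%N (o.2 v) (o.2 u).
 move=> oin Zv [x nx Bx];have lo: op_linear o.2 by apply: lin;right.
 exists (o.2 x);first exact: nearO.
 have -> : o.2 u - T j (o.2 v) - T j.+1 (o.2 x) = o.2 (u - T j v - T j.+1 x)
  + (o.2 (T j v) - T j (o.2 v)) + (o.2 (T j.+1 x) - T j.+1 (o.2 x)).
  have aux (p q r s z : U) : p - r - s = p - q - z + (q - r) + (z - s).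
   by rewrite [p - q - z + _]addrAC !subrKA.
  by rewrite !(op_linearB _ _ lo);apply: aux.
 apply: (gsubD sB);first apply: (gsubD sB).
 - by rewrite addnAC;apply: (gsubO sB').
 - by apply: comT Zv _;rewrite // addnAC.
 - case: nx => [->|[m em Zx]].
   by rewrite !(op_linear0 (ltT _)) (op_linear0 lo) (op_linear0 (ltT _)) subrr;apply: (gsub0 sB).
  by apply: comT Zx _;rewrite //;lia.
have relT j i n v u : rel j n v u -> rel (i + j)%N n v (T i u).
 move=> [x nx Bx];exists x => //.
 have -> : T i u - T (i + j)%N v - T (i + j).+1 x = T i (u - T j v - T j.+1 x).
  by rewrite !(op_linearB _ _ (ltT _)) /T -!iterD addnS.
 by rewrite mulnDl [(i * e + _)%N]addnC addnA;apply: TB.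
have WW j i n v : W j n v -> W (i + j)%N n v.
 move=> [Zv [u Nu r]];split=> //;exists (T i u);last exact: relT.
 rewrite mulnDl [(i * e + _)%N]addnC addnA.
 elim: i {r} => [|i IH];first by rewrite addn0.
 by rewrite mulSn addnCA addnC;apply: (gsubO sN tin);exact: IH.
have sW j : gsub ops (W j).
 split=> [n|n u v [Zu [u' Nu ru]] [Zv [v' Nv rv]]|n c u [Zu [u' Nu ru]]|o n u oin [Zu [u' Nu ru]]].
 - split;first exact: (gsub0 sZ).
  exists 0;first exact: (gsub0 sN).
  by exists 0;[left|rewrite !(op_linear0 (ltT _)) !subrr;exact: (gsub0 sB)].
 - split;first exact: (gsubD sZ).
  by exists (u' + v');[exact: (gsubD sN)|exact: relD].
 - split;first exact: (gsubZ sZ).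
  by exists (c *: u');[exact: (gsubZ sN)|exact: relZ].
 - split;first exact: (gsubO sZ').
  by exists (o.2 u');[rewrite addnAC;exact: (gsubO sN')|exact: relO].
have ltn: op_linear t.2 := lt.
have addopW j n v : addop t Z B n v -> W j n v.
 move=> [x hx Bx];split.
  rewrite -(subrK (t.2 x) v);apply: (gsubD sZ);first exact: BZ.
  case: hx => [->|[m -> Zx]];first by rewrite op_linear0 //;exact: (gsub0 sZ).
  exact: (gsubO sZ tin).
 exists 0;first exact: (gsub0 sN).
 exists (- x);first by rewrite -scaleN1r;apply: nearZ.
 rewrite sub0r (op_linearN _ (ltT _)) -opprD.
 have -> : T j.+1 x = T j (t.2 x) by rewrite /T iterSr.
 by apply: (gsubN sB);rewrite -(op_linearB _ _ (ltT j));apply: TB.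
have gens j : exists s, (forall n v, List.In (n, v) s -> W j n v) /\
  forall n v, W j n v -> gen ops (addop t Z B) s n v.
 by apply: nZ => //;[exact: addopW|move=> n u []].
have [||n u [j []] //|s [sW' Ws]] := nZ (fun n v => exists j, W j n v).
- split=> [n|n u v [i Wu] [j Wv]|n c u [j Wu]|o n u oin [j Wu]].
 + by exists 0%N;apply: (gsub0 (sW _)).
 + exists (i + j)%N;apply: (gsubD (sW _));last exact: WW.
  by rewrite addnC;apply: WW.
 + by exists j;apply: (gsubZ (sW _)).
 + by exists j;apply: (gsubO (sW _)).
- by move=> n u h;exists 0%N;apply: addopW.
(* The finitely many generators of the union all lie in one W J, where the chain becomes
   stationary. *)
have [J sJ] : exists J, forall n v, List.In (n, v) s -> W J n v.
 elim: s sW' {Ws} => [|[n v] s IH] h;first by exists 0%N.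
 have [|J hJ] := IH;first by move=> m w ?;apply: h;right.
 have [|j hj] := h n v;first by left.
 exists (j + J)%N => m w [[<- <-]|/hJ];last exact: WW.
 by rewrite addnC;apply: WW.
have WJ j n v : W j n v -> W J n v.
 move=> h;have : gen ops (addop t Z B) s n v by apply: Ws;exists j.
 by apply: gen_min => // m w;apply: addopW.
have [S [SN SP]] : exists S, (forall n u, List.In (n, u) S -> N n u) /\
  forall j, (j <= J)%N -> forall n v, W j n v ->
   exists2 u, gen (t :: ops) B S (n + j * e)%N u & rel j n v u.
 have one j : exists S, (forall n u, List.In (n, u) S -> N n u) /\
   forall n v, W j n v -> exists2 u, gen (t :: ops) B S (n + j * e)%N u & rel j n v u.
  have [s' [s'W Ws']] := gens j.
  have [|S [S1 S2]] := @list_choice _ _ (fun x y : nat * U =>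
   [/\ y.1 = (x.1 + j * e)%N, N y.1 y.2 & rel j x.1 x.2 y.2]) s'.
   by case=> n v /s'W[_ [u Nu r]];exists (n + j * e, u)%N.
  exists S;split=> [n u /S2[[m v] _ /= []] //|n v /Ws'].
  suff : gen ops (addop t Z B) s' n v -> Z n v /\
   exists2 u, gen (t :: ops) B S (n + j * e)%N u & rel j n v u by move=> h /h[].
  elim=> {n v} [n v hv|n v /[dup] /s'W[Zv _] /S1[[m u] inS /= [em Nu r]]|n u v _ [Zu [u' gu ru]] _ [Zv [v' gv rv]]|n c u _ [Zu [u' gu ru]]|o n u oin _ [Zu [u' gu ru]]].
  - have [Zv _] := addopW j _ _ hv;split=> //.
   exists 0;first exact/gen_base/(gsub0 sB).
   have [_ [u _ _]] := addopW j _ _ hv.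
   move: hv => [x hx Bx];exists (- x);first by rewrite -scaleN1r;apply: nearZ.
   rewrite sub0r (op_linearN _ (ltT _)) -opprD.
   have -> : T j.+1 x = T j (t.2 x) by rewrite /T iterSr.
   by apply: (gsubN sB);rewrite -(op_linearB _ _ (ltT j));apply: TB.
  - by split=> //;exists u => //;rewrite em in inS;apply: gen_mem.
  - split;first exact: (gsubD sZ).
   by exists (u' + v');[exact: gen_add|exact: relD].
  - split;first exact: (gsubZ sZ).
   by exists (c *: u');[exact: gen_scale|exact: relZ].
  - split;first exact: (gsubO sZ').
   by exists (o.2 u');[rewrite addnAC;apply: gen_op => //;right|exact: relO].
 elim: J {sJ WJ} => [|J [S [SN SP]]].
  by have [S [SN SP]] := one 0%N;exists S;split=> // j;rewrite leqn0 => /eqP->.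
 have [S' [SN' SP']] := one J.+1;exists (S ++ S');split.
  by move=> n u /(List.in_app_or S S')[/SN|/SN'].
 have sub1 X n u : gen (t :: ops) B X n u -> (forall x, List.In x X -> List.In x (S ++ S')) ->
   gen (t :: ops) B (S ++ S') n u.
  move=> g ss;apply: gen_min g;first exact: gen_gsub.
  - by move=> *;apply: gen_base.
  - by move=> m v /ss;apply: gen_mem.
 move=> j;rewrite leq_eqVlt => /orP[/eqP-> n v /SP'|lej n v /(SP _ lej)] [u gu ru];exists u => //.
  by apply: sub1 gu _ => x ?;apply: List.in_or_app;right.
 by apply: sub1 gu _ => x ?;apply: List.in_or_app;left.
have SPj j n v : W j n v -> exists2 u, gen (t :: ops) B S (n + j * e)%N u & rel j n v u.
 have [le|gt] := leqP j J;first exact: SP.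
 move=> /WJ /(SP _ (leqnn J))[u gu ru];exists (T (j - J)%N u).
  rewrite -{1}(subnK (ltnW gt)) mulnDl [((j - J) * e + _)%N]addnC addnA.
  elim: (j - J)%N => [|i IH];first by rewrite addn0.
  by rewrite mulSn addnCA addnC;apply: (gen_op tin);exact: IH.
 by rewrite -{1}(subnK (ltnW gt));apply: relT.
exists S;split=> // n u Nu.
(* Induction on the degree m of the leading coefficient: subtracting a generated element with the
   same leading coefficient leaves one whose leading coefficient has degree m - e. *)
suff main m j v : Z m v -> forall u, N (m + j * e)%N u -> B (m + j * e)%N (u - T j v) ->
  gen (t :: ops) B S (m + j * e)%N u.
 have := main n 0%N u (NZ _ _ Nu) u;rewrite addn0;apply=> //.
 by rewrite subrr;apply: (gsub0 sB).
elim/ltn_ind: m j v => m IH j v Zv {}u {}Nu Bu.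
have [|u0 gu0 [x hx Bx]] := SPj j m v.
 by split=> //;exists u => //;exists 0;[left|rewrite (op_linear0 (ltT _)) subr0].
have Nu0: N (m + j * e)%N u0 by apply: gen_min gu0.
rewrite -(subrK u0 u);apply: gen_add => //.
have Bd: B (m + j * e)%N (u - u0 - T j.+1 (- x)).
 have -> : u - u0 - T j.+1 (- x) = (u - T j v) - (u0 - T j v - T j.+1 x).
  by rewrite (op_linearN _ (ltT j.+1)) opprK [in RHS]opprB opprB addrCA subrKA addrC.
 exact: (gsubB sB).
case: hx => [x0|[m' em Zx]].
 apply: gen_base;move: Bd.
 by rewrite x0 oppr0 (op_linear0 (ltT _)) subr0.
have eqm: (m + j * e = m' + j.+1 * e)%N by lia.
rewrite eqm in Bd *;apply: (IH m' _ j.+1 (- x)) => //;first by lia.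
 by rewrite -scaleN1r;apply: (gsubZ sZ).
by rewrite -eqm;apply: (gsubB sN).
Qed.
(** Without operators this is linear algebra: Z/B is spanned by s, and the generators are absorbed
    into B one at a time. *)
Lemma noeth_fin Z B s : gsub [::] Z -> gsub [::] B -> (forall n u, B n u -> Z n u) ->
 (forall n u, List.In (n, u) s -> Z n u) ->
 (forall n u, Z n u -> gen [::] B s n u) -> noeth [::] Z B.
elim: s B => [|[d x] s IH] B sZ sB BZ sZs Zs.
 apply: noeth_triv => n u /Zs;exact: gen_min.
pose B1 n u := exists2 c, (n = d \/ c = 0) & B n (u - c *: x).
have sB1: gsub [::] B1.
 split=> [n|n u v [c hc Bu] [c' hc' Bv]|n a u [c hc Bu]|//].
 - by exists 0;[right|rewrite scale0r subr0;exact: (gsub0 sB)].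
 - exists (c + c');last by rewrite scalerDl opprD addrACA;apply: (gsubD sB).
  by case: hc hc' => [->|->] [e|->];[left|left|left|right;rewrite addr0].
 - exists (a * c);last by rewrite -scalerA -scalerBr;apply: (gsubZ sB).
  by case: hc => [->|->];[left|right;rewrite mulr0].
have BB1 n u : B n u -> B1 n u by move=> Bu;exists 0;[right|rewrite scale0r subr0].
have Zx: Z d x by apply: sZs;left.
have B1Z n u : B1 n u -> Z n u.
 move=> [c hc Bu];rewrite -(subrK (c *: x) u);apply: (gsubD sZ);first exact: BZ.
 case: hc => [->|->];first exact: (gsubZ sZ).
 by rewrite scale0r;apply: (gsub0 sZ).
apply: (@noeth_ext _ _ [::] Z B1) => //.
- move=> N sN BN NB1;have [[[n u] [/= Nu [c hc c0]]]|no] := pselect (exists nu : nat * U,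
  N nu.1 nu.2 /\ exists2 c, (nu.1 = d /\ c != 0) & B nu.1 (nu.2 - c *: x)).
  case: hc => en cn0;subst n.
  have Nx: N d x.
   have -> : x = c^-1 *: (u - (u - c *: x)).
    by rewrite opprB addrC subrK scalerA mulVf ?scale1r.
   by apply: (gsubZ sN);apply: (gsubB sN) => //;apply: BN.
  exists [:: (d, x)];split=> [m v [[<- <-]|[]] //|m v /NB1[c' hc' Bv]].
  rewrite -(subrK (c' *: x) v);apply: gen_add;first exact: gen_base.
  case: hc' => [->|->];first by apply: gen_scale;apply: gen_mem;left.
  by rewrite scale0r;apply/gen_base/(gsub0 sB).
 exists [::];split=> // n u Nu;apply: gen_base;have [c hc Bu] := NB1 _ _ Nu.
 case: (eqVneq c 0) => [c0|cn0];first by rewrite c0 scale0r subr0 in Bu.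
 case: hc => [en|/eqP c0];last by rewrite c0 in cn0.
 by case: no;exists (n, u);split=> //;exists c.
- apply: IH => // [n u inu|n u /Zs];first by apply: sZs;right.
 apply: gen_min;first exact: gen_gsub.
 + by move=> m v /BB1;apply: gen_base.
 + move=> m v [[<- <-]|];last exact: gen_mem.
  by apply: gen_base;exists 1;[left|rewrite scale1r subrr;exact: (gsub0 sB)].
Qed.
(** [noeth_step] trades each operator t for the quotient by tZ, until no operator is left and
    [noeth_fin] applies. *)
Lemma fg_noeth ops Z B s : ops_linear ops -> gsub ops Z -> gsub ops B ->
 (forall n u, B n u -> Z n u) -> ops_comm ops Z B ->
 (forall o, List.In o ops -> (0 < o.1)%N) ->
 (forall n u, List.In (n, u) s -> Z n u) ->
 (forall n u, Z n u -> gen ops B s n u) -> noeth ops Z B.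
elim: ops B => [|t ops IH] B lin sZ sB BZ com pos sZs Zs;first exact: noeth_fin Zs.
have lt: op_linear t.2 by apply: lin;left.
have lin' : ops_linear ops by move=> o oin;apply: lin;right.
have sZ' : gsub ops Z by apply: gsub_sub sZ => o;right.
have sA := gsub_addop lin sZ sB com.
have addZ n u : addop t Z B n u -> Z n u.
 move=> [x hx Bx];rewrite -(subrK (t.2 x) u);apply: (gsubD sZ);first exact: BZ.
 case: hx => [->|[m -> Zx]];first by rewrite op_linear0 //;exact: (gsub0 sZ).
 by apply: (gsubO sZ) => //;left.
apply: noeth_step => //;first by apply: pos;left.
apply: IH => //.
- move=> o o' oin oin' n u m Zu em;apply: sub_addop => //.
 by apply: com Zu em;right.
- by move=> o oin;apply: pos;right.
move=> n u /Zs g;suff [] : Z n u /\ gen ops (addop t Z B) s n u by [].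
elim: g => {n u} [n u Bu|n u inu|n u v _ [Zu gu] _ [Zv gv]|n c u _ [Zu gu]|o n u oin _ [Zu gu]].
- by split;[exact: BZ|apply: gen_base;apply: sub_addop].
- by split;[exact: sZs|exact: gen_mem].
- by split;[exact: (gsubD sZ)|exact: gen_add].
- by split;[exact: (gsubZ sZ)|exact: gen_scale].
- split;first exact: (gsubO sZ).
 case: oin => [<-|oin];last exact: gen_op.
 by apply: gen_base;exists u;[right;exists n|rewrite subrr;exact: (gsub0 sB)].
Qed.

Inductive aplus ops Z B : nat -> U -> Prop :=
| aplus_base n u of B n u : aplus ops Z B n u
| aplus_add n u v of aplus ops Z B n u & aplus ops Z B n v : aplus ops Z B n (u + v)
| aplus_op o n u of List.In o ops & Z n u : aplus ops Z B (n + o.1)%N (o.2 u).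

End Hilbert.

Section Product.
Variables (k : fieldType) (U : lmodType k) (Q : finType).
Variables (ops : seq (nat * (U -> U))) (Z B : Q -> nat -> U -> Prop).
Hypotheses (lin : ops_linear ops) (sZ : forall q, gsub ops (Z q)) (sB : forall q, gsub ops (B q)).
Hypothesis BZ : forall q n u, B q n u -> Z q n u.

Definition pointwise_ops := [seq (o.1, fun (F : Q -> U) q => o.2 (F q)) | o <- ops].

Lemma in_pointwise_ops o : List.In o pointwise_ops ->
 exists2 o', List.In o' ops & o = (o'.1, fun (F : Q -> U) q => o'.2 (F q)).
by move=> /List.in_map_iff[o' [<- ?]];exists o'. Qed.
Lemma pointwise_ops_linear : ops_linear pointwise_ops.
move=> o /in_pointwise_ops[o' oin ->] a u v;apply/funext => q /=.
exact: (lin oin).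
Qed.
Lemma gsub_pointwise (N : Q -> nat -> U -> Prop) : (forall q, gsub ops (N q)) ->
 gsub pointwise_ops (fun n F => forall q, N q n (F q)).
move=> sN;split=> [n q|n u v Nu Nv q|n a u Nu q|o n u /in_pointwise_ops[o' oin ->] Nu q].
- exact: (gsub0 (sN q)).
- by apply: (gsubD (sN q)).
- by apply: (gsubZ (sN q)).
- by apply: (gsubO (sN q)).
Qed.
(** A finite product is filtered by its coordinates, and each layer embeds into one factor. *)
Lemma noeth_pointwise : (forall q, noeth ops (Z q) (B q)) ->
 noeth pointwise_ops (fun n F => forall q, Z q n (F q)) (fun n F => forall q, B q n (F q)).
move=> nQ.
pose ZB (s : seq Q) q := if q \in s then Z q else B q.
have sZB s q : gsub ops (ZB s q) by rewrite /ZB;case: ifP.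
suff main s : noeth pointwise_ops (fun n F => forall q, ZB s q n (F q))
  (fun n F => forall q, B q n (F q)).
 apply: noeth_mono (main (enum Q)) => //;first exact: gsub_pointwise.
 by move=> n F ZF q;rewrite /ZB mem_enum.
elim: s => [|q0 s IH];first by apply: noeth_triv => n F h q;apply: h.
have incl n F : (forall q, ZB s q n (F q)) -> forall q, ZB (q0 :: s) q n (F q).
 move=> h q;have := h q;rewrite /ZB inE;case: (q \in s);rewrite ?orbT ?orbF // => Bq.
 by case: ifP => // _;apply: BZ.
apply: (@noeth_ext _ _ _ _ (fun n F => forall q, ZB s q n (F q))) => //.
- exact: pointwise_ops_linear.
- exact: gsub_pointwise.
- exact: gsub_pointwise.
- by move=> n F h q;rewrite /ZB;case: ifP => // _;apply: BZ.
- apply: (@noeth_inj _ _ _ (fun F : Q -> U => F q0) _ ops _ _ lin _ _ (Z q0)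
  (ZB s q0) 0 0).
 + by [].
 + split=> [o /in_pointwise_ops[o' oin ->]|o oin];first by exists o'.
  exists (o.1, fun F q => o.2 (F q)) => //.
  by apply/List.in_map_iff;exists o.
 + exact: gsub_pointwise.
 + exact: sZ.
 + exact: sZB.
 + exact: incl.
 + by move=> n u;rewrite /ZB;case: ifP => // _;apply: BZ.
 + by move=> n F _;right;exists n.
 + move=> n m F;rewrite !addn0 => <- h;have := h q0;rewrite /ZB inE eqxx /=.
  by [].
 + move=> n m F;rewrite !addn0 => <- h h0 q;have := h q;rewrite /ZB inE.
  by case: (eqVneq q q0) => [->|].
 + rewrite /ZB;case: ifP => _;last exact: nQ.
  by apply: noeth_triv.
- exact: gsub_pointwise.
Qed.

End Product.

(** * Cocycles on subgroups, finite sets with action, Shapiro's lemma *)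

Section Cohom.
Variables (k : fieldType) (gT : finGroupType).
Implicit Types (L : {set gT}) (f : seq gT -> k) (w : seq gT).

(** The group coboundary on all functions on words, without finite support; [codiff_dt] identifies
    it with [codiff]. *)
Definition dt f w : k := if w is g :: v then f v - rest f g v else 0.

                                                                             
                                    
(** Tested only on words in L of one length, so that restriction to a subgroup is the identity on
    functions. *)
Definition zt L n f := forall w : seq gT, all [in L] w -> size w = n.+1 -> dt f w = 0.
Definition bt L n f := exists h, forall w : seq gT, all [in L] w -> size w = n -> f w = dt h w.

(** Multiplication by b on the right: if b is a cocycle, this commutes with the differential without
    any sign. *)
Definition tcup e b f w : k :=
 if (e <= size w)%N then f (take (size w - e) w) * b (drop (size w - e) w) else 0.

Lemma dtE f w : dt f w = dQ (fun q _ => q) (fun _ : unit => f) tt w.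
by case: w. Qed.
Lemma eq_dt (L : {group gT}) f h w : all [in L] w ->
 (forall u : seq gT, all [in L] u -> (size u).+1 = size w -> f u = h u) -> dt f w = dt h w.
move=> Lw E;rewrite !dtE;apply: (@eq_dQ _ _ _ _ L (fun=> True)) => //.
- by move=> x y;apply: groupM.
- by move=> _ u _;apply: E.
Qed.
Lemma dtB f h w : dt (fun w => f w - h w) w = dt f w - dt h w.
by rewrite !dtE dQB. Qed.
Lemma dtZ a f w : dt (fun w => a * f w) w = a * dt f w.
by rewrite !dtE dQZ. Qed.
Lemma dt0 w : dt (fun w => 0) w = 0.
by rewrite !dtE dQ0. Qed.
Lemma dtD f h w : dt (fun w => f w + h w) w = dt f w + dt h w.
by have := dQ_lin (fun (q : unit) _ => q) 1 (fun=> f) (fun=> h) tt w;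
 rewrite -!dtE mul1r => <-;apply: (@eq_dt [set: gT]%G);rewrite ?all_inT // => u _ _;rewrite mul1r.
Qed.
Lemma dtK f w : dt (dt f) w = 0.
have := @dQK k gT unit (fun q _ => q) (fun _ _ _ => erefl) (fun=> f) tt w;rewrite dtE => <-.
by apply: (@eq_dQ _ _ _ _ [set: gT] (fun=> True)) => [x y _ _||||q u _ _ _];rewrite ?in_setT ?all_inT ?dtE.
Qed.

Section Q.
Variables (Q : Type) (act : Q -> gT -> Q) (L : {group gT}) (D : Q -> Prop).
Hypothesis actM : forall q g h, act (act q g) h = act q (g * h)%g.
Hypothesis DL : forall q g, D q -> g \in L -> D (act q g).
Implicit Types F H : Q -> seq gT -> k.

                                                                 
(** The shift j is the dimension of the cells that carry the cochain: in total degree n the words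
    have length n - j, written as a sum. *)
Definition zQ j n F := forall q (w : seq gT), D q -> all [in L] w -> (size w + j = n.+1)%N ->
 dQ act F q w = 0.
Definition bQ j n F := exists H, forall q (w : seq gT), D q -> all [in L] w -> (size w + j = n)%N ->
 F q w = dQ act H q w.

Lemma eq_dQL F H q w : D q -> all [in L] w ->
 (forall q (u : seq gT), D q -> all [in L] u -> (size u).+1 = size w -> F q u = H q u) ->
 dQ act F q w = dQ act H q w.
by move=> Dq Lw;apply: (@eq_dQ _ _ _ _ L D) => // x y;apply: groupM. Qed.
Lemma tcup_rcup e b F q w : tcup e b (F q) w = rcup act e (fun=> b) F q w.
by rewrite /tcup /rcup;case: ifP => // _;rewrite ccupE ?leq_subr. Qed.
Lemma dQ_tcup e b F q w : zt L e b -> D q -> all [in L] w ->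
 dQ act (fun q => tcup e b (F q)) q w = tcup e b (dQ act F q) w.
move=> zb Dq Lw;have [lt|le] := ltnP e (size w).
 have -> : dQ act (fun q => tcup e b (F q)) q w = dQ act (rcup act e (fun=> b) F) q w.
  by apply: eq_dQL => // *;rewrite tcup_rcup.
 rewrite dQ_rcup // tcup_rcup ccupE;last by lia.
 rewrite (_ : dQ act _ _ _ = dt b (drop (size w - e.+1) w));last by case: drop.
 rewrite zb ?mulr0 ?addr0 //;first by apply/allP => x /mem_drop xw;apply: (allP Lw).
 by rewrite size_drop subKn.
rewrite /tcup;rewrite (@eq_dQL _ (fun _ _ => 0)) ?dQ0 //;last first.
 by move=> q' u _ _ szu;rewrite leqNgt szu le.
case: ifP => // ge;have -> : (size w - e = 0)%N by lia.
by rewrite take0 /= mul0r.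
Qed.

End Q.

Lemma dt_tcup (L : {group gT}) e b f w : zt L e b -> all [in L] w ->
 dt (tcup e b f) w = tcup e b (dt f) w.
move=> zb Lw.
have := @dQ_tcup unit (fun q _ => q) L (fun=> True) (fun _ _ _ => erefl) (fun _ _ _ _ => I) e b
 (fun=> f) tt w zb I Lw;rewrite dtE => ->.
by rewrite /tcup;case: ifP => //;rewrite dtE.
Qed.
Definition top (A : seq (nat * (seq gT -> k))) : seq (nat * ((seq gT -> k^o) -> seq gT -> k^o)) :=
 [seq (b.1, tcup b.1 b.2) | b <- A].

Definition cocycles L (A : seq (nat * (seq gT -> k))) := forall b, List.In b A -> zt L b.1 b.2.

Lemma in_top A o : List.In o (top A) -> exists2 b, List.In b A & o = (b.1, tcup b.1 b.2).
by move=> /List.in_map_iff[b [<- ?]];exists b. Qed.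
Lemma top_linear A : ops_linear (top A).
move=> o /in_top[b _ ->] a u v;apply/funext => w /=.
change (tcup b.1 b.2 (fun w => a * u w + v w) w = a * tcup b.1 b.2 u w + tcup b.1 b.2 v w).
by rewrite /tcup;case: ifP => _;rewrite ?mulr0 ?addr0 // mulrDl mulrA.
Qed.

Variable Q : finType.
Variables (act : Q -> gT -> Q) (L : {group gT}) (D : Q -> Prop).
Hypothesis actM : forall q g h, act (act q g) h = act q (g * h)%g.
Hypothesis act1 : forall q, act q 1%g = q.
Hypothesis DL : forall q g, D q -> g \in L -> D (act q g).

Definition qop A := pointwise_ops Q (top A).

Lemma in_qop A o : List.In o (qop A) ->
 exists2 b, List.In b A & o = (b.1, fun F q => tcup b.1 b.2 (F q)).
by move=> /in_pointwise_ops[_ /in_top[b bA ->] ->];exists b. Qed.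
Lemma gsub_zQ A j : cocycles L A -> gsub (qop A) (zQ act L D j).
move=> cA;split=> [n q w Dq Lw _|n u v zu zv q w Dq Lw sz|n a u zu q w Dq Lw sz|o n u /in_qop[b bA ->] zu q w Dq Lw sz].
- exact: dQ0.
- have := @dQ_lin k _ _ act 1 u v q w;rewrite zu // zv // mulr0 addr0 => <-.
 by apply: (eq_dQL DL) => // *;rewrite mul1r.
- by have := @dQZ k _ _ act a u q w;rewrite zu // mulr0 => <-.
- rewrite /= in sz *;rewrite (dQ_tcup actM DL _ (cA _ bA) Dq Lw) /tcup;case: leqP => // le.
 rewrite zu ?mul0r //;last by rewrite size_takel ?leq_subr //;lia.
 by apply/allP => x /mem_take xw;apply: (allP Lw).
Qed.
Lemma gsub_bQ A j : cocycles L A -> gsub (qop A) (bQ act L D j).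
move=> cA;split=> [n|n u v [hu Hu] [hv Hv]|n a u [hu Hu]|o n u /in_qop[b bA ->] [h Hh]].
- by exists (fun _ _ => 0 : k) => q w _ _ _;rewrite dQ0.
- exists (fun q w => hu q w + hv q w) => q w Dq Lw sz.
 have := @dQ_lin k _ _ act 1 hu hv q w;rewrite -Hu // -Hv // mul1r => E.
 rewrite -[LHS]E.
 by apply: (eq_dQL DL) => // *;rewrite mul1r.
- by exists (fun q w => a * hu q w) => q w Dq Lw sz;rewrite (@dQZ k) -Hu.
- exists (fun q => tcup b.1 b.2 (h q)) => q w Dq Lw sz.
 rewrite /= in sz *;rewrite (dQ_tcup actM DL _ (cA _ bA) Dq Lw) /tcup;case: leqP => // le.
 rewrite Hh //;last by rewrite size_takel ?leq_subr //;lia.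
 by apply/allP => x /mem_take xw;apply: (allP Lw).
Qed.
Lemma bQ_zQ j n F : bQ act L D j n F -> zQ act L D j n F.
move=> [h Hh] q w Dq Lw sz;rewrite -[RHS](dQK actM h q w).
by apply: (eq_dQL DL) => // *;rewrite Hh //;lia.
Qed.
Definition zts (S : {set gT}) j n f := forall w : seq gT, all [in S] w -> (size w + j = n.+1)%N -> dt f w = 0.
Definition bts (S : {set gT}) j n f :=
 exists h, forall w : seq gT, all [in S] w -> (size w + j = n)%N -> f w = dt h w.

Lemma gsub_zts (S : {group gT}) A j : cocycles S A -> gsub (top A) (zts S j).
move=> cA;split=> [n w Lw _|n u v zu zv w Lw sz|n a u zu w Lw sz|o n u /in_top[b bA ->] zu w Lw sz].
- exact: dt0.
- by have := dtD u v w;rewrite zu // zv // addr0.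
- by have := dtZ a u w;rewrite zu // mulr0.
- rewrite /= in sz *;rewrite (dt_tcup _ (cA _ bA) Lw) /tcup;case: leqP => // le.
 rewrite zu ?mul0r //;last by rewrite size_takel ?leq_subr //;lia.
 by apply/allP => x /mem_take xw;apply: (allP Lw).
Qed.
Lemma gsub_bts (S : {group gT}) A j : cocycles S A -> gsub (top A) (bts S j).
move=> cA;split=> [n|n u v [hu Hu] [hv Hv]|n a u [hu Hu]|o n u /in_top[b bA ->] [h Hh]].
- by exists (fun _ => 0 : k) => w _ _;rewrite dt0.
- exists (fun w => hu w + hv w) => w Lw sz.
 by rewrite dtD -Hu // -Hv.
- by exists (fun w => a * hu w) => w Lw sz;rewrite dtZ -Hu.
- exists (tcup b.1 b.2 h) => w Lw sz.
 rewrite /= in sz *;rewrite (dt_tcup _ (cA _ bA) Lw) /tcup;case: leqP => // le.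
 rewrite Hh //;last by rewrite size_takel ?leq_subr //;lia.
 by apply/allP => x /mem_take xw;apply: (allP Lw).
Qed.
Lemma bts_zts (S : {group gT}) j n f : bts S j n f -> zts S j n f.
move=> [h Hh] w Lw sz;rewrite -[RHS](dtK h w).
by apply: (@eq_dt S) => // *;rewrite Hh //;lia.
Qed.
Lemma zts0 (S : {set gT}) n f : zts S 0 n f <-> zt S n f.
by split=> h w Lw sz;apply: h => //;rewrite addn0 in sz *. Qed.
Lemma bts0 (S : {set gT}) n f : bts S 0 n f <-> bt S n f.
by split=> -[h Hh];exists h => w Lw sz;apply: Hh => //;rewrite addn0 in sz *. Qed.
Lemma gsub_iff (U : lmodType k) (ops : seq (nat * (U -> U))) (N N' : nat -> U -> Prop) :
 (forall n u, N n u <-> N' n u) -> gsub ops N -> gsub ops N'.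
move=> E [h0 hD hZ hO];split=> [n|n u v /E Nu /E Nv|n a u /E Nu|o n u oin /E Nu];apply/E.
- exact: h0.
- exact: hD.
- exact: hZ.
- exact: hO.
Qed.
Lemma gsub_zt (S : {group gT}) A : cocycles S A -> gsub (top A) (zt S).
by move/(gsub_zts 0);apply: gsub_iff => n u;apply: zts0. Qed.
Lemma gsub_bt (S : {group gT}) A : cocycles S A -> gsub (top A) (bt S).
by move/(gsub_bts 0);apply: gsub_iff => n u;apply: bts0. Qed.
Lemma bt_zt (S : {group gT}) n f : bt S n f -> zt S n f.
by move/bts0/bts_zts/zts0. Qed.
Lemma ops_match_id (U : lmodType k) (ops : seq (nat * (U -> U))) : ops_match id ops ops.
by split=> o oin;exists o. Qed.
Lemma noeth_zts (S : {group gT}) A j : cocycles S A ->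
 noeth (top A) (zt S) (bt S) -> noeth (top A) (zts S j) (bts S j).
move=> cA;apply: (@noeth_inj _ _ _ id _ _ _ _ _ _ _ _ _ 0 j) => //.
- exact: ops_match_id.
- exact: top_linear.
- exact: gsub_zts.
- exact: gsub_zt.
- exact: gsub_bt.
- exact: bts_zts.
- exact: bt_zt.
- move=> n f _;have [le|lt] := leqP j n;first by right;exists (n - j)%N;lia.
 by left;exists (fun=> 0) => w _ sz;exfalso;lia.
- by move=> n m f e z w Lw sz;apply: z => //;lia.
- by move=> n m f e z [h Hh];exists h => w Lw sz;apply: Hh => //;lia.
Qed.
Definition stab q := [set g in L | act q g == q].

Lemma stab_group_set q : group_set (stab q).
apply/group_setP;split;first by rewrite inE group1 act1 eqxx.
move=> x y;rewrite !inE => /andP[Lx /eqP qx] /andP[Ly /eqP qy].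
by rewrite groupM //= -actM qx qy eqxx.
Qed.
Canonical stab_group q := Group (stab_group_set q).

Let orb q := [set act q g | g in L].
Let rep q := odflt q [pick x in orb q].
Let tau q := odflt 1%g [pick g in L | act q g == rep q].

Let tauP q : tau q \in L /\ act q (tau q) = rep q.
have : rep q \in orb q.
 rewrite /rep;case: pickP => [//|/(_ q)/negP[]].
 by apply/imsetP;exists 1%g;rewrite ?act1.
case/imsetP => g Lg e;rewrite /tau;case: pickP => [x /andP[Lx /eqP] //|/(_ g)].
by rewrite Lg -e eqxx.
Qed.
Let repE q g : g \in L -> rep (act q g) = rep q.
move=> Lg;suff E : orb (act q g) = orb q.
 by rewrite /rep E;case: pickP => // /(_ q)/negP[];apply/imsetP;exists 1%g;rewrite ?act1.
apply/setP => x;apply/imsetP/imsetP => -[h Lh ->].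
 by exists (g * h)%g;rewrite ?groupM // actM.
by exists (g^-1 * h)%g;rewrite ?groupM ?groupV // actM mulKVg.
Qed.
(** The injective half of Shapiro's lemma. [tau] moves each point to a chosen representative of its
    orbit; the gauged cocycle only sees representatives and words in their stabilisers, where it
    bounds by hypothesis, and the prism homotopy compares it with F. *)
Lemma shapiro_inj j n F : zQ act L D j n F ->
 (forall q, D q -> bts (stab q) j n (F q)) -> bQ act L D j n F.
move=> zF bF.
have DL' q : D q -> D (rep q) by move=> Dq;have [Lt <-] := tauP q;apply: DL.
have [h hP] : exists h : Q -> seq gT -> k, forall q, D q ->
  forall w : seq gT, all [in stab q] w -> (size w + j = n)%N -> F q w = dt (h q) w.
 have := @choice _ _ (fun q (h : seq gT -> k) => D q ->
  forall w : seq gT, all [in stab q] w -> (size w + j = n)%N -> F q w = dt h w).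
 case=> [q|h hP];last by exists h.
 by have [/bF[h Hh]|nD] := pselect (D q);[exists h|exists (fun=> 0)].
have gst q w : D q -> all [in L] w -> all [in stab (rep q)] (gauge_word act tau q w).
 elim: w q => //= g w IH q Dq /andP[Lg Lw].
 have [Lt tr] := tauP q;have [Ltg trg] := tauP (act q g).
 rewrite -{2}(repE q Lg) IH ?andbT //;last exact: DL.
 rewrite inE groupM ?groupM ?groupV //= -tr actM !mulgA mulgV mul1g -actM trg repE //.
 by rewrite tr.
exists (fun q w => h (rep q) (gauge_word act tau q w) - prism act tau (F q) q w) => q w Dq Lw sz.
have := prism_homotopy actM tau F q w.
have -> : prism act tau (dQ act F q) q w = 0.
 rewrite -[RHS](prism0 k act tau q w).
 apply: (@eq_prism _ _ _ act tau L _ _ _ _ D) => //.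
 - by move=> x y;apply: groupM.
 - by move=> x;rewrite groupV.
 - by move=> x _;have [] := tauP x.
 - by move=> u Lu szu;apply: zF => //;lia.
rewrite addr0 (@dQB k) => ->.
have -> : dQ act (fun q w => h (rep q) (gauge_word act tau q w)) q w = gauge act tau F q w.
 rewrite /gauge;have [_ ->] := tauP q;rewrite hP ?size_gauge_word //;[|exact: DL'|exact: gst].
 case: w Lw {sz} => //= g w /andP[Lg _];rewrite repE //.
 by rewrite (rest_gauge_word actM).
by rewrite opprB addrC subrK.
Qed.
(** By [shapiro_inj] the restriction to stabilisers embeds the cohomology with coefficients in
    functions on D into a finite product, to which [noeth_pointwise] applies. *)
Lemma noeth_zQ A j : cocycles L A ->
 (forall q, D q -> noeth (top A) (zt (stab q)) (bt (stab q))) ->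
 noeth (qop A) (zQ act L D j) (bQ act L D j).
move=> cA nS.
have cS q : cocycles (stab q) A.
 move=> b bA w Sw;apply: cA => //;apply/allP => x /(allP Sw).
 by rewrite inE => /andP[].
have := @noeth_pointwise k _ Q (top A) (fun q n f => D q -> zts (stab q) j n f)
 (fun q n f => D q -> bts (stab q) j n f) (@top_linear A).
have gi (N : Q -> nat -> (seq gT -> k^o) -> Prop) q :
  gsub (top A) (N q) -> gsub (top A) (fun n f => D q -> N q n f).
 move=> [h0 hD hZ hO];split=> [n Dq|n u v Nu Nv Dq|n a u Nu Dq|o n u oin Nu Dq].
 - exact: h0.
 - by apply: hD;[apply: Nu|apply: Nv].
 - exact/hZ/Nu.
 - by apply: hO => //;apply: Nu.
have g1 q := gi (fun q => zts (stab q) j) q (gsub_zts (S := stab_group q) j (@cS q)).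
have g2 q := gi (fun q => bts (stab q) j) q (gsub_bts (S := stab_group q) j (@cS q)).
move=> /(_ g1 g2) nP.
have HB q n f : (D q -> bts (stab q) j n f) -> D q -> zts (stab q) j n f.
 by move=> h Dq;apply/(@bts_zts (stab_group q))/h.
have {}nP := nP HB _;apply: (@noeth_inj _ _ _ id _ _ _ _ _ _ _ _ _ 0 0 _ _ _ _ _ _ _ _ (nP _)) => //.
- exact: ops_match_id.
- exact/pointwise_ops_linear/top_linear.
- exact: gsub_zQ.
- exact: (gsub_pointwise g1).
- exact: (gsub_pointwise g2).
- exact: bQ_zQ.
- by move=> n F h q;exact: (HB q _ _ (h q)).
- by move=> n F _;right;exists n.
- move=> n m F;rewrite !addn0 => <- zF q Dq w Sw sz;rewrite -(zF q w) //.
  by case: w Sw {sz} => //= g w /andP[];rewrite inE => /andP[_ /eqP ->].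
 by apply/allP => x /(allP Sw);rewrite inE => /andP[].
- by move=> n m F;rewrite !addn0 => <- zF bF;apply: shapiro_inj.
move=> q;have [Dq|nD] := pselect (D q);last by apply: noeth_triv.
have nq := noeth_zts (j := j) (S := stab_group q) (@cS q) (nS q Dq).
apply: (@noeth_mono _ _ _ _ _ _ _ (g2 q) _ _ nq) => //.
by move=> n u;apply.
Qed.
End Cohom.

Section Functional.
Variables (k : fieldType) (gT : finGroupType) (Q : finType) (lam : (Q -> k) -> k).
Hypothesis lam_lin : forall a f g, lam (fun q => a * f q + g q) = a * lam f + lam g.

Lemma funB f g : lam (fun q => f q - g q) = lam f - lam g.
transitivity (lam (fun q => -1 * g q + f q));last by rewrite lam_lin;ring.
by congr lam;apply/funext => q;ring.
Qed.
Lemma fun0 : lam (fun=> 0) = 0.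
have := lam_lin 1 (fun=> 0) (fun=> 0).
by rewrite mulr0 addr0 mul1r -[in LHS](addr0 (lam _)) => /addrI/esym.
Qed.
Lemma funZ a f : lam (fun q => a * f q) = a * lam f.
have := lam_lin a f (fun=> 0);rewrite fun0 addr0 => <-.
by congr lam;apply/funext => q;rewrite addr0.
Qed.
Lemma rest_fun (phi : Q -> seq gT -> k) g w :
 rest (fun u => lam (fun q => phi q u)) g w = lam (fun q => rest (phi q) g w).
elim: w g phi => //= h w IH g phi.
by rewrite (IH _ (fun q u => phi q (g :: u))) -funB.
Qed.
End Functional.

(** * Equivariant cohomology of a cellular sphere and its Euler class *)

Section Complex.
Variables (k : fieldType) (gT : finGroupType) (L : {group gT}) (Q : finType).
Variables (act : Q -> gT -> Q) (vld : pred Q) (dim : Q -> nat).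
Variables (bd : (Q -> k) -> Q -> k) (qb : Q) (N : nat) (s : (Q -> k) -> k).
Hypothesis actM : forall q g h, act (act q g) h = act q (g * h)%g.
Hypothesis act1 : forall q, act q 1%g = q.
Implicit Types (F G : Q -> seq gT -> k) (w : seq gT) (v : Q -> k).

                                                                             
                                                                            
                          
(** A finite L-complex with the cohomology of a sphere, through its augmented cochains: 0 -> C^0 ->
    ... -> C^N -> k -> 0 is exact, where C^j is the space of functions on valid cells of [dim] j,
    the last map is s, and qb is the empty cell. So [dim] is one more than the geometric dimension.
    As bd is defined on functions on all of Q, the locality fields say that only valid cells of the
    right dimension matter. *)
Record complex := Complex {
 vldL : forall q g, vld q -> g \in L -> vld (act q g);
 dimL : forall q g, vld q -> g \in L -> dim (act q g) = dim q;
 bd_lin : forall q a f g, bd (fun q => a * f q + g q) q = a * bd f q + bd g q;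
 bd_loc : forall f g q, vld q ->
  (forall q', vld q' -> (dim q').+1 = dim q -> f q' = g q') -> bd f q = bd g q;
 bd_act : forall f g q, vld q -> g \in L -> bd (fun q => f (act q g)) q = bd f (act q g);
 bdK : forall f q, vld q -> bd (bd f) q = 0;
 vld_qb : vld qb;
 dim_eq0 : forall q, vld q -> (dim q == 0%N) = (q == qb);
 dim_le : forall q, vld q -> (dim q <= N)%N;
 s_lin : forall a f g, s (fun q => a * f q + g q) = a * s f + s g;
 s_loc : forall f g, (forall q, vld q -> dim q = N -> f q = g q) -> s f = s g;
 s_act : forall f g, g \in L -> s (fun q => f (act q g)) = s f;
 s_bd : forall f, s (bd f) = 0;
 s_one : exists f, s f = 1;
 bd_exact : forall j f, (forall q, vld q -> dim q = j.+1 -> bd f q = 0) ->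
  (j = N -> s f = 0) -> exists u, forall q, vld q -> dim q = j -> f q = bd u q }.
Hypothesis cpx : complex.

Let vldL' := vldL cpx.
Let dqb : dim qb = 0%N.
by apply/eqP;rewrite (dim_eq0 cpx) ?(vld_qb cpx). Qed.
Let qbL g : g \in L -> act qb g = qb.
move=> Lg;apply/eqP;rewrite -(dim_eq0 cpx) ?vldL' ?(vld_qb cpx) //.
by rewrite (dimL cpx) ?(vld_qb cpx) // dqb.
Qed.
Definition DT F q w : k := bd (fun q => F q w) q + (-1) ^+ dim q * dQ act F q w.

Let vd d q := vld q /\ dim q = d.
Let vdL d q g : vd d q -> g \in L -> vd d (act q g).
by move=> [vq <-] Lg;split;[exact: vldL'|exact: dimL cpx _ _ _ _]. Qed.
Lemma dQ_eq0 d F w q : vd d q -> all [in L] w ->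
 (forall q (u : seq gT), vd d q -> all [in L] u -> (size u).+1 = size w -> F q u = 0) ->
 dQ act F q w = 0.
by move=> vq Lw E;rewrite (eq_dQL (@vdL d) vq Lw E) dQ0. Qed.
Let bd0 q : bd (fun=> 0) q = 0.
exact: (@fun0 _ _ (bd^~ q) (bd_lin cpx q)). Qed.
Let bdB q f g : bd (fun q => f q - g q) q = bd f q - bd g q.
exact: (@funB _ _ (bd^~ q) (bd_lin cpx q)). Qed.
Let bdZ q a f : bd (fun q => a * f q) q = a * bd f q.
exact: (@funZ _ _ (bd^~ q) (bd_lin cpx q)). Qed.
Let s0 : s (fun=> 0) = 0. Proof. exact: fun0 (s_lin cpx). Qed.
Let sB f g : s (fun q => f q - g q) = s f - s g. Proof. exact: funB (s_lin cpx) _ _. Qed.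
Let sZ a f : s (fun q => a * f q) = a * s f. Proof. exact: funZ (s_lin cpx) _ _. Qed.
Lemma DTB F G q w : DT (fun q w => F q w - G q w) q w = DT F q w - DT G q w.
by rewrite /DT bdB dQB;ring. Qed.
Lemma DTZ a F q w : DT (fun q w => a * F q w) q w = a * DT F q w.
by rewrite /DT bdZ dQZ;ring. Qed.
Lemma DT_lin a F G q w : DT (fun q w => a * F q w + G q w) q w = a * DT F q w + DT G q w.
by rewrite /DT (bd_lin cpx) dQ_lin;ring. Qed.

                                                                       
Definition onT n q w := [/\ vld q, all [in L] w & size w + dim q = n]%N.

Lemma DT_loc n F G q w : onT n.+1 q w -> (forall q w, onT n q w -> F q w = G q w) ->
 DT F q w = DT G q w.
move=> [vq Lw sz] E;rewrite /DT;congr (_ + _ * _).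
 by apply: (bd_loc cpx) => // q' vq' dq';apply: E;split=> //;lia.
by apply: (eq_dQL (@vdL (dim q))) => // q' u [vq' dq'] Lu szu;apply: E;split=> //;lia.
Qed.
Lemma bd_dQ F q w : vld q -> all [in L] w ->
 dQ act (fun q w => bd (fun q => F q w) q) q w = bd (fun q => dQ act F q w) q.
case: w => [|g w] vq /= Lw;first by rewrite bd0.
rewrite bdB (@rest_fun _ _ _ (bd^~ q) (bd_lin cpx q)) -(bd_act cpx) //.
by case/andP: Lw.
Qed.
Lemma s_dQ F w : all [in L] w ->
 dt (fun w => s (fun q => F q w)) w = s (fun q => dQ act F q w).
case: w => [|g w] /= Lw;first by rewrite s0.
rewrite sB (rest_fun (s_lin cpx)) -(s_act cpx (g := g) (fun q => F q w)) //.
by case/andP: Lw.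
Qed.
Lemma DTK F q w : vld q -> all [in L] w -> DT (DT F) q w = 0.
move=> vq Lw;rewrite {1}/DT.
have -> : bd (fun q => DT F q w) q = - (-1) ^+ dim q * bd (fun q => dQ act F q w) q.
 rewrite -bdZ;transitivity (bd (fun q' => 1 * bd (fun q => F q w) q' + - (-1) ^+ dim q * dQ act F q' w) q).
  apply: (bd_loc cpx) => // q' _ dq';rewrite /DT -dq' mul1r exprS;ring.
 by rewrite (bd_lin cpx) (bdK cpx) // mulr0 add0r.
have -> : dQ act (DT F) q w = dQ act (fun q w => bd (fun q => F q w) q) q w.
 transitivity (dQ act (fun q' w => (-1) ^+ dim q * dQ act F q' w + bd (fun q => F q w) q') q w).
  apply: (eq_dQL (@vdL (dim q))) => // q' u [vq' dq'] Lu szu.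
  by rewrite /DT dq' addrC.
 by rewrite dQ_lin (dQK actM) mulr0 add0r.
by rewrite bd_dQ //;ring.
Qed.
(** Cocycles of the total complex of degree n that vanish in dimensions below j; with [bT] they give
    the cohomology of the steps of the filtration by dimension. *)
Definition zT j n F := (forall q w, onT n.+1 q w -> DT F q w = 0) /\
 (forall q w, onT n q w -> (dim q < j)%N -> F q w = 0).
Definition bT j n F := exists G, (forall q w, onT n q w -> F q w = DT G q w) /\
 (forall q w, vld q -> all [in L] w -> (dim q < j)%N -> G q w = 0).

(** Exactness of bd removes the part of F in the highest dimension J by a cochain in dimension J -
    1, and so on downwards; s is an obstruction only for J = N. *)
Lemma zT_acyclic n F : zT 0 n F ->
 (forall w : seq gT, all [in L] w -> (size w + N = n)%N -> s (fun q => F q w) = 0) ->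
 exists G, (forall q w, vld q -> (N <= dim q)%N -> G q w = 0) /\
  (forall q w, onT n q w -> F q w = DT G q w).
suff main J : (J <= N.+1)%N -> forall F, zT 0 n F ->
 (forall w : seq gT, all [in L] w -> (size w + N = n)%N -> s (fun q => F q w) = 0) ->
 (forall q w, onT n q w -> (J <= dim q)%N -> F q w = 0) ->
 exists G, (forall q w, vld q -> (N <= dim q)%N -> G q w = 0) /\
  (forall q w, onT n q w -> F q w = DT G q w).
 move=> zF sF;apply: (main N.+1) => // q w [vq _ _];rewrite ltnNge.
 by rewrite (dim_le cpx).
elim: J => [|J IH] leJ {}F zF sF F0.
 exists (fun _ _ => 0);split=> // q w h;rewrite F0 //.
 by rewrite /DT bd0 dQ0 mulr0 addr0.
have bdF q w : onT n.+1 q w -> dim q = J.+1 -> bd (fun q => F q w) q = 0.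
 move=> h dq;have := zF.1 q w h;rewrite /DT (@dQ_eq0 (dim q) F) ?mulr0 ?addr0 //.
 - by case: h.
 - by case: h.
 - move=> q' u [vq' dq'] Lu szu;case: h => _ _ sz;apply: F0;[split=> //|];lia.
have [U UP] : exists U : seq gT -> Q -> k, forall w : seq gT, all [in L] w -> (size w + J = n)%N ->
  forall q, vld q -> dim q = J -> F q w = bd (U w) q.
 have := @choice _ _ (fun (w : seq gT) (u : Q -> k) => all [in L] w -> (size w + J = n)%N ->
  forall q, vld q -> dim q = J -> F q w = bd u q).
 case=> [w|U UP];last by exists U.
 have [[Lw sz]|no] := pselect (all [in L] w /\ (size w + J = n)%N);last first.
  by exists (fun=> 0) => Lw sz;case: no.
 have [||u Hu] := bd_exact cpx (j := J) (f := fun q => F q w).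
 - by move=> q vq dq;apply: bdF => //;split=> //;lia.
 - by move=> e;apply: sF => //;rewrite -e.
 - by exists u => _ _;apply: Hu.
pose G0 q w := if (dim q).+1 == J then U w q else 0.
have G0_ge q w : (J <= dim q)%N -> G0 q w = 0.
 by rewrite /G0;case: eqP => // <-;rewrite ltnn.
have dG0 q w : vld q -> all [in L] w -> (J <= dim q)%N -> dQ act G0 q w = 0.
 move=> vq Lw le;apply: (@dQ_eq0 (dim q)) => // q' u [vq' dq'] _ _.
 by apply: G0_ge;rewrite dq'.
have [|||G1 [G1N FG1]] := IH (ltnW leJ) (fun q w => F q w - DT G0 q w).
- split=> // q w h;have [vq Lw _] := h.
 by rewrite DTB zF.1 // DTK // subr0.
- move=> w Lw sz;rewrite sB sF // sub0r.
 rewrite (@s_loc cpx _ (fun q => 1 * bd (fun q => G0 q w) q + 0));last first.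
  move=> q vq dq;rewrite /DT dG0 ?mulr0 ?mul1r //;lia.
 by rewrite (s_lin cpx) (s_bd cpx) s0 mulr0 addr0 oppr0.
- move=> q w h le;have [vq Lw sz] := h;rewrite /DT dG0 // mulr0 addr0.
 have [eJ|neJ] := eqVneq (dim q) J.
  rewrite (UP w) //;last by rewrite -eJ.
  rewrite (_ : bd (fun q => G0 q w) q = bd (U w) q) ?subrr //.
  by apply: (bd_loc cpx) => // q' vq' dq';rewrite /G0 dq' eJ eqxx.
 have lt: (J < dim q)%N by rewrite ltn_neqAle eq_sym neJ.
 have E: bd (fun q => G0 q w) q = bd (fun=> 0) q.
  by apply: (bd_loc cpx) => // q' vq' dq';apply: G0_ge;lia.
 by rewrite F0 // sub0r E bd0 oppr0.
exists (fun q w => 1 * G0 q w + G1 q w);split=> [q w vq le|q w h].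
 by rewrite G1N // G0_ge ?mulr0 ?addr0 //;lia.
by rewrite DT_lin -FG1 // mul1r addrC subrK.
Qed.
Let s_top : exists f, s f = 1 /\ forall q, dim q != N -> f q = 0.
have [f sf] := s_one cpx;exists (fun q => if dim q == N then f q else 0);split.
 by rewrite -sf;apply: (s_loc cpx) => q _ ->;rewrite eqxx.
by move=> q /negbTE ->.
Qed.
(** By [zT_acyclic] only the integral of F under s matters, and an integral dh is realised by the
    total coboundary of a cochain concentrated in dimension N. *)
Lemma zT_base n F : zT 0 n F ->
 (exists h, forall w : seq gT, all [in L] w -> (size w + N = n)%N -> s (fun q => F q w) = dt h w) ->
 bt L n (F qb).
move=> zF [h Hh];have [f [sf fN]] := s_top.
pose G0 q w := (-1) ^+ N * h w * f q.
have [|| G [_ FG]] := @zT_acyclic n (fun q w => F q w - DT G0 q w).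
- split=> // q w hT;have [vq Lw _] := hT.
 by rewrite DTB zF.1 // DTK // subr0.
- move=> w Lw sz;rewrite sB Hh //.
 rewrite (@s_loc cpx _ (fun q => 1 * bd (fun q => G0 q w) q + (-1) ^+ N * dQ act G0 q w));last first.
  by move=> q vq dq;rewrite /DT dq mul1r.
 rewrite (s_lin cpx) (s_bd cpx) sZ -s_dQ // mulr0 add0r.
 have -> : dt (fun w => s (fun q => G0 q w)) w = dt (fun w => (-1) ^+ N * h w) w.
  by apply: (@eq_dt _ _ L) => // u _ _;rewrite sZ sf mulr1.
 by rewrite dtZ mulrA -expr2 sqrr_sign mul1r subrr.
exists (fun w => G qb w + G0 qb w) => w Lw sz.
have hT: onT n qb w by split;rewrite ?(vld_qb cpx) // dqb addn0.
have base H : DT H qb w = dt (H qb) w.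
 have E: bd (fun q => H q w) qb = bd (fun=> 0) qb.
  by apply: (bd_loc cpx);rewrite ?(vld_qb cpx) // dqb.
 rewrite /DT dqb mul1r E bd0 add0r.
 by case: w Lw {sz hT E} => //= g w /andP[Lg _];rewrite qbL.
by rewrite dtD -!base -FG // subrK.
Qed.
(** W lifts the class 1 of H^0(L) through s; its value on qb is the Euler class of the complex, of
    degree N. *)
Lemma zT_exists : exists W, zT 0 N W /\ s (fun q => W q [::]) = 1.
have [f [sf fN]] := s_top.
pose G0 q w := if w is [::] then f q else 0 : k.
have [|| G [GN FG]] := @zT_acyclic N.+1 (DT G0).
- by split=> // q w [vq Lw _];apply: DTK.
- move=> w Lw sz;rewrite (@s_loc cpx _ (fun q => 1 * bd (fun q => G0 q w) q + (-1) ^+ N * dQ act G0 q w));last first.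
  by move=> q vq dq;rewrite /DT dq mul1r.
 rewrite (s_lin cpx) (s_bd cpx) sZ -s_dQ // mulr0 add0r.
 case: w sz Lw => [|g [|h w]];rewrite /= ?add0n => sz _;try by [exfalso;lia].
 by rewrite subrr mulr0.
exists (fun q w => G0 q w - G q w);split.
 by split=> // q w h;rewrite DTB FG // subrr.
rewrite (sB (fun q => G0 q [::])) sf (@s_loc cpx _ (fun=> 0)) ?s0 ?subr0 // => q vq dq.
by rewrite GN // dq.
Qed.
Lemma DT_tcup e b F q w : zt L e b -> vld q -> all [in L] w ->
 DT (fun q => tcup e b (F q)) q w = tcup e b (DT F q) w.
move=> zb vq Lw;rewrite /DT (dQ_tcup actM vldL' _ zb vq Lw).
rewrite /tcup;case: ifP => le;last by rewrite bd0 mulr0 addr0.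
rewrite (_ : (fun q => _) = fun q => b (drop (size w - e) w) * F q (take (size w - e) w)).
 by rewrite bdZ;ring.
by apply/funext => q';rewrite mulrC.
Qed.
Definition lcup m e y w : k := if (m <= size w)%N then e (take m w) * y (drop m w) else 0.

(** F and the product of W with the integral y of F have the same integral, so by [zT_base] their
    values on qb agree up to a coboundary: F qb is the Euler class times y. *)
Lemma zT_division_sum W n F (y := fun w => s (fun q => F q w)) :
 zT 0 N W -> s (fun q => W q [::]) = 1 -> zT 0 n F ->
 zts L N n y /\ bt L n (fun w => F qb w - lcup N (W qb) y w).
move=> zW sW zF.
have zy: zts L N n y.
 move=> w Lw sz;rewrite s_dQ //.
 transitivity ((-1) ^+ N * s (fun q => (-1) ^+ N * dQ act F q w)).
  by rewrite sZ mulrA -expr2 sqrr_sign mul1r.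
 have := s_lin cpx 1 (bd (fun q => F q w)) (fun q => (-1) ^+ N * dQ act F q w).
 rewrite (s_bd cpx) mulr0 add0r => <-.
 rewrite (@s_loc cpx _ (fun=> 0)) ?s0 ?mulr0 // => q vq dq.
 by rewrite mul1r -[in (-1) ^+ N]dq -/(DT F q w) zF.1 //;split=> //;rewrite dq.
split=> //.
have [le|lt] := leqP N n;last first.
 have [|h Hh] := zT_base zF.
  by exists (fun=> 0) => w _ sz;exfalso;lia.
 exists h => w Lw sz;rewrite -Hh // /lcup;case: leqP;rewrite ?subr0 // => ?;exfalso;lia.
have zy' : zt L (n - N) y by move=> w Lw sz;apply: zy => //;lia.
have [||h Hh] := @zT_base n (fun q w => F q w - tcup (n - N) y (W q) w).
- split=> // q w h;have [vq Lw sz] := h;rewrite DTB zF.1 // sub0r DT_tcup //.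
 rewrite /tcup;case: leqP => // le';rewrite ?oppr0 // zW.1 ?mul0r ?oppr0 //;split=> //.
  by apply/allP => x /mem_take xw;apply: (allP Lw).
 by rewrite size_takel ?leq_subr //;lia.
- exists (fun=> 0) => w Lw sz;rewrite sB dt0 /tcup.
 have ew: size w = (n - N)%N by lia.
 rewrite ew leqnn subnn take0 drop0.
 rewrite (_ : s (fun q => W q [::] * y w) = y w * s (fun q => W q [::])).
  by rewrite sW mulr1 /y subrr.
 by rewrite -sZ;congr s;apply/funext => q;rewrite mulrC.
exists h => w Lw sz;rewrite -Hh // /lcup /tcup sz le leq_subr (_ : n - (n - N) = N)%N //;lia.
Qed.
Lemma zT_division W n F : zT 0 N W -> s (fun q => W q [::]) = 1 -> zT 0 n F ->
 exists y, zts L N n y /\ bt L n (fun w => F qb w - lcup N (W qb) y w).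
by move=> zW sW zF;eexists;apply: zT_division_sum. Qed.
Definition multiples m e n x := exists y, zts L m n y /\ bt L n (fun w => x w - lcup m e y w).

Lemma lcup_tcup m e y d b w : lcup m e (tcup d b y) w = tcup d b (lcup m e y) w.
rewrite /lcup /tcup;case: (leqP m (size w)) => le1;case: (leqP d (size w)) => le2 //.
- rewrite size_drop size_takel ?leq_subr //.
 case: (leqP d (size w - m)) => le3;case: (leqP m (size w - d)) => le4;try by [exfalso;lia|rewrite mulr0 mul0r].
 rewrite -mulrA take_takel //;congr (_ * (_ * _)).
  by rewrite take_drop;congr (y (drop _ (take _ _)));lia.
 by rewrite drop_drop;congr (b (drop _ _));lia.
- by rewrite size_drop;case: leqP => [?|_];rewrite ?mulr0 //;exfalso;lia.
- by rewrite size_takel ?leq_subr //;case: leqP => [?|_];rewrite ?mul0r //;exfalso;lia.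
Qed.
Lemma zt_lcup m e n y : zt L m e -> zts L m n y -> zt L n (lcup m e y).
move=> ze zy w Lw sz;have [le|lt] := leqP m n;last first.
 rewrite (@eq_dt _ _ L _ (fun=> 0)) ?dt0 // => u _ szu;rewrite /lcup.
 by case: leqP => // ?;exfalso;lia.
have zy' : zt L (n - m) y by move=> u Lu szu;apply: zy => //;lia.
rewrite (@eq_dt _ _ L _ (tcup (n - m) y e)) // => [|u _ szu].
 rewrite (dt_tcup _ zy' Lw) /tcup;case: leqP => // _;rewrite ze ?mul0r //.
  by apply/allP => x /mem_take xw;apply: (allP Lw).
 by rewrite size_takel ?leq_subr //;lia.
have {}szu : size u = n by lia.
by rewrite /lcup /tcup szu le leq_subr subKn.
Qed.
Lemma multiples_zt m e n x : zt L m e -> multiples m e n x -> zt L n x.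
move=> ze [y [zy /bt_zt b]] w Lw sz;rewrite -[LHS]subr0 -[X in _ - X](zt_lcup ze zy Lw sz) -dtB.
exact: b.
Qed.
Lemma gsub_multiples A m e : cocycles L A -> gsub (top A) (multiples m e).
move=> cA;have gz := gsub_zts m cA;have gb := gsub_bt cA.
split=> [n|n u v [y [zy by_]] [y' [zy' by']]|n a u [y [zy by_]]|o n u oin [y [zy by_]]].
- exists 0;split;first exact: (gsub0 gz).
 have -> : (fun w => (0 : seq gT -> k^o) w - lcup m e 0 w) = 0 :> (seq gT -> k^o);last exact: (gsub0 gb).
 by apply/funext => w;rewrite /lcup mulr0;case: ifP;rewrite subr0.
- exists ((y : seq gT -> k^o) + y');split;first exact: (gsubD gz).
 have -> : (fun w => (u + v) w - lcup m e ((y : seq gT -> k^o) + y') w) =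
  (fun w => u w - lcup m e y w : k^o) + (fun w => v w - lcup m e y' w);last exact: (gsubD gb).
 apply/funext => w;change (u w + v w - lcup m e (fun w => y w + y' w) w = u w - lcup m e y w + (v w - lcup m e y' w)).
 by rewrite /lcup;case: ifP;rewrite ?mulrDr => _;ring.
- exists (a *: (y : seq gT -> k^o));split;first exact: (gsubZ gz).
 have -> : (fun w => (a *: u) w - lcup m e (a *: (y : seq gT -> k^o)) w) =
  a *: (fun w => u w - lcup m e y w : k^o);last exact: (gsubZ gb).
 apply/funext => w;change (a * u w - lcup m e (fun w => a * y w) w = a * (u w - lcup m e y w)).
 by rewrite /lcup;case: ifP;rewrite ?mulrDr => _;ring.
- exists (o.2 y);split;first exact: (gsubO gz).
 have -> : (fun w => o.2 u w - lcup m e (o.2 y) w) = o.2 (fun w => u w - lcup m e y w).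
  have [b bA ->] := in_top oin;apply/funext => w;rewrite /= lcup_tcup /tcup.
  by case: ifP;rewrite ?subr0 // mulrBl.
 exact: (gsubO gb).
Qed.

Variable A : seq (nat * (seq gT -> k)).
Hypothesis cA : cocycles L A.

Lemma gsub_zT j : gsub (qop Q A) (zT j).
split=> [n|n u v [zu vu] [zv vv]|n a u [zu vu]|o n u /in_qop[b bA ->] [zu vu]].
- split=> // q w [vq Lw _].
 change (DT (fun _ _ => 0) q w = 0).
 by rewrite /DT bd0 dQ0 mulr0 addr0.
- split=> q w h;last first.
  by move=> lt;change (u q w + v q w = 0);rewrite vu // vv // addr0.
 have := DT_lin 1 u v q w;rewrite zu // zv // mulr0 addr0 => E;rewrite -[RHS]E.
 by apply: (DT_loc h) => q' w' _;rewrite mul1r.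
- split=> q w h;last by move=> lt;change (a * u q w = 0);rewrite vu // mulr0.
 by have := DTZ a u q w;rewrite zu // mulr0.
- split=> q w h;have [vq Lw sz] := h;rewrite /= in sz *.
  rewrite (DT_tcup _ (cA bA) vq Lw) /tcup;case: leqP => // le.
  rewrite zu ?mul0r //;split=> //;first by apply/allP => x /mem_take xw;apply: (allP Lw).
  by rewrite size_takel ?leq_subr //;lia.
 move=> lt;rewrite /tcup;case: leqP => // le;rewrite vu ?mul0r //;split=> //.
  by apply/allP => x /mem_take xw;apply: (allP Lw).
 by rewrite size_takel ?leq_subr //;lia.
Qed.
Lemma gsub_bT j : gsub (qop Q A) (bT j).
split=> [n|n u v [H [uH H0]] [H' [vH H0']]|n a u [H [uH H0]]|o n u /in_qop[b bA ->] [H [uH H0]]].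
- exists (fun _ _ => 0);split=> // q w _.
 by rewrite /DT bd0 dQ0 mulr0 addr0.
- exists (fun q w => 1 * H q w + H' q w);split=> q w.
  by move=> h;rewrite DT_lin -uH // -vH // mul1r.
 by move=> vq Lw lt;rewrite H0 // H0' // mulr0 addr0.
- exists (fun q w => a * H q w);split=> q w;first by move=> h;rewrite DTZ -uH.
 by move=> vq Lw lt;rewrite H0 // mulr0.
- exists (fun q => tcup b.1 b.2 (H q));split=> q w.
  move=> [vq Lw /= sz];rewrite (DT_tcup _ (cA bA) vq Lw) /tcup;case: leqP => // le.
  rewrite uH //;split=> //;first by apply/allP => x /mem_take xw;apply: (allP Lw).
  by rewrite size_takel ?leq_subr //;lia.
 move=> vq Lw lt;rewrite /tcup;case: leqP => // le;rewrite H0 ?mul0r //.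
 by apply/allP => x /mem_take xw;apply: (allP Lw).
Qed.
Lemma bT_zT j n F : bT j n F -> zT j n F.
move=> [H [uH H0]];split=> q w h;have [vq Lw sz] := h.
 by rewrite -(DTK H vq Lw);apply: (DT_loc h) => q' w' h';apply: uH.
move=> lt;rewrite uH // /DT.
have -> : bd (fun q => H q w) q = bd (fun=> 0) q.
 by apply: (bd_loc cpx) => // q' vq' dq';apply: H0 => //;lia.
rewrite bd0 add0r (@dQ_eq0 (dim q)) ?mulr0 // => q' u [vq' dq'] Lu _.
by apply: H0 => //;rewrite dq'.
Qed.
(** Descending induction on j: modulo step j + 1, step j of the filtration embeds into the
    cohomology of the cells of dimension j, which [noeth_zQ] controls by their stabilisers. *)
Lemma noeth_zT j : (0 < j)%N ->
 (forall q, vld q -> (0 < dim q)%N -> noeth (top A) (zt (stab act L q)) (bt (stab act L q))) ->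
 noeth (qop Q A) (zT j) (bT j).
move=> j_gt0 nS.
have [jN|] := leqP j N.+1;last first.
 move=> lt;apply: noeth_triv => n F [_ F0];exists (fun _ _ => 0);split=> // q w h.
 rewrite F0 //;first by rewrite /DT bd0 dQ0 mulr0 addr0.
 have [vq _ _] := h;have := dim_le cpx vq;lia.
rewrite -(subKn jN) in j_gt0 *;elim: (N.+1 - j)%N j_gt0 => [|i IH] {jN} j_gt0 {j}.
 apply: noeth_triv => n F [_ F0];exists (fun _ _ => 0);split=> // q w h.
 rewrite F0 //;first by rewrite /DT bd0 dQ0 mulr0 addr0.
 have [vq _ _] := h;have := dim_le cpx vq;lia.
set j := (N.+1 - i.+1)%N in j_gt0 *;have ej: (N.+1 - i)%N = j.+1 by rewrite /j;lia.
rewrite ej in IH;have {}IH := IH isT.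
(* The cocycles of step j that are cohomologous to one of step j + 1. *)
pose Z' n F := zT j n F /\ exists F', zT j.+1 n F' /\ bT j n ((F : Q -> seq gT -> k^o) - F').
have sz := gsub_zT j;have sz1 := gsub_zT j.+1;have sb := gsub_bT j;have sb1 := gsub_bT j.+1.
have sZ' : gsub (qop Q A) Z'.
 split=> [n|n u v [zu [F [zF bF]]] [zv [F' [zF' bF']]]|n a u [zu [F [zF bF]]]|o n u oin [zu [F [zF bF]]]].
 - split;first exact: (gsub0 sz).
  by exists 0;split;[exact: (gsub0 sz1)|rewrite subrr;exact: (gsub0 sb)].
 - split;first exact: (gsubD sz).
  exists ((F : Q -> seq gT -> k^o) + F');split;first exact: (gsubD sz1).
  by rewrite opprD addrACA;apply: (gsubD sb).
 - split;first exact: (gsubZ sz).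
  exists (a *: (F : Q -> seq gT -> k^o));split;first exact: (gsubZ sz1).
  by rewrite -scalerBr;apply: (gsubZ sb).
 - split;first exact: (gsubO sz).
  exists (o.2 F);split;first exact: (gsubO sz1).
  rewrite -(@op_linearB _ _ o.2);first exact: (gsubO sb).
  exact: (@pointwise_ops_linear _ _ Q _ (@top_linear _ _ A)).
have linq: ops_linear (qop Q A) := @pointwise_ops_linear _ _ Q _ (@top_linear _ _ A).
have b10 n F : bT j.+1 n F -> bT j n F.
 by move=> [H [FH H0]];exists H;split=> // q w vq Lw lt;apply: H0 => //;lia.
have z10 n F : zT j.+1 n F -> zT j n F.
 by move=> [h h0];split=> // q w hT lt;apply: h0 => //;lia.
have bZ' n F : bT j n F -> Z' n F.
 move=> bF;split;first exact: bT_zT.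
 by exists 0;split;[exact: (gsub0 sz1)|rewrite subr0].
apply: (@noeth_ext k (Q -> (seq gT -> k^o) : lmodType k) _ _ Z') => //.
- pose UQ := (Q -> (seq gT -> k^o) : lmodType k).
 have := @noeth_surj k UQ UQ id (qop Q A) (qop Q A) (fun _ _ _ => erefl) (@ops_match_id _ _ _)  (zT j.+1) (bT j.+1) Z' (bT j) 0;apply=> //.
 + exact: bT_zT.
 + move=> n F zF;rewrite addn0;split;first exact: z10.
  by exists F;split=> //;rewrite subrr;exact: (gsub0 sb).
 + by move=> n F;rewrite addn0;apply: b10.
 + by move=> n F [_ [F' [zF' bF']]];right;exists n, F';rewrite addn0.
- pose D q := vld q /\ dim q = j.
 have DL q g : D q -> g \in L -> D (act q g) by exact: vdL.
 have nQ := @noeth_zQ k gT Q act L D actM act1 DL A j cA.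
 have {}nQ := nQ (fun q h => nS q h.1 (eq_ind_r (fun x => 0 < x)%N j_gt0 h.2)).
 pose UQ := (Q -> (seq gT -> k^o) : lmodType k).
 apply: (@noeth_inj k UQ UQ id _ _ _ _ _ _ _ _ _ 0 0 _ _ _ _ _ _ _ _ nQ) => //.
 + exact: ops_match_id.
 + exact: gsub_zQ.
 + exact: gsub_bQ.
 + by move=> n F [].
 + exact: bQ_zQ.
 + by move=> n F _;right;exists n.
 + move=> n m F;rewrite !addn0 => <- zF q w [vq dq] Lw szw.
  have := zF.1 q w;rewrite /DT.
  have -> : bd (fun q => F q w) q = bd (fun=> 0) q.
   apply: (bd_loc cpx) => // q' vq' dq';apply: zF.2;last by lia.
   by split=> //;lia.
  rewrite bd0 add0r => /(_ _)/eqP;rewrite mulf_eq0 signr_eq0 /= => h.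
  by apply/eqP/h;split=> //;rewrite dq.
 + move=> n m F;rewrite !addn0 => <- zF [H FH];split=> //.
  pose G0 q w : k := if dim q == j then (-1) ^+ j * H q w else 0.
  have G00 q w : (dim q < j)%N -> G0 q w = 0 by rewrite /G0;case: eqP => // ->;rewrite ltnn.
  exists (fun q w => F q w - DT G0 q w);split;last first.
   exists G0;split=> [q w h|q w _ _];last exact: G00.
   by change (F q w - (F q w - DT G0 q w) = DT G0 q w);rewrite opprB addrC subrK.
  split=> q w h;have [vq Lw szw] := h;first by rewrite DTB zF.1 // DTK // subr0.
  rewrite ltnS => le;rewrite /DT.
  have -> : bd (fun q => G0 q w) q = bd (fun=> 0) q.
   by apply: (bd_loc cpx) => // q' vq' dq';apply: G00;lia.
  rewrite bd0 add0r;have [dq|neq] := eqVneq (dim q) j;last first.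
   rewrite zF.2 // ?(@dQ_eq0 (dim q)) ?mulr0 ?subr0 //;try by rewrite ltn_neqAle neq.
   by move=> q' u [vq' dq'] _ _;apply: G00;rewrite dq' ltn_neqAle neq.
  rewrite FH // -?dq //.
  rewrite (_ : dQ act G0 q w = dQ act (fun q w => (-1) ^+ j * H q w) q w).
   by rewrite dQZ dq mulrA -expr2 sqrr_sign mul1r subrr.
  apply: (eq_dQL (@vdL j)) => // q' u [vq' dq'] _ _.
  by rewrite /G0 dq' eqxx.
- by move=> n F [].
Qed.
(** The Gysin sequence. A cocycle x placed on qb has its total boundary in positive dimensions; if
    that boundary bounds there, x extends to a total cocycle and is a multiple of the Euler class by
    the division lemma. So H(L) modulo the Euler class embeds, with degree shift 1, into the
    cohomology of the nonempty cells. *)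
Lemma noeth_multiples W : zT 0 N W -> s (fun q => W q [::]) = 1 ->
 (forall q, vld q -> (0 < dim q)%N -> noeth (top A) (zt (stab act L q)) (bt (stab act L q))) ->
 noeth (top A) (zt L) (multiples N (W qb)).
move=> zW sW nS;have nT := noeth_zT (ltn0Sn 0) nS.
have zW0: zt L N (W qb).
 move=> w Lw sz;rewrite -(zW.1 qb w);last by split;rewrite ?(vld_qb cpx) // dqb addn0.
 have E: bd (fun q => W q w) qb = bd (fun=> 0) qb.
  by apply: (bd_loc cpx);rewrite ?(vld_qb cpx) // dqb.
 rewrite /DT dqb mul1r E bd0 add0r.
 by case: w Lw {sz E} => //= g w /andP[Lg _];rewrite qbL.
pose hat (x : seq gT -> k) q w : k := if q == qb then x w else 0.
pose phi (x : seq gT -> k^o) : Q -> seq gT -> k^o := fun q w => bd (fun q => hat x q w) q.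
have phiE (x : seq gT -> k) n q w : zt L n x -> onT n.+1 q w -> phi x q w = DT (hat x) q w.
 move=> zx [vq Lw szw];rewrite /DT /phi.
 rewrite (_ : dQ act (hat x) q w = 0) ?mulr0 ?addr0 //.
 have [eq|neq] := eqVneq q qb.
  transitivity (dt x w);last by apply: zx => //;move: szw;rewrite eq dqb addn0.
  rewrite eq;case: w Lw {szw} => //= g w /andP[Lg _];rewrite qbL //.
  by congr (_ - _);rewrite /hat ?eqxx //;apply: rest_ext => u;rewrite eqxx.
 apply: (@dQ_eq0 (dim q)) => // q' u [vq' dq'] _ _;rewrite /hat -(dim_eq0 cpx) //.
 by rewrite dq' (dim_eq0 cpx) // (negbTE neq).
pose UT := (seq gT -> k^o : lmodType k);pose UQ := (Q -> (seq gT -> k^o) : lmodType k).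
apply: (@noeth_inj k UT UQ phi _ _ _ _ _ _ _ _ _ 1 0 _ _ _ _ _ _ _ _ nT) => //.
- move=> a u v;apply/funext => q;apply/funext => w.
 change (bd (fun q => hat (fun w => a * u w + v w) q w) q =
  a * bd (fun q => hat u q w) q + bd (fun q => hat v q w) q).
 rewrite -(bd_lin cpx);congr bd;apply/funext => q'.
 by rewrite /hat;case: ifP => _;rewrite ?mulr0 ?addr0.
- have ophi b x : phi (tcup b.1 b.2 x) = fun q => tcup b.1 b.2 (phi x q).
  apply/funext => q;apply/funext => w;rewrite /phi /tcup;case: leqP => le.
   rewrite (_ : (fun q => _) = fun q => b.2 (drop (size w - b.1) w) * hat x q (take (size w - b.1) w)).
    by rewrite bdZ mulrC.
   by apply/funext => q';rewrite /hat le;case: ifP => _;rewrite ?mulr0 // mulrC.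
  by rewrite -[RHS](bd0 q);congr bd;apply/funext => q';rewrite /hat leqNgt le if_same.
 split=> o.
  move=> /in_top[b bA ->];exists (b.1, fun (F : Q -> seq gT -> k^o) q => tcup b.1 b.2 (F q));last by split=> // u;exact: ophi.
  by apply/List.in_map_iff;exists (b.1, tcup b.1 b.2);split=> //;apply/List.in_map_iff;exists b.
 move=> /in_qop[b bA ->];exists (b.1, tcup b.1 b.2);last by split=> // u;exact: ophi.
 by apply/List.in_map_iff;exists b.
- exact: (@pointwise_ops_linear _ _ Q _ (@top_linear _ _ A)).
- exact: gsub_zt.
- exact: gsub_zT.
- exact: gsub_bT.
- by move=> n u;apply: multiples_zt.
- exact: bT_zT.
- by move=> n u _;right;exists n.+1;lia.
- move=> n m x e zx;rewrite addn1 addn0 in e;rewrite -e;split=> q w h.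
  have [vq Lw szw] := h;rewrite -(DTK (hat x) vq Lw);apply: (DT_loc h) => q' w' h'.
  exact: (@phiE _ n).
 move=> lt;rewrite /phi -(bd0 q);have [vq Lw szw] := h.
 by apply: (bd_loc cpx) => // q' vq' dq';lia.
- move=> n m x e zx;rewrite addn1 addn0 in e;rewrite -e => -[G [GE G0]].
 have [|y [zy by_]] := @zT_division W n (fun q w => hat x q w - G q w) zW sW.
  by split=> // q w h;rewrite DTB -(@phiE x n) // GE // subrr.
 exists y;split=> //;have [z Hz] := by_;exists z => w Lw szw;rewrite -Hz //.
 by rewrite /hat eqxx G0 ?subr0 ?(vld_qb cpx) ?dqb.
Qed.

End Complex.

(** Terms are paired by rank rather than compared with their own negative, which would say nothing
    in characteristic 2. *)
Lemma antisum (k : fieldType) (X : finType) (A : {set X}) (g : X -> X -> k) :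
 (forall x y, x \in A -> y \in A -> x != y -> g x y = - g y x) ->
 \sum_(x in A) \sum_(y in A :\ x) g x y = 0.
move=> anti;rewrite (eq_bigr (fun x => \sum_(y in A | (enum_rank x < enum_rank y)%N) g x y
 + \sum_(y in A | (enum_rank y < enum_rank x)%N) g x y));last first.
 move=> x Ax;rewrite (bigID (fun y => (enum_rank x < enum_rank y)%N)) /=.
 congr (_ + _);apply: eq_bigl => y;rewrite !inE;case: (y \in A);rewrite ?andbF //= ?andbT.
  by case: eqP => // ->;rewrite ltnn.
 by rewrite -leqNgt ltn_neqAle val_eqE (inj_eq enum_rank_inj).
rewrite big_split /=;set S := (X in X + _).
suff -> : \sum_(x in A) \sum_(y in A | (enum_rank y < enum_rank x)%N) g x y = - S by rewrite subrr.
rewrite (exchange_big_dep (mem A)) //=;last by move=> x y _ /andP[].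
rewrite /S -sumrN.
apply: eq_bigr => y Ay;rewrite -sumrN;apply: eq_big => x;first by rewrite Ay.
by case/and3P=> Ax _ lt;apply: anti => //;apply: contraTneq lt => ->;rewrite ltnn.
Qed.

(** * The cells of a join of polygons *)

Section Cells.
Variables (k : fieldType) (X : finType) (gam : X -> X) (c : X -> X -> k).
Hypothesis gamI : injective gam.
Hypothesis cN : forall x y, x != y -> c y x = - c x y.
Hypothesis cc : forall x y, c x y * c x y = 1.
Implicit Types (V E Y : {set X}) (f : {set X} * {set X} -> k).

Let P z V := \prod_(y in V) c z y.

Let PP z V : P z V * P z V = 1.
by rewrite -big_split big1 // => y _;apply: cc. Qed.
Let PU z y V : y \notin V -> P z (y |: V) = c z y * P z V.
by move=> yV;rewrite /P big_setU1. Qed.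
Let PD z y V : y \in V -> P z V = c z y * P z (V :\ y).
by move=> yV;rewrite -PU ?setD1K // !inE eqxx. Qed.
(** Creation and annihilation of a vertex. The antisymmetric sign c replaces an ordering of the
    vertices, because c can be chosen invariant under a group. *)
Definition cre z f (q : {set X} * {set X}) : k := P z q.1 * f (z |: q.1, q.2).
Definition ann f (q : {set X} * {set X}) : k :=
 \sum_(x in q.1) P x (q.1 :\ x) * f (q.1 :\ x, q.2).
(** An element x of q.2 stands for the edge from x to gam x, and its boundary is the difference of
    the two ends. Edges count 2 in [cdim], so they carry no sign. *)
Definition lnk f (q : {set X} * {set X}) : k :=
 \sum_(x in q.2) (cre (gam x) f (q.1, q.2 :\ x) - cre x f (q.1, q.2 :\ x)).

                                                                                
                                      
Definition bdry f q := ann f q + lnk f q.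

(** The canonical anticommutation relation: annihilating z itself returns f, and every other vertex
    passes z at the cost of a sign. *)
Lemma cre_ann z f V E : z \notin V -> cre z (ann f) (V, E) = f (V, E) - ann (cre z f) (V, E).
move=> zV;rewrite /cre /ann /= big_setU1 //= setU1K // mulrDr mulrA PP mul1r.
congr (_ + _);rewrite mulr_sumr -sumrN;apply: eq_bigr => x xV.
have xz: x != z by apply: contraNneq zV => <-.
rewrite (PD z xV) (_ : (z |: V) :\ x = z |: (V :\ x));last first.
 by apply/setP => y;rewrite !inE;case: eqP => // ->;rewrite (negbTE xz).
rewrite PU;last by rewrite !inE (negbTE zV) andbF.
have := cc z x;rewrite (@cN z x) 1?eq_sym // => E1.
transitivity (- (c z x * c z x) * (P x (V :\ x) * (P z (V :\ x) * f (z |: V :\ x, E))));first by ring.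
by rewrite E1;ring.
Qed.
Lemma cre_cre y z f V E : y \notin V -> z \notin V -> y != z ->
 cre y (cre z f) (V, E) = - cre z (cre y f) (V, E).
move=> yV zV yz;rewrite /cre /= !PU // setUCA (cN yz);ring.
Qed.
Lemma ann_ann f q : ann (ann f) q = 0.
case: q => V E;rewrite /ann /=.
under eq_bigr => x _ do rewrite mulr_sumr.
apply: antisum => x y xV yV xy.
have yV' : y \in V :\ x by rewrite !inE eq_sym xy.
have xV' : x \in V :\ y by rewrite !inE xy.
rewrite (PD x yV') (PD y xV') (cN xy).
have -> : V :\ y :\ x = V :\ x :\ y by apply/setP => z;rewrite !inE andbCA.
ring.
Qed.
(** The gam-orbits in Y are the polygons, and a cell of their join picks at most one vertex or one
    edge in each of them; the pair of empty sets is the empty cell. *)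
Definition vcell Y (q : {set X} * {set X}) := [&& q.1 \subset Y, q.2 \subset Y,
 [disjoint q.1 & q.2] &
 [forall x in q.1 :|: q.2, forall y in q.1 :|: q.2, fconnect gam x y ==> (x == y)]].

Lemma vcellP Y V E : reflect [/\ V \subset Y, E \subset Y, forall x, x \in V -> x \in E -> False
  & forall x y, x \in V :|: E -> y \in V :|: E -> fconnect gam x y -> x = y]
 (vcell Y (V, E)).
apply: (iffP and4P) => -[h1 h2 h3 h4];split=> //=.
- by move=> x xV xE;move/pred0P/(_ x): h3;rewrite /= xV xE.
- by move=> x y xVE yVE xy;move/forall_inP/(_ x xVE)/forall_inP/(_ y yVE)/implyP/(_ xy)/eqP: h4.
- by apply/pred0P => x /=;apply/negP => /andP[];apply: h3.
- by apply/forall_inP => x xVE;apply/forall_inP => y yVE;apply/implyP => /h4->.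
Qed.
Definition gstable Y := forall x, (gam x \in Y) = (x \in Y).

Let fsym := fconnect_sym gamI.

Lemma gstable_connect Y x y : gstable Y -> fconnect gam x y -> (x \in Y) = (y \in Y).
by move=> gY;apply: (closed_connect (a := mem Y)) => u v /eqP <-;exact/esym/gY. Qed.
Lemma vcell_ann Y V E x : vcell Y (V, E) -> vcell Y (V :\ x, E).
move/vcellP=> [h1 h2 h3 h4];apply/vcellP;split=> //.
- by apply: subset_trans (subsetDl _ _) h1.
- by move=> y;rewrite !inE => /andP[_];apply: h3.
- by move=> y z yVE zVE;apply: h4;[move: yVE|move: zVE];rewrite !inE => /orP[/andP[_ ->]|->];
  rewrite ?orbT.
Qed.
Lemma vcell_edge Y V E x z : gstable Y -> vcell Y (V, E) -> x \in E -> fconnect gam x z ->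
 z \notin V /\ vcell Y (z |: V, E :\ x).
move=> gY /vcellP[h1 h2 h3 h4] xE xz.
have xVE: x \in V :|: E by rewrite inE xE orbT.
have zV: z \notin V.
 apply/negP => zV;have e: x = z by apply: h4;rewrite // inE zV.
 by apply: (h3 x) => //;rewrite e.
split=> //;apply/vcellP;split.
- by rewrite subUset h1 sub1set -(gstable_connect gY xz) (subsetP h2) // andbT.
- by apply: subset_trans (subsetDl _ _) h2.
- move=> y;rewrite !inE => /orP[/eqP->|yV] /andP[nx yE];last exact: (h3 y).
 by move/eqP: nx;case;apply/esym;apply: h4;rewrite // inE yE orbT.
have key y : y \in V :|: E :\ x -> fconnect gam y z -> False.
 rewrite !inE => hy yz;have yVE: y \in V :|: E by case/orP: hy => [h|/andP[_ h]];rewrite inE h ?orbT.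
 have e: y = x by apply: h4;rewrite // (connect_trans yz) // fsym.
 by case/orP: hy;rewrite e ?eqxx // => xV;apply: (h3 x).
move=> y y';rewrite -!setUA ![_ \in z |: _]in_setU1 => /orP[/eqP->|hy] /orP[/eqP->|hy'] //.
- by rewrite fsym => h;case: (key y').
- by move=> h;case: (key y).
- by apply: h4;[move: hy|move: hy'];rewrite !inE => /orP[->|/andP[_ ->]];rewrite ?orbT.
Qed.
Lemma lnkD f g q : lnk (fun q => f q + g q) q = lnk f q + lnk g q.
by rewrite /lnk -big_split;apply: eq_bigr => x _;rewrite /cre /=;ring. Qed.
Lemma annD f g q : ann (fun q => f q + g q) q = ann f q + ann g q.
by rewrite /ann -big_split;apply: eq_bigr => x _;rewrite /=;ring. Qed.
Lemma edge_notin Y V E x : gstable Y -> vcell Y (V, E) -> x \in E ->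
 x \notin V /\ gam x \notin V.
move=> gY v xE;have [h1 _] := vcell_edge gY v xE (connect0 _ x).
by have [h2 _] := vcell_edge gY v xE (fconnect1 _ x).
Qed.
(** [ann] squares to zero, the mixed terms cancel by [cre_ann], and the terms with two edges are
    antisymmetric because creations anticommute. *)
Lemma bdryK Y f q : gstable Y -> vcell Y q -> bdry (bdry f) q = 0.
case: q => V E gY v;rewrite {1}/bdry annD lnkD ann_ann add0r.
have -> : ann (lnk f) (V, E) =
  \sum_(x in E) (ann (cre (gam x) f) (V, E :\ x) - ann (cre x f) (V, E :\ x)).
 rewrite /ann /lnk /=;under eq_bigr => x _ do rewrite mulr_sumr.
 rewrite exchange_big;apply: eq_bigr => x _;rewrite -sumrB.
 by apply: eq_bigr => y _;rewrite mulrBr.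
have -> : lnk (ann f) (V, E) =
  - \sum_(x in E) (ann (cre (gam x) f) (V, E :\ x) - ann (cre x f) (V, E :\ x)).
 rewrite -sumrN;apply: eq_bigr => x xE /=;have [xV gxV] := edge_notin gY v xE.
 by rewrite !cre_ann //;ring.
rewrite addrA subrr add0r.
pose g x y := cre (gam x) (cre (gam y) f) (V, E :\ x :\ y)
 - cre (gam x) (cre y f) (V, E :\ x :\ y) - cre x (cre (gam y) f) (V, E :\ x :\ y)
 + cre x (cre y f) (V, E :\ x :\ y).
rewrite -[RHS](@antisum k X E g) => [|x y xE yE xy].
 rewrite /lnk /=;apply: eq_bigr => x xE;rewrite /cre /= !mulr_sumr -sumrB.
 by apply: eq_bigr => y _;rewrite /g /cre /=;ring.
have [xV gxV] := edge_notin gY v xE;have [yV gyV] := edge_notin gY v yE.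
have /vcellP[_ _ _ h4] := v.
have key u u' : fconnect gam x u -> fconnect gam y u' -> u != u'.
 move=> xu yu';apply: contraNneq xy => e;apply/eqP;apply: h4;rewrite ?inE ?xE ?yE ?orbT //.
 by apply: connect_trans xu _;rewrite e fsym.
have cx := connect0 (frel gam) x;have cy := connect0 (frel gam) y.
have gx := fconnect1 gam x;have gy := fconnect1 gam y.
have eE: E :\ y :\ x = E :\ x :\ y by apply/setP => z;rewrite !inE andbCA.
rewrite /g eE (@cre_cre (gam x) (gam y)) ?key // (@cre_cre (gam x) y) ?key //.
by rewrite (@cre_cre x (gam y)) ?key // (@cre_cre x y) ?key //;ring.
Qed.

End Cells.

Notation cre_of := cre.
Notation bdry_of := bdry.

Section Tops.
Variables (k : fieldType) (X : finType) (gam : X -> X) (c : X -> X -> k).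
Hypothesis gamI : injective gam.
Implicit Types (V E Y : {set X}) (f : {set X} * {set X} -> k).

Let fsym := fconnect_sym gamI.

(** Top cells pick an edge in every polygon. They involve no vertex signs, so the fundamental class
    [tsum] is a plain sum over them. *)
Definition tcell Y E := vcell gam Y (set0, E) && [forall x in Y, [exists y in E, fconnect gam y x]].
Definition tsum Y f : k := \sum_(E | tcell Y E) f (set0, E).

Lemma tcellP Y E : reflect [/\ E \subset Y,
 forall x y, x \in E -> y \in E -> fconnect gam x y -> x = y
 & forall x, x \in Y -> exists2 y, y \in E & fconnect gam y x] (tcell Y E).
apply: (iffP andP) => [[/(vcellP gam)[_ h1 _ h2] h3]|[h1 h2 h3]];split=> //.
- by move=> x y xE yE;apply: h2;rewrite set0U.
- by move=> x /(forall_inP h3)/exists_inP[y];exists y.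
- by apply/(vcellP gam);split=> //;[exact: sub0set|by move=> x;rewrite inE|by move=> x y;rewrite !set0U;exact: h2].
- by apply/forall_inP => x /h3[y yE yx];apply/exists_inP;exists y.
Qed.

Section Split.
Variables (Y : {set X}) (x0 : X).
Hypotheses (gY : gstable gam Y) (x0Y : x0 \in Y).
(** One polygon; together with the join [rest_orb] of the others it drives the inductions on the
    number of polygons. *)
Definition orb0 := [set y in Y | fconnect gam x0 y].
Definition rest_orb := Y :\: orb0.

Lemma orb0E y : (y \in orb0) = fconnect gam x0 y.
rewrite inE;case e: (fconnect gam x0 y);rewrite ?andbF //.
by rewrite -(gstable_connect gY e) x0Y.
Qed.
Lemma gstable_rest0 : gstable gam rest_orb.
move=> x;rewrite !inE gY -[X in ~~ (_ && X)](same_connect_r fsym (fconnect1 gam x)) //.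
Qed.
Lemma orb0_connect x y : x \in orb0 -> (y \in orb0) = fconnect gam x y.
by rewrite !orb0E => x0x;rewrite (same_connect fsym x0x). Qed.
Lemma rest0_nconnect x y : x \in orb0 -> y \in rest_orb -> fconnect gam x y = false.
by move=> xO;rewrite -(orb0_connect y xO) inE => /andP[/negbTE]. Qed.
Lemma vcell_add V E x : vcell gam rest_orb (V, E) -> x \in orb0 ->
 [/\ x \notin V, x \notin E, vcell gam Y (x |: V, E) & vcell gam Y (V, x |: E)].
move=> /(vcellP gam)[h1 h2 h3 h4] xO.
have nin (Z : {set X}) : Z \subset rest_orb -> x \notin Z.
 by move=> h;apply/negP => xZ;have := subsetP h _ xZ;rewrite inE xO.
have xY: x \in Y by move: xO;rewrite inE => /andP[].
have VE y : y \in V :|: E -> y \in rest_orb.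
 by rewrite inE => /orP[/(subsetP h1)|/(subsetP h2)].
have key y y' : y \in x |: (V :|: E) -> y' \in x |: (V :|: E) -> fconnect gam y y' -> y = y'.
 rewrite !in_setU1 => /orP[/eqP->|hy] /orP[/eqP->|hy'] //.
 - by rewrite rest0_nconnect ?VE.
 - by rewrite fsym rest0_nconnect ?VE.
 - exact: h4.
have sub (Z : {set X}) : Z \subset rest_orb -> Z \subset Y by move=> h;apply: subset_trans h (subsetDl _ _).
split;rewrite ?nin //;apply/(vcellP gam);split;rewrite ?subUset ?sub1set ?xY ?sub //.
- by move=> y;rewrite !inE => /orP[/eqP->|];[apply/negP/nin|exact: h3].
- by move=> y y';rewrite -!setUA;apply: key.
- by move=> y yV;rewrite !inE => /orP[/eqP yx|];[move: yV;rewrite yx;apply/negP/nin|exact: h3].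
- by move=> y y';rewrite !(setUCA V);apply: key.
Qed.
Lemma vcell_split V E : vcell gam Y (V, E) ->
 [\/ vcell gam rest_orb (V, E),
   exists x, [/\ x \in orb0, x \in V & vcell gam rest_orb (V :\ x, E)] |
   exists x, [/\ x \in orb0, x \in E & vcell gam rest_orb (V, E :\ x)]].
move=> /(vcellP gam)[h1 h2 h3 h4].
have uni x : x \in orb0 -> x \in V :|: E -> forall y, y \in V :|: E -> y != x -> y \in rest_orb.
 move=> xO xVE y yVE yx;rewrite inE (orb0_connect y xO).
 apply/andP;split;last by move: yVE;rewrite inE => /orP[/(subsetP h1)|/(subsetP h2)].
 by apply: contraNN yx => xy;rewrite (h4 x y).
have [x /andP[xO xV]|nV] := pickP [pred x | (x \in orb0) && (x \in V)].
 apply: Or32;exists x;split=> //;apply/(vcellP gam);split.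
 - apply/subsetP => y;rewrite !inE => /andP[yx yV].
  by have := uni x xO _ y _ yx;rewrite !inE xV yV;apply.
 - apply/subsetP => y yE;apply: (uni x xO);rewrite ?inE ?xV ?yE ?orbT //.
  by apply: contraTneq yE => ->;apply/negP;apply: h3.
 - by move=> y;rewrite inE => /andP[_];apply: h3.
 - by move=> y y';rewrite !inE => hy hy';apply: h4;rewrite inE;
   [case/orP: hy => [/andP[_ ->]|->]|case/orP: hy' => [/andP[_ ->]|->]];rewrite ?orbT.
have [x /andP[xO xE]|nE] := pickP [pred x | (x \in orb0) && (x \in E)].
 apply: Or33;exists x;split=> //;apply/(vcellP gam);split.
 - apply/subsetP => y yV;apply: (uni x xO);rewrite ?inE ?xE ?yV ?orbT //.
  by apply: contraTneq yV => ->;apply/negP => /h3;apply.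
 - apply/subsetP => y;rewrite !inE => /andP[yx yE].
  by have := uni x xO _ y _ yx;rewrite !inE xE yE ?orbT;apply.
 - by move=> y yV;rewrite inE => /andP[_];apply: h3.
 - by move=> y y';rewrite !inE => hy hy';apply: h4;rewrite inE;
   [case/orP: hy => [->|/andP[_ ->]]|case/orP: hy' => [->|/andP[_ ->]]];rewrite ?orbT.
apply: Or31;apply/(vcellP gam);split=> //;apply/subsetP => y yy.
 by rewrite inE (subsetP h1 _ yy) andbT;apply/negP => yO;have := nV y;rewrite /= yO yy.
by rewrite inE (subsetP h2 _ yy) andbT;apply/negP => yO;have := nE y;rewrite /= yO yy.
Qed.
Lemma tcell_add E x : x \in orb0 -> tcell rest_orb E = [&& x \notin E & tcell Y (x |: E)].
move=> xO;apply/idP/andP => [h|[xE /tcellP[h1 h2 h3]]].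
 have v: vcell gam rest_orb (set0, E) by case/andP: h.
 have [_ xE _ /(vcellP gam)[_ h1 _ h2]] := vcell_add v xO;split=> //.
 apply/tcellP;split=> // [y y' yE y'E|y yY];first by apply: h2;rewrite set0U.
 have [yO|nyO] := boolP (y \in orb0).
  by exists x;rewrite ?inE ?eqxx // -(orb0_connect y xO).
 have /tcellP[_ _ h3] := h;have [|z zE zy] := h3 y;first by rewrite inE nyO.
 by exists z => //;rewrite inE zE orbT.
apply/tcellP;split.
- apply/subsetP => y yE;rewrite in_setD (subsetP h1 y) ?andbT;last by rewrite inE yE orbT.
 rewrite (orb0_connect y xO);apply: contraNN xE => xy.
 by rewrite (h2 x y) // !inE ?eqxx ?yE ?orbT.
- by move=> y y' yE y'E;apply: h2;rewrite inE ?yE ?y'E orbT.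
- move=> y;rewrite inE => /andP[nyO /h3[z]];rewrite !inE => /orP[/eqP->|zE] zy;last by exists z.
 by rewrite (orb0_connect y xO) zy in nyO.
Qed.
Lemma tsum_split f : tsum Y f = \sum_(x in orb0) tsum rest_orb (fun q => f (q.1, x |: q.2)).
transitivity (\sum_(E | tcell Y E) \sum_(x in orb0 | x \in E) f (set0, E)).
 apply: eq_bigr => E /tcellP[h1 h2 h3].
 have [x xE xx0] := h3 x0 x0Y.
 rewrite (big_pred1 x) // => y /=;rewrite orb0E.
 apply/andP/eqP => [[x0y yE]|->];last by rewrite fsym xx0.
 by apply: h2 => //;rewrite fsym (connect_trans xx0).
rewrite (exchange_big_dep (mem orb0)) //=;last by move=> E x _ /andP[].
apply: eq_bigr => x xO;rewrite /tsum /=.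
rewrite (reindex_onto (fun E => x |: E) (fun E => E :\ x)) /=;last first.
 by move=> E /and3P[_ _ xE];rewrite setD1K.
apply: eq_bigl => E;rewrite (tcell_add _ xO) xO setU11 andbT andbC;congr (_ && _);rewrite ?andbT //.
apply/eqP/idP => [<-|xE];first by rewrite !inE eqxx.
by rewrite setU1K.
Qed.

End Split.
End Tops.

(** * A join of polygons has the cohomology of a sphere *)

Section Exact.
Variables (k : fieldType) (X : finType) (gam : X -> X) (c : X -> X -> k).
Hypothesis gamI : injective gam.
Hypothesis cN : forall x y, x != y -> c y x = - c x y.
Hypothesis cc : forall x y, c x y * c x y = 1.
Implicit Types (V E Y : {set X}) (f : {set X} * {set X} -> k).

Notation bdry := (bdry gam c).
Notation cre := (cre c).
Notation vcell := (vcell gam).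
Let fsym := fconnect_sym gamI.

Definition cdim (q : {set X} * {set X}) := (#|q.1| + 2 * #|q.2|)%N.

Lemma bdry_lin a f g q : bdry (fun q => a * f q + g q) q = a * bdry f q + bdry g q.
rewrite /bdry_of /ann /lnk !mulrDr !mulr_sumr addrACA -!big_split.
by congr (_ + _);apply: eq_bigr => x _;rewrite /cre_of /=;ring.
Qed.
Lemma bdry_loc Y f g q : gstable gam Y -> vcell Y q ->
 (forall q', vcell Y q' -> (cdim q').+1 = cdim q -> f q' = g q') -> bdry f q = bdry g q.
case: q => V E gY v fg;rewrite /bdry_of /ann /lnk /=;congr (_ + _);apply: eq_bigr => x xq.
 rewrite fg //;first exact: vcell_ann.
 by rewrite /cdim /= (cardsD1 x V) xq;lia.
have dz z : fconnect gam x z -> cre z f (V, E :\ x) = cre z g (V, E :\ x).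
 move=> xz;have [zV v'] := vcell_edge gamI gY v xq xz.
 by rewrite /cre_of fg //= /cdim /= cardsU1 zV (cardsD1 x E) xq;lia.
by rewrite !dz ?connect0 ?fconnect1.
Qed.
Lemma bdry0 q : bdry (fun=> 0) q = 0.
exact: (@fun0 k _ (fun f => bdry f q) (fun a f g => bdry_lin a f g q)). Qed.
Lemma bdry_sum (I : finType) (P : pred I) (F : I -> {set X} * {set X} -> k) q :
 bdry (fun q => \sum_(i | P i) F i q) q = \sum_(i | P i) bdry (F i) q.
rewrite /bdry_of /ann /lnk [RHS]big_split /=;congr (_ + _).
 rewrite exchange_big;apply: eq_bigr => x _;by rewrite mulr_sumr.
rewrite exchange_big;apply: eq_bigr => x _;rewrite sumrB /cre_of !mulr_sumr //.
Qed.
(** Adding a vertex outside Y is coning, hence a contracting homotopy. *)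
Lemma cre_bdry Y V E x f : gstable gam Y -> vcell Y (V, E) -> x \notin Y ->
 cre x (bdry f) (V, E) = f (V, E) - bdry (cre x f) (V, E).
move=> gY v xY;have /vcellP[h1 h2 _ _] := v.
have xV: x \notin V by apply: contraNN xY;apply: (subsetP h1).
have -> : cre x (bdry f) (V, E) = cre x (ann c f) (V, E) + cre x (lnk gam c f) (V, E).
 by rewrite /cre_of /bdry_of /=;ring.
rewrite (cre_ann cN cc f E xV) /bdry_of opprD addrA;congr (_ + _).
rewrite {1}/cre_of /lnk /= mulr_sumr -sumrN;apply: eq_bigr => y yE.
have [yV gyV] := edge_notin gamI gY v yE.
have yx: x != y by apply: contraNneq xY => ->;apply: (subsetP h2).
have gyx: x != gam y by apply: contraNneq xY => ->;rewrite gY;apply: (subsetP h2).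
have c1 := @cre_cre k X c cN _ _ f V (E :\ y) xV yV yx.
have c2 := @cre_cre k X c cN _ _ f V (E :\ y) xV gyV gyx.
transitivity (cre x (cre (gam y) f) (V, E :\ y) - cre x (cre y f) (V, E :\ y)).
 by rewrite mulrBr.
by rewrite c1 c2;ring.
Qed.
Lemma bdry_edge V E x f : x \notin E ->
 bdry f (V, x |: E) = bdry (fun q => f (q.1, x |: q.2)) (V, E)
  + (cre (gam x) f (V, E) - cre x f (V, E)).
move=> xE;rewrite /bdry_of /lnk /= big_setU1 //= setU1K // -[RHS]addrA;congr (_ + _).
rewrite [LHS]addrC;congr (_ + _);apply: eq_bigr => y yE;rewrite /cre_of /=.
have -> // : (x |: E) :\ y = x |: E :\ y.
by apply/setP => z;rewrite !inE;case: (eqVneq z x) => // ->;case: eqP => // xy;rewrite xy yE in xE.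
Qed.
Lemma tsum0 f : tsum gam set0 f = f (set0, set0).
rewrite /tsum (big_pred1 set0) // => E /=;apply/tcellP/eqP => [[]|->].
 by rewrite subset0 => /eqP.
by split=> [|x y|x];rewrite ?sub0set ?inE.
Qed.
Lemma eq_tsum Y f g : (forall E, tcell gam Y E -> f (set0, E) = g (set0, E)) ->
 tsum gam Y f = tsum gam Y g.
by move=> fg;apply: eq_bigr => E;apply: fg. Qed.
Lemma tsum_lin Y a f g : tsum gam Y (fun q => a * f q + g q) = a * tsum gam Y f + tsum gam Y g.
by rewrite /tsum big_split mulr_sumr. Qed.
Lemma card_rest0 Y x0 : x0 \in Y -> (#|rest_orb gam Y x0| < #|Y|)%N.
move=> x0Y;apply: proper_card;apply/properP;split;first exact: subsetDl.
by exists x0 => //;rewrite !inE x0Y connect0.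
Qed.
Lemma orb0_gam Y x0 x : gstable gam Y -> x0 \in Y -> (gam x \in orb0 gam Y x0) = (x \in orb0 gam Y x0).
by move=> gY x0Y;rewrite !(orb0E gY x0Y) -(same_connect_r fsym (fconnect1 gam x)).
Qed.
(** Around one polygon the contributions g (gam x) - g x of its edges cancel, since gam permutes the
    orbit; what remains is an integral over the other polygons. *)
Lemma tsum_bdry Y f : gstable gam Y -> tsum gam Y (bdry f) = 0.
have [n] := ubnP #|Y|;elim: n Y f => // n IH Y f;rewrite ltnS => leY gY.
have [->|[x0 x0Y]] := set_0Vmem Y.
 by rewrite tsum0 /bdry_of /ann /lnk !big_set0 addr0.
rewrite (tsum_split gamI gY x0Y).
set O := orb0 gam Y x0;set R := rest_orb gam Y x0.
have gR: gstable gam R by apply: gstable_rest0.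
pose g x := tsum gam R (cre x f).
rewrite (eq_bigr (fun x => g (gam x) - g x)) => [|x xO].
 rewrite sumrB;apply/eqP;rewrite subr_eq0;apply/eqP.
 rewrite [RHS](reindex_inj gamI) /=.
 by apply: eq_bigl => x;rewrite /O orb0_gam.
transitivity (tsum gam R (fun q => 1 * bdry (fun q => f (q.1, x |: q.2)) q
  + (1 * cre (gam x) f q + (-1 * cre x f q + 0)))).
 apply: eq_tsum => E tE;have vE: vcell R (set0, E) by case/andP: tE.
 have [_ xE _ _] := vcell_add gamI gY x0Y vE xO.
 by rewrite /= bdry_edge //;ring.
rewrite !tsum_lin IH //;last exact: leq_trans (card_rest0 x0Y) leY.
have t0: tsum gam R (fun=> 0 : k) = 0 by rewrite /tsum big1.
by rewrite t0 /g;ring.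
Qed.
(** Split off the polygon O of x0. On cells of the remaining join R, f has a part without O, parts
    cre x f for the vertices x of O, and parts b x for its edges. Closedness makes every cre x f a
    primitive of f ([eqa]) and b x a homotopy between cre x f and cre (gam x) f ([eqb]). The sum of
    the b x is closed with integral 0, so it has a primitive b' by induction. A primitive u of f is
    then given by cre x0 f on R, by the sum of the b along the arc from x0 to x at the vertex x, and
    by b' at the last edge, the one that returns to x0. *)
Lemma bdry_exact Y f : gstable gam Y -> (forall q, vcell Y q -> bdry f q = 0) ->
 tsum gam Y f = 0 -> exists u, forall q, vcell Y q -> f q = bdry u q.
have [n] := ubnP #|Y|;elim: n Y f => // n IH Y f;rewrite ltnS => leY gY df sf.
have [Y0|[x0 x0Y]] := set_0Vmem Y.
 exists (fun=> 0) => -[V E] /vcellP[];rewrite Y0 !subset0 => /eqP-> /eqP-> _ _.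
 by rewrite bdry0 -tsum0 -Y0.
set O := orb0 gam Y x0;set R := rest_orb gam Y x0.
have gR: gstable gam R by apply: gstable_rest0.
have x0O: x0 \in O by rewrite inE x0Y connect0.
have addv V E x : vcell R (V, E) -> x \in O ->
 [/\ x \notin V, x \notin E, vcell Y (x |: V, E) & vcell Y (V, x |: E)] by apply: vcell_add.
have xR x : x \in O -> x \notin R by move=> xO;rewrite /R /rest_orb in_setD -/O xO.
have OS x : x \in O -> gam x \in O by rewrite /O orb0_gam.
have eqa q x : vcell R q -> x \in O -> f q = bdry (cre x f) q.
 case: q => V E v xO;apply/eqP;rewrite -subr_eq0 -(cre_bdry f gR v (xR _ xO)).
 by rewrite /cre_of /= df ?mulr0 //;case: (addv _ _ _ v xO).
pose b x q := f (q.1, x |: q.2).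
have eqb q x : vcell R q -> x \in O -> bdry (b x) q = cre x f q - cre (gam x) f q.
 case: q => V E v xO;have [_ xE _ v'] := addv _ _ _ v xO.
 have := bdry_edge V f xE;rewrite df // -/(b x) => /esym/eqP.
 by rewrite addr_eq0 => /eqP ->;rewrite opprB.
have [||b' Hb] := IH R (fun q => \sum_(x in O) b x q) (leq_trans (card_rest0 x0Y) leY) gR.
- move=> q v;rewrite bdry_sum (eq_bigr (fun x => cre x f q - cre (gam x) f q)).
  rewrite sumrB;apply/eqP;rewrite subr_eq0;apply/eqP.
  rewrite [LHS](reindex_inj gamI) /=;apply: eq_bigl => x.
  by rewrite /O orb0_gam.
 by move=> x xO;rewrite eqb.
- rewrite -[RHS]sf (tsum_split gamI gY x0Y) /tsum exchange_big.
 by apply: eq_bigr => E _.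
pose ind x := findex gam x0 x.
pose a' x q := \sum_(i < ind x) b (iter i gam x0) q.
have iterO i : iter i gam x0 \in O by elim: i => //= i /OS.
have da' x q : x \in O -> vcell R q -> bdry (a' x) q = cre x0 f q - cre x f q.
 move=> xO v;rewrite bdry_sum.
 suff H m : \sum_(i < m) bdry (b (iter i gam x0)) q = cre x0 f q - cre (iter m gam x0) f q.
  by rewrite H iter_findex // -(orb0E gY x0Y).
 elim: m => [|m IHm];first by rewrite big_ord0 subrr.
 by rewrite big_ord_recr /= IHm eqb //= addrA subrK.
pose last x := gam x == x0.
pose u (q : {set X} * {set X}) : k :=
 if [pick x in O | x \in q.1] is Some x then cre x (fun p => a' x (p.1 :\ x, p.2)) (q.1 :\ x, q.2)
 else if [pick x in O | x \in q.2] is Some x then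
  (if last x then b' (q.1, q.2 :\ x) else 0)
 else cre x0 f q.
have pickN (Z : {set X}) x : [disjoint Z & O] -> x \in O -> [pick y in O | y \in x |: Z] = Some x.
 move=> ZO xO;case: pickP => [y /andP[yO]|/(_ x)];last by rewrite xO setU11.
 by rewrite !inE => /orP[/eqP->//|yZ];move: (disjointFr ZO yZ);rewrite yO.
have pick0 (Z : {set X}) : [disjoint Z & O] -> [pick y in O | y \in Z] = None.
 by move=> ZO;case: pickP => // y /andP[yO yZ];move: (disjointFr ZO yZ);rewrite yO.
have dis V E : vcell R (V, E) -> [disjoint V & O] /\ [disjoint E & O].
 move=> /vcellP[h1 h2 _ _];split;apply/pred0P => y /=;apply/negP => /andP[yV yO].
  by have := subsetP h1 _ yV;apply/negP/xR.
 by have := subsetP h2 _ yV;apply/negP/xR.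
have u0 q : vcell R q -> u q = cre x0 f q.
 by case: q => V E /dis[dV dE];rewrite /u /= !pick0.
have u1 q x : vcell R q -> x \in O -> cre x u q = a' x q.
 case: q => V E v xO;have [dV dE] := dis _ _ v;have [xV _ _ _] := addv _ _ _ v xO.
 rewrite {1}/cre_of /u /= pickN // setU1K // /cre_of /= setU1K // mulrA -big_split /=.
 by rewrite big1 ?mul1r.
have u2 q x : vcell R q -> x \in O -> u (q.1, x |: q.2) = if last x then b' q else 0.
 case: q => V E v xO;have [dV dE] := dis _ _ v;have [_ xE _ _] := addv _ _ _ v xO.
 by rewrite /u /= pick0 // pickN // setU1K.
exists u => -[V E] v.
have [v'|[x [xO xV v']]|[x [xO xE v']]] := vcell_split gamI gY x0Y v.
- rewrite (eqa _ x0) //;apply: (bdry_loc gR v') => q vq _;by rewrite u0.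
- have xV' : x \notin V :\ x by rewrite !inE eqxx.
 suff e : cre x f (V :\ x, E) = cre x (bdry u) (V :\ x, E).
  have P2: (\prod_(y in V :\ x) c x y) != 0.
   apply/eqP => P0;have : (\prod_(y in V :\ x) c x y) * (\prod_(y in V :\ x) c x y) = 1.
    by rewrite -big_split big1 // => y _;apply: cc.
   by rewrite P0 mul0r => /esym/eqP;rewrite oner_eq0.
  by move: e;rewrite /cre_of /= setD1K // => /(mulfI P2).
 rewrite (cre_bdry u gR v' (xR _ xO)) u0 //.
 have -> : bdry (cre x u) (V :\ x, E) = bdry (a' x) (V :\ x, E).
  by apply: (bdry_loc gR v') => q vq _;rewrite u1.
 by rewrite da' // opprB addrC subrK.
have xE' : x \notin E :\ x by rewrite !inE eqxx.
have edge := bdry_edge V u xE';rewrite setD1K // !u1 ?OS // in edge;rewrite edge.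
have -> : f (V, E) = b x (V, E :\ x) by rewrite /b /= setD1K.
have -> : bdry (fun q => u (q.1, x |: q.2)) (V, E :\ x) =
  bdry (fun q => if last x then b' q else 0) (V, E :\ x).
 by apply: (bdry_loc gR v') => q vq _;rewrite u2.
have x0x: fconnect gam x0 x by rewrite -(orb0E gY x0Y).
have xind: iter (ind x) gam x0 = x by apply: iter_findex.
have ltx: (ind x < fingraph.order gam x0)%N by apply: findex_max.
rewrite /last;case: eqP => gx.
 have ox: (ind x).+1 = fingraph.order gam x0.
  apply/eqP;rewrite eqn_leq ltx leqNgt;apply/negP => lt.
  by have := findex_iter lt;rewrite iterS xind gx findex0.
 have -> : bdry (fun q => b' q) (V, E :\ x) = bdry b' (V, E :\ x) by [].
 rewrite -Hb // gx {1}/a' /ind findex0 big_ord0 sub0r.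
 have -> : \sum_(y in O) b y (V, E :\ x) = \sum_(i < fingraph.order gam x0) b (iter i gam x0) (V, E :\ x).
  rewrite (eq_bigl (mem (fingraph.orbit gam x0))) => [|y];last by rewrite /O (orb0E gY x0Y) fconnect_orbit.
  rewrite -big_uniq ?fingraph.orbit_uniq //= /fingraph.orbit.
  elim: (fingraph.order gam x0) => [|m IHm];first by rewrite big_nil big_ord0.
  by rewrite trajectSr -cats1 big_cat big_seq1 big_ord_recr IHm.
 by rewrite -ox big_ord_recr /= xind /a' addrAC subrr add0r.
have gxi: ind (gam x) = (ind x).+1.
 have [lt|ge] := ltnP (ind x).+1 (fingraph.order gam x0).
  by have := findex_iter lt;rewrite iterS xind.
 have e: (ind x).+1 = fingraph.order gam x0 by apply/eqP;rewrite eqn_leq ltx ge.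
 by case: gx;rewrite -[RHS](iter_order gamI) -e iterS xind.
by rewrite bdry0 add0r /a' gxi big_ord_recr /= xind addrAC subrr add0r.
Qed.
Lemma tcell_roots Y : gstable gam Y -> tcell gam Y [set x in Y | froots gam x].
move=> gY;apply/tcellP;split.
- by apply/subsetP => x;rewrite inE => /andP[].
- move=> x y;rewrite !inE => /andP[_ /eqP rx] /andP[_ /eqP ry] /(fingraph.rootP fsym).
 by rewrite rx ry.
- move=> x xY;exists (froot gam x);last by rewrite fsym connect_root.
 by rewrite inE roots_root // andbT -(gstable_connect gY (connect_root _ x)).
Qed.
Definition norb Y := #|[set x in Y | froots gam x]|.

Lemma card_indep Y (A : {set X}) : gstable gam Y -> A \subset Y ->
 (forall x y, x \in A -> y \in A -> fconnect gam x y -> x = y) -> (#|A| <= norb Y)%N.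
move=> gY AY ind;rewrite -(@card_in_imset _ _ (froot gam));last first.
 by move=> x y xA yA /(fingraph.rootP fsym);apply: ind.
apply/subset_leq_card/subsetP => _ /imsetP[x xA ->].
by rewrite inE roots_root // andbT -(gstable_connect gY (connect_root _ x)) (subsetP AY).
Qed.
Lemma card_tcell Y E : gstable gam Y -> tcell gam Y E -> #|E| = norb Y.
move=> gY /tcellP[h1 h2 h3];apply/eqP;rewrite eqn_leq card_indep //=.
rewrite -(@card_in_imset _ _ (froot gam) E);last by move=> x y xA yA /(fingraph.rootP fsym);apply: h2.
apply/subset_leq_card/subsetP => x;rewrite inE => /andP[/h3[y yE yx] /eqP rx].
by apply/imsetP;exists y => //;rewrite -rx;apply/esym/(fingraph.rootP fsym).
Qed.
Lemma cdim_le Y q : gstable gam Y -> vcell Y q -> (cdim q <= 2 * norb Y)%N.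
case: q => V E gY /vcellP[h1 h2 h3 h4];rewrite /cdim /=.
have le: (#|V :|: E| <= norb Y)%N by apply: card_indep;rewrite // subUset h1.
have dVE: #|V :&: E| = 0%N.
 by apply/eqP;rewrite cards_eq0 -subset0;apply/subsetP => x /setIP[/h3 xV /xV].
by move: le;rewrite cardsU dVE subn0;lia.
Qed.

End Exact.

(** * Invariant signs, and the join as an equivariant complex *)

Section Sign.
Variables (k : fieldType) (gT : finGroupType) (X : finType) (act : X -> gT -> X).
Hypothesis actM : forall x g h, act (act x g) h = act x (g * h)%g.
Hypothesis act1 : forall x, act x 1%g = x.

Lemma act_inj g : injective (act^~ g).
by apply: (can_inj (g := act^~ g^-1%g)) => x;rewrite actM mulgV act1. Qed.

                                                                             
                                                                  
(** The signs of an arbitrary ordering are multiplied over L, which makes them invariant. For p odd,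
    #|L| is odd and the product stays antisymmetric; for p = 2, -1 = 1 in k. *)
Lemma sign_exists p (L : {group gT}) : prime p -> p \in [pchar k] -> (p.-group L)%g ->
 exists c : X -> X -> k, [/\ forall x y, x != y -> c y x = - c x y,
  forall x y, c x y * c x y = 1
  & forall g, g \in L -> forall x y, c (act x g) (act y g) = c x y].
move=> pp chp pL;pose t (x y : X) : k := (-1) ^+ (enum_rank x < enum_rank y)%N.
exists (fun x y => \prod_(h in L) t (act x h) (act y h));split.
- move=> x y xy;have e: (-1) ^+ #|L| = -1 :> k.
  have [p2|p2] := eqVneq p 2%N.
   have /oppr_pchar2 N : 2%N \in [pchar k] by rewrite -p2.
   by rewrite N expr1n.
  have oL: odd #|L|.
   have [n ->] := p_natP pL;rewrite oddX;apply/orP;right.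
   by case/even_prime: pp p2 => [->|].
  by rewrite -signr_odd oL.
 rewrite -mulN1r -e -prodr_const -big_split;apply: eq_bigr => h _ /=.
 have : act x h != act y h by rewrite (inj_eq (@act_inj h)).
 rewrite -(inj_eq enum_rank_inj) -val_eqE /t /=.
 by case: ltngtP => //= _ _;rewrite ?expr0 ?expr1;ring.
- by move=> x y;rewrite -big_split big1 // => h _;rewrite /= /t -signr_addb addbb.
- move=> g gL x y;rewrite [RHS](reindex_inj (mulgI g)) /=.
 by apply: eq_big => h;rewrite ?groupMl ?actM.
Qed.
End Sign.

Section Instance.
Variables (k : fieldType) (gT : finGroupType) (X : finType) (act : X -> gT -> X).
Hypothesis actM : forall x g h, act (act x g) h = act x (g * h)%g.
Hypothesis act1 : forall x, act x 1%g = x.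
Variables (gam : X -> X) (c : X -> X -> k).
Hypothesis gamI : injective gam.
Hypothesis cN : forall x y, x != y -> c y x = - c x y.
Hypothesis cc : forall x y, c x y * c x y = 1.

Definition cact (q : {set X} * {set X}) g : {set X} * {set X} :=
 ([set act x g | x in q.1], [set act x g | x in q.2]).

Lemma cactM q g h : cact (cact q g) h = cact q (g * h)%g.
by rewrite /cact /=;congr pair;rewrite -imset_comp;apply: eq_imset => x /=;rewrite actM.
Qed.
Lemma cact1 q : cact q 1%g = q.
case: q => V E;rewrite /cact /=;congr pair;rewrite -[RHS]imset_id;apply: eq_imset => x;
 exact: act1.
Qed.

Variables (L : {group gT}) (Y : {set X}).
Hypothesis cL : forall g, g \in L -> forall x y, c (act x g) (act y g) = c x y.
Hypothesis gamL : forall g, g \in L -> forall x, gam (act x g) = act (gam x) g.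
Hypothesis gY : gstable gam Y.
Hypothesis YL : forall x g, x \in Y -> g \in L -> act x g \in Y.

Let aI g : injective (act^~ g) := @act_inj gT X act actM act1 g.

Lemma fconnect_act g x y : g \in L -> fconnect gam (act x g) (act y g) = fconnect gam x y.
have st h a b : h \in L -> fconnect gam a b -> fconnect gam (act a h) (act b h).
 move=> hL /iter_findex <-;elim: (findex _ _ _) => //= n IH.
 by rewrite -gamL //;apply: connect_trans IH (fconnect1 _ _).
move=> gL;apply/idP/idP;last exact: st.
by move/(st _ _ _ (groupVr gL));rewrite !actM mulgV !act1.
Qed.
Lemma act_in x g : g \in L -> (act x g \in Y) = (x \in Y).
move=> gL;apply/idP/idP => [|/YL];last exact.
by move/YL => /(_ _ (groupVr gL));rewrite actM mulgV act1.
Qed.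
Lemma vcell_cact q g : vcell gam Y q -> g \in L -> vcell gam Y (cact q g).
case: q => V E /vcellP[h1 h2 h3 h4] gL;apply/vcellP;split.
- by apply/subsetP => _ /imsetP[x /(subsetP h1) xY ->];apply: YL.
- by apply/subsetP => _ /imsetP[x /(subsetP h2) xY ->];apply: YL.
- move=> _ /imsetP[x xV ->];rewrite (mem_imset _ _ (@aI g));exact: h3.
- move=> x y;rewrite /= -imsetU => /imsetP[{}x xVE ->] /imsetP[{}y yVE ->].
 by rewrite fconnect_act // => /h4 ->.
Qed.
Lemma cdim_cact q g : cdim (cact q g) = cdim q.
by rewrite /cdim /cact /= !card_imset //;exact: aI. Qed.
Lemma imsetD1 (V : {set X}) x g :
 [set act x g | x in V] :\ act x g = [set act x g | x in V :\ x].
apply/setP => y;rewrite !inE;apply/andP/imsetP.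
 by move=> [nx /imsetP[z zV e]];exists z;rewrite // !inE zV andbT;apply: contraNneq nx => <-;rewrite e.
by move=> [z];rewrite !inE => /andP[zx zV] ->;rewrite (inj_eq (@aI g)) zx imset_f.
Qed.
Lemma imsetU1' (V : {set X}) x g :
 act x g |: [set act x g | x in V] = [set act x g | x in x |: V].
by rewrite imsetU1. Qed.
Lemma bdry_cact f q g : g \in L -> bdry gam c (fun q => f (cact q g)) q = bdry gam c f (cact q g).
move=> gL;have Pg x (V : {set X}) : \prod_(y in [set act x g | x in V]) c (act x g) y = \prod_(y in V) c x y.
 rewrite big_imset /=;last by move=> ? ? _ _;apply: aI.
 by apply: eq_bigr => y _;rewrite cL.
rewrite /bdry /ann /lnk;congr (_ + _);rewrite [RHS]big_imset /=;try by move=> ? ? _ _;apply: aI.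
 by apply: eq_bigr => x _;rewrite imsetD1 Pg.
by apply: eq_bigr => x _;rewrite /cre /= !imsetD1 gamL // !imsetU1' !Pg.
Qed.
Lemma tcell_cact (E : {set X}) g : g \in L -> tcell gam Y [set act x g | x in E] = tcell gam Y E.
have st h A : h \in L -> tcell gam Y A -> tcell gam Y [set act x h | x in A].
 move=> hL /tcellP[h1 h2 h3];apply/tcellP;split.
 - by apply/subsetP => _ /imsetP[x /(subsetP h1) xY ->];apply: YL.
 - by move=> _ _ /imsetP[x xA ->] /imsetP[y yA ->];rewrite fconnect_act // => /h2->.
 - move=> x xY;have [|y yA yx] := h3 (act x h^-1%g);first by rewrite act_in ?groupV.
  exists (act y h);first by rewrite imset_f.
  by rewrite -(fconnect_act _ _ (groupVr hL)) actM mulgV act1.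
move=> gL;apply/idP/idP;last exact: st.
move/(st _ _ (groupVr gL));congr (tcell _ _ _);rewrite -imset_comp -[RHS]imset_id.
by apply: eq_imset => x /=;rewrite actM mulgV act1.
Qed.
Lemma tsum_cact (f : {set X} * {set X} -> k) g : g \in L -> tsum gam Y (fun q => f (cact q g)) = tsum gam Y f.
move=> gL;rewrite /tsum [RHS](reindex_inj (imset_inj (@aI g))) /=.
by apply: eq_big => E;rewrite ?tcell_cact //;rewrite /cact /= imset0.
Qed.
(** The join of n polygons is a sphere of dimension 2n - 1, whence the length 2n with the empty cell
    included. *)
Lemma polygon_complex : complex L cact (vcell gam Y) (@cdim X) (bdry gam c) (set0, set0)
 (2 * norb gam Y) (tsum gam Y).
have locY f g q := @bdry_loc k X gam c gamI Y f g q gY.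
have top E : tcell gam Y E -> vcell gam Y (set0, E) /\ cdim (set0, E) = (2 * norb gam Y)%N.
 by move=> tE;split;[case/andP: tE|rewrite /cdim cards0 (card_tcell gamI gY tE)].
split.
- exact: vcell_cact.
- by move=> q g _ _;apply: cdim_cact.
- by move=> q a f g;apply: bdry_lin.
- by move=> f g q vq;apply: locY.
- by move=> f g q _;apply: bdry_cact.
- by move=> f q;apply: bdryK.
- by apply/vcellP;split=> [||x|x y];rewrite ?sub0set ?inE.
- case=> V E _;rewrite /cdim /= addn_eq0 muln_eq0 /= !cards_eq0.
 by rewrite xpair_eqE.
- by move=> q;apply: cdim_le.
- by move=> a f g;apply: tsum_lin.
- by move=> f g fg;apply: eq_tsum => E /top[];apply: fg.
- by move=> f g;apply: tsum_cact.
- by move=> f;apply: tsum_bdry.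
- have t0 := tcell_roots gamI gY;set E0 := [set x in Y | froots gam x] in t0.
 exists (fun q => (q == (set0, E0))%:R);rewrite /tsum (bigD1 E0) //= eqxx big1 ?addr0 //.
 by move=> E /andP[_ nE];rewrite xpair_eqE eqxx (negbTE nE).
(* [bdry_exact] wants closedness in all dimensions at once, so f is first cut down to dimension
   j. *)
- move=> j f df sf;pose f' q := if cdim q == j then f q else 0.
 have [|| u fu] := bdry_exact gamI cN cc (f := f') gY.
 + move=> q vq;have [dq|dq] := eqVneq (cdim q) j.+1.
   by rewrite -(df q vq dq);apply: locY => // q' _;rewrite dq /f' => -[->];rewrite eqxx.
  rewrite -(bdry0 gam c q);apply: locY => // q' _ e;rewrite /f';case: eqP => // e'.
  by case/eqP: dq;rewrite -e e'.
 + have [jN|jN] := eqVneq j (2 * norb gam Y)%N.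
   by rewrite -(sf jN);apply: eq_tsum => E /top[_ dE];rewrite /f' dE jN eqxx.
  transitivity (tsum gam Y (fun=> 0 : k));last by rewrite /tsum big1.
  by apply: eq_tsum => E /top[_ dE];rewrite /f' dE eq_sym (negbTE jN).
 by exists u => q vq dq;rewrite -fu // /f' dq eqxx.
Qed.

End Instance.

(** * Homogeneous components and classes of cocycles *)

Module Grading.
Import finmap monalg boolp functions ring zify generic_quotient Defs GRing.Theory.
Local Open Scope ring_scope.

Section Components.
Variables (k : fieldType) (gT : finGroupType).
Implicit Types (f F : cochain k gT) (w : seq gT) (z : cocycle k gT) (x y : cohomology k gT).

Lemma codiff_dt f w : (codiff f)@_(w : bar gT) = dt (fun u : seq gT => f@_(u : bar gT)) w.
rewrite codiffE;case: w => //= x w.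
have R (phi : seq gT -> k) g (v : seq gT) :
  rest phi g v = \sum_(0 <= i < (size v).+1) (-1) ^+ i * phi (face i.+1 (g :: v)).
 elim: v g phi => [|h v IH] g phi;first by rewrite big_nat1 expr0 mul1r.
 rewrite /= IH big_nat_recl //= expr0 mul1r -sumrN;congr (_ + _).
 by apply: eq_bigr => i _;rewrite exprS mulN1r mulNr.
rewrite R big_nat_recl //= expr0 mul1r face0 /= -sumrN;congr (_ + _).
by apply: eq_bigr => i _;rewrite exprS mulN1r mulNr.
Qed.
Definition trunc n f : cochain k gT := \sum_(t : n.-tuple gT) << f@_(tval t : bar gT) *g (tval t : bar gT) >>.

Lemma truncE n f w : (trunc n f)@_(w : bar gT) = if size w == n then f@_(w : bar gT) else 0.
exact: (mcoeff_words n (fun u => f@_(u : bar gT))). Qed.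
Lemma trunc_linear n : linear (trunc n).
move=> a f g;apply/malgP => w;rewrite mcoeffD mcoeffZ !truncE mcoeffD mcoeffZ.
by case: ifP;rewrite ?mulr0 ?addr0.
Qed.
Lemma codiff_trunc n f : codiff (trunc n f) = trunc n.+1 (codiff f).
apply/malgP => w;rewrite truncE !codiffE;case: w => [|x w] //.
rewrite -[(size (x :: w) == _)]/(size w == n);case: eqVneq => sz.
 by apply: eq_big_nat => i /andP[_ lti];rewrite truncE size_face //= sz eqxx.
rewrite big_nat big1 // => i /andP[_ lti];by rewrite truncE size_face //= (negbTE sz) mulr0.
Qed.
Lemma trunc_cocycle n z : trunc n (\val z) \in is_cocycle.
apply/eqP;rewrite codiff_trunc (eqP (valP z));apply/malgP => w.
by rewrite truncE mcoeff0 if_same.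
Qed.
(** The component of degree n. It is independent of the representative since truncation commutes
    with the differential up to a shift of degree, see [hpr_class]. *)
Definition hpr n x : cohomology k gT := coh_class (Cocycle (trunc_cocycle n (repr x))).

Lemma hpr_class n z : hpr n (coh_class z) = coh_class (Cocycle (trunc_cocycle n z)).
apply/eqP;rewrite class_eq;have /asboolP[f df] := repr_class z.
apply/asboolP;case: n => [|n].
 exists 0;rewrite raddf0 raddfB /=;apply/malgP => w;rewrite mcoeff0 mcoeffB !truncE.
 case: ifP => [/eqP/size0nil ->|_];rewrite ?subr0 // -mcoeffB.
 by have := congr1 (mcoeff ([::] : bar gT)) df;rewrite codiffE raddfB => <-.
exists (trunc n f);rewrite codiff_trunc df;apply/malgP => w.
by rewrite truncE !raddfB /= !truncE;case: ifP => //;rewrite subrr.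
Qed.
Lemma hpr_linear n : linear (hpr n).
move=> a x y;have [u ->] := classP x;have [v ->] := classP y.
rewrite -classZ -raddfD !hpr_class -classZ -raddfD;congr coh_class.
by apply/val_inj;apply: trunc_linear.
Qed.
HB.instance Definition _ n := GRing.isLinear.Build k (cohomology k gT) (cohomology k gT)
 *:%R (hpr n) (hpr_linear n).

Lemma hpr_hpr m n x : hpr m (hpr n x) = if m == n then hpr n x else 0.
have [u ->] := classP x;rewrite !hpr_class;case: (eqVneq m n) => [->|mn].
 by congr coh_class;apply/val_inj/malgP => w /=;rewrite !truncE;case: (size w == n).
rewrite -(raddf0 (@coh_class k gT));congr coh_class;apply/val_inj/malgP => w /=.
rewrite !truncE mcoeff0;case: ifP => // /eqP e;case: ifP => // /eqP e'.
by rewrite -e -e' eqxx in mn.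
Qed.
Lemma hpr_sum x : exists M, forall M', (M <= M')%N -> x = \sum_(n < M') hpr n x.
have [u ->] := classP x;exists (deg_bound (\val u)).+1 => M le.
under eq_bigr do rewrite hpr_class.
rewrite -raddf_sum;congr coh_class;apply/val_inj;rewrite raddf_sum /=;apply/malgP => w.
rewrite raddf_sum /=;under eq_bigr do rewrite truncE.
rewrite -big_mkcond /=;have [le_w|gt_w] := ltnP (size w) M.
 by rewrite (big_pred1 (Ordinal le_w)).
rewrite deg_boundP;last exact: leq_trans le gt_w.
by rewrite big1 // => i /eqP e;have := ltn_ord i;rewrite -e ltnNge gt_w.
Qed.
Definition hcl n x := hpr n x = x.

Lemma hcl_hpr n x : hcl n (hpr n x).
by rewrite /hcl hpr_hpr eqxx. Qed.
Lemma hclP n x : hcl n x <-> exists2 z, cochain_homogeneous n (\val z) & x = coh_class z.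
split=> [<-|[z hz ->]].
 have [z ->] := classP x;rewrite hpr_class;eexists;last by [].
 by move=> w;rewrite /= -mcoeff_neq0 truncE;case: ifP => [/eqP//|_];rewrite eqxx.
rewrite /hcl hpr_class;congr coh_class;apply/val_inj/malgP => w /=;rewrite truncE.
by case: eqP => // ne;apply/esym/eqP;rewrite mcoeff_eq0;apply/negP => /hz.
Qed.
Lemma homogeneousP x : homogeneous x <-> exists n, hcl n x.
split=> [[n [z [hz ->]]]|[n /hclP[z hz ->]]];last by exists n, z.
by exists n;apply/hclP;exists z.
Qed.
Lemma hpr_mul m n x y : hcl m x -> hpr (m + n) (x * y) = x * hpr n y.
case/hclP => u hu ->;have [v ->] := classP y.
rewrite -classM !hpr_class -classM;congr coh_class;apply/val_inj/malgP => w.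
rewrite /= truncE !cupE /=.
have u0 i : (i <= size w)%N -> i != m -> (cocycle_val u)@_(take i w : bar gT) = 0.
 move=> le ne;apply/eqP;rewrite mcoeff_eq0;apply/negP => /hu.
 by rewrite size_takel // => e;rewrite e eqxx in ne.
case: eqP => sz.
 apply: eq_big_nat => i /andP[_ lti];rewrite truncE size_drop sz.
 case: (eqVneq i m) => [->|ne];first by rewrite addKn eqxx.
 by rewrite u0 ?mul0r.
rewrite big_nat big1 // => i /andP[_ lti];rewrite truncE size_drop.
case: (eqVneq i m) => [ei|ne];last by rewrite u0 ?mul0r.
by case: eqP => [ej|_];rewrite ?mulr0 //;case: sz;rewrite -ej -ei;lia.
Qed.
Lemma hpr_mul_lt m n x y : hcl m x -> (n < m)%N -> hpr n (x * y) = 0.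
case/hclP => u hu ->;have [v ->] := classP y => lt.
rewrite -classM !hpr_class -(raddf0 (@coh_class k gT));congr coh_class;apply/val_inj/malgP => w.
rewrite truncE mcoeff0 !(rmorphM, cupE) /=;case: eqP => // sz.
rewrite big_nat big1 // => i /andP[_ lti].
rewrite (_ : (cocycle_val u)@_ _ = 0) ?mul0r //;apply/eqP;rewrite mcoeff_eq0;apply/negP => /hu.
by rewrite size_takel //;lia.
Qed.
Lemma hclM m n x y : hcl m x -> hcl n y -> hcl (m + n) (x * y).
by move=> hx hy;rewrite /hcl hpr_mul // hy. Qed.
Lemma hcl1 : hcl 0 (1 : cohomology k gT).
apply/hclP;exists 1 => // w;rewrite -mcoeff_neq0 (_ : \val (1 : cocycle k gT) = 1) // mcoeff1.
by case E: (w == mone);[move/eqP: E => ->|rewrite eqxx].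
Qed.
Lemma hclX m x n : hcl m x -> hcl (m * n) (x ^+ n).
move=> hx;elim: n => [|n IH];first by rewrite muln0 expr0;apply: hcl1.
by rewrite exprS mulnS;apply: hclM.
Qed.
Lemma hclD n x y : hcl n x -> hcl n y -> hcl n (x + y).
by rewrite /hcl raddfD /= => -> ->. Qed.
Lemma hclZ n a x : hcl n x -> hcl n (a *: x).
by rewrite /hcl linearZ /= => ->. Qed.
Lemma hcl_degree0 x : hcl 0 x -> exists a : k, x = a%:A.
case/hclP => z hz ->;exists (\val z)@_([::] : bar gT).
rewrite -[1]/(coh_class 1) -classZ;congr coh_class;apply/val_inj/malgP => w.
rewrite (_ : \val (_ *: 1) = (\val z)@_([::] : bar gT) *: 1) // mcoeffZ mcoeff1.
have [->|ne] := eqVneq w (mone : bar gT);first by rewrite mulr1.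
rewrite mulr0;apply/eqP;rewrite mcoeff_eq0;apply/negP => /hz /size0nil e.
by rewrite e in ne.
Qed.

End Components.

Section PullComponents.
Variables (k : fieldType) (aT rT : finGroupType) (phi : aT -> rT).
Hypothesis phiM : {morph phi : x y / (x * y)%g}.

Lemma hpr_pullback n (x : cohomology k rT) :
 hpr n (cohomology_pullback phiM x) = cohomology_pullback phiM (hpr n x).
have [u ->] := classP x;rewrite hpr_class !cohomology_pullbackE hpr_class.
congr coh_class;apply/val_inj/malgP => w.
by rewrite truncE /= !cochain_pullbackE truncE size_map.
Qed.
Lemma hcl_pullback n (x : cohomology k rT) : hcl n x -> hcl n (cohomology_pullback phiM x).
by rewrite /hcl hpr_pullback => ->. Qed.
Lemma rest_map (f : seq rT -> k) g (w : seq aT) :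
 rest f (phi g) (map phi w) = rest (fun u => f (map phi u)) g w.
by elim: w g f => //= h w IH g f;rewrite -phiM (IH _ (fun u => f (_ :: u))). Qed.
Lemma dt_map (f : seq rT -> k) (w : seq aT) :
 dt f (map phi w) = dt (fun u => f (map phi u)) w.
by case: w => //= g w;rewrite rest_map. Qed.
End PullComponents.

Lemma eq_scaleN1 (k : fieldType) (V : lmodType k) (x y : V) : x = y <-> -1 *: y + x = 0.
by rewrite scaleN1r addrC;split=> [->|/eqP];rewrite ?subrr // subr_eq0 => /eqP. Qed.

Section Bridge.
Variables (k : fieldType) (gT : finGroupType).
Implicit Types (L : {group gT}) (f e y : seq gT -> k).

Lemma sgvalM L : {morph @sgval gT L : x y / (x * y)%g}.
by []. Qed.
Lemma words_in L (w : seq gT) : all [in L] w -> map sgval (map (subg L) w) = w.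
by elim: w => //= x w IH /andP[xL wL];rewrite IH // subgK. Qed.
Lemma sgval_words L (w : seq (subg_of L)) : all [in L] (map sgval w).
by elim: w => //= x w ->;rewrite subgP. Qed.
Lemma subg_words L (w : seq (subg_of L)) : map (subg L) (map sgval w) = w.
by rewrite -map_comp -[RHS]map_id;apply: eq_map => x /=;rewrite sgvalK. Qed.
Definition cmal L n f : cochain k (subg_of L) :=
 \sum_(t : n.-tuple (subg_of L)) << f (map sgval t) *g (tval t : bar (subg_of L)) >>.

Lemma cmalE L n f (w : seq (subg_of L)) :
 (cmal L n f)@_(w : bar (subg_of L)) = if size w == n then f (map sgval w) else 0.
exact: (mcoeff_words n (fun u => f (map sgval u))). Qed.
Lemma codiff_cmal L n f (w : seq (subg_of L)) : (codiff (cmal L n f))@_(w : bar (subg_of L)) =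
 if size w == n.+1 then dt f (map sgval w) else 0.
rewrite codiff_dt.
case: eqP => sz.
 rewrite (dt_map (@sgvalM L));apply: (@eq_dt _ _ [set: subg_of L]%G) => [|u _ szu].
  by apply/allP => ? _;apply: in_setT.
 by rewrite cmalE;move: szu;rewrite sz => -[->];rewrite eqxx.
rewrite (@eq_dt _ _ [set: subg_of L]%G _ (fun=> 0)) ?dt0 // => [|u _ szu].
 by apply/allP => ? _;apply: in_setT.
by rewrite cmalE;case: ifP => // /eqP e;case: sz;rewrite -szu e.
Qed.
Lemma cmal_cocycle L n f : zt L n f -> cmal L n f \in is_cocycle.
move=> zf;apply/eqP/malgP => w;rewrite codiff_cmal mcoeff0;case: eqP => // sz.
by apply: zf;rewrite ?sgval_words ?size_map.
Qed.
(** The class in H(L) of a function on words in gT. The default 0 for functions that are not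
    cocycles on L makes this total. *)
Definition fcl L n f : 'H^*(L, k) := coh_class (insubd (0 : cocycle k (subg_of L)) (cmal L n f)).

Lemma fclE L n f (zf : zt L n f) : fcl L n f = coh_class (Cocycle (cmal_cocycle zf)).
by congr coh_class;apply/val_inj;rewrite val_insubd cmal_cocycle. Qed.
Lemma fcl0P L n f : zt L n f -> fcl L n f = 0 <-> bt L n f.
move=> zf;rewrite fclE;split=> [/eqP|[h Hh]].
 rewrite -(raddf0 (@coh_class k _)) class_eq subr0 => /asboolP[F dF].
 exists (fun u => F@_(map (subg L) u : bar (subg_of L))) => w Lw sz.
 rewrite -(words_in Lw) (dt_map (@sgvalM L)).
 transitivity (codiff F)@_(map (subg L) w : bar (subg_of L)).
  by rewrite dF /= cmalE size_map sz eqxx.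
 rewrite codiff_dt;apply: (@eq_dt _ _ [set: subg_of L]%G) => [|u _ _].
  by apply/allP => ? _;apply: in_setT.
 by rewrite subg_words.
apply/eqP;rewrite -(raddf0 (@coh_class k _)) class_eq subr0;apply/asboolP.
case: n zf Hh => [|n] zf Hh.
 exists 0;rewrite raddf0;apply/malgP => w;rewrite mcoeff0 /= cmalE;case: eqP => // /size0nil ->.
 by rewrite Hh.
exists (cmal L n h);apply/malgP => w;rewrite codiff_cmal /= cmalE;case: eqP => // sz.
by rewrite Hh ?size_map ?sgval_words.
Qed.
Lemma zt_lin L n a f g : zt L n f -> zt L n g -> zt L n (fun w => a * f w + g w).
by move=> zf zg w Lw sz;have := dtD (fun w => a * f w) g w;rewrite dtZ zf // zg // mulr0 addr0.
Qed.
Lemma fcl_lin L n a f g : zt L n f -> zt L n g ->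
 fcl L n (fun w => a * f w + g w) = a *: fcl L n f + fcl L n g.
move=> zf zg;rewrite (fclE zf) (fclE zg) (fclE (zt_lin a zf zg)) -classZ -raddfD.
congr coh_class;apply/val_inj/malgP => w /=.
rewrite mcoeffD mcoeffZ !cmalE.
by case: eqP;rewrite ?mulr0 ?addr0.
Qed.
Lemma fcl_eq L n f g : zt L n f -> zt L n g ->
 fcl L n f = fcl L n g <-> bt L n (fun w => f w - g w).
move=> zf zg;have E w : f w - g w = -1 * g w + f w by ring.
have zd := zt_lin (-1) zg zf.
have -> : (fun w => f w - g w) = (fun w => -1 * g w + f w) by apply/funext.
rewrite -(fcl0P zd) (fcl_lin (-1) zg zf);exact: eq_scaleN1.
Qed.
Lemma eq_fcl L n f g : zt L n f -> (forall w : seq gT, all [in L] w -> size w = n -> f w = g w) ->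
 fcl L n f = fcl L n g.
move=> zf fg;congr (coh_class (insubd _ _));apply/malgP => w;rewrite !cmalE.
by case: eqP => // sz;rewrite fg ?sgval_words ?size_map.
Qed.
Lemma zt_lcup' L m n e y : zt L m e -> zt L n y -> zt L (m + n) (lcup m e y).
move=> ze zy w Lw sz;rewrite (@eq_dt _ _ L _ (tcup n y e)) // => [|u _ szu].
 rewrite (dt_tcup _ zy Lw) /tcup;case: leqP => // _;rewrite ze ?mul0r //.
  by apply/allP => x /mem_take xw;apply: (allP Lw).
 by rewrite size_takel ?leq_subr //;lia.
have {}szu : size u = (m + n)%N by lia.
by rewrite /lcup /tcup szu leq_addr leq_addl addnK.
Qed.
Lemma fclM L m n e y : zt L m e -> zt L n y ->
 fcl L m e * fcl L n y = fcl L (m + n) (lcup m e y).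
move=> ze zy;rewrite (fclE ze) (fclE zy) (fclE (zt_lcup' ze zy)) -classM.
congr coh_class;apply/val_inj/malgP => w;rewrite rmorphM /= cupE cmalE.
have [sz|sz] := eqVneq (size w) (m + n)%N.
 rewrite (bigD1_seq m) ?iota_uniq //=;last by rewrite mem_index_iota sz;lia.
 rewrite !cmalE size_takel ?size_drop ?sz ?leq_addr // addKn !eqxx /lcup size_map sz leq_addr.
 rewrite map_take map_drop big_seq_cond big1 ?addr0 // => i;rewrite mem_index_iota ltnS => /andP[/andP[_ le] ne].
 by rewrite cmalE size_takel ?sz // (negbTE ne) mul0r.
rewrite big_nat big1 // => i /andP[_ lti];rewrite !cmalE size_takel // size_drop.
case: eqP => [ei|_];last by rewrite mul0r.
case: ifP => [/eqP ej|_];rewrite ?mulr0 //.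
by case/eqP: sz;rewrite -ei -ej subnKC.
Qed.
Lemma hcl_fcl L n f : zt L n f -> hcl n (fcl L n f).
move=> zf;apply/hclP;rewrite fclE;eexists;last by [].
by move=> w;rewrite /= -mcoeff_neq0 cmalE;case: ifP => [/eqP//|_];rewrite eqxx.
Qed.
Lemma hcl_fclP L n (x : 'H^*(L, k)) : hcl n x -> exists2 f, zt L n f & x = fcl L n f.
case/hclP => z hz ->;pose f (u : seq gT) := (\val z)@_(map (subg L) u : bar (subg_of L)).
have zf: zt L n f.
 move=> w Lw sz;rewrite -(words_in Lw) (dt_map (@sgvalM L)).
 transitivity (codiff (\val z))@_(map (subg L) w : bar (subg_of L)).
  rewrite codiff_dt;apply: (@eq_dt _ _ [set: subg_of L]%G) => [|u _ _].
   by apply/allP => ? _;apply: in_setT.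
  by rewrite /f subg_words.
 by rewrite (eqP (valP z)) mcoeff0.
exists f => //;rewrite (fclE zf);congr coh_class;apply/val_inj/malgP => w /=.
rewrite cmalE /f subg_words;case: eqP => // ne.
by apply/eqP;rewrite mcoeff_eq0;apply/negP => /hz.
Qed.
End Bridge.

Lemma fcl_pullback (k : fieldType) (aT rT : finGroupType) (A : {group aT}) (B : {group rT})
 (phi : subg_of A -> subg_of B) (phiM : {morph phi : x y / (x * y)%g}) (psi : aT -> rT) n
 (f : seq rT -> k) : (forall u, sgval (phi u) = psi (sgval u)) -> zt B n f ->
 zt A n (fun w => f (map psi w)) /\
 cohomology_pullback phiM (fcl B n f) = fcl A n (fun w => f (map psi w)).
move=> E zf;have Em (w : seq (subg_of A)) : map psi (map sgval w) = map sgval (map phi w).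
 by rewrite -!map_comp;apply: eq_map => u /=;rewrite E.
have zp: zt A n (fun w => f (map psi w)).
 move=> w Aw sz;rewrite -(words_in Aw) (dt_map (@sgvalM _ A)).
 rewrite (_ : (fun u => _) = fun u => f (map sgval (map phi u)));last by apply/funext => u;rewrite Em.
 rewrite -(dt_map phiM (fun u => f (map sgval u))) -(dt_map (@sgvalM _ B)).
 by apply: zf;rewrite ?sgval_words ?size_map.
split=> //;rewrite (fclE zf) (fclE zp) cohomology_pullbackE;congr coh_class.
by apply/val_inj/malgP => w /=;rewrite cochain_pullbackE !cmalE size_map Em.
Qed.
Lemma zt_sub (k : fieldType) (gT : finGroupType) (G H : {set gT}) n (f : seq gT -> k) :
 H \subset G -> zt G n f -> zt H n f.
by move=> /subsetP sHG zf w Hw;apply: zf;apply/allP => x /(allP Hw)/sHG. Qed.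
Lemma fcl_Res (k : fieldType) (gT : finGroupType) (G H : {group gT}) (sHG : H \subset G) n
 (f : seq gT -> k) : zt G n f -> Res sHG (fcl G n f) = fcl H n f.
move=> zf;have [|z1 e] := fcl_pullback (phi := @subg_incl gT G H) (subg_inclM sHG) (psi := id) _ zf.
 by move=> u;rewrite /subg_incl subgK // (subsetP sHG) ?subgP.
by rewrite [LHS]e;apply: eq_fcl => // w _ _;rewrite map_id.
Qed.
Lemma lalg_expand_l (k : fieldType) (R : lalgType k) e (A B D U : R) :
 (A - e *: B - e *: D) * U = A * U - e *: (B * U) - e *: (D * U).
by rewrite !mulrBl -!scalerAl. Qed.
Lemma lalg_expand_r (k : fieldType) (R : lalgType k) :
 (forall a (x y : R), x * (a *: y) = a *: (x * y)) -> forall a b (U A B D V : R),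
 U * (A * V - a *: (V * B) - b *: D) = U * A * V - a *: (U * V * B) - b *: (U * D).
by move=> sAr a b U A B D V;rewrite !mulrBr !sAr !mulrA. Qed.
Lemma lmod_cancel (k : fieldType) (V : lmodType k) (e : k) : e * e = 1 -> forall en (p1 p2 p3 p4 p5 p6 p7 : V),
 e *: (p1 + e *: p2 - e *: (p3 - p4)) + ((p5 - e *: p6 - e *: p1) + p3
  - (p2 - e *: (p6 - en *: p7 - e *: p4))) = p5 - (e * en) *: p7.
move=> ee en p1 p2 p3 p4 p5 p6 p7;rewrite !(scalerBr, scalerDr) !scalerA ee !scale1r.
move: (e *: p1) (e *: p6) ((e * en) *: p7) => q1 q6 q7;rewrite !opprB !addrA.
rewrite [LHS](ACl (5*10*(1*7)*(2*12)*(3*11)*(4*8)*(6*9))) /=.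
by rewrite !subrr !addNr !addr0.
Qed.

(** * Graded commutativity by a cup-one product *)

Section GradedCommutative.
Variables (k : fieldType) (gT : finGroupType) (m : nat) (z : cocycle k gT).
Hypothesis hz : cochain_homogeneous m (\val z).
Implicit Types (f F : cochain k gT) (w u v : seq gT).

Let g : cochain k gT := \val z.
Let e : k := (-1) ^+ m.
Let ee : e * e = 1. Proof. by rewrite /e -expr2 sqrr_sign. Qed.
Definition wordm (u : seq gT) : cochain k gT := << (u : bar gT) >>.
Definition prodw (u : seq gT) : gT := foldr mulg 1%g u.
(** The part of the cocycle g supported on words with product x. *)
Definition fibre x : cochain k gT := \sum_(t : m.-tuple gT)
 << (prodw t == x)%:R * g@_(tval t : bar gT) *g (tval t : bar gT) >>.

Lemma wordmE u w : (wordm u)@_(w : bar gT) = (u == w)%:R.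
by rewrite mcoeffU. Qed.
Lemma wordm0 : wordm [::] = 1. Proof. by []. Qed.
Lemma wordmM u v : wordm u * wordm v = wordm (u ++ v).
by rewrite /wordm malgM_def fgmulUU mulr1. Qed.
Lemma scAr a f F : f * (a *: F) = a *: (f * F).
apply/malgP => w;rewrite mcoeffZ !cupE mulr_sumr;apply: eq_bigr => i _.
by rewrite mcoeffZ mulrCA.
Qed.
Let csum (F : gT -> cochain k gT) w :
 (\sum_a F a)@_(w : bar gT) = \sum_a (F a)@_(w : bar gT).
exact: raddf_sum. Qed.
Let cD (f h : cochain k gT) w : (f + h)@_(w : bar gT) = f@_w + h@_w. Proof. exact: mcoeffD. Qed.
Let cB (f h : cochain k gT) w : (f - h)@_(w : bar gT) = f@_w - h@_w. Proof. exact: mcoeffB. Qed.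
Let cZ a f w : (a *: f)@_(w : bar gT) = a * f@_w. Proof. exact: mcoeffZ. Qed.
Let c3 (A B D : cochain k gT) w : (A + B - D)@_(w : bar gT) = A@_w + B@_w - D@_w.
by rewrite cB cD. Qed.
Let c4 a b (A B D E : cochain k gT) w :
 (a *: A - B - b *: D + E)@_(w : bar gT) = a * A@_w - B@_w - b * D@_w + E@_w.
by rewrite cD !cB !cZ. Qed.
Let mBl (A B U : cochain k gT) : (A - B) * U = A * U - B * U. Proof. exact: mulrBl. Qed.
Let sAl a (A U : cochain k gT) : (a *: A) * U = a *: (A * U). Proof. by rewrite scalerAl. Qed.
Lemma codB f h : codiff (f - h) = codiff f - codiff h. Proof. exact: linearB. Qed.
Lemma codZ a f : codiff (a *: f) = a *: codiff f. Proof. exact: linearZ. Qed.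
Lemma cod0 : codiff (0 : cochain k gT) = 0. Proof. exact: linear0. Qed.
Let g_sz u : size u != m -> g@_(u : bar gT) = 0.
by move=> ne;apply/eqP;rewrite mcoeff_eq0;apply/negP => /hz su;rewrite su eqxx in ne. Qed.
Let g_sign u : (-1) ^+ size u * g@_(u : bar gT) = e * g@_(u : bar gT).
by have [->//|ne] := eqVneq (size u) m;rewrite g_sz // !mulr0. Qed.
Lemma fibreE x u : (fibre x)@_(u : bar gT) = (prodw u == x)%:R * g@_(u : bar gT).
rewrite (mcoeff_words m (fun u => (prodw u == x)%:R * g@_(u : bar gT))).
by case: ifP => // /negbT ne;rewrite g_sz ?mulr0.
Qed.
Lemma letter_mulE x f w : (wordm [:: x] * f)@_(w : bar gT) =
 if w is y :: v then (x == y)%:R * f@_(v : bar gT) else 0.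
rewrite cupE;case: w => [|y v];first by rewrite big_nat1 wordmE mul0r.
rewrite /= big_nat_recl // big_nat_recl //= take0 !wordmE drop0 mul0r add0r.
rewrite big_nat big1 ?addr0 ?eqseq_cons ?andbT // => i /andP[_ lti].
by case: v lti => // ? ? _;rewrite wordmE /= eqseq_cons andbF mul0r.
Qed.
Lemma mul_letterE x f w y : (f * wordm [:: x])@_(rcons w y : bar gT) = f@_(w : bar gT) * (x == y)%:R.
rewrite cupE size_rcons big_nat_recr //= big_nat_recr //=.
rewrite -cats1 take_size_cat // drop_size_cat // drop_oversize ?size_cat ?addn1 //.
rewrite !wordmE eqseq_cons andbT mulr0 addr0 big_nat big1 ?add0r // => i /andP[_ lti].
rewrite wordmE drop_cat lti;case E: (drop i w) => [|a [|b l]] /=;rewrite ?eqseq_cons ?andbF ?mulr0 //.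
by move/(congr1 size)/eqP: E;rewrite size_drop subn_eq0 leqNgt lti.
Qed.
Lemma mulE0 f F : (f * F)@_([::] : bar gT) = f@_([::] : bar gT) * F@_([::] : bar gT).
by rewrite cupE big_nat1. Qed.

(** Replaces the letters x of u, one at a time and with signs, by the words of product x weighted by
    g: this is Steenrod's cup-one product with g, written as a derivation on words. *)
Fixpoint derw u : cochain k gT :=
 if u is x :: v then fibre x * wordm v - e *: (wordm [:: x] * derw v) else 0.
Definition der f : cochain k gT := \sum_(u <- msupp f) f@_u *: derw u.

Lemma derEw f (A : {fset bar gT}) : (msupp f `<=` A)%fset -> der f = \sum_(u <- A) f@_u *: derw u.
move=> sA;apply: big_fset_incl => // u _ nu.
by rewrite mcoeff_outdom ?scale0r.
Qed.
Lemma der_linear : linear der.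
move=> a f h;pose A := (msupp f `|` msupp h `|` msupp (a *: f + h))%fset.
have s1: (msupp f `<=` A)%fset by rewrite /A -fsetUA fsubsetUl.
have s2: (msupp h `<=` A)%fset by rewrite /A (fsetUC (msupp f)) -fsetUA fsubsetUl.
have s3: (msupp (a *: f + h) `<=` A)%fset by rewrite fsubsetUr.
rewrite (derEw s1) (derEw s2) (derEw s3) scaler_sumr -big_split;apply: eq_bigr => u _.
by rewrite mcoeffD mcoeffZ scalerDl scalerA.
Qed.
HB.instance Definition _ :=
 GRing.isLinear.Build k (cochain k gT) (cochain k gT) *:%R der der_linear.

Lemma der_wordm u : der (wordm u) = derw u.
rewrite (@derEw _ [fset (u : bar gT)]%fset);last by apply: msuppU_le.
by rewrite big_seq_fset1 wordmE eqxx scale1r.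
Qed.
Lemma word_expand f : f = \sum_(u <- msupp f) f@_u *: wordm u.
rewrite {1}(monalgE f);apply: eq_bigr => u _;apply/malgP => w.
by rewrite mcoeffZ wordmE mcoeffU mulr_natr.
Qed.
Lemma derB f h : der (f - h) = der f - der h. Proof. exact: linearB. Qed.
Lemma der0 : der 0 = 0. Proof. exact: linear0. Qed.
Lemma lin_word (phi psi : cochain k gT -> cochain k gT) f : linear phi -> linear psi ->
 (forall u : bar gT, u \in msupp f -> phi (wordm u) = psi (wordm u)) -> phi f = psi f.
move=> lphi lpsi E;rewrite (word_expand f) big_seq.
elim/big_rec: _ => [|u h uf IH];last by rewrite lphi lpsi IH E.
have L0 (L : cochain k gT -> cochain k gT) : linear L -> L 0 = 0.
 by move=> lL;have := lL (-1) 0 0;rewrite scaler0 addr0 scaleN1r addNr.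
by rewrite !L0.
Qed.
Local Opaque wordm fibre der.

Lemma der_letter x f : der (wordm [:: x] * f) = fibre x * f - e *: (wordm [:: x] * der f).
apply: (@lin_word (fun f => der (wordm [:: x] * f)) (fun f => fibre x * f - e *: (wordm [:: x] * der f))).
- by move=> a F h /=;rewrite mulrDr scAr der_linear.
- move=> a F h /=;rewrite der_linear !mulrDr !scAr scalerDr scalerA (mulrC e) -scalerA opprD addrACA.
 by rewrite -scalerBr.
- by move=> u _;rewrite wordmM !der_wordm.
Qed.
Lemma der_letter1 x : der (wordm [:: x]) = fibre x.
by rewrite der_wordm /= wordm0 mulr1 mulr0 scaler0 subr0. Qed.
(** On two letters the derivation rule has sign (-1)^(2m) = 1; the coboundary of a single letter
    consists of such words. *)
Lemma der_pair F f : (forall u, size u != 2 -> F@_(u : bar gT) = 0) ->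
 der (F * f) = der F * f + F * der f.
move=> F2;rewrite (word_expand F) mulr_suml !raddf_sum !mulr_suml -big_split big_seq [RHS]big_seq.
apply: eq_bigr => u;rewrite -mcoeff_neq0 => Fu /=;rewrite -!scalerAl !linearZ /= -!scalerAl -scalerDr.
congr (_ *: _);have : size u = 2 by apply/eqP;apply: contraNT Fu => /F2->.
case: u {Fu} => [|a [|b []]] // _;rewrite -[[:: a;b]]/([:: a] ++ [:: b]) -wordmM -mulrA !der_letter.
rewrite der_letter1 mulrBr scAr scalerBr mulrBl -!scalerAl scalerA ee scale1r !mulrA opprB addrA.
by rewrite addrAC.
Qed.
Lemma prodw_face i w : (0 < i < size w)%N -> prodw (face i w) = prodw w.
elim: w i => [|x w IH] [|[|i]] //=;case: w IH => [|y w] //= IH lt.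
 by rewrite /face /= mulgA.
by have /= := IH i.+1 lt;rewrite /face /= => ->.
Qed.
Lemma prodw_rcons w x : prodw (rcons w x) = (prodw w * x)%g.
by elim: w => [|y w /= ->];rewrite /= ?mulgA // mulg1 mul1g. Qed.
Lemma codiff_letter x : codiff (wordm [:: x]) = \sum_(a : gT) (wordm [:: a] * wordm [:: x]
 + wordm [:: x] * wordm [:: a] - wordm [:: a] * wordm [:: (a^-1 * x)%g]).
apply/malgP => w;rewrite codiffE csum;case: w => [|y [|t [|t' w]]].
- by rewrite big1 // => a _;rewrite c3 !letter_mulE addr0 subrr.
- rewrite big_nat_recl // big_nat1 !wordmE /= !mulr0 addr0 big1 // => a _.
 by rewrite c3 !letter_mulE !wordmE /= !mulr0 addr0 subrr.
- transitivity (\sum_a ((a == y)%:R * (x == t)%:R + (x == y)%:R * (a == t)%:R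
  - (a == y)%:R * ((a^-1 * x)%g == t)%:R) : k);last first.
  by apply: eq_bigr => a _;rewrite c3 !letter_mulE !wordmE !eqseq_cons !andbT.
 rewrite big_nat_recl // big_nat_recl // big_nat1 /= !wordmE /face /= !eqseq_cons !andbT.
 rewrite sumrB big_split /=.
 have S (h : gT -> k) b : \sum_a (a == b)%:R * h a = h b.
  rewrite (bigD1 b) //= eqxx mul1r big1 ?addr0 // => a /negbTE->;exact: mul0r.
 rewrite (S (fun=> (x == t)%:R)) (S (fun a => ((a^-1 * x)%g == t)%:R)) -mulr_sumr.
 have -> : \sum_a (a == t)%:R = 1 :> k.
  by rewrite -[RHS](S (fun=> 1) t);apply: eq_bigr => a _;rewrite mulr1.
 rewrite (_ : ((y^-1 * x)%g == t) = (x == (y * t)%g));last first.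
  by apply/eqP/eqP => [<-|->];rewrite ?mulKVg ?mulKg.
 by rewrite expr0 expr1 sqrrN expr1n;ring.
- rewrite [RHS]big1 => [|a _];last first.
  by rewrite c3 !letter_mulE !wordmE /= !eqseq_cons !andbF !mulr0 addr0 subrr.
 rewrite big_nat big1 // => i /andP[_ lti];rewrite wordmE;case: eqP => [E|_];last by rewrite mulr0.
 by have := @size_face gT i [:: y, t, t' & w] lti;rewrite -E.
Qed.
Lemma fibre_sum : \sum_a fibre a = g.
apply/malgP => w;rewrite raddf_sum /=;under eq_bigr do rewrite fibreE.
rewrite (bigD1 (prodw w)) //= eqxx mul1r big1 ?addr0 // => a;rewrite eq_sym => /negbTE->.
exact: mul0r.
Qed.
Let dg w : (0 < size w)%N -> \sum_(0 <= i < (size w).+1) (-1) ^+ i * g@_(face i w : bar gT) = 0.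
by move=> w0;rewrite -codiffE_gt0 // (eqP (valP z)) mcoeff0. Qed.
(** The cocycle condition on g enters here: inner faces keep the product of a word, so only the two
    outer faces leave the fibre. *)
Lemma codiff_fibre x : e *: codiff (fibre x) = \sum_(a : gT)
 (e *: (wordm [:: a] * fibre x) - fibre x * wordm [:: a]
 - e *: (wordm [:: a] * fibre (a^-1 * x)%g) + fibre a * wordm [:: (a^-1 * x)%g]).
apply/malgP => w;rewrite cZ codiffE csum.
case/lastP: w => [|w t].
 rewrite mulr0;apply/esym/big1 => a _;rewrite c4 !mulE0 !wordmE.
 by rewrite !mulr0 !mul0r !mulr0 !subr0 addr0.
have -> : (if rcons w t is [::] then 0 else \sum_(0 <= i < (size (rcons w t)).+1)
 (-1) ^+ i * (fibre x)@_(face i (rcons w t) : bar gT)) = \sum_(0 <= i < (size (rcons w t)).+1)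
 (-1) ^+ i * (fibre x)@_(face i (rcons w t) : bar gT) by case: (w).
have [y [v Ew]] : exists y v, rcons w t = y :: v by case: (w) => [|y v];[exists t, [::]|exists y, (rcons v t)].
have szw: size v = size w by have := congr1 size Ew;rewrite size_rcons => -[].
have Ev: face 0 (rcons w t) = v by rewrite face0 Ew.
have El: face (size w).+1 (rcons w t) = w.
 by have := face_last (rcons w t);rewrite size_rcons -cats1 take_size_cat.
have := @dg (rcons w t);rewrite size_rcons => /(_ isT).
rewrite big_nat_recl // big_nat_recr //= Ev El expr0 mul1r => dgw.
rewrite big_nat_recl // big_nat_recr //= Ev El expr0 mul1r.
transitivity (\sum_a (e * ((a == y)%:R * (fibre x)@_(v : bar gT)) - (fibre x)@_(w : bar gT) * (a == t)%:R
 - e * ((a == y)%:R * (fibre (a^-1 * x)%g)@_(v : bar gT))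
 + (fibre a)@_(w : bar gT) * ((a^-1 * x)%g == t)%:R));last first.
 by apply: eq_bigr => a _;rewrite c4 !mul_letterE Ew !letter_mulE.
rewrite !fibreE.
rewrite (eq_big_nat _ _ (F2 := fun i => (prodw (rcons w t) == x)%:R *
  ((-1) ^+ i.+1 * g@_(face i.+1 (rcons w t) : bar gT))));last first.
 by move=> i /andP[_ lti];rewrite fibreE prodw_face ?size_rcons //;ring.
rewrite -mulr_sumr.
set S := \sum_(0 <= i < _) _ in dgw *.
have {dgw} -> : S = - g@_(v : bar gT) - (-1) ^+ (size w).+1 * g@_(w : bar gT).
 by apply/eqP;rewrite -subr_eq0 -[X in _ == X]dgw;apply/eqP;ring.
rewrite exprS (_ : forall b : k, -1 * (-1) ^+ size w * (b * g@_(w : bar gT)) = - (b * (e * g@_(w : bar gT))));last first.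
 by move=> b;rewrite -g_sign;ring.
rewrite (_ : -1 * (-1) ^+ size w * g@_(w : bar gT) = - (e * g@_(w : bar gT)));last by rewrite -g_sign;ring.
rewrite big_split /= !sumrB.
have D1 (F : gT -> k) b : \sum_a (a == b)%:R * F a = F b.
 by rewrite (bigD1 b) //= eqxx mul1r big1 ?addr0 // => a /negbTE->;apply: mul0r.
have -> : \sum_(a : gT) e * ((a == y)%:R * ((prodw v == x)%:R * g@_(v : bar gT))) =
 e * ((prodw v == x)%:R * g@_(v : bar gT)).
 by rewrite -mulr_sumr (D1 (fun=> _)).
have -> : \sum_(a : gT) (prodw w == x)%:R * g@_(w : bar gT) * (a == t)%:R =
 (prodw w == x)%:R * g@_(w : bar gT).
 by under eq_bigr do rewrite mulrC;rewrite (D1 (fun=> _)).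
have pE: prodw (rcons w t) = (y * prodw v)%g by rewrite Ew.
have -> : \sum_(a : gT) e * ((a == y)%:R * (fibre (a^-1 * x)%g)@_(v : bar gT)) =
 e * ((prodw (rcons w t) == x)%:R * g@_(v : bar gT)).
 rewrite -mulr_sumr (D1 (fun a => (fibre (a^-1 * x)%g)@_(v : bar gT))) fibreE pE.
 congr (_ * (_%:R * _));congr nat_of_bool;apply/eqP/eqP => [->|<-];by rewrite ?mulKVg ?mulKg.
have -> : \sum_(a : gT) (fibre a)@_(w : bar gT) * ((a^-1 * x)%g == t)%:R =
 (prodw (rcons w t) == x)%:R * g@_(w : bar gT).
 under eq_bigr do rewrite fibreE -mulrA eq_sym.
 rewrite (D1 (fun a => g@_(w : bar gT) * ((a^-1 * x)%g == t)%:R)) mulrC prodw_rcons.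
 congr (_%:R * _);congr nat_of_bool;apply/eqP/eqP => [<-|<-];by rewrite ?mulKVg ?mulKg.
move: (_%:R : k) (_%:R : k) (_%:R : k) (g@_(v : bar gT)) (g@_(w : bar gT)) => B C A gv gw.
by transitivity (e * (A * gv) - e * (B * gv) + e * e * (B * gw) - e * e * (C * gw));[ring|rewrite ee;ring].
Qed.
Lemma der_homotopy_letter x : e *: codiff (fibre x) + der (codiff (wordm [:: x])) =
 g * wordm [:: x] - e *: (wordm [:: x] * g).
have D2 a b : der (wordm [:: a] * wordm [:: b]) = fibre a * wordm [:: b] - e *: (wordm [:: a] * fibre b).
 by rewrite der_letter der_letter1.
rewrite codiff_fibre codiff_letter raddf_sum -big_split /=.
rewrite -{1}fibre_sum -fibre_sum mulr_suml mulr_sumr scaler_sumr -sumrB;apply: eq_bigr => a _.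
rewrite derB [der (_ + _)](linearD der) /= !D2.
have A (x1 x2 x3 x4 y1 t : cochain k gT) :
  x1 - x2 - x3 + x4 + (y1 - x1 + (x2 - t) - (x4 - x3)) = y1 - t.
 by apply/malgP => w;rewrite !(cD, cB);ring.
exact: A.
Qed.
Lemma der_homotopy_word u : e *: codiff (derw u) + der (codiff (wordm u)) =
 g * wordm u - e ^+ size u *: (wordm u * g).
elim: u => [|x u IH].
 by rewrite /= cod0 scaler0 wordm0 codiff1 der0 expr0 scale1r mulr1 mul1r subrr addr0.
have gx: grsign (wordm [:: x]) = - wordm [:: x].
 apply/malgP => w;rewrite grsignE mcoeffN wordmE;case: eqP => [<-|_];rewrite ?mulr0 ?oppr0 //.
 by rewrite expr1 mulN1r.
have gB: grsign (fibre x) = e *: fibre x.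
 by apply/malgP => w;rewrite grsignE mcoeffZ fibreE mulrCA g_sign;ring.
have E1: codiff (derw (x :: u)) = codiff (fibre x) * wordm u + e *: (fibre x * codiff (wordm u))
  - e *: (codiff (wordm [:: x]) * derw u - wordm [:: x] * codiff (derw u)).
 by rewrite /= codB codZ !codiffM gx gB mulNr sAl.
have E2: der (codiff (wordm (x :: u))) = der (codiff (wordm [:: x])) * wordm u
  + codiff (wordm [:: x]) * derw u
  - (fibre x * codiff (wordm u) - e *: (wordm [:: x] * der (codiff (wordm u)))).
 rewrite -[x :: u]/([:: x] ++ u) -wordmM codiffM gx mulNr derB der_letter der_pair ?der_wordm //.
 move=> v nv;rewrite codiffE;case: v nv => // a v nv.
 rewrite big_nat big1 // => i /andP[_ lti];rewrite wordmE;case: eqP => [E|_];last by rewrite mulr0.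
 by case/eqP: nv;have := @size_face gT i (a :: v) lti;rewrite -E /= => <-.
rewrite E1 E2 -[in RHS]cat1s -wordmM.
have H1: der (codiff (wordm [:: x])) = g * wordm [:: x] - e *: (wordm [:: x] * g) - e *: codiff (fibre x).
 by rewrite -der_homotopy_letter addrAC subrr add0r.
have H2: der (codiff (wordm u)) = g * wordm u - e ^+ size u *: (wordm u * g) - e *: codiff (derw u).
 by rewrite -IH addrAC subrr add0r.
have T1: (g * wordm [:: x] - e *: (wordm [:: x] * g) - e *: codiff (fibre x)) * wordm u =
  g * wordm [:: x] * wordm u - e *: (wordm [:: x] * g * wordm u) - e *: (codiff (fibre x) * wordm u).
 exact: lalg_expand_l.
have T2: wordm [:: x] * (g * wordm u - e ^+ size u *: (wordm u * g) - e *: codiff (derw u)) =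
  wordm [:: x] * g * wordm u - e ^+ size u *: (wordm [:: x] * wordm u * g)
  - e *: (wordm [:: x] * codiff (derw u)).
 exact: (lalg_expand_r scAr).
rewrite H1 H2 T1 T2 exprS [g * (_ * _)]mulrA.
exact: lmod_cancel.
Qed.
Lemma der_homotopy f n : cochain_homogeneous n f ->
 e *: codiff (der f) + der (codiff f) = g * f - e ^+ n *: (f * g).
move=> hf;apply: (@lin_word (fun f => e *: codiff (der f) + der (codiff f))
 (fun f => g * f - e ^+ n *: (f * g))).
- move=> a F h /=;rewrite (der_linear a) !(codiff_is_linear a) (der_linear a) scalerDr !scalerA (mulrC e).
 by rewrite -scalerA addrACA -scalerDr.
- move=> a F h /=;rewrite mulrDr scAr mulrDl -scalerAl scalerDr scalerA (mulrC _ a) -scalerA opprD addrACA.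
 by rewrite -scalerBr.
- by move=> u uf;rewrite -(hf u uf) der_wordm;apply: (der_homotopy_word u).
Qed.

End GradedCommutative.

(** [der_homotopy] for a cocycle: the graded commutator is the coboundary of the cup-one product. *)
Lemma hcl_comm (k : fieldType) (gT : finGroupType) m n (x y : cohomology k gT) :
 hcl m x -> hcl n y -> x * y = (-1) ^+ (m * n) *: (y * x).
move=> /hclP[z hz ->] /hclP[t ht ->];rewrite -!classM -classZ;apply/eqP;rewrite class_eq.
apply/asboolP;exists ((-1) ^+ m *: der m z (\val t)).
have := der_homotopy hz ht;rewrite (eqP (valP t)) der0 addr0.
by move=> H;rewrite codZ;apply: etrans H _;rewrite exprM.
Qed.

End Grading.
Export Grading.

Lemma zQ_gauge (k : fieldType) (gT : finGroupType) (Q : finType) (act : Q -> gT -> Q)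
  (L : {group gT}) (D : Q -> Prop) (tau : Q -> gT) j n (F : Q -> seq gT -> k) :
 (forall q g h, act (act q g) h = act q (g * h)%g) ->
 (forall q g, D q -> g \in L -> D (act q g)) -> (forall q, D q -> tau q \in L) ->
 zQ act L D j n F -> exists H, forall q (w : seq gT), D q -> all [in L] w -> (size w + j = n)%N ->
  F q w - gauge act tau F q w = dQ act H q w.
move=> actM DL Dt zF;exists (fun q w => -1 * prism act tau (F q) q w) => q w Dq Lw sz.
rewrite (@dQZ k);have := prism_homotopy actM tau F q w.
have -> : prism act tau (dQ act F q) q w = 0.
 rewrite -[RHS](prism0 k act tau q w).
 apply: (@eq_prism _ _ _ act tau L _ _ _ _ D) => //.
 - by move=> x y;apply: groupM.
 - by move=> x;rewrite groupV.
 - by move=> u Lu szu;apply: zF => //;lia.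
by rewrite addr0 => ->;ring.
Qed.

(** * A single p-gon on which the group acts by rotations *)

Section Pgon.
Variables (k : fieldType) (p : nat) (gT : finGroupType) (X : finType) (act : X -> gT -> X).
Variables (gam : X -> X) (c : X -> X -> k) (L : {group gT}) (Y : {set X}) (x0 : X) (n : gT -> nat).
Hypothesis actM : forall x g h, act (act x g) h = act x (g * h)%g.
Hypothesis act1 : forall x, act x 1%g = x.
Hypothesis gamI : injective gam.
Hypothesis cN : forall x y, x != y -> c y x = - c x y.
Hypothesis cc : forall x y, c x y * c x y = 1.
Hypothesis cL : forall g, g \in L -> forall x y, c (act x g) (act y g) = c x y.
Hypothesis gamL : forall g, g \in L -> forall x, gam (act x g) = act (gam x) g.
Hypothesis YE : forall x, (x \in Y) = fconnect gam x0 x.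
Hypothesis ord_p : fingraph.order gam x0 = p.
Hypothesis p_gt0 : (0 < p)%N.
Hypothesis nP : forall g, g \in L -> (n g < p)%N.
Hypothesis nM : forall g h, g \in L -> h \in L -> n (g * h)%g = ((n g + n h) %% p)%N.
Hypothesis actE : forall g x, g \in L -> x \in Y -> act x g = iter (n g) gam x.

Let fsym := fconnect_sym gamI.

Lemma pgon_x0 : x0 \in Y. Proof. by rewrite YE connect0. Qed.
Lemma pgon_gstable : gstable gam Y.
by move=> x;rewrite !YE -(same_connect_r fsym (fconnect1 gam x)). Qed.
Lemma pgon_stable x g : x \in Y -> g \in L -> act x g \in Y.
move=> xY gL;rewrite actE // YE;move: xY;rewrite YE => xY.
exact: connect_trans xY (fconnect_iter _ _ _).
Qed.
Definition idx x := findex gam x0 x.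
Lemma idxP x : x \in Y -> (idx x < p)%N /\ iter (idx x) gam x0 = x.
by rewrite YE => xY;rewrite -ord_p findex_max // iter_findex. Qed.
Lemma iter_p m : iter (m %% p)%N gam x0 = iter m gam x0.
rewrite {2}(divn_eq m p) addnC iterD;congr (iter _ _ _);rewrite mulnC.
elim: (m %/ p)%N => [|q IH];first by rewrite muln0.
by rewrite mulnS iterD -IH -ord_p iter_order.
Qed.
Lemma idx_iter m : idx (iter m gam x0) = (m %% p)%N.
by rewrite -iter_p /idx findex_iter // ord_p ltn_mod. Qed.
Lemma idx_gam x : x \in Y -> idx (gam x) = ((idx x).+1 %% p)%N.
by move=> /idxP[_ e];rewrite -{1}e -iterS idx_iter. Qed.
Lemma idx_act x g : x \in Y -> g \in L -> idx (act x g) = ((idx x + n g) %% p)%N.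
move=> xY gL;have [_ e] := idxP xY.
by rewrite actE // -{1}e -iterD idx_iter addnC.
Qed.
Definition tot (F0 : seq gT -> k) (F1 F2 : X -> seq gT -> k) (q : {set X} * {set X}) w : k :=
 if q.1 == set0 then if q.2 == set0 then F0 w else \sum_(x in q.2) F2 x w
 else \sum_(x in q.1) F1 x w.

Lemma tot1 F0 F1 F2 x w : tot F0 F1 F2 ([set x], set0) w = F1 x w.
by rewrite /tot /= -cards_eq0 cards1 big_set1. Qed.
Lemma tot2 F0 F1 F2 x w : tot F0 F1 F2 (set0, [set x]) w = F2 x w.
by rewrite /tot /= eqxx -cards_eq0 cards1 big_set1. Qed.
Lemma tot0 F0 F1 F2 w : tot F0 F1 F2 (set0, set0) w = F0 w.
by rewrite /tot /= !eqxx. Qed.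

                                                                           
                            
(** The total cocycle condition for [tot F0 F1 F2], written out on the empty cell, the vertices and
    the edges. *)
Definition pgon_cocycle m (F0 : seq gT -> k) (F1 F2 : X -> seq gT -> k) :=
 [/\ forall w : seq gT, all [in L] w -> size w = m.+1 -> dt F0 w = 0,
   forall x (w : seq gT), x \in Y -> all [in L] w -> size w = m -> F0 w = dQ act F1 x w
  & forall x (w : seq gT), x \in Y -> all [in L] w -> (size w).+1 = m ->
    F1 (gam x) w - F1 x w + dQ act F2 x w = 0].

Lemma pgon_cells q : vcell gam Y q -> [\/ q = (set0, set0),
 exists2 x, x \in Y & q = ([set x], set0) | exists2 x, x \in Y & q = (set0, [set x])].
case: q => V E /vcellP[h1 h2 h3 h4].
have u x y : x \in V :|: E -> y \in V :|: E -> x = y.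
 move=> xq yq;apply: h4 => //;have YY z : z \in V :|: E -> z \in Y.
  by rewrite !inE => /orP[/(subsetP h1)|/(subsetP h2)].
 by have := YY _ xq;rewrite YE fsym => /connect_trans;apply;rewrite -YE YY.
have [V0|[x xV]] := set_0Vmem V;have [E0|[y yE]] := set_0Vmem E.
- by apply: Or31;rewrite V0 E0.
- apply: Or33;exists y;rewrite ?(subsetP h2) //;congr pair => //;apply/setP => z.
 rewrite inE;apply/idP/eqP => [zE|-> //];apply: u;rewrite inE ?zE ?yE orbT //.
- apply: Or32;exists x;rewrite ?(subsetP h1) //;congr pair => //;apply/setP => z.
 rewrite inE;apply/idP/eqP => [zE|-> //];apply: u;rewrite inE ?zE ?xV //.
- by case: (h3 x) => //;rewrite (u x y) // inE ?xV ?yE ?orbT.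
Qed.
Lemma tot_zT m F0 F1 F2 : pgon_cocycle m F0 F1 F2 ->
 zT L (cact act) (vcell gam Y) (@cdim X) (bdry gam c) 0 m (tot F0 F1 F2).
move=> [h0 h1 h2];split=> // q w [vq Lw sz];rewrite /DT /bdry /ann /lnk.
case: (pgon_cells vq) => [->|[x xY ->]|[x xY ->]] in sz *;rewrite /cdim /= ?cards0 ?cards1 /= in sz *.
- rewrite !big_set0 addr0 add0r mul1r.
 transitivity (dt F0 w);last by apply: h0 => //;lia.
 case: w {Lw sz} => //= g v;rewrite /cact /= !imset0 tot0;congr (_ - _).
 by apply: rest_ext => u;rewrite tot0.
- rewrite big_set1 big_set0 addr0 setDv big_set0 mul1r tot0 (h1 x) //;last by lia.
 rewrite expr1 mulN1r;apply/eqP;rewrite subr_eq0;apply/eqP.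
 case: w {Lw sz} => //= g v;rewrite /cact /= imset0 imset_set1 tot1;congr (_ - _).
 by apply: rest_ext => u;rewrite tot1.
- rewrite big_set0 big_set1 add0r setDv /cre /= !big_set0 !mul1r !setU0 !tot1 sqrrN expr1n mul1r.
 rewrite -[RHS](h2 x w) //;last by lia.
 congr (_ + _).
 case: w {Lw sz} => //= g v;rewrite /cact /= imset0 imset_set1 tot2;congr (_ - _).
 by apply: rest_ext => u;rewrite tot2.
Qed.
Lemma pgon_tsum f : tsum gam Y f = \sum_(x in Y) f (set0, [set x]) :> k.
rewrite (tsum_split gamI pgon_gstable pgon_x0).
have O: orb0 gam Y x0 = Y by apply/setP => x;rewrite (orb0E pgon_gstable pgon_x0) YE.
have R: rest_orb gam Y x0 = set0 by rewrite /rest_orb O setDv.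
by rewrite O;apply: eq_bigr => x _;rewrite R tsum0 /= setU0.
Qed.
Lemma pgon_norb : norb gam Y = 1%N.
rewrite -(cards1 x0);apply/esym/(card_tcell gamI pgon_gstable)/tcellP;split.
- by rewrite sub1set pgon_x0.
- by move=> x y /set1P-> /set1P->.
- by move=> x xY;exists x0;rewrite ?inE // -YE.
Qed.
(** An explicit lift of 1 for the polygon, whose Euler class is pW0: minus the carry cocycle of
    addition modulo p, that is, minus the Bockstein of the rotation number n. *)
Definition pW0 w : k := if w is [:: g;h] then - (p <= n g + n h)%N%:R else 0.
Definition pW1 x w : k := if w is [:: g] then - (p <= idx x + n g)%N%:R else 0.
Definition pW2 x (w : seq gT) : k := if w is [::] then (idx x == p.-1)%:R else 0.

Lemma pW_cocycle : pgon_cocycle 2 pW0 pW1 pW2.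
have h1 x (w : seq gT) : x \in Y -> all [in L] w -> size w = 2 -> pW0 w = dQ act pW1 x w.
 case: w => [|g [|h [|]]] //= xY /and3P[gL hL _] _;rewrite idx_act // nM //.
 have [ix _] := idxP xY;have := nP gL;have := nP hL.
 move: (idx x) (n g) (n h) ix => a b d la lb ld.
 have M m : (m < 2 * p)%N -> (m %% p)%N = if (p <= m)%N then (m - p)%N else m.
  move=> lm;case: leqP => le;last by rewrite modn_small.
  by rewrite -{1}(subnK le) modnDr modn_small //;lia.
 rewrite !M;try lia.
 case: (leqP p (b + d)) => ?;case: (leqP p (a + b)) => ? /=;
 repeat case: leqP => ? //=;rewrite ?opprK;try (by ring);exfalso;lia.
split=> // [w Lw sz|x w xY Lw sz].
 transitivity (dQ act (dQ act pW1) x0 w);last exact: dQK.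
 transitivity (dQ act (fun _ => pW0) x0 w);first by case: w {Lw sz}.
 apply: (@eq_dQL k gT X act L (fun x => x \in Y)) => //;first by move=> *;exact: pgon_stable.
 - exact: pgon_x0.
 - by move=> q u qY Lu szu;rewrite -h1 //;lia.
case: w Lw sz => [|g [|]] //= /andP[gL _] _;rewrite idx_gam // idx_act //.
have [ix _] := idxP xY;have := nP gL;move: (idx x) (n g) ix => a b la lb.
have M m : (m < 2 * p)%N -> (m %% p)%N = if (p <= m)%N then (m - p)%N else m.
 move=> lm;case: leqP => le;last by rewrite modn_small.
 by rewrite -{1}(subnK le) modnDr modn_small //;lia.
rewrite !M;try lia.
case: (leqP p a.+1) => ?;case: (leqP p (a + b)) => ? /=;
 repeat (case: leqP => ? //=);repeat (case: eqP => ? //=);rewrite ?opprK;try (by ring);exfalso;lia.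
Qed.
Lemma pW_sum : \sum_(x in Y) pW2 x [::] = 1.
have i0: idx (iter p.-1 gam x0) = p.-1 by rewrite idx_iter modn_small //;lia.
rewrite (bigD1 (iter p.-1 gam x0)) /=;last by rewrite YE fconnect_iter.
rewrite i0 eqxx big1 ?addr0 // => x /andP[xY ne];case: eqP => // e.
by case/eqP: ne;rewrite -e;have [_ ->] := idxP xY.
Qed.
Lemma pgon_is_complex : complex L (cact act) (vcell gam Y) (@cdim X) (bdry gam c) (set0, set0)
 2 (tsum gam Y).
have := polygon_complex actM act1 gamI cN cc cL gamL pgon_gstable pgon_stable.
by rewrite pgon_norb muln1.
Qed.
Lemma pgon_division_sum m F0 F1 F2 (a := fun w => \sum_(x in Y) F2 x w) : pgon_cocycle m F0 F1 F2 ->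
 zts L 2 m a /\ bt L m (fun w => F0 w - lcup 2 pW0 a w).
move=> /tot_zT zF;have zW := tot_zT pW_cocycle.
have sW: tsum gam Y (fun q => tot pW0 pW1 pW2 q [::]) = 1.
 by rewrite pgon_tsum -[RHS]pW_sum;apply: eq_bigr => x _;rewrite tot2.
have [za [h Hh]] := zT_division_sum (cactM actM) pgon_is_complex zW sW zF.
have E: (fun w => tsum gam Y (fun q => tot F0 F1 F2 q w)) = a.
 by apply/funext => w;rewrite pgon_tsum;apply: eq_bigr => x _;rewrite tot2.
rewrite E in za Hh;split=> //;exists h => w Lw sz;rewrite -Hh // tot0 /lcup.
by case: ifP => // _;rewrite tot0.
Qed.
Lemma pgon_division m F0 F1 F2 : pgon_cocycle m F0 F1 F2 ->
 exists a, zts L 2 m a /\ bt L m (fun w => F0 w - lcup 2 pW0 a w).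
by move=> h;eexists;apply: pgon_division_sum h. Qed.

End Pgon.

(** * The cohomology of L × <c> on the level of cochains *)

Section Kunneth.
Variables (k : fieldType) (p : nat) (gT hT : finGroupType) (L : {group gT}) (c : hT).
Hypotheses (p_pr : prime p) (char_k : p \in [pchar k]) (pL : (p.-group L)%g) (ord_c : #[c]%g = p).

(** The group L × <c>. Through its second factor it rotates the p-gon with vertex set <c>, and the
    stabiliser of a vertex is L. *)
Definition cylinder : {group gT * hT} := setX_group L <[c]>%G.
Local Notation G2 := cylinder.
Let P : {group hT} := <[c]>%G.
Let act (x : hT) (g : gT * hT) : hT := (x * g.2)%g.
Let gam (x : hT) : hT := (c * x)%g.
Let nlog (g : gT * hT) := findex gam 1%g g.2.
Let D x := x \in P : Prop.

Let actM x g h : act (act x g) h = act x (g * h)%g. Proof. by rewrite /act -mulgA. Qed.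
Let act1 x : act x 1%g = x. Proof. exact: mulg1. Qed.
Let gamI : injective gam. Proof. exact: mulgI. Qed.
Let iter_gam i x : iter i gam x = (c ^+ i * x)%g.
by elim: i => [|i IH] /=;rewrite ?mul1g // IH /gam expgS mulgA. Qed.
Let YE x : (x \in (P : {set hT})) = fconnect gam 1%g x.
apply/cycleP/idP => [[i ->]|/iter_findex <-].
 by rewrite -[(c ^+ i)%g]mulg1 -iter_gam fconnect_iter.
by exists (findex gam 1%g x);rewrite iter_gam mulg1.
Qed.
Let ord_p : fingraph.order gam 1%g = p.
by rewrite -ord_c /order /fingraph.order;apply: eq_card => x;rewrite [RHS]YE. Qed.
Let p_gt0 : (0 < p)%N := prime_gt0 p_pr.
Let inP g : g \in G2 -> g.2 \in P. Proof. by rewrite inE => /andP[]. Qed.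
Let inL g : g \in G2 -> g.1 \in L. Proof. by rewrite inE => /andP[]. Qed.
Let logP u : u \in P -> (findex gam 1%g u < p)%N /\ (c ^+ findex gam 1%g u)%g = u.
by rewrite YE => uP;rewrite -ord_p findex_max // -[RHS](iter_findex uP) iter_gam mulg1. Qed.
Let nP g : g \in G2 -> (nlog g < p)%N. Proof. by move=> /inP/logP[]. Qed.
Let nM g h : g \in G2 -> h \in G2 -> nlog (g * h)%g = ((nlog g + nlog h) %% p)%N.
move=> /inP/logP[_ eg] /inP/logP[_ eh];rewrite {1}/nlog /= -eg -eh -expgD.
by rewrite -[X in findex _ _ X]mulg1 -iter_gam -/(idx gam 1%g (iter _ gam 1%g)) (idx_iter gamI ord_p p_gt0).
Qed.
Let actE g x : g \in G2 -> x \in (P : {set hT}) -> act x g = iter (nlog g) gam x.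
move=> /inP/logP[_ eg] xP;rewrite iter_gam /act -{1}eg.
by case/cycleP: xP => i ->;rewrite -!expgD addnC.
Qed.
Let gamL g : g \in G2 -> forall x, gam (act x g) = act (gam x) g.
by move=> _ x;rewrite /gam /act mulgA. Qed.
Let DL x g : D x -> g \in G2 -> D (act x g).
by move=> xP /inP gP;rewrite /D groupM. Qed.
Let Dgam x : D x -> D (gam x). Proof. by move=> xP;rewrite /D groupM ?cycle_id. Qed.
Lemma cylinder_pgroup : (p.-group G2)%g.
rewrite /pgroup (cardsX L <[c]>%g) pnatM -[#|<[c]>%g|]/(order c) ord_c pnat_id // andbT;exact: pL. Qed.
(** [zgen] is the Euler class of this p-gon, in degree 2, and [ygen] is the class of degree 1 given
    by the logarithm to the base c. *)
Definition zgen : seq (gT * hT) -> k := pW0 k p nlog.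
Definition ygen (w : seq (gT * hT)) : k := if w is [:: g] then (nlog g)%:R else 0.
Definition infl (r : seq gT -> k) (w : seq (gT * hT)) : k := r (map fst w).

Let pW1' : hT -> seq (gT * hT) -> k := pW1 k p gam 1%g nlog.
Let pW2' : hT -> seq (gT * hT) -> k := pW2 k p gam 1%g.
Let W2 : pgon_cocycle act gam G2 P 2 zgen pW1' pW2'.
exact: (pW_cocycle k actM gamI YE ord_p p_gt0 nP nM actE). Qed.
Lemma pr_in (w : seq (gT * hT)) : all [in G2] w -> all [in L] (map fst w).
by move=> Gw;apply/allP => _ /mapP[g /(allP Gw) gG ->];apply: inL. Qed.
Lemma inl_in (w : seq gT) : all [in L] w -> all [in G2] (map (fun g => (g, 1%g)) w).
by move=> Lw;apply/allP => _ /mapP[g /(allP Lw) gL ->];rewrite !inE gL group1. Qed.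
Lemma pr_inl (w : seq gT) : map fst (map (fun g : gT => (g, 1%g : hT)) w) = w.
by rewrite -map_comp map_id_in. Qed.
Lemma dt_infl r w : dt (infl r) w = dt r (map fst w).
by rewrite (@dt_map k _ _ (fst : gT * hT -> gT)). Qed.
Lemma zts_infl j n r : zts L j n r -> zts G2 j n (infl r).
by move=> zr w Gw sz;rewrite dt_infl zr ?pr_in ?size_map. Qed.
Lemma dt_inl (f : seq (gT * hT) -> k) w :
 dt f (map (fun g => (g, 1%g)) w) = dt (fun u => f (map (fun g => (g, 1%g)) u)) w.
by rewrite (@dt_map k _ _ (fun g : gT => (g, 1%g : hT))) // => x y;congr pair;rewrite mulg1.
Qed.
Let dQ1_inl (F : hT -> seq (gT * hT) -> k) (w : seq gT) : dQ act F 1%g (map (fun g => (g, 1%g)) w) =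
 dt (fun u => F 1%g (map (fun g => (g, 1%g)) u)) w.
by rewrite -dt_inl;case: w => //= g w;rewrite /act mulg1. Qed.
Let dQ_gam (H : hT -> seq (gT * hT) -> k) x w : dQ act (fun x => H (gam x)) x w = dQ act H (gam x) w :> k.
by case: w => //= g w;rewrite /act /gam mulgA. Qed.
(** Shapiro's lemma for the transitive action on <c>: a gauge moves all vertices to 1, after which
    the cocycle is inflated from its restriction to L at the vertex 1. *)
Let slice j n (F : hT -> seq (gT * hT) -> k) : zQ act G2 D j n F -> exists H, forall x (w : seq (gT * hT)), D x ->
 all [in G2] w -> (size w + j = n)%N -> F x w - infl (fun u => F 1%g (map (fun g => (g, 1%g)) u)) w =
  dQ act H x w :> k.
move=> zF;have [|H HH] := zQ_gauge (tau := fun x => (1%g, x^-1%g)) actM DL _ zF.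
 by move=> x xP;rewrite !inE /= group1 groupV.
exists H => x w xP Gw sz;rewrite -HH //;congr (_ - _).
rewrite /gauge /infl /act /= mulgV;congr (F _ _).
elim: w x {xP Gw sz} => //= g w IH x;rewrite -IH;congr (_ :: _).
rewrite -[(_ * _)%g]/(_, _);congr pair;first by rewrite /= invg1 mul1g mulg1.
by rewrite /= invgK mulgV.
Qed.
Let dQ_sum (H : hT -> seq (gT * hT) -> k) (w : seq (gT * hT)) : all [in G2] w -> \sum_(x in P) dQ act H x w = dt (fun w => \sum_(x in P) H x w) w :> k.
case: w => [|g w] /=;first by rewrite big1.
move=> /andP[/inP gP _];rewrite sumrB rest_sum;congr (_ - _).
by rewrite [RHS](reindex_inj (mulIg g.2)) /=;apply: eq_bigl => x;rewrite groupMr.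
Qed.
Lemma zgen_zt : zt G2 2 zgen. Proof. by case: W2. Qed.
Let pchar0 : p%:R = 0 :> k := pcharf0 char_k.
Let tcup_ext e (b f h : seq (gT * hT) -> k) w : (forall u, size u = (size w - e)%N -> all [in G2] u -> f u = h u) ->
 all [in G2] w -> tcup e b f w = tcup e b h w.
move=> E Gw;rewrite /tcup;case: ifP => // le;rewrite E ?size_takel ?leq_subr //.
by apply/allP => x /mem_take xw;apply: (allP Gw).
Qed.
Let tcupB e (b f h : seq (gT * hT) -> k) w : tcup e b (fun w => f w - h w) w = tcup e b f w - tcup e b h w.
by rewrite /tcup;case: ifP;rewrite ?subr0 // mulrBl. Qed.
Let lcup_tcup_size m n e (y : seq (gT * hT) -> k) w : size w = (m + n)%N -> lcup m e y w = tcup n y e w.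
by move=> sz;rewrite /lcup /tcup sz leq_addr leq_addl addnK. Qed.
(** If z a = dh, then W1 cup a - h is a cocycle on the vertices, hence inflated up to some dH. The
    differences of H along the edges, added to W2 cup a, form a cocycle on the edges, again inflated
    up to a coboundary. Summed over the polygon it gives a, as W2 sums to 1, while the inflated part
    is counted p times and vanishes in k. *)
Lemma zgen_inj n a : zt G2 n a -> bt G2 (2 + n) (lcup 2 zgen a) -> bt G2 n a.
move=> za [h Hh];have [_ h1 h2] := W2.
pose F1 x (w : seq (gT * hT)) := tcup n a (pW1' x) w - h w.
have zF1: zQ act G2 D 0 n.+1 F1.
 move=> x w xP Gw sz;rewrite addn0 in sz.
 have -> : dQ act F1 x w = dQ act (fun x => tcup n a (pW1' x)) x w - dt h w.
  by rewrite dQB;congr (_ - _);case: w {Gw sz}.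
 rewrite (dQ_tcup actM DL _ za xP Gw) -Hh //.
 rewrite (@lcup_tcup_size 2 n _ _ w sz).
 apply/eqP;rewrite subr_eq0;apply/eqP/tcup_ext => // u su Gu.
 by rewrite -h1 // su sz;lia.
have [H HH] := slice zF1.
pose F2 x w := tcup n a (pW2' x) w + (H (gam x) w - H x w).
have zF2: zQ act G2 D 0 n F2.
 move=> x w xP Gw sz;rewrite addn0 in sz.
 have -> : dQ act F2 x w = dQ act (fun x => tcup n a (pW2' x)) x w + (dQ act H (gam x) w - dQ act H x w).
  have := @dQ_lin k _ _ act 1 (fun x => tcup n a (pW2' x)) (fun x w => H (gam x) w - H x w) x w.
  rewrite mul1r dQB dQ_gam => <-;apply: (eq_dQL DL) => // *;by rewrite mul1r.
 rewrite -!HH ?addn0 //;last exact: Dgam.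
 rewrite (dQ_tcup actM DL _ za xP Gw) /F1.
 rewrite (tcup_ext a (h := fun u => pW1' x u - pW1' (gam x) u)) => [|u su Gu|//].
  by rewrite tcupB;ring.
 have := h2 x _ xP Gu;rewrite su sz => /(_ ltac:(lia)) E.
 by apply/eqP;rewrite -subr_eq0 -E;apply/eqP;ring.
have [H' HH'] := slice zF2.
exists (fun w => \sum_(x in P) H' x w) => w Gw sz;rewrite -dQ_sum //.
transitivity (\sum_(x in P) (F2 x w - infl (fun u => F2 1%g (map (fun g => (g, 1%g)) u)) w)).
 rewrite sumrB big_split sumrB /= sumr_const.
 rewrite (_ : \sum_(x in P) H (gam x) w = \sum_(x in P) H x w);last first.
  by rewrite [RHS](reindex_inj gamI) /=;apply: eq_bigl => x;rewrite groupMl ?cycle_id.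
 rewrite -/(order c) ord_c -mulr_natr pchar0 mulr0 subrr addr0 subr0 /tcup sz leqnn subnn take0 drop0.
 rewrite -mulr_suml;have := pW_sum k (gT * hT)%type gamI YE ord_p p_gt0 => ->.
 by rewrite mul1r.
by apply: eq_bigr => x xP;rewrite HH' ?addn0.
Qed.
Let nu x : k := (findex gam 1%g x)%:R.
Let natr_mod m : (m %% p)%:R = m%:R :> k.
by rewrite [in RHS](divn_eq m p) natrD natrM pchar0 mulr0 add0r. Qed.
Let nu_gam x : D x -> nu (gam x) = nu x + 1.
by move=> xP;rewrite /nu -[findex _ _ (gam x)]/(idx gam 1%g (gam x)) (idx_gam gamI YE ord_p p_gt0) // natr_mod -natr1. Qed.
Let nu_act x g : D x -> g \in G2 -> nu (act x g) = nu x + (nlog g)%:R.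
move=> xP gG;rewrite /nu -[findex _ _ (act x g)]/(idx gam 1%g (act x g)).
by rewrite (idx_act gamI YE ord_p p_gt0 actE) // natr_mod natrD.
Qed.
Let dQ_nu n s x w : zts L 1 n s -> D x -> all [in G2] w -> size w = n ->
 dQ act (fun x w => nu x * infl s w) x w = lcup 1 ygen (infl s) w.
case: w => [|g w] zs xP Gw sz //.
have := zts_infl zs (w := g :: w) Gw;rewrite sz addn1 => /(_ erefl) /=.
move/andP: Gw => [gG Gw] E.
rewrite /= restZ nu_act // /lcup /= take0 drop0.
by transitivity ((nlog g)%:R * infl s w + nu x * (infl s w - rest (infl s) g w));[ring|rewrite E;ring].
Qed.
Let nlog1 g : nlog (g, 1%g) = 0%N. Proof. by rewrite /nlog findex0. Qed.
Let dQ_infl j n r x w : zts L j n r -> all [in G2] w -> (size w + j = n.+1)%N ->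
 dQ act (fun _ => infl r) x w = 0.
move=> zr Gw sz;rewrite -[RHS](zts_infl zr Gw sz);by case: w {Gw sz}.
Qed.
(** Restriction to L × 1 shows that r bounds. The rest of the relation is a coboundary on the
    vertices, which is sliced and compared at the vertices 1 and c; the jump of nu by 1 between them
    isolates s. *)
Lemma cylinder_indep n r s a : zt L n r -> zts L 1 n s -> zts G2 2 n a ->
 bt G2 n (fun w => infl r w + lcup 1 ygen (infl s) w - lcup 2 zgen a w) ->
 bt L n r /\ bts L 1 n s.
move=> zr zs za [h Hh];have [_ h1 h2] := W2.
have br: bt L n r.
 exists (fun u => h (map (fun g => (g, 1%g)) u)) => w Lw sz.
 rewrite -dt_inl -Hh ?size_map ?inl_in // /infl pr_inl.
 have -> : lcup 1 ygen (infl s) (map (fun g => (g, 1%g)) w) = 0.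
  by rewrite /lcup size_map;case: w {Lw sz} => //= g w;rewrite take0 nlog1 mul0r.
 have -> : lcup 2 zgen a (map (fun g => (g, 1%g)) w) = 0.
  rewrite /lcup size_map;case: w {Lw sz} => [|g1 [|g2 w]] //=.
  by rewrite take0 /zgen /= !nlog1 addn0 leqNgt p_gt0 oppr0 mul0r.
 by rewrite addr0 subr0.
split=> //;case: br => h' Hh'.
pose h'' w := h w - infl h' w.
have E w : all [in G2] w -> size w = n -> lcup 1 ygen (infl s) w - lcup 2 zgen a w = dt h'' w.
 move=> Gw sz;rewrite dtB dt_infl -Hh // -Hh' ?size_map ?pr_in //;rewrite /infl;ring.
case: n zr zs za Hh Hh' E => [|n] zr zs za Hh Hh' E.
 by exists (fun=> 0) => w _;rewrite addn1.
pose m := (n.-1)%N.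
pose Wa (V : hT -> seq (gT * hT) -> k) x w := if (1 <= n)%N then tcup m a (V x) w else 0.
have za' : (1 <= n)%N -> zt G2 m a by move=> n1 w Gw sz;apply: za => //;rewrite /m in sz;lia.
pose F1 x w := nu x * infl s w - Wa pW1' x w - h'' w.
have dWa V x w : D x -> all [in G2] w -> dQ act (Wa V) x w = if (1 <= n)%N then tcup m a (dQ act V x) w else 0.
 move=> xP Gw;rewrite /Wa;case: ifP => [n1|_];last exact: dQ0.
 by rewrite (dQ_tcup actM DL _ (za' n1) xP Gw).
have zF1: zQ act G2 D 1 n.+1 F1.
 move=> x w xP Gw;rewrite addn1 => -[sz].
 have -> : dQ act F1 x w = dQ act (fun x w => nu x * infl s w) x w - dQ act (Wa pW1') x w - dt h'' w.
  by rewrite (@dQB k _ _ act (fun x w => nu x * infl s w - Wa pW1' x w)) dQB;congr (_ - _);case: w {Gw sz}.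
 rewrite (dQ_nu zs) // dWa // -E //.
 suff -> : lcup 2 zgen a w = if (1 <= n)%N then tcup m a (dQ act pW1' x) w else 0 by ring.
 case: ifP => n1;last by rewrite /lcup;case: ifP => //;rewrite sz;lia.
 rewrite (lcup_tcup_size (n := m));last by rewrite sz /m;lia.
 by apply: tcup_ext => // u su Gu;rewrite -h1 // su sz /m;lia.
have [H HH] := slice zF1.
pose K x w := H (gam x) w - H x w - Wa pW2' x w.
exists (fun u => K 1%g (map (fun g => (g, 1%g)) u)) => w Lw;rewrite addn1 => -[sz].
rewrite -dQ1_inl;set w' := map _ w.
have Gw' : all [in G2] w' by apply: inl_in.
have szw' : size w' = n by rewrite size_map.
have D1: D 1%g by rewrite /D group1.
have -> : dQ act K 1%g w' = dQ act H (gam 1%g) w' - dQ act H 1%g w' - dQ act (Wa pW2') 1%g w'.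
 by rewrite (@dQB k _ _ act (fun x w => H (gam x) w - H x w)) dQB dQ_gam.
rewrite -!HH ?addn1 ?szw' //;last exact: Dgam.
have Z (x y u : k) : x - u - (y - u) = x - y by ring.
rewrite Z dWa // /F1 nu_gam //.
have -> : infl s w' = s w by rewrite /infl /w' pr_inl.
suff -> : Wa pW1' (gam 1%g) w' = Wa pW1' 1%g w' - (if (1 <= n)%N then tcup m a (dQ act pW2' 1%g) w' else 0).
 by ring.
rewrite /Wa;case: ifP => n1;last by rewrite subr0.
rewrite -tcupB;apply: tcup_ext => // u su Gu.
have := h2 1%g _ D1 Gu;rewrite su szw' => /(_ ltac:(rewrite /m;lia)) E'.
by apply/eqP;rewrite -subr_eq0 -E';apply/eqP;ring.
Qed.
(** With r the restriction of a to L × 1, a - r is the coboundary of a vertex cochain H, and s is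
    the slice of the differences of H along edges. Then a - r - y s is the value on the empty cell
    of a total cocycle of the polygon, so it is divisible by z. *)
Lemma cylinder_span n a : zt G2 n a -> exists r s a', [/\ zt L n r, zts L 1 n s, zts G2 2 n a'
 & bt G2 n (fun w => a w - infl r w - lcup 1 ygen (infl s) w - lcup 2 zgen a' w)].
move=> za;pose r u := a (map (fun g => (g, 1%g)) u).
have zr: zt L n r by move=> w Lw sz;rewrite -dt_inl za ?inl_in ?size_map.
pose f0 w := a w - infl r w.
have zf0 w : all [in G2] w -> size w = n.+1 -> dt f0 w = 0.
 by move=> Gw sz;rewrite dtB za // dt_infl zr ?pr_in ?size_map // subr0.
have zF: zQ act G2 D 0 n (fun _ => f0).
 by move=> x w xP Gw;rewrite addn0 => /(zf0 _ Gw) <-;case: w {Gw}.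
have [H HH] := slice zF.
have f0H x w : D x -> all [in G2] w -> size w = n -> f0 w = dQ act H x w.
 move=> xP Gw sz;rewrite -HH ?addn0 // -[LHS]subr0;congr (_ - _).
 by rewrite /infl /f0 /infl pr_inl /r subrr.
pose phi x w := H (gam x) w - H x w.
have zphi: zQ act G2 D 1 n phi.
 move=> x w xP Gw;rewrite addn1 => -[sz];rewrite dQB dQ_gam -!f0H ?subrr //;exact: Dgam.
have [H' HH'] := slice zphi.
pose s u := phi 1%g (map (fun g => (g, 1%g)) u).
have D1: D 1%g by rewrite /D group1.
have zs: zts L 1 n s.
 move=> w Lw sz;rewrite -dQ1_inl zphi ?inl_in ?size_map //.
pose F0 w := f0 w - lcup 1 ygen (infl s) w.
pose F1 x w := H x w - nu x * infl s w.
pose F2 x w := -1 * H' x w.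
have cF: pgon_cocycle act gam G2 P n F0 F1 F2.
 have e1 x w : D x -> all [in G2] w -> size w = n -> F0 w = dQ act F1 x w.
  by move=> xP Gw sz;rewrite dQB -f0H // (dQ_nu zs).
 split=> //.
 - move=> w Gw sz;transitivity (dQ act (dQ act F1) 1%g w);last exact: dQK.
  transitivity (dQ act (fun _ => F0) 1%g w);first by case: w {Gw sz}.
  by apply: (eq_dQL DL) => // x u xP Gu szu;rewrite -e1 //;move: szu;rewrite sz => -[].
 - move=> x w xP Gw sz;rewrite dQZ -HH' ?addn1 // /F1 nu_gam // /phi -/s;ring.
have [c' [cN cc cL]] := sign_exists actM act1 p_pr char_k cylinder_pgroup.
have [a' [za' [h Hh]]] := pgon_division actM act1 gamI cN cc cL gamL YE ord_p p_gt0 nP nM actE cF.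
by exists r, s, a';split=> //;exists h => w Gw sz;rewrite -Hh.
Qed.
Lemma ygen_zt : zt G2 1 ygen.
case=> [|g [|h [|]]] //= /and3P[gG hG _] _.
by rewrite nM // natr_mod natrD;ring.
Qed.
Lemma ygen_sq (w : seq (gT * hT)) : p = 2%N -> all [in G2] w -> size w = 2%N ->
 lcup 1 ygen ygen w = - zgen w.
move=> p2;case: w => [|g [|h [|]]] //= /and3P[/nP gG /nP hG _] _;rewrite /lcup /= opprK.
move: gG hG;rewrite p2;case: (nlog g) => [|[|]] //;case: (nlog h) => [|[|]] // _ _;
 by rewrite ?mul0r ?mulr0 ?mulr1.
Qed.

End Kunneth.

Section Graded.
Variables (k : fieldType) (H : finGroupType).
Implicit Types x y : cohomology k H.

Definition hprs j n x : cohomology k H := if (j <= n)%N then hpr (n - j) x else 0.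

Lemma hpr_mul_shift j n x y : hcl j x -> hpr n (x * y) = x * hprs j n y.
move=> hx;rewrite /hprs;case: leqP => le;last by rewrite (hpr_mul_lt _ hx le) mulr0.
by rewrite -{1}(subnKC le) (hpr_mul _ _ hx).
Qed.
Lemma hpr_ext x y : (forall n, hpr n x = hpr n y) -> x = y.
move=> E;have [M1 e1] := hpr_sum x;have [M2 e2] := hpr_sum y.
by rewrite (e1 (maxn M1 M2)) ?leq_maxl // (e2 (maxn M1 M2)) ?leq_maxr //;apply: eq_bigr.
Qed.
Lemma hprs_ext j x y : (forall n, hprs j n x = hprs j n y) -> x = y.
by move=> E;apply: hpr_ext => n;have := E (n + j)%N;rewrite /hprs leq_addl addnK.
Qed.
Lemma hpr0 n : hpr n (0 : cohomology k H) = 0. Proof. exact: linear0. Qed.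
Lemma even_central x y n : hcl n x -> (-1) ^+ n = 1 :> k -> x * y = y * x.
move=> hx e;have [M /(_ M (leqnn M)) ->] := hpr_sum y.
rewrite mulr_sumr mulr_suml;apply: eq_bigr => i _.
by rewrite (hcl_comm hx (hcl_hpr i y)) exprM e expr1n scale1r.
Qed.
End Graded.

                                                                                  
(** * Division by monic elements over the basis 1, Y, Z, YZ, Z^2, .. *)

Section Skew.
Variables (k : fieldType) (R A : algType k) (f : {lrmorphism R -> A}) (Y Z : A).
Hypothesis Zcen : forall x, Z * x = x * Z.
Hypothesis Ycomm : forall r, exists r', f r * Y = Y * f r'.
Hypothesis Ysq : exists kap : k, Y * Y = kap *: Z.
Hypothesis Zinj : forall a, Z * a = 0 -> a = 0.
Hypothesis YZ_indep : forall r s a, f r + Y * f s = Z * a -> r = 0 /\ s = 0.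

(** The basis 1, Y, Z, YZ, Z^2, ... of H(L × <c>) over H(L), with Y in degree 1 and Z in degree 2,
    so that the index is the degree. *)
Definition ebase i := (if odd i then Y else 1) * Z ^+ i./2.

Lemma ebaseSS i : ebase i.+2 = Z * ebase i.
by rewrite /ebase /= negbK exprS mulrA -Zcen -mulrA. Qed.
Lemma ZX_central i x : Z ^+ i * x = x * Z ^+ i.
by elim: i => [|i IH];rewrite ?expr0 ?mul1r ?mulr1 // exprS -mulrA IH mulrA Zcen mulrA. Qed.
(** As Y^2 is a multiple of Z, the basis multiplies like the powers of one variable, up to scalars
    which may vanish. *)
Lemma ebase_mul i j r : exists r', ebase i * f r * ebase j = ebase (i + j) * f r'.
have [r1 e1] : exists r1, f r * (if odd j then Y else 1) = (if odd j then Y else 1) * f r1.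
 by case: ifP => _;[apply: Ycomm|exists r;rewrite mulr1 mul1r].
have [kap [e2 e3]] : exists kap : k, (if odd i then Y else 1) * (if odd j then Y else 1) =
  kap *: ((if odd (i + j) then Y else 1) * Z ^+ (odd i && odd j)) /\
  (i + j)./2 = (i./2 + j./2 + (odd i && odd j))%N.
 have [kap e] := Ysq;rewrite oddD.
 have h: (i + j)./2 = (i./2 + j./2 + (odd i && odd j))%N.
  by rewrite halfD addnC.
 case: (odd i) (odd j) h => [] [] /= h;[exists kap|exists 1|exists 1|exists 1];split=> //;
  by rewrite ?e ?expr0 ?expr1 ?scale1r ?mulr1 ?mul1r.
exists (kap *: r1);rewrite linearZ /= -scalerAr.
rewrite /ebase -(mulrA (_ * Z ^+ i./2)) -(mulrA _ (Z ^+ i./2)) ZX_central !mulrA.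
rewrite -(mulrA _ (f r)) e1 mulrA e2 -!scalerAl;congr (_ *: _).
rewrite -(mulrA (_ * f r1) (Z ^+ j./2)) -exprD -(mulrA (_ * Z ^+ (odd i && odd j)) (f r1)).
have -> n : f r1 * Z ^+ n = Z ^+ n * f r1 by rewrite ZX_central.
rewrite mulrA -(mulrA _ (Z ^+ (odd i && odd j))) -exprD e3.
by congr (_ * _ ^+ _ * _);lia.
Qed.
Definition esum M (u : nat -> R) := \sum_(i < M) ebase i * f (u i).

Lemma esum_pad M M' u : (M <= M')%N -> esum M u = esum M' (fun i => if (i < M)%N then u i else 0).
move=> le;rewrite /esum (big_ord_widen M' (fun i => ebase i * f (u i)) le) big_mkcond.
by apply: eq_bigr => i _;case: ifP;rewrite ?raddf0 ?mulr0.
Qed.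
Lemma esumSS M u : esum M.+2 u = f (u 0%N) + Y * f (u 1%N) + Z * esum M (fun i => u i.+2).
rewrite /esum !big_ord_recl /= /ebase /= expr0 !mulr1 mul1r addrA mulr_sumr;congr (_ + _).
apply: eq_bigr => i _;rewrite /bump /= !add0n !add1n;have := ebaseSS i;rewrite /ebase /= => ->.
by rewrite !mulrA.
Qed.
Lemma esum_eq0 M u : esum M u = 0 -> forall i, (i < M)%N -> u i = 0.
suff key n v : esum n.*2 v = 0 -> forall i, (i < n.*2)%N -> v i = 0.
 have le: (M <= M.*2)%N by lia.
 rewrite (esum_pad u le) => /key H i lt;have := H i;rewrite lt;apply;exact: leq_trans lt le.
elim: n v => [|n IH] v // E.
have {E} E : f (v 0%N) + Y * f (v 1%N) = Z * - esum n.*2 (fun i => v i.+2).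
 by apply/eqP;rewrite mulrN -subr_eq0 opprK -esumSS E.
have [v0 v1] := YZ_indep E.
have E' : esum n.*2 (fun i => v i.+2) = 0.
 apply: Zinj;apply/eqP;rewrite -oppr_eq0 -mulrN -E v0 v1 !raddf0 mulr0 addr0 //.
case=> [|[|i]] // lt;apply: (IH _ E');lia.
Qed.
Lemma esumB M u v : esum M (fun i => u i - v i) = esum M u - esum M v.
by rewrite /esum -sumrB;apply: eq_bigr => i _;rewrite raddfB mulrBr. Qed.
Lemma esumD M u v : esum M (fun i => u i + v i) = esum M u + esum M v.
by rewrite /esum -big_split;apply: eq_bigr => i _;rewrite raddfD mulrDr. Qed.

Section Tail.
Variable N : R -> Prop.
Hypotheses (N0 : N 0) (ND : forall x y, N x -> N y -> N (x + y)) (NM : forall a x, N x -> N (a * x)).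

Lemma NN x : N x -> N (- x). Proof. by move=> /(NM (-1));rewrite mulN1r. Qed.
Lemma NZ (a : k) x : N x -> N (a *: x). Proof. by move=> /(NM a%:A);rewrite mulr_algl. Qed.
(** All coefficients of x of index at least n lie in the ideal N. *)
Definition tailN n x := exists M u, (forall i, (n <= i)%N -> N (u i)) /\ x = esum M u.

Lemma tailND n x y : tailN n x -> tailN n y -> tailN n (x + y).
move=> [M1 [u1 [h1 ->]]] [M2 [u2 [h2 ->]]].
rewrite (esum_pad u1 (leq_maxl M1 M2)) (esum_pad u2 (leq_maxr M1 M2)) -esumD.
by do 2!eexists;split;last reflexivity;move=> i le /=;apply: ND;case: ifP => _ //;auto.
Qed.
Lemma tailN_base n i r : ((n <= i)%N -> N r) -> tailN n (ebase i * f r).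
move=> h;exists i.+1, (fun j => if j == i then r else 0);split=> [j le|].
 by case: eqP => // e;apply: h;rewrite -e.
rewrite /esum big_ord_recr /= eqxx big1 ?add0r // => j _.
by rewrite (ltn_eqF (ltn_ord j)) raddf0 mulr0.
Qed.
Lemma tailN0 n : tailN n 0.
by exists 0%N, (fun=> 0);split=> //;rewrite /esum big_ord0. Qed.
Lemma tailN_sum n (I : eqType) (s : seq I) (F : I -> A) : (forall i, i \in s -> tailN n (F i)) ->
 tailN n (\sum_(i <- s) F i).
elim: s => [|i s IH] h;first by rewrite big_nil;apply: tailN0.
by rewrite big_cons;apply: tailND;[apply: h;rewrite mem_head|apply: IH => j js;apply: h;rewrite in_cons js orbT].
Qed.
Lemma tailN_coef n M u : tailN n (esum M u) -> forall i, (n <= i < M)%N -> N (u i).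
move=> [M' [v [hv E]]] i /andP[le lt].
rewrite (esum_pad u (leq_maxl M M')) (esum_pad v (leq_maxr M M')) in E.
have /esum_eq0 H : esum (maxn M M') (fun i => (if (i < M)%N then u i else 0) - (if (i < M')%N then v i else 0)) = 0.
 by rewrite esumB E subrr.
have := H i;rewrite leq_max lt => /(_ isT)/eqP;rewrite subr_eq0 => /eqP ->.
by case: ifP => // _;apply: hv.
Qed.
Lemma tailN_monic m (al : k) (a : nat -> R) eps j r n :
 eps = al *: ebase m + esum m a -> ((n <= m + j)%N -> N r) ->
 (forall i, (i < m)%N -> (n <= i + j)%N -> N r) -> tailN n (eps * (ebase j * f r)).
move=> Ee h1 h2;rewrite Ee mulrDl mulr_suml;apply: tailND.
 have [r' e] := ebase_mul m j 1;rewrite rmorph1 mulr1 in e.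
 rewrite mulrA -scalerAl -scalerAl e -mulrA -rmorphM scalerAr -linearZ /=.
 by apply: tailN_base => /h1 Nr;apply/NZ/NM.
apply: tailN_sum => i _;rewrite mulrA;have [r' ->] := ebase_mul i j (a i).
rewrite -mulrA -rmorphM;apply: tailN_base => le;apply: NM;exact: h2 le.
Qed.

End Tail.

(** The top coefficient of x reappears, times al, as the coefficient of index m + M of eps * x, so
    it lies in N and can be split off. Since m is even, ebase m is a power of Z and ebase m * ebase
    M is ebase (m + M) exactly. *)
Lemma monic_cancel (N : R -> Prop) m (al : k) (a : nat -> R) eps x : N 0 ->
 (forall x y, N x -> N y -> N (x + y)) -> (forall a x, N x -> N (a * x)) ->
 al != 0 -> ~~ odd m -> eps = al *: ebase m + esum m a -> (exists M u, x = esum M u) ->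
 tailN N m (eps * x) -> tailN N 0 x.
move=> N0 ND NM al0 em Ee [M [u ->]];elim: M u => [|M IH] u;first by rewrite /esum big_ord0 => _;apply: tailN0.
rewrite {1}/esum big_ord_recr /= -/(esum M u) => T.
pose O (x : R) := x = 0.
have OD r1 r2 : O r1 -> O r2 -> O (r1 + r2) by rewrite /O => -> ->;rewrite addr0.
have OM b y : O y -> O (b * y) by rewrite /O => ->;rewrite mulr0.
have [M1 [v [hv Ev]]] : tailN O (m + M)
  (eps * (esum M u + ebase M * f (u M)) - ebase (m + M) * f (al *: u M)).
 rewrite mulrDr -addrA;apply: tailND => //.
  rewrite /esum mulr_sumr;apply: tailN_sum => // j _;apply: (tailN_monic _ OD OM Ee) => //.
   by rewrite leq_add2l leqNgt ltn_ord.
  by move=> i lt;have := ltn_ord j;lia.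
 have -> : ebase (m + M) = ebase m * ebase M.
  rewrite /ebase oddD (negbTE em) /= mul1r halfD (negbTE em) /= add0n exprD mulrA.
  by rewrite -(ZX_central m./2 (if _ then _ else _)) mulrA.
 rewrite {1}Ee mulrDl linearZ /= -!scalerAl -scalerAr mulrA addrAC subrr add0r.
 rewrite mulr_suml;apply: tailN_sum => // i _;rewrite mulrA;have [r' ->] := ebase_mul i M (a i).
 rewrite -mulrA -rmorphM;apply: tailN_base => //.
 by have := ltn_ord i;lia.
have NM' : N (u M).
 have E: eps * (esum M u + ebase M * f (u M)) = esum (maxn M1 (m + M).+1)
   (fun i => (if (i < M1)%N then v i else 0) + (if i == (m + M)%N then al *: u M else 0)).
  rewrite esumD -(esum_pad v (leq_maxl _ _)) -Ev.
  rewrite (_ : esum _ (fun i => if i == (m + M)%N then _ else _) = ebase (m + M) * f (al *: u M)) ?subrK //.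
  rewrite /esum (bigD1 (Ordinal (leq_maxr M1 (m + M).+1))) //= eqxx big1 ?addr0 // => i.
  by rewrite -val_eqE /= => /negbTE->;rewrite raddf0 mulr0.
 rewrite E in T;have := tailN_coef N0 T;move=> /(_ (m + M)%N).
 rewrite leq_addr leq_maxr eqxx (_ : (if _ then _ else _) = 0 :> R);last first.
  by case: ifP => // _;apply: hv.
 by rewrite add0r => /(_ isT) /(NZ NM al^-1);rewrite scalerA mulVf // scale1r.
have {}T : tailN N m (eps * esum M u).
 have -> : eps * esum M u = eps * (esum M u + ebase M * f (u M)) + eps * (ebase M * f (- u M)).
  by rewrite mulrDr raddfN mulrN mulrN addrK.
 apply: tailND => //;apply: (tailN_monic N0 ND NM Ee) => *;exact: NN.
have := IH _ T;rewrite [esum M.+1 u]/esum big_ord_recr /= => h.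
apply: tailND => //;exact: tailN_base.
Qed.

End Skew.

(** * The ring H(L × <c>) as a free module over H(L) *)

Section RingKunneth.
Variables (k : fieldType) (p : nat) (gT hT : finGroupType) (L : {group gT}) (c : hT).
Hypotheses (p_pr : prime p) (char_k : p \in [pchar k]) (pL : (p.-group L)%g) (ord_c : #[c]%g = p).
Local Notation G2 := (cylinder L c).

Definition cyl_proj (u : subg_of G2) : subg_of L := subg L (sgval u).1.

Lemma cyl_projE u : sgval (cyl_proj u) = (sgval u).1.
by rewrite subgK //;have := subgP u;rewrite inE => /andP[]. Qed.
Lemma cyl_projM : {morph cyl_proj : u v / (u * v)%g}.
by move=> u v;apply: val_inj;rewrite /= !cyl_projE. Qed.
Definition Infl : 'H^*(L, k) -> 'H^*(G2, k) := cohomology_pullback cyl_projM.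
HB.instance Definition _ := GRing.LRMorphism.on Infl.

Lemma Infl_fcl n r : zt L n r -> Infl (fcl L n r) = fcl G2 n (infl r).
by move=> zr;have [_ e] := fcl_pullback cyl_projM cyl_projE zr. Qed.
Lemma hpr_Infl n x : hpr n (Infl x) = Infl (hpr n x). Proof. exact: hpr_pullback. Qed.
Definition Zc : 'H^*(G2, k) := fcl G2 2 (zgen k p c).
Definition Yc : 'H^*(G2, k) := fcl G2 1 (ygen k c).

Let zz : zt G2 2 (zgen k p c) := zgen_zt k p_pr ord_c.
Let zy : zt G2 1 (ygen k c) := ygen_zt p_pr char_k ord_c.
Lemma hcl_Zc : hcl 2 Zc. Proof. exact: (hcl_fcl zz). Qed.
Lemma hcl_Yc : hcl 1 Yc. Proof. exact: (hcl_fcl zy). Qed.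
Lemma Zc_central x : Zc * x = x * Zc.
by apply: even_central hcl_Zc _;rewrite sqrrN expr1n. Qed.
Lemma Yc_comm r : exists r', Infl r * Yc = Yc * Infl r'.
have [M /(_ M (leqnn M)) {1}->] := hpr_sum r.
exists (\sum_(n < M) (-1) ^+ n *: hpr n r).
rewrite !raddf_sum mulr_suml mulr_sumr;apply: eq_bigr => n _ /=.
by rewrite (hcl_comm (hcl_pullback cyl_projM (hcl_hpr n r)) hcl_Yc) muln1 linearZ /= -scalerAr.
Qed.
(** For p = 2 the square of the logarithm is the carry cocycle, that is -z; for p odd, graded
    commutativity forces a class of degree 1 to have square zero. *)
Lemma Yc_sq : exists kap : k, Yc * Yc = kap *: Zc.
have [p2|p2] := eqVneq p 2%N.
 exists (-1);rewrite fclM //;have := fcl_lin (-1) zz (zt_lcup' zy zy).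
 have z0: zt G2 2 (fun=> 0 : k) by move=> w _ _;apply: dt0.
 have -> : fcl G2 2 (lcup 1 (ygen k c) (ygen k c)) = fcl G2 2 (fun w => -1 * zgen k p c w + 0).
  apply: eq_fcl;first exact: (zt_lcup' zy zy).
  by move=> w Gw sz;rewrite (ygen_sq k (L := L) ord_c) //;ring.
 rewrite (fcl_lin (-1) zz z0) => _;rewrite [fcl _ _ (fun=> 0)](_ : _ = 0) ?addr0 //.
 by apply/fcl0P => //;exists (fun=> 0) => w _ _;rewrite dt0.
exists 0;rewrite scale0r;have := hcl_comm hcl_Yc hcl_Yc;rewrite muln1 expr1 scaleN1r => /eqP.
rewrite -subr_eq0 opprK -mulr2n -scaler_nat scaler_eq0 => /orP[|/eqP //].
by rewrite -(dvdn_pcharf char_k) dvdn_prime2 // (negbTE p2).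
Qed.
Lemma Zc_inj a : Zc * a = 0 -> a = 0.
move=> Za;apply: hpr_ext => n;rewrite hpr0.
have := congr1 (hpr (2 + n)) Za;rewrite hpr0 (hpr_mul _ _ hcl_Zc).
have [f zf ->] := hcl_fclP (hcl_hpr n a).
rewrite fclM // => /(fcl0P (zt_lcup' zz zf)) /(zgen_inj p_pr char_k pL ord_c zf) ?.
exact/fcl0P.
Qed.
Let sclP (gT' : finGroupType) (L' : {group gT'}) j n (x : 'H^*(L', k)) : exists2 s, zts L' j n s &
 hprs j n x = if (j <= n)%N then fcl L' (n - j) s else 0.
rewrite /hprs;case le : (j <= n)%N;last by exists (fun=> 0) => // w _ _;apply: dt0.
by have [f zf ->] := hcl_fclP (hcl_hpr (n - j) x);exists f => // w Lw sz;apply: zf => //;lia.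
Qed.
Let zts_zt (gT' : finGroupType) (L' : {group gT'}) j n (s : seq gT' -> k) :
 zts L' j n s -> (j <= n)%N -> zt L' (n - j) s.
by move=> zs le w Lw sz;apply: zs => //;lia. Qed.
Let zts_lcup (gT' : finGroupType) (L' : {group gT'}) m n (b s : seq gT' -> k) : zt L' m b -> zts L' m n s ->
 zt L' n (lcup m b s) /\ fcl L' n (lcup m b s) = fcl L' m b * (if (m <= n)%N then fcl L' (n - m) s else 0).
move=> zb zs;case: leqP => le.
 have zs' := zts_zt zs le;rewrite fclM //;have := zt_lcup' zb zs'.
 by rewrite subnKC.
have z: zt L' n (lcup m b s).
 move=> w Lw sz;rewrite (@eq_dt _ _ L' _ (fun=> 0)) ?dt0 // => u _ szu;rewrite /lcup.
 by case: leqP => // ?;exfalso;lia.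
split=> //;rewrite mulr0;apply/fcl0P => //;exists (fun=> 0) => w _ sz.
by rewrite dt0 /lcup;case: leqP => // ?;exfalso;lia.
Qed.
Lemma cyl_indep r s a : Infl r + Yc * Infl s = Zc * a -> r = 0 /\ s = 0.
move=> E;suff key n : hpr n r = 0 /\ hprs 1 n s = 0.
 split;[apply: hpr_ext => n;rewrite hpr0;by have [] := key n|].
 by apply: (@hprs_ext _ _ 1) => n;have [_ ->] := key n;rewrite /hprs hpr0 if_same.
have := congr1 (hpr n) E;rewrite raddfD /= (hpr_mul_shift _ _ hcl_Yc) (hpr_mul_shift _ _ hcl_Zc) hpr_Infl.
have -> : hprs 1 n (Infl s) = Infl (hprs 1 n s).
 by rewrite /hprs;case: ifP => _;rewrite ?raddf0 ?hpr_Infl.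
have [r' zr ->] := hcl_fclP (hcl_hpr n r).
have [s' zs es] := sclP 1 n s;have [a' za ea] := sclP 2 n a;rewrite es ea.
have zsG := zts_infl (c := c) zs.
have -> : Infl (if (1 <= n)%N then fcl L (n - 1) s' else 0) = if (1 <= n)%N then fcl G2 (n - 1) (infl s') else 0.
 by case: ifP => le;rewrite ?raddf0 // Infl_fcl //;apply: zts_zt.
have [z1 <-] := zts_lcup zy zsG;have [z2 <-] := zts_lcup zz za.
rewrite Infl_fcl // => {}E.
have z0: zt G2 n (infl r') := (zts0 _ _ _).1 (zts_infl (c := c) ((zts0 _ _ _).2 zr)).
have z01 := zt_lin 1 z0 z1.
have : fcl G2 n (fun w => 1 * infl r' w + lcup 1 (ygen k c) (infl s') w) = fcl G2 n (lcup 2 (zgen k p c) a').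
 by rewrite fcl_lin // scale1r.
move/(fcl_eq z01 z2) => [h Hh].
have [|br bs] := cylinder_indep p_pr char_k pL ord_c zr zs za.
 by exists h => w Gw sz;rewrite -Hh // mul1r.
split;first exact/fcl0P.
case: ifP => // le;apply/(fcl0P (zts_zt zs le)).
by case: bs => h' Hh';exists h' => w Lw sz;apply: Hh' => //;lia.
Qed.
Lemma cyl_span n a : hcl n a -> exists r s a', [/\ a = Infl r + Yc * Infl s + Zc * a',
 hcl n r, (if (1 <= n)%N then hcl (n - 1) s else s = 0)
 & (if (2 <= n)%N then hcl (n - 2) a' else a' = 0)].
case/hcl_fclP => f zf ->.
have [r [s [a' [zr zs za [h Hh]]]]] := cylinder_span p_pr char_k pL ord_c zf.
exists (fcl L n r), (if (1 <= n)%N then fcl L (n - 1) s else 0), (if (2 <= n)%N then fcl G2 (n - 2) a' else 0).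
split;first last.
- by case le: (1 < n)%N => //;exact: (hcl_fcl (zts_zt za le)).
- by case le: (0 < n)%N => //;exact: (hcl_fcl (zts_zt zs le)).
- exact: hcl_fcl.
have -> : Infl (if (1 <= n)%N then fcl L (n - 1) s else 0) = if (1 <= n)%N then fcl G2 (n - 1) (infl s) else 0.
 by case: ifP => le;rewrite ?raddf0 // Infl_fcl //;apply: zts_zt.
have zsG := zts_infl (c := c) zs.
have [z1 <-] := zts_lcup zy zsG;have [z2 <-] := zts_lcup zz za.
have z0: zt G2 n (infl r) := (zts0 _ _ _).1 (zts_infl (c := c) ((zts0 _ _ _).2 zr)).
have z01 := zt_lin 1 z0 z1;have z012 := zt_lin 1 z01 z2.
rewrite Infl_fcl //.
transitivity (fcl G2 n (fun w => 1 * (1 * infl r w + lcup 1 (ygen k c) (infl s) w) + lcup 2 (zgen k p c) a' w)).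
 by apply/fcl_eq => //;exists h => w Gw sz;rewrite -Hh //;ring.
by rewrite !fcl_lin // !scale1r.
Qed.
Local Notation csum := (esum Infl Yc Zc).
Local Notation cbase := (ebase Yc Zc).

Lemma cyl_gen_hcl n a : hcl n a ->
 exists u, a = csum n.+1 u /\ forall i, (i <= n)%N -> hcl (n - i) (u i).
elim/ltn_ind: n a => n IH a /cyl_span [r [s [a' [-> hr hs ha]]]].
case: n IH hr hs ha => [|[|n]] IH hr hs ha.
- exists (fun=> r);rewrite hs ha raddf0 !mulr0 !addr0 /esum big_ord1 /ebase /= expr0 !mul1r.
 by split=> // -[].
- exists (fun i => if i is 0%N then r else s);rewrite ha mulr0 addr0 /esum !big_ord_recl big_ord0.
 rewrite /ebase /= expr0 !mul1r mulr1 addr0;split=> // -[|[|//]] //= _.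
have {}ha : hcl n a' by move: ha;rewrite /= !subSS subn0.
have {}hs : hcl n.+1 s by move: hs;rewrite /= !subSS subn0.
have [|u [-> hu]] := IH n _ _ ha;first by lia.
exists (fun i => if i is j.+2 then u j else if i is 0%N then r else s);split.
 by rewrite esumSS //;exact: Zc_central.
by case=> [|[|i]] //= le;rewrite ?subn0 //;apply: hu;lia.
Qed.
Lemma cyl_gen a : exists M u, a = csum M u.
have [M /(_ M (leqnn M)) ->] := hpr_sum a.
suff [M' [u [_ ->]]] : tailN Infl Yc Zc (fun=> True) 0 (\sum_(n < M) hpr n a) by exists M', u.
apply: tailN_sum => // i _;have [u [-> _]] := cyl_gen_hcl (hcl_hpr i a).
by exists i.+1, u.
Qed.
Lemma cyl_esum_eq0 M u : csum M u = 0 -> forall i, (i < M)%N -> u i = 0.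
by apply: esum_eq0;[exact: Zc_central|exact: Zc_inj|exact: cyl_indep]. Qed.
Lemma cyl_cancel (N : 'H^*(L, k) -> Prop) m (al : k) (a : nat -> 'H^*(L, k)) eps x : N 0 ->
 (forall x y, N x -> N y -> N (x + y)) -> (forall a x, N x -> N (a * x)) ->
 al != 0 -> ~~ odd m -> eps = al *: cbase m + csum m a ->
 tailN Infl Yc Zc N m (eps * x) -> tailN Infl Yc Zc N 0 x.
move=> N0 ND NM al0 em Ee;apply: monic_cancel N0 ND NM al0 em Ee _.
- exact: Zc_central.
- exact: Yc_comm.
- exact: Yc_sq.
- exact: Zc_inj.
- exact: cyl_indep.
- exact: cyl_gen.
Qed.
Lemma rest_ones (H : finGroupType) (f : seq H -> k) m :
 rest f 1%g (nseq m 1%g) = if odd m then 0 else f (nseq m 1%g).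
suff : rest f 1%g (nseq m 1%g) = if odd m then 0 else f (nseq m 1%g) by [].
elim: m f => //= m IH f;rewrite mulg1 (IH (fun u => f (1%g :: u))).
by case: (odd m);rewrite ?subr0 ?subrr.
Qed.
Lemma zt_triv (H : finGroupType) (f : seq H -> k) n : (0 < n)%N ->
 zt (1%G : {group H}) n f -> bt (1%G : {group H}) n f.
move=> n0 zf;have ones (w : seq H) : all [in (1%G : {group H})] w -> w = nseq (size w) 1%g.
 by elim: w => //= x w IH /andP[/set1P-> /IH <-].
have in1 m : all [in (1%G : {group H})] (nseq m (1%g : H)) by elim: m => //= m ->;rewrite group1.
have dt_ones (g : seq H -> k) m : dt g (nseq m.+1 (1%g : H)) = if odd m then g (nseq m 1%g) else 0.
 by rewrite /= rest_ones;case: (odd m);rewrite ?subr0 ?subrr.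
case on : (odd n).
 exists (fun=> 0) => w Hw sz;rewrite dt0 (ones w Hw) sz.
 by have := zf _ (in1 n.+1);rewrite size_nseq dt_ones on;apply.
exists (fun=> f (nseq n 1%g)) => w Hw sz;rewrite (ones w Hw) sz.
by case: n n0 on {zf sz} => // n _ on;rewrite dt_ones;move: on => /= /negbFE ->.
Qed.
Lemma cyl_sub1 : cylinder 1%G c \subset G2.
by apply/subsetP => -[g u];rewrite !inE /= => /andP[/eqP-> ->];rewrite group1. Qed.
(** In the expansion of eps, the coefficients of index below m have positive degree and die on 1 ×
    <c>. The coefficient of index m has degree 0, so it is a scalar, nonzero because the restriction
    is. *)
Lemma cyl_monic m eps : hcl m eps -> Res cyl_sub1 eps != 0 ->
 exists al a, al != 0 /\ eps = al *: cbase m + csum m a.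
case/cyl_gen_hcl => u [Ee hu];rewrite {1}Ee /esum raddf_sum big_ord_recr /=.
rewrite big1 => [|i _];last first.
 rewrite rmorphM /=;have [f zf ->] := hcl_fclP (hu i (ltnW (ltn_ord i))).
 rewrite Infl_fcl // fcl_Res;last exact: ((zts0 _ _ _).1 (zts_infl (c := c) ((zts0 _ _ _).2 zf))).
 have lt: (0 < m - i)%N by rewrite subn_gt0.
 have /(zt_triv lt)[h Hh] : zt (1%G : {group gT}) (m - i) f by apply: zt_sub zf;apply: sub1G.
 rewrite (_ : fcl _ _ _ = 0) ?mulr0 //;apply/fcl0P.
  exact: ((zts0 _ _ _).1 (zts_infl (c := c) ((zts0 _ _ _).2 (zt_sub (sub1G L) zf)))).
 exists (infl (hT := hT) h) => w Gw sz;rewrite dt_infl -Hh ?size_map //;exact: pr_in Gw.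
rewrite add0r => nz;have := hu m (leqnn m);rewrite subnn => /hcl_degree0[al Eal].
exists al, u;split;last by rewrite Ee /esum big_ord_recr /= Eal linearZ /= rmorph1 -scalerAr mulr1 addrC.
by apply: contraNneq nz => e;rewrite Eal e scale0r raddf0 mulr0 raddf0.
Qed.

End RingKunneth.

(** * Euler classes of free actions of a cyclic group *)

Section CyclicNonzero.
Variables (k : fieldType) (p : nat) (aT : finGroupType) (g0 : aT).
Hypotheses (p_pr : prime p) (char_k : p \in [pchar k]) (ord_g : #[g0]%g = p).
Let P := <[g0]>%G.

(** The powers of z are basis elements of H(1 × <g0>) over H(1), hence nonzero in every even
    degree. *)
Lemma cyclic_coh_infinite n0 : ~ (forall n (f : seq aT -> k), (n0 <= n)%N -> zt P n f -> bt P n f).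
have p1: (p.-group (1%G : {group aT}))%g by exact: pgroup1.
move=> h;have hz: hcl (2 * n0) (Zc k p (1%G : {group aT}) g0 ^+ n0) by apply/hclX/hcl_Zc.
have [f zf ef] := hcl_fclP hz.
have i2 (w : seq (aT * aT)) : all [in cylinder 1%G g0] w -> map (fun u => (1%g : aT, u)) (map snd w) = w.
 by elim: w => //= -[a b] w IH /andP[];rewrite !inE /= => /andP[/eqP-> _] /IH ->.
have M: {morph (fun u : aT => (1%g : aT, u)) : x y / (x * y)%g} by move=> x y;congr pair;rewrite mulg1.
have in1 (w : seq aT) : all [in P] w -> all [in cylinder 1%G g0] (map (fun u => (1%g : aT, u)) w).
 by move=> Pw;apply/allP => _ /mapP[u /(allP Pw) uP ->];rewrite !inE eqxx.
have [] := h (2 * n0)%N (fun w => f (map (fun u => (1%g, u)) w)) _ _;first by lia.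
 by move=> w Pw sz;rewrite -(dt_map M) zf ?size_map // in1.
move=> g Hg;have e0: fcl (cylinder 1%G g0) (2 * n0) f = 0.
 apply/fcl0P => //;exists (fun w => g (map snd w)) => w Gw sz.
 rewrite -(@dt_map k _ _ (snd : aT * aT -> aT)) // -Hg ?size_map ?i2 //.
 by apply/allP => z /mapP[[a b] abw ->];have := allP Gw _ abw;rewrite !inE /= => /andP[].
have := cyl_esum_eq0 p_pr char_k p1 ord_g (M := (2 * n0).+1) (u := fun i => if i == (2 * n0)%N then 1 else 0).
rewrite /esum big_ord_recr /= eqxx big1 => [|i _];last by rewrite (ltn_eqF (ltn_ord i)) raddf0 mulr0.
rewrite rmorph1 mulr1 add0r /ebase mul2n odd_double doubleK mul1r.
move=> /(_ _ (2 * n0)%N);rewrite mul2n eqxx ltnSn => H.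
have /eqP : (1 : 'H^*((1%G : {group aT}), k)) = 0 by apply: H => //;rewrite -e0 -ef.
by rewrite oner_eq0.
Qed.
Lemma noeth_trivial_group : noeth (top (Nil (nat * (seq aT -> k)))) (zt (k := k) (1%G : {group aT})) (bt (k := k) (1%G : {group aT})).
move=> N gN BN NZ;have [[u [Nu u0]]|no] := pselect (exists u, N 0%N u /\ u [::] != 0).
 exists [:: (0%N, u)];split=> [n v [[<- <-]|[]] //|[|n] v Nv];last first.
  by apply: gen_base;apply: zt_triv => //;apply: NZ.
 pose a := v [::] / u [::].
 have -> : v = (fun w => v w - a * u w) + a *: (u : seq aT -> k^o).
  by apply/funext => w;change (v w = v w - a * u w + a * u w);rewrite subrK.
 apply: gen_add;last by apply/gen_scale/gen_mem;left.
 by apply: gen_base;exists (fun=> 0) => -[|//] _ _ /=;rewrite /a divfK // subrr.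
exists [::];split=> // -[|n] v Nv;last by apply: gen_base;apply: zt_triv => //;apply: NZ.
apply: gen_base;exists (fun=> 0) => -[|//] _ _ /=.
by apply/eqP/negP => /negP v0;apply: no;exists v.
Qed.

Variables (Q : finType) (act : Q -> aT -> Q) (vld : pred Q) (dim : Q -> nat).
Variables (bd : (Q -> k) -> Q -> k) (qb : Q) (N : nat) (s : (Q -> k) -> k).
Hypothesis actM : forall q g h, act (act q g) h = act q (g * h)%g.
Hypothesis act1 : forall q, act q 1%g = q.
Hypothesis cpx : complex P act vld dim bd qb N s.

(** With trivial stabilisers, [noeth_multiples] makes H(<g0>) modulo the Euler class noetherian over
    no operators at all, that is, bounded in degree; were the Euler class zero, this would
    contradict [cyclic_coh_infinite]. *)
Lemma free_euler_nonzero W : (forall q, vld q -> (0 < dim q)%N -> stab act P q = 1%g) ->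
 zT P act vld dim bd 0 N W -> s (fun q => W q [::]) = 1 -> ~ bt P N (W qb).
move=> free zW sW bW.
have cA: cocycles P (Nil (nat * (seq aT -> k))) by move=> b [].
have nT := noeth_multiples actM act1 cpx cA zW sW.
have {nT}nT : noeth (top (Nil (nat * (seq aT -> k)))) (zt P) (multiples P N (W qb)).
 by apply: nT => q vq dq;rewrite free //;apply: noeth_trivial_group.
have zW0: zt P N (W qb) := bt_zt bW.
have [|n u mu|//|sg [_ gs]] := nT (zt P);first exact: gsub_zt.
 exact: (multiples_zt cpx zW0 mu).
have [n0 hn0] : exists n0, forall m u, List.In (m, u) sg -> (m < n0)%N.
 elim: (sg) => [|[m u] t [n0 IH]];first by exists 0%N.
 exists (maxn m.+1 n0) => m' u' [[<- _]|/IH];rewrite leq_max ?ltnSn // => ->;exact: orbT.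
apply: (@cyclic_coh_infinite n0) => n f le zf.
have gB m u : gen (top (Nil (nat * (seq aT -> k)))) (multiples P N (W qb)) sg m u -> (n0 <= m)%N ->
  multiples P N (W qb) m u.
 have [m0 mD mZ _] := gsub_multiples cpx N (W qb) cA.
 elim=> {m u} [m u //|m u /hn0 lt|m u v _ IHu _ IHv|m a u _ IH|o m u []].
 - by rewrite leqNgt lt.
 - by move=> le';apply: mD;auto.
 - by move=> le';apply: mZ;auto.
have [y [zy [h Hh]]] := gB n f (gs n f zf) le.
have [Nn|lt] := leqP N n;last first.
 exists h => w Pw sz;rewrite -Hh // /lcup;case: leqP;rewrite ?subr0 // sz => ?;exfalso;lia.
have zy' : zt P (n - N) y by move=> w Pw sz;apply: zy => //;lia.
have e0: fcl P n (lcup N (W qb) y) = 0.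
 by rewrite -[in fcl P n](subnKC Nn) -fclM // (proj2 (fcl0P zW0)) // mul0r.
have zl: zt P n (lcup N (W qb) y) by rewrite -(subnKC Nn);apply: zt_lcup'.
have [h' Hh'] := (proj1 (fcl0P zl)) e0.
by exists (fun w => h w + h' w) => w Pw sz;rewrite dtD -Hh // -Hh' // subrK.
Qed.
End CyclicNonzero.

(** * Euler classes of joins of polygons *)

Section PolyEuler.
Variables (k : fieldType) (gT : finGroupType) (X : finType) (act : X -> gT -> X).
Hypothesis actM : forall x g h, act (act x g) h = act x (g * h)%g.
Hypothesis act1 : forall x, act x 1%g = x.
Variables (c : X -> X -> k).
Hypothesis cN : forall x y, x != y -> c y x = - c x y.
Hypothesis cc : forall x y, c x y * c x y = 1.
Variables (L : {group gT}).
Hypothesis cL : forall g, g \in L -> forall x y, c (act x g) (act y g) = c x y.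
Implicit Types (Y : {set X}) (W F : {set X} * {set X} -> seq gT -> k).

Definition polyT gam Y n W := zT L (cact act) (vcell gam Y) (@cdim X) (bdry gam c) 0 n W.

Lemma vcell0 gam Y : vcell gam Y (set0, set0).
by apply/vcellP;split=> [||x|x y];rewrite ?sub0set ?inE. Qed.
Lemma polyT_zt gam Y n W : polyT gam Y n W -> zt L n (W (set0, set0)).
move=> [zW _] w Lw sz;rewrite -(zW (set0, set0) w);last first.
 by split;rewrite ?vcell0 // /cdim /= !cards0 addn0.
rewrite /DT /bdry /ann /lnk !big_set0 addr0 add0r /cdim /= !cards0 mul1r.
by case: w {Lw sz} => //= g w;rewrite /cact /= !imset0.
Qed.

                                                                           
                                                   
(** V0 spans an L-stable simplex of the join. W restricted to the faces of this simplex is extended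
    by zero to the join of the 1-gons on V0, that is, with gam the identity; all top cells of that
    join have edges, so the integral is zero and [zT_base] applies. *)
Lemma euler_vanish gam Y (V0 : {set X}) n W x0 : x0 \in V0 -> V0 \subset Y ->
 (forall x g, x \in V0 -> g \in L -> act x g \in V0) ->
 (forall x y, x \in V0 -> y \in V0 -> fconnect gam x y -> x = y) ->
 polyT gam Y n W -> bt L n (W (set0, set0)).
move=> x0V sV VL Vind [zW _].
pose F (q : {set X} * {set X}) w := if q.2 == set0 then W (q.1, set0) w else 0.
have cpx: complex L (cact act) (vcell id V0) (@cdim X) (bdry id c) (set0, set0) (2 * norb id V0) (tsum id V0).
 by apply: polygon_complex.
have zF: polyT id V0 n F.
 split=> // -[V E] w [/(vcellP id)[h1 h2 h3 h4] Lw];rewrite /cdim /= => sz;rewrite /DT.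
 have lnk0 f q : lnk id c f q = 0 by rewrite /lnk big1 // => x _;rewrite subrr.
 rewrite /bdry lnk0 addr0.
 have [E0|nE] := eqVneq E set0;last first.
  rewrite /ann big1 => [|x _];last by rewrite /F /= (negbTE nE) mulr0.
  rewrite add0r;case: w {Lw sz} => [|g w] /=;first by rewrite mulr0.
  have z q' u : q'.2 != set0 -> F q' u = 0 by rewrite /F => /negbTE ->.
  rewrite z ?imset_eq0 // (@rest_ext k gT _ (fun=> 0) _ _ (fun u => z (V, E) u nE)).
  by rewrite rest0 subrr mulr0.
 rewrite E0 in h2 h3 h4 sz *;rewrite -(zW (V, set0) w);last first.
  split=> //;apply/vcellP;split=> //;first exact: subset_trans h1 sV.
   exact: sub0set.
  by move=> x y;rewrite !setU0 => xV yV;apply: Vind;apply: (subsetP h1).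
 rewrite /DT /bdry /lnk big_set0 addr0 /ann /=;congr (_ + _ * _).
  by apply: eq_bigr => x _;rewrite /F /= eqxx.
 case: w {Lw sz} => //= g w;rewrite /F /cact /= imset0 eqxx;congr (_ - _).
have -> : W (set0, set0) = F (set0, set0) by rewrite /F /= eqxx.
apply: (zT_base (cactM actM) cpx zF).
exists (fun=> 0) => w _ _;rewrite dt0 /tsum big1 // => E /tcellP[_ _ /(_ x0 x0V)[y yE _]].
by rewrite /F /=;case: eqP => // E0;rewrite E0 inE in yE.
Qed.

Variable gam : X -> X.
Hypothesis gamI : injective gam.
Hypothesis gamL : forall g, g \in L -> forall x, gam (act x g) = act (gam x) g.
Local Notation PT := (polyT gam).

Lemma norb_rest0 Y x0 : gstable gam Y -> x0 \in Y -> norb gam Y = (norb gam (rest_orb gam Y x0)).+1.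
move=> gY x0Y;have gR: gstable gam (rest_orb gam Y x0) by apply: gstable_rest0.
have t0 := tcell_roots gamI gR;set E0 := [set x in _ | _] in t0.
have x0O: x0 \in orb0 gam Y x0 by rewrite (orb0E gY x0Y) connect0.
have := t0;rewrite (tcell_add gamI gY x0Y _ x0O) => /andP[nE tE].
by rewrite -(card_tcell gamI gY tE) cardsU1 nE -(card_tcell gamI gR t0).
Qed.
(** Integration over the edges of one polygon, which lowers the degree by 2. *)
Lemma polyT_fibre Y x0 n W : gstable gam Y -> x0 \in Y ->
 (forall x g, x \in orb0 gam Y x0 -> g \in L -> act x g \in orb0 gam Y x0) ->
 PT Y n.+2 W -> PT (rest_orb gam Y x0) n (fun q w => \sum_(x in orb0 gam Y x0) W (q.1, x |: q.2) w).
move=> gY x0Y OL [zW _];set O := orb0 gam Y x0.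
split=> // -[V E] w [v Lw sz];rewrite /DT.
transitivity (\sum_(x in O) DT (cact act) (@cdim X) (bdry gam c) W (V, x |: E) w);last first.
 rewrite big1 // => x xO;have [_ xE _ vx] := vcell_add gamI gY x0Y v xO.
 apply: zW;split=> //;move: sz;rewrite /cdim /= cardsU1 xE;lia.
rewrite /DT big_split /=;congr (_ + _).
 rewrite bdry_sum.
 transitivity (\sum_(x in O) (bdry gam c (fun q => W (q.1, x |: q.2) w) (V, E)
  + cre c (gam x) (fun q => W q w) (V, E) - cre c x (fun q => W q w) (V, E))).
  rewrite [RHS]sumrB [X in _ = X - _]big_split /= -addrA -[LHS]addr0;congr (_ + _);apply/esym/eqP;rewrite subr_eq0.
  rewrite [X in _ == X](reindex_inj gamI) /=;apply/eqP/eq_bigl => x.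
  by rewrite /O orb0_gam.
 apply: eq_bigr => x xO;have [_ xE _ _] := vcell_add gamI gY x0Y v xO.
 by rewrite [RHS]bdry_edge // addrA.
rewrite (eq_bigr (fun x => (-1) ^+ cdim (V, E) * dQ (cact act) W (V, x |: E) w));last first.
 move=> x xO;have [_ xE _ _] := vcell_add gamI gY x0Y v xO.
 by rewrite /cdim /= cardsU1 xE mulnDr addnCA exprD sqrrN expr1n mul1r.
rewrite -mulr_sumr;congr (_ * _);case: w Lw {sz} => [|g w] /=;first by rewrite big1.
move=> /andP[gL _];rewrite sumrB rest_sum;congr (_ - _).
have aI: injective (act^~ g) by apply: (can_inj (g := fun x => act x g^-1%g)) => z;rewrite actM mulgV act1.
rewrite (reindex_inj aI) /=;apply: eq_big => x.
 apply/idP/idP => [|xO];last exact: OL.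
 by move/(OL _ _)/(_ (groupVr gL));rewrite actM mulgV act1.
by rewrite /cact /= imsetU1.
Qed.
Lemma polyT_orbit Y (O : {set X}) n W : gstable gam Y -> O \subset Y -> PT Y n W ->
 pgon_cocycle act gam L O n (W (set0, set0)) (fun x => W ([set x], set0)) (fun x => W (set0, [set x])).
move=> gY sO zT0;have [zW _] := zT0;have hv x : x \in O -> vcell gam Y ([set x], set0) /\ vcell gam Y (set0, [set x]).
 move=> xO;split;apply/vcellP;split;rewrite ?sub0set ?sub1set ?(subsetP sO) // => a;rewrite ?inE //.
  by move=> b;rewrite !inE !orbF => /eqP-> /eqP->.
 by move=> b;rewrite !inE !orFb => /eqP-> /eqP->.
split=> [|x w xO Lw sz|x w xO Lw sz];first exact: polyT_zt zT0.
 have [v1 _] := hv x xO;have := zW ([set x], set0) w;rewrite /DT /bdry /ann /lnk /cdim /= cards0 cards1.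
 rewrite big_set1 big_set0 setDv big_set0 addr0 mul1r expr1 mulN1r => E.
 apply/eqP;rewrite -subr_eq0 -[X in _ == X]E;last by split=> //;rewrite /= ?cards0 ?cards1 sz addn1.
 by case: w {Lw sz E} => //= g w;rewrite /cact /= imset_set1 imset0.
have [_ v2] := hv x xO;have := zW (set0, [set x]) w;rewrite /DT /bdry /ann /lnk /cdim /= cards0 cards1.
rewrite big_set1 big_set0 setDv /cre /= !big_set0 !setU0 !mul1r add0r sqrrN expr1n mul1r => <-.
 by congr (_ + _);case: w {Lw sz} => //= g w;rewrite /cact /= imset_set1 imset0.
by split=> //;rewrite /= ?cards0 ?cards1;lia.
Qed.

Variables (p : nat) (n : gT -> nat).
Hypothesis p_gt0 : (0 < p)%N.
Hypothesis nP : forall g, g \in L -> (n g < p)%N.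
Hypothesis nM : forall g h, g \in L -> h \in L -> n (g * h)%g = ((n g + n h) %% p)%N.

(** Euler classes of joins multiply. [pgon_division_sum] for one polygon writes the class as pW0
    times the integral over the edges of that polygon, and this integral is the Euler class of the
    join of the others. All polygons carry the same rotation number n. *)
Lemma euler_power Y W : gstable gam Y -> (forall x, x \in Y -> fingraph.order gam x = p) ->
 (forall g x, g \in L -> x \in Y -> act x g = iter (n g) gam x) ->
 PT Y (2 * norb gam Y) W -> tsum gam Y (fun q => W q [::]) = 1 ->
 fcl L (2 * norb gam Y) (W (set0, set0)) = fcl L 2 (pW0 k p n) ^+ norb gam Y.
have [m] := ubnP #|Y|;elim: m Y W => // m IH Y W;rewrite ltnS => leY gY ordY actE zW sW.
have [Y0|[x0 x0Y]] := set_0Vmem Y.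
 have n0: norb gam Y = 0%N by rewrite /norb Y0;apply/eqP;rewrite cards_eq0 -subset0;apply/subsetP => x;rewrite !inE.
 rewrite n0 muln0 expr0 in zW *;have zt0 := polyT_zt zW.
 rewrite Y0 tsum0 in sW.
 have [a Ea] := hcl_degree0 (hcl_fcl zt0).
 have z1: zt L 0 (fun=> 1 : k) by case=> [|g [|]] //= _ _;rewrite subrr.
 have -> : fcl L 0 (W (set0, set0)) = fcl L 0 (fun=> 1 : k).
  by apply: eq_fcl => // -[|//] _ _.
 rewrite (fclE z1);congr coh_class;apply/val_inj/malgP => w;rewrite /= cmalE.
 rewrite mcoeff1;case: ifP => [/eqP/size0nil ->|/negP nw] //.
 by case: eqP => // e;case: nw;rewrite e.
set O := orb0 gam Y x0;set R := rest_orb gam Y x0.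
have gR: gstable gam R by apply: gstable_rest0.
have OY: O \subset Y by apply/subsetP => x;rewrite inE => /andP[].
have RY: {subset R <= Y} by move=> x;rewrite inE => /andP[].
have OE x : (x \in O) = fconnect gam x0 x by apply: orb0E.
have OL x g : x \in O -> g \in L -> act x g \in O.
 by move=> xO gL;rewrite actE ?(subsetP OY) // OE;apply: connect_trans (fconnect_iter _ _ _);rewrite -OE.
have nY := norb_rest0 gY x0Y;rewrite nY mulnS addnC addn2 in zW *.
have zF := polyT_fibre gY x0Y OL zW.
have sF: tsum gam R (fun q => \sum_(x in O) W (q.1, x |: q.2) [::]) = 1.
 rewrite -sW (tsum_split gamI gY x0Y) /tsum exchange_big /=;apply: eq_bigr => E _.
 by apply: eq_bigr.
have {}IH := IH R _ (leq_trans (card_rest0 gam x0Y) leY) gR (fun x xR => ordY x (RY x xR))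
 (fun g x gL xR => actE g x gL (RY x xR)) zF sF.
have cP := polyT_orbit gY OY zW.
have [za ba] := pgon_division_sum actM act1 gamI cN cc cL gamL OE (ordY x0 x0Y) p_gt0 nP nM
 (fun g x gL xO => actE g x gL (subsetP OY x xO)) cP.
have zW2: zt L 2 (pW0 k p n).
 by have [] := pW_cocycle k actM gamI OE (ordY x0 x0Y) p_gt0 nP nM (fun g x gL xO => actE g x gL (subsetP OY x xO)).
set a := (fun w => _) in za ba.
have za' : zt L (2 * norb gam R) a by move=> w Lw sz;apply: za => //;rewrite sz addn2.
have zl: zt L (2 * norb gam R).+2 (lcup 2 (pW0 k p n) a) by rewrite -[_.+2]/(2 + _)%N;apply: zt_lcup'.
have -> : fcl L (2 * norb gam R).+2 (W (set0, set0)) = fcl L (2 * norb gam R).+2 (lcup 2 (pW0 k p n) a).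
 by apply/(fcl_eq (polyT_zt zW) zl).
rewrite -[_.+2]/(2 + _)%N -fclM // exprS;congr (_ * _);rewrite -IH.
apply: eq_fcl => // w _ _;apply: eq_bigr => x _;by rewrite /= setU0.
Qed.

End PolyEuler.

Section Euler.
Variables (k : fieldType) (p : nat) (gT : finGroupType) (X : finType) (act : X -> gT -> X).
Hypothesis actM : forall x g h, act (act x g) h = act x (g * h)%g.
Hypothesis act1 : forall x, act x 1%g = x.
Variables (gam : X -> X) (Y : {set X}).
Hypotheses (p_pr : prime p) (char_k : p \in [pchar k]).
Hypotheses (gamI : injective gam) (gY : gstable gam Y).

Definition euler (L : {group gT}) c (W : {set X} * {set X} -> seq gT -> k) :=
 [/\ (forall x y, x != y -> c y x = - c x y), (forall x y, c x y * c x y = 1),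
 (forall g, g \in L -> forall x y, c (act x g) (act y g) = c x y),
 polyT act c L gam Y (2 * norb gam Y) W & tsum gam Y (fun q => W q [::]) = 1].

Lemma euler_exists (L : {group gT}) : (p.-group L)%g ->
 (forall g, g \in L -> forall x, gam (act x g) = act (gam x) g) ->
 (forall x g, x \in Y -> g \in L -> act x g \in Y) -> exists c W, euler L c W.
move=> pL gamL YL;have [c [cN cc cL]] := sign_exists actM act1 p_pr char_k pL.
have cpx := polygon_complex actM act1 gamI cN cc cL gamL gY YL.
have [W [zW sW]] := zT_exists (cactM actM) cpx.
by exists c, W.
Qed.
Lemma polyT_sub (L L' : {group gT}) (c : X -> X -> k) n W : L' \subset L ->
 polyT act c L gam Y n W -> polyT act c L' gam Y n W.
move=> /subsetP sL [zW W0];split=> // q w [vq L'w sz];apply: zW;split=> //.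
by apply/allP => x /(allP L'w)/sL.
Qed.
Lemma euler_sub (L L' : {group gT}) c W : L' \subset L -> euler L c W -> euler L' c W.
move=> sL [cN cc cL zW sW];split=> //;first by move=> g /(subsetP sL);apply: cL.
exact: polyT_sub zW.
Qed.
(** g0 turns each polygon by one step, so <g0> acts freely on the nonempty cells and
    [free_euler_nonzero] applies. *)
Lemma euler_nonzero (L : {group gT}) c W g0 : euler L c W -> g0 \in L -> #[g0]%g = p ->
 (forall g, g \in L -> forall x, gam (act x g) = act (gam x) g) ->
 (forall x, x \in Y -> act x g0 = gam x) -> (forall x, x \in Y -> fingraph.order gam x = p) ->
 ~ bt <[g0]>%G (2 * norb gam Y) (W (set0, set0)).
move=> eW gL og gamL actg ordY.
have sL: (<[g0]> \subset L)%g by rewrite cycle_subG.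
have actX i x : x \in Y -> act x (g0 ^+ i)%g = iter i gam x.
 move=> xY;elim: i => [|i IH] /=;first by rewrite expg0 act1.
 rewrite -IH expgSr -actM IH actg //.
 by rewrite -(gstable_connect gY (fconnect_iter gam i x)).
have YL x g : x \in Y -> g \in <[g0]>%g -> act x g \in Y.
 by move=> xY /cycleP[i ->];rewrite actX // -(gstable_connect gY (fconnect_iter gam i x)).
have [cN cc cL zW sW] := euler_sub (L' := <[g0]>%G) sL eW.
have gamL' g : g \in <[g0]>%g -> forall x, gam (act x g) = act (gam x) g.
 by move=> /(subsetP sL);apply: gamL.
have cpx := polygon_complex actM act1 gamI cN cc cL gamL' gY YL.
apply: (free_euler_nonzero p_pr char_k og (cactM actM) (cact1 act1) cpx _ zW sW) => -[V E] v dq.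
have [x xVE] : exists x, x \in V :|: E.
 have [VE0|[x xV]] := set_0Vmem (V :|: E);last by exists x.
 by move: dq;have /eqP := VE0;rewrite setU_eq0 /cdim /= => /andP[/eqP-> /eqP->];rewrite cards0.
have [h1 h2 h3 h4] := vcellP gam _ _ _ v.
have xY: x \in Y by case/setUP: xVE => [/(subsetP h1)|/(subsetP h2)].
apply/setP => s;apply/idP/set1P => [|->];last by rewrite inE group1 (cact1 act1) eqxx.
rewrite inE => /andP[/cycleP[i ->] /eqP].
rewrite /cact /= => -[eV eE].
have xi: iter i gam x \in V :|: E.
 by rewrite -actX // -eV -eE -imsetU;apply: imset_f.
have ix := h4 _ _ xVE xi (fconnect_iter _ _ _).
have := idx_iter gamI (ordY x xY) (prime_gt0 p_pr) i;rewrite -ix => e1.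
have := idx_iter gamI (ordY x xY) (prime_gt0 p_pr) 0;rewrite e1 mod0n => e2.
by apply/eqP;rewrite -order_dvdn og /dvdn e2.
Qed.

End Euler.

(** * Polygons of cosets under translation by a central element *)

Section Cosets.
Variables (p : nat) (gT : finGroupType) (H K : {group gT}) (e : gT).
Hypotheses (p_pr : prime p) (sKH : K \subset H) (eZ : e \in 'Z(H)%g) (ord_e : #[e]%g = p).
Hypothesis eK : e \notin K.
(** Left translation by e. It commutes with right translation, and for e central of order p outside
    K its orbits on the right cosets of K in H are p-gons. *)
Definition csh (A : {set gT}) : {set gT} := (e *: A)%g.
Local Notation Y := (rcosets K H).

Lemma cshI : injective csh. Proof. by move=> A B;rewrite /csh => /lcoset_inj. Qed.
Lemma csh_rcoset A g : csh (A :* g)%g = (csh A :* g)%g.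
by rewrite /csh -mulgA. Qed.
Lemma csh_coset h : h \in H -> csh (K :* h)%g = (K :* (e * h))%g.
move=> hH;rewrite csh_rcoset rcosetM;congr (_ * _)%g.
by rewrite /csh norm_rlcoset //;apply: (subsetP (cent_sub _));case/setIP: eZ => _ /centP eC;apply/centP => x /(subsetP sKH)/eC.
Qed.
Lemma iter_csh i A : iter i csh A = (e ^+ i *: A)%g.
by elim: i => [|i IH] /=;rewrite ?lcoset1 // IH /csh expgS lcosetM. Qed.
Lemma csh_gstable : gstable csh Y.
have eH: e \in H by case/setIP: eZ.
have up A : A \in Y -> csh A \in Y.
 by case/rcosetsP => h hH ->;rewrite csh_coset //;apply/rcosetsP;exists (e * h)%g;rewrite ?groupM.
move=> A;apply/idP/idP => [|/up //].
have iY n B : B \in Y -> iter n csh B \in Y by move=> BY;elim: n => //= n;apply: up.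
move/(iY p.-1);rewrite -iterSr iter_csh prednK ?prime_gt0 // -ord_e expg_order.
by rewrite lcoset1.
Qed.
Lemma rcosets_stable A g : A \in Y -> g \in H -> (A :* g)%g \in Y.
by case/rcosetsP => h hH -> gH;rewrite -rcosetM;apply/rcosetsP;exists (h * g)%g;rewrite ?groupM. Qed.
Lemma csh_order A : A \in Y -> fingraph.order csh A = p.
case/rcosetsP => h hH ->{A};rewrite -ord_e /order -(card_in_imset (f := fun u => (u *: (K :* h))%g) (D := <[e]>%g)).
 apply: eq_card => B;apply/idP/imsetP => [/iter_findex <-|[u /cycleP[i ->] ->]];last by rewrite -iter_csh;apply: fconnect_iter.
 by exists (e ^+ findex csh (K :* h)%g B)%g;rewrite ?mem_cycle ?iter_csh.
have TI: <[e]>%g :&: K = 1%g.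
 by apply: prime_TIg;rewrite ?cycle_subG // -?[#|_|]/#[e]%g ?ord_e.
move=> u v /cycleP[i ->] /cycleP[j ->];rewrite -!iter_csh.
have it n : iter n csh (K :* h)%g = (K :* (e ^+ n * h))%g.
 elim: n => [|n IH] /=;first by rewrite mul1g.
 by rewrite IH csh_coset ?groupM ?groupX //;[rewrite expgS mulgA|case/setIP: eZ].
rewrite !it => /rcoset_eqP;rewrite mem_rcoset invMg mulgA mulgK => eij.
have : (e ^+ i * (e ^+ j)^-1)%g \in <[e]>%g :&: K by rewrite inE eij groupM ?groupV ?mem_cycle.
by rewrite TI inE => /eqP/eqP;rewrite -eq_mulgV1 => /eqP.
Qed.
Lemma norb_csh : (norb csh Y * p = #|H : K|%g)%N.
transitivity (fcard csh Y * p)%N.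
- by congr (_ * _)%N;rewrite /norb;apply: eq_card => A;rewrite !inE andbC.
apply: (fcard_order_set cshI);first by apply/subsetP => A /csh_order oA;rewrite inE oA.
by move=> A B /eqP <-;rewrite csh_gstable.
Qed.

End Cosets.

Section GaugeD.
Variables (k : fieldType) (gT : finGroupType) (Q : Type) (act : Q -> gT -> Q).
Hypothesis actM : forall q g h, act (act q g) h = act q (g * h)%g.

Lemma dQ_gauge tau (F : Q -> seq gT -> k) q w : dQ act (gauge act tau F) q w = gauge act tau (dQ act F) q w.
have E1: gauge act tau F = fun q w => (dQ act (fun q => prism act tau (F q) q) q w + prism act tau (dQ act F q) q w) + F q w.
 by apply/funext => r;apply/funext => u;rewrite (prism_homotopy actM) subrK.
have dD (A B : Q -> seq gT -> k) r u : dQ act (fun q w => A q w + B q w) r u = dQ act A r u + dQ act B r u.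
 by have := dQ_lin act 1 A B r u;rewrite mul1r => <-;congr (dQ act _ r u);apply/funext => ?;apply/funext => ?;rewrite mul1r.
rewrite E1 !dD (dQK actM) add0r;have := prism_homotopy actM tau (dQ act F) q w.
have -> : dQ act (dQ act F) q = fun=> 0 by apply/funext => u;apply: dQK.
by rewrite prism0 addr0 => ->;rewrite subrK.
Qed.
End GaugeD.

Lemma dQ_sum_dt (k : fieldType) (gT : finGroupType) (X : finType) (act : X -> gT -> X) (L : {group gT})
  (O : {set X}) (F : X -> seq gT -> k) (w : seq gT) :
 (forall x g h, act (act x g) h = act x (g * h)%g) -> (forall x, act x 1%g = x) ->
 (forall x g, x \in O -> g \in L -> act x g \in O) -> all [in L] w ->
 \sum_(x in O) dQ act F x w = dt (fun w => \sum_(x in O) F x w) w.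
move=> actM act1 OL;case: w => [|g w] /=;first by rewrite big1.
move=> /andP[gL _];rewrite sumrB rest_sum;congr (_ - _).
have aI: injective (act^~ g) by apply: (can_inj (g := fun x => act x g^-1%g)) => z;rewrite actM mulgV act1.
rewrite [RHS](reindex_inj aI) /=;apply: eq_bigl => x.
apply/idP/idP => [xO|/(OL _ _)/(_ (groupVr gL))];first exact: OL.
by rewrite actM mulgV act1.
Qed.

Section MapIn.
Variables (k : fieldType) (aT rT : finGroupType) (A : {group aT}) (pi : aT -> rT).
Hypothesis piM : {in A &, {morph pi : x y / (x * y)%g}}.

Lemma rest_map_in (f : seq rT -> k) g (w : seq aT) : g \in A -> all [in A] w ->
 rest (fun u => f (map pi u)) g w = rest f (pi g) (map pi w).
elim: w f g => //= h w IH f g gA /andP[hA wA];rewrite piM //;congr (_ - _).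
by rewrite (IH (fun u => f (pi g :: u))).
Qed.
Lemma dt_map_in (f : seq rT -> k) (w : seq aT) : all [in A] w ->
 dt (fun u => f (map pi u)) w = dt f (map pi w).
by case: w => //= g w /andP[gA wA];rewrite rest_map_in. Qed.
Lemma zt_map_in (B : {group rT}) n f : (forall g, g \in A -> pi g \in B) ->
 zt B n f -> zt A n (fun w => f (map pi w) : k).
move=> AB zf w Aw sz;rewrite dt_map_in // zf ?size_map //.
by apply/allP => x /mapP[y /(allP Aw) yA ->];apply: AB.
Qed.
Lemma bt_map_in (B : {group rT}) n f : (forall g, g \in A -> pi g \in B) ->
 bt B n f -> bt A n (fun w => f (map pi w) : k).
move=> AB [h Hh];exists (fun w => h (map pi w)) => w Aw sz;rewrite dt_map_in // -Hh ?size_map //.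
by apply/allP => x /mapP[y /(allP Aw) yA ->];apply: AB.
Qed.
End MapIn.

(** * Transfer: sums over orbits, Mackey's formula, Frobenius reciprocity *)

Section OrbitSum.
Variables (k : fieldType) (p : nat) (gT : finGroupType) (E : {group gT}).
Hypotheses (p_pr : prime p) (char_k : p \in [pchar k]) (aE : (p.-abelem E)%g).
Implicit Types (O Y : {set {set gT}}) (F : {set gT} -> seq gT -> k).
Let act (A : {set gT}) g := (A :* g)%g.
Let actM A g h : act (act A g) h = act A (g * h)%g. Proof. by rewrite /act rcosetM. Qed.
Let act1 A : act A 1%g = A. Proof. exact: rcoset1. Qed.
Let cEE : abelian E. Proof. exact: abelem_abelian aE. Qed.
(** A transfer from the stabiliser S of A, a proper subgroup of E. As S is a direct factor of E, the
    cocycle F A extends to E through the projection pi; by Shapiro's lemma F is cohomologous to the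
    constant family with this value, whose sum has the factor #|O|, a positive power of p. *)
Lemma orbit_sum_bt A n F : zQ act E (fun B => B \in [set act A g | g in E]) 0 n F ->
 (exists2 g, g \in E & act A g != A) ->
 bt E n (fun w => \sum_(B in [set act A g | g in E]) F B w).
set O := [set act A g | g in E] => zF [g0 g0E ng0].
pose S := stab_group (Q := {set gT}) E actM act1 A.
have sSE: S \subset E by apply/subsetP => g;rewrite inE => /andP[].
have AO: A \in O by apply/imsetP;exists 1%g;rewrite ?act1.
have OE x g : x \in O -> g \in E -> act x g \in O.
 by case/imsetP => h hE -> gE;rewrite actM;apply: imset_f;rewrite groupM.
have fixA g : g \in S -> act A g = A by rewrite inE => /andP[_ /eqP].
have pO: p%:R = 0 :> k by apply: pcharf0.
have cO: #|O|%:R = 0 :> k.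
 have -> : #|O| = #|E : S|%g.
  have -> : O = orbit 'Rs%act E A by apply: eq_imset => g;rewrite /= rcosetE.
  rewrite card_orbit;congr #|_ : _|%g;apply/setP => g;rewrite !inE;congr (_ && _).
  by rewrite /= sub1set inE rcosetE.
 have [|[|j] e] := @p_natP p #|E : S|%g;first by apply: pnat_dvd (dvdn_indexg _ _) _;exact: abelem_pgroup aE.
  move: e => /eqP;rewrite indexg_eq1 => /subsetP/(_ _ g0E)/fixA e.
  by rewrite e eqxx in ng0.
 by rewrite e natrX pO expr0n.
have [S' cS'] : exists S' : {group gT}, S' \in [complements to S in E]%g.
 by have /splitsP := abelem_splits aE sSE;case=> S' ?;exists S'.
have cS: (S : {group gT}) \in [complements to S' in E]%g by rewrite complgC.
have nS' : (S' <| E)%g.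
 by rewrite -sub_abelian_normal //;case/complP: cS => _ <-;apply: mulG_subl.
pose pi := remgr S' S.
have piM: {in E &, {morph pi : x y / (x * y)%g}} by apply: (remgrM cS nS').
have piS g : g \in E -> pi g \in S.
 by move=> gE;apply: (mem_remgr (K := S') (B := S));case/complP: cS => _ ->.
have pi_id g : g \in S -> pi g = g by move=> gS;apply: remgr_id => //;case/complP: cS.
have dA w : all [in S] w -> dQ act F A w = dt (F A) w.
 by case: w => //= g w /andP[/fixA-> _].
have zA: zt S n (F A).
 move=> w Sw sz;rewrite -dA //;apply: zF => //;last by rewrite addn0.
 by apply/allP => x /(allP Sw)/(subsetP sSE).
have zAp: zt E n (fun w => F A (map pi w)) by apply: zt_map_in zA.
pose F' B w := F B w - F A (map pi w).
have zF' : zQ act E (fun B => B \in O) 0 n F'.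
 move=> B w BO Ew sz;rewrite /F' (@dQB k) zF // sub0r;apply/eqP;rewrite oppr_eq0;apply/eqP.
 by rewrite -[RHS](zAp w Ew);[case: (w)|rewrite -sz addn0].
have [|H HP] := shapiro_inj actM act1 OE zF'.
 move=> B /imsetP[s sE eB].
 have [|H HP] := zQ_gauge (tau := fun=> s) actM OE _ zF;first by [].
 have stB: {subset stab act E B <= S}.
  move=> g;rewrite !inE eB => /andP[gE /eqP e];rewrite gE /=.
  move: e;rewrite !actM (centsP cEE s sE g gE) -actM => /(congr1 (act^~ s^-1%g)).
  by rewrite !actM mulgV mulg1 act1 => ->.
 exists (fun w => - 1 * H A w) => w Bw sz;rewrite dtZ /F'.
 have Sw: all [in S] w by apply/allP => x /(allP Bw)/stB.
 have Ew: all [in E] w by apply/allP => x /(allP Sw)/(subsetP sSE).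
 have -> : map pi w = w by rewrite -[RHS]map_id;apply/eq_in_map => x /(allP Sw)/pi_id.
 have gw (u : seq gT) : all [in E] u -> forall C, gauge_word act (fun=> s) C u = u.
  elim: u => //= x u IH /andP[xE uE] C;rewrite IH //;congr (_ :: _).
  by rewrite -mulgA (centsP cEE x xE s sE) mulKg.
 have := HP A w AO Ew sz;rewrite /gauge gw // -eB => e.
 have -> : dt (H A) w = dQ act H A w by case: (w) Sw => //= g v /andP[/fixA-> _].
 by rewrite -e mulN1r opprB.
exists (fun w => \sum_(B in O) H B w) => w Ew sz.
rewrite -(dQ_sum_dt H actM act1 OE Ew).
rewrite -(eq_bigr _ (fun B BO => HP B w BO Ew _)) ?addn0 //.
by rewrite /F' sumrB sumr_const -mulr_natl cO mul0r subr0.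
Qed.
(** The orbits without fixed points are removed one by one by [orbit_sum_bt]. *)
Lemma fixed_sum_bt Y n F : (forall A g, A \in Y -> g \in E -> act A g \in Y) ->
 zQ act E (fun B => B \in Y) 0 n F ->
 bt E n (fun w => \sum_(B in Y) F B w
  - \sum_(B in Y | [forall g in E, (B :* g)%g == B]) F B w).
move=> YE zF;pose fx (B : {set gT}) := [forall g in E, (B :* g)%g == B].
have fxE B g : g \in E -> fx (act B g) = fx B.
 move=> gE;have up C h : h \in E -> fx C -> fx (act C h).
  move=> hE /forall_inP fC;apply/forall_inP => u uE;rewrite -/(act _ u) actM.
  by rewrite /act (eqP (fC _ (groupM hE uE))) (eqP (fC _ hE)).
 apply/idP/idP;last exact: up.
 by move/(up _ _ (groupVr gE));rewrite actM mulgV act1.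
pose Z := [set B in Y | ~~ fx B].
suff : bt E n (fun w => \sum_(B in Z) F B w).
 case=> h Hh;exists h => w Ew sz;rewrite -Hh //.
 rewrite [X in X - _](bigID fx) /= [X in X - _]addrC addrK.
 by apply: eq_bigl => B;rewrite inE.
have ZE A g : A \in Z -> g \in E -> act A g \in Z by rewrite !inE => /andP[AY nA] gE;rewrite YE // fxE.
have ZY: {subset Z <= Y} by move=> B;rewrite inE => /andP[].
have nfx B : B \in Z -> ~~ fx B by rewrite inE => /andP[].
clearbody Z;have [m] := ubnP #|Z|;elim: m Z ZE ZY nfx => // m IH Z ZE ZY nfx;rewrite ltnS => leZ.
have [Z0|[A AZ]] := set_0Vmem Z;first by exists (fun=> 0) => w _ _;rewrite dt0 Z0 big_set0.
pose O := [set act A g | g in E].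
have AO: A \in O by apply/imsetP;exists 1%g;rewrite ?act1.
have OZ: O \subset Z by apply/subsetP => _ /imsetP[g gE ->];apply: ZE.
have [||h1 H1] := @orbit_sum_bt A n F;first by move=> B w BO;apply: zF;apply: ZY;apply: (subsetP OZ).
 by have /forall_inPn[g gE ng] := nfx A AZ;exists g.
have [||||h2 H2] := IH (Z :\: O).
- move=> B g;rewrite !inE => /andP[nB BZ] gE;rewrite ZE // andbT;apply: contra nB.
 by case/imsetP => u uE e;apply/imsetP;exists (u * g^-1)%g;rewrite ?groupM ?groupV // -actM -e actM mulgV act1.
- by move=> B;rewrite inE => /andP[_ /ZY].
- by move=> B;rewrite inE => /andP[_ /nfx].
- apply: leq_trans leZ;apply: proper_card;apply/properP;split;first exact: subsetDl.
 by exists A => //;rewrite inE AO.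
exists (fun w => h1 w + h2 w) => w Ew sz;rewrite dtD -H1 // -H2 //.
rewrite (big_setID O) /=;congr (_ + _);apply: eq_bigl => B.
by rewrite (setIidPr OZ).
Qed.
End OrbitSum.

Section Transfer.
Variables (k : fieldType) (gT : finGroupType) (H G : {group gT}).
Hypothesis sHG : H \subset G.
Let act (A : {set gT}) g := (A :* g)%g.
Let actM A g h : act (act A g) h = act A (g * h)%g. Proof. by rewrite /act rcosetM. Qed.
Let act1 A : act A 1%g = A. Proof. exact: rcoset1. Qed.
Local Notation Y := (rcosets H G).
Let tau (A : {set gT}) := (fingroup.repr A)^-1%g.
Let D A := A \in Y : Prop.

(** The summand of the transfer at the coset A: translating A back to H by the inverse of its
    representative turns words in G into words in H. Hence [trf] is the transfer from H to G. *)
Definition trc (a : seq gT -> k) A w := a (gauge_word act tau A w).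
Definition trf a w := \sum_(A in Y) trc a A w.

Let YG A g : A \in Y -> g \in G -> act A g \in Y.
exact: rcosets_stable. Qed.
Lemma rcoset_rep A : A \in Y -> A = (H :* fingroup.repr A)%g /\ fingroup.repr A \in G.
case/rcosetsP => h hG ->;rewrite rcoset_repr;split=> //.
case/rcosetP: (mem_repr_rcoset H h) => x xH ->;rewrite groupM // (subsetP sHG) //.
Qed.
Let gwH A w : A \in Y -> all [in G] w -> all [in H] (gauge_word act tau A w).
elim: w A => //= g w IH A AY /andP[gG wG];rewrite IH ?YG // andbT.
have [eA rG] := rcoset_rep AY;have [eAg _] := rcoset_rep (YG AY gG).
rewrite /tau invgK -mem_rcoset;have : (fingroup.repr A * g)%g \in act A g.
 by rewrite /act {2}eA -rcosetM rcoset_refl.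
by rewrite {1}eAg.
Qed.
Lemma trc_zQ n a : zt H n a -> zQ act G D 0 n (trc a).
move=> za A w DA Gw sz;have -> : trc a = gauge act tau (fun=> a) by [].
rewrite dQ_gauge // /gauge;have -> : dQ act (fun=> a) (act A (tau A)) (gauge_word act tau A w) = dt a (gauge_word act tau A w).
 by case: (gauge_word _ _ _ _).
by apply: za;rewrite ?gwH // size_gauge_word -sz addn0.
Qed.
Lemma trf_zt n a : zt H n a -> zt G n (trf a).
move=> za w Gw sz;rewrite /trf -(dQ_sum_dt (trc a) actM act1 YG Gw) big1 // => A AY.
by apply: (trc_zQ za AY Gw);rewrite addn0.
Qed.
(** Frobenius reciprocity. The stabilisers on the cosets of H are the conjugates of H, so the
    constant family x is the coboundary of some B there; the product is then, up to sign, the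
    coboundary of the sum of the trc a cup B. *)
Lemma trf_mul_bt n m a x : zt H n a -> zt G m x ->
 (forall r, r \in G -> bt (H :^ r)%G m x) -> bt G (n + m) (lcup n (trf a) x).
move=> za zx bx;have zX: zQ act G D 0 m (fun=> x).
 by move=> A w _ Gw sz;rewrite -[RHS](zx w Gw) -?sz ?addn0 //;case: (w).
have [|B HB] := shapiro_inj actM act1 YG zX.
 move=> A /rcosetsP[r rG eA];have [h Hh] := bx r rG;exists h => w Sw sz;apply: Hh;last by rewrite -sz addn0.
 apply/allP => g /(allP Sw);rewrite inE eA => /andP[gG /eqP].
 by rewrite /act -rcosetM => /rcoset_eqP;rewrite mem_rcoset mem_conjg conjgE invgK mulgA.
case: m zx bx zX HB => [|m] zx bx zX HB.
 exists (fun=> 0) => w Gw sz;rewrite addn0 in sz;rewrite dt0 /lcup -sz leqnn drop_size.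
 rewrite (HB (H : {set gT}) [::]) ?mulr0 //;rewrite ?addn0 //.
 by apply/rcosetsP;exists 1%g;rewrite ?rcoset1.
exists (fun w => (-1) ^+ n * \sum_(A in Y) rcup act m B (trc a) A w) => w Gw sz.
rewrite dtZ -(dQ_sum_dt _ actM act1 YG Gw) mulr_sumr /lcup sz leq_addr /trf mulr_suml.
apply: eq_bigr => A AY;rewrite dQ_rcup //;last by rewrite sz;lia.
have -> : (size w - m.+1 = n)%N by rewrite sz addnK.
have sz1: (m <= size w)%N by rewrite sz;lia.
rewrite /rcup sz1 ccupE ?leq_subr // (trc_zQ za AY) ?mul0r ?add0r;last first.
- by rewrite size_takel ?leq_subr // sz addn0;lia.
- by apply/allP => y /mem_take;apply: (allP Gw).
rewrite mulrA -exprD addnn -signr_odd odd_double mul1r ccupE;last by rewrite sz leq_addr.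
have [Gt Gd] : all [in G] (take n w) /\ all [in G] (drop n w).
 by split;apply/allP => y;[move/mem_take|move/mem_drop];apply: (allP Gw).
congr (_ * _);apply: HB => //;last by rewrite size_drop sz addKn addn0.
elim: (take n w) A AY Gt => //= g u IH A AY /andP[gG uG];apply: IH => //;exact: YG.
Qed.
Lemma trc_fixed a A w : (forall g, g \in w -> (A :* g)%g = A) ->
 trc a A w = a (map (conjg^~ (fingroup.repr A)^-1%g) w).
move=> fA;rewrite /trc;congr a;elim: w fA => //= g w IH fA.
have e: act A g = A by apply: fA;rewrite inE eqxx.
by rewrite e /tau invgK conjgE invgK -mulgA IH // => h hw;apply: fA;rewrite inE hw orbT.
Qed.
End Transfer.

Lemma multiplesP (k : fieldType) (gT : finGroupType) (L : {group gT}) m e n x : zt (k := k) L m e ->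
 multiples L m e n x <-> zt L n x /\ exists y, fcl L n x = fcl L m e * y.
move=> ze;split=> [mx|[zx [y Hy]]].
 case: mx => y [zy [h Hh]];have [le|lt] := leqP m n;last first.
  have bx: bt L n x by exists h => w Lw sz;rewrite -Hh // /lcup sz leqNgt lt subr0.
  by split;[exact: bt_zt|exists 0;rewrite mulr0;apply/fcl0P => //;exact: bt_zt].
 have zx: zt L n x.
  have -> : x = fun w => 1 * (x w - lcup m e y w) + lcup m e y w by apply/funext => w;rewrite mul1r subrK.
  apply: zt_lin;first by apply: bt_zt;exists h.
  by rewrite -(subnKC le);apply: zt_lcup' => // w Lw sz;apply: zy => //;rewrite sz;lia.
 split=> //.
  have zy' : zt L (n - m) y by move=> w Lw sz;apply: zy => //;rewrite sz;lia.
  have zl: zt L n (lcup m e y) by rewrite -(subnKC le);apply: zt_lcup'.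
  have eM := fclM ze zy';rewrite subnKC // in eM.
  exists (fcl L (n - m) y);rewrite eM;apply: (proj2 (fcl_eq zx zl));exists h;exact: Hh.
have e1 := hpr_mul_shift n y (hcl_fcl ze);rewrite -Hy (hcl_fcl zx) /hprs in e1.
move: e1;case: leqP => [le|lt].
 have [f zf ->] := hcl_fclP (hcl_hpr (n - m) y).
 have zl: zt L n (lcup m e f) by rewrite -(subnKC le);apply: zt_lcup'.
 have eM := fclM ze zf;rewrite subnKC // in eM;rewrite eM => /(fcl_eq zx zl) e1.
 by exists f;split;first by move=> w Lw sz;apply: zf => //;lia.
rewrite mulr0 => /(fcl0P zx)[h Hh];exists (fun=> 0);split;first by move=> w _ _;rewrite dt0.
by exists h => w Lw sz;rewrite -Hh // /lcup sz leqNgt lt subr0.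
Qed.

Section InflOps.
Variables (k : fieldType) (gT hT : finGroupType).
Implicit Types (A : seq (nat * (seq gT -> k))).

Definition inflA A := [seq (b.1, infl (hT := hT) b.2) | b <- A].

Lemma infl_tcup e b f w : infl (hT := hT) (tcup e b f) w = tcup e (infl b : seq (gT * hT) -> k) (infl f) w.
by rewrite /infl /tcup size_map map_take map_drop. Qed.
Lemma in_inflA A o : List.In o (inflA A) <-> exists2 b, List.In b A & o = (b.1, infl b.2).
rewrite /inflA;elim: A => [|b A IH] /=;first by split=> // -[].
split=> [[<-|/IH[b' bA ->]]|[b' [<-|bA] eo]];[by exists b;[left|]|by exists b';[right|]|by left|].
by right;apply: (proj2 IH);exists b'.
Qed.
Lemma infl_match A : ops_match (U1 := seq gT -> k^o) (U2 := seq (gT * hT) -> k^o) (@infl k gT hT) (top A) (top (inflA A)).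
have topP (aT : finGroupType) (B : seq (nat * (seq aT -> k))) b : List.In b B -> List.In (b.1, tcup b.1 b.2) (top B).
 by elim: B => //= b' B IH [->|/IH];[left|right].
split=> o /in_top[b bA ->].
 exists (b.1, tcup b.1 (infl b.2));first by apply: (topP _ _ (b.1, infl b.2));apply/in_inflA;exists b.
 by split=> // u;apply/funext => w;apply: infl_tcup.
have /in_inflA[b' bA' eb] := bA;exists (b'.1, tcup b'.1 b'.2);first exact: topP.
by rewrite eb /=;split=> // u;apply/funext => w;apply: infl_tcup.
Qed.
(** S is the graph of a homomorphism defined on S', so the first projection identifies the
    cohomology of S with that of S', operators included. *)
Lemma noeth_graph A (S : {group gT * hT}) (S' : {group gT}) : fst @: S = S' -> {in S &, injective fst} ->
 cocycles S' A -> noeth (top A) (zt S') (bt S') -> noeth (top (inflA A)) (zt S) (bt S).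
move=> fS inj cA nS';pose sg g : gT * hT := odflt 1%g [pick x in S | x.1 == g].
have sgP g : g \in S' -> sg g \in S /\ (sg g).1 = g.
 rewrite -fS => /imsetP[x xS ->];rewrite /sg;case: pickP => [y /andP[yS /eqP]//|/(_ x)].
 by rewrite xS eqxx.
have sgK x : x \in S -> sg x.1 = x.
 by move=> xS;have [s1 s2] : sg x.1 \in S /\ (sg x.1).1 = x.1;[apply: sgP;rewrite -fS imset_f|apply: inj].
have S'f x : x \in S -> x.1 \in S' by move=> xS;rewrite -fS imset_f.
have sgM: {in S' &, {morph sg : x y / (x * y)%g}}.
 move=> x y xS yS;have [sx ex] := sgP x xS;have [sy ey] := sgP y yS;have [sxy exy] := sgP _ (groupM xS yS).
 by apply: inj;rewrite ?groupM // exy -[in LHS]ex -[in LHS]ey.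
have fM: {in S &, {morph fst : x y / (x * y)%g}} by [].
have cA' : cocycles S (inflA A).
 by move=> o /in_inflA[b bA ->];apply: zt_map_in (cA _ bA).
apply: (@noeth_surj k (seq gT -> k^o) (seq (gT * hT) -> k^o) (@infl k gT hT) _ _ _ _ _ _ _ _ 0%N _ _ _ _ _ nS') => //.
- exact: infl_match.
- exact: gsub_zt.
- exact: bt_zt.
- by move=> n u zu;rewrite addn0;apply: zt_map_in zu.
- by move=> n u zu;rewrite addn0;apply: bt_map_in zu.
move=> n v zv;right;exists n, (fun w => v (map sg w));split;rewrite ?addn0 //.
 by apply: zt_map_in zv => // g /sgP[].
exists (fun=> 0) => w Sw sz;rewrite dt0.
change (v w - v (map sg (map fst w)) = 0);rewrite -map_comp (_ : map _ w = w) ?subrr //.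
by rewrite -[RHS]map_id;apply/eq_in_map => x /(allP Sw)/sgK.
Qed.
End InflOps.

(** * The inductive step for subgroups that are not elementary abelian *)

Section NonAbelem.
Variables (k : fieldType) (p : nat) (gT : finGroupType) (L C K : {group gT}) (z : gT).
Hypotheses (p_pr : prime p) (char_k : p \in [pchar k]) (pL : (p.-group L)%g).
Hypotheses (CZ : C \subset 'Z(L)%g) (zZ : z \in 'Z(L)%g) (zPhi : z \in 'Phi(L)%g) (oz : #[z]%g = p).
Hypotheses (sKL : K \subset L) (zK : z \notin K) (CK : forall c, c \in C -> exists i, (c * z ^+ i)%g \in K :&: 'Z(L)%g).
Variable A : seq (nat * (seq gT -> k)).
Hypothesis cA : cocycles L A.
Hypothesis IH : forall S' : {group gT}, C \subset S' -> S' \proper L -> noeth (top A) (zt S') (bt S').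
(** L × <z> acts on subsets by left and right translation. On cosets of K the diagonal element (z,
    z) acts trivially, and (1, z) is one step of the polygons. *)
Let act (B : {set gT}) (g : gT * gT) := (g.2^-1 *: (B :* g.1))%g.
Let actM B g h : act (act B g) h = act B (g * h)%g.
by rewrite /act /= invMg lcosetM rcosetM !mulgA. Qed.
Let act1 B : act B 1%g = B. Proof. by rewrite /act /= invg1 lcoset1 rcoset1. Qed.
Local Notation Ga := (cylinder L z).
Local Notation gam := (csh z^-1%g).
Local Notation Y := (rcosets K L).
Let zL : z \in L. Proof. by case/setIP: zZ. Qed.
Let z'Z : (z^-1)%g \in 'Z(L)%g. Proof. by rewrite groupV. Qed.
Let oz' : #[z^-1]%g = p. Proof. by rewrite orderV. Qed.
Let z'K : (z^-1)%g \notin K. Proof. by rewrite groupV. Qed.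
Let GaP g : g \in Ga -> g.1 \in L /\ exists i, g.2 = (z ^+ i)%g.
by rewrite inE => /andP[gL /cycleP]. Qed.
Let gamL g : g \in Ga -> forall B, gam (act B g) = act (gam B) g.
move=> /GaP[_ [i e]] B;rewrite /act /csh e -!lcosetM -mulgA -!lcosetM;congr (_ *: _)%g.
by rewrite -expVgn -expgS -expgSr.
Qed.
Let actY g h : g \in Ga -> h \in L -> act (K :* h)%g g = (K :* (g.2^-1 * h * g.1))%g.
move=> /GaP[gL [i e]] hL;rewrite /act -rcosetM e -expVgn -iter_csh.
have -> : (K :* ((z^-1) ^+ i * h * g.1))%g = (K :* ((z^-1) ^+ i * (h * g.1)))%g by rewrite !mulgA.
elim: i {e} => [|i IHi] /=;first by rewrite mul1g.
by rewrite IHi (csh_coset sKL z'Z) // ?groupM ?groupX ?groupV // expgS !mulgA.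
Qed.
Let YG B g : B \in Y -> g \in Ga -> act B g \in Y.
case/rcosetsP => h hL -> gG;rewrite actY //;have [gL [i ->]] := GaP gG.
by apply/rcosetsP;exists (z ^- i * h * g.1)%g;rewrite ?groupM ?groupV ?groupX.
Qed.
(** No nontrivial (1, u) fixes a nonempty cell, so the stabiliser S is a graph over its first
    projection S'. This S' contains C and is a proper subgroup of L, so the induction hypothesis
    applies. *)
Let stab_noeth (q : {set {set gT}} * {set {set gT}}) : vcell gam Y q -> (0 < cdim q)%N ->
 noeth (top (inflA gT A)) (zt (stab (cact act) Ga q)) (bt (stab (cact act) Ga q)).
case: q => V E v dq;set q := (V, E).
pose S := stab_group Ga (cactM actM) (cact1 act1) q.
rewrite -[stab _ _ _]/(S : {set _}).
have [h1 h2 h3 h4] := vcellP gam _ _ _ v.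
have VEY: V :|: E \subset Y by rewrite subUset h1.
have SGa: {subset S <= Ga} by move=> g;rewrite inE => /andP[].
have fixS g : g \in Ga -> (forall B, B \in Y -> act B g = B) -> g \in S.
 move=> gG fB;rewrite inE gG /= /cact /=;apply/eqP;congr pair.
  by rewrite -[RHS]imset_id;apply: eq_in_imset => B /(subsetP h1)/fB.
 by rewrite -[RHS]imset_id;apply: eq_in_imset => B /(subsetP h2)/fB.
have free u : (1%g, u) \in S -> u = 1%g.
 move=> uS;have [_ [i /= eu]] := GaP (SGa _ uS).
 have [B BVE] : exists x, x \in V :|: E.
  have [VE0|[x xV]] := set_0Vmem (V :|: E);last by exists x.
  by move: dq;have /eqP := VE0;rewrite setU_eq0 /cdim /= => /andP[/eqP-> /eqP->];rewrite cards0.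
 have aB: act B (1%g, u) = iter i gam B by rewrite /act /= rcoset1 eu iter_csh expVgn.
 have xi: iter i gam B \in V :|: E.
  move: uS;rewrite inE => /andP[_ /eqP];rewrite /cact /= => -[eV eE].
  by rewrite -aB -eV -eE -imsetU;apply: imset_f.
 have ix := h4 _ _ BVE xi (fconnect_iter _ _ _).
 have oB := csh_order p_pr sKL z'Z oz' z'K (subsetP VEY _ BVE).
 have := idx_iter (@cshI _ _) oB (prime_gt0 p_pr) i;rewrite -ix => e1.
 have := idx_iter (@cshI _ _) oB (prime_gt0 p_pr) 0;rewrite e1 mod0n => e2.
 by rewrite eu;apply/eqP;rewrite -order_dvdn oz /dvdn e2.
have cent h c : h \in L -> c \in 'Z(L)%g -> (h * c = c * h)%g.
 by move=> hL /setIP[_ /centP cC];rewrite cC.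
have inj: {in S &, injective fst}.
 move=> [a u] [b u'] aS bS /= eab;rewrite -eab in bS *;congr pair.
 have : (1%g, (u * u'^-1)%g) \in S.
  have := groupM aS (groupVr bS);rewrite (_ : (_ * _)%g = (1%g, (u * u'^-1)%g)) //.
  by congr pair;rewrite /= mulgV.
 by move/free/eqP;rewrite -eq_mulgV1 => /eqP.
have S'E : fst @: S = (fst @* S)%G by rewrite /= morphimEsub ?subsetT.
have sS'L : (fst @* S \subset L)%g.
 by apply/subsetP => x;rewrite -[(fst @* S)%g]/((fst @* S)%G : {set _}) -S'E => /imsetP[g /SGa/GaP[gL _] ->].
apply: (noeth_graph S'E inj).
 by move=> b bA;apply: zt_sub sS'L _;apply: cA.
apply: IH.
 (* The pair (c, z^-i) sends K h to K c z^i h, which is K h by the choice of i. *)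
 apply/subsetP => c cC;have [i /setIP[ciK ciZ]] := CK cC;rewrite -S'E.
 have cL: c \in L by case/setIP: (subsetP CZ c cC).
 apply/imsetP;exists (c, (z ^- i)%g) => //;apply: fixS.
  by rewrite inE /= cL groupV mem_cycle.
 move=> B /rcosetsP[h hL ->];rewrite actY ?inE /= ?cL ?groupV ?mem_cycle //.
 rewrite invgK;apply: rcoset_eqP;rewrite mem_rcoset.
 have -> : (z ^+ i * h * c * h^-1 = c * z ^+ i)%g;last exact: ciK.
 have cZ := subsetP CZ c cC.
 rewrite -[(z ^+ i * h * c)%g]mulgA (cent h c hL cZ) !mulgA mulgK.
 by rewrite (cent _ _ (groupX i zL) cZ).
rewrite properEneq sS'L andbT;apply/eqP => eL.
have pS: (p.-group S)%g.
 by apply: pgroupS (cylinder_pgroup p_pr pL oz);apply/subsetP => g;apply: SGa.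
(* If S' = L, then z in Phi(L) is the first coordinate of an element of Phi(S). Its second
   coordinate lies in the Frattini subgroup of a subgroup of <z>, which is trivial. So S contains
   (z, 1) as well as (z, z), hence (1, z), against freeness. *)
have zPS: (z : gT) \in (fst @* 'Phi(S))%g.
 by rewrite (morphim_Phi _ pS) ?subsetT // eL.
case/morphimP: zPS => -[a u] _ auP /= ea;rewrite -ea in auP.
have uP1: u \in 'Phi(snd @* S)%g.
 by rewrite -(morphim_Phi _ pS) ?subsetT //;apply/morphimP;exists (z, u).
have snd1: 'Phi(snd @* S)%g = 1%g.
 have sz: (snd @* S \subset <[z]>)%g.
  by apply/subsetP => x /morphimP[g _ /SGa/GaP[_ [i e]] ->];rewrite /= e mem_cycle.
 have ab: (p.-abelem (snd @* S))%g by apply: abelemS sz _;rewrite prime_abelem // -[#|_|]/#[z]%g oz.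
 by apply/eqP;rewrite (trivg_Phi (abelem_pgroup ab)).
move: uP1;rewrite snd1 => /set1P eu;rewrite eu in auP.
have z1S: (z, 1%g) \in S by apply: (subsetP (Phi_sub _)).
have zzS: (z, z) \in S.
 apply: fixS;first by rewrite inE /= zL cycle_id.
 move=> B /rcosetsP[h hL ->];rewrite actY ?inE /= ?zL ?cycle_id //.
 by rewrite -mulgA (cent h z hL zZ) mulKg.
have := free z;rewrite (_ : (1%g, z) = (z, z) * (z, 1%g)^-1)%g;last by congr pair;rewrite /= ?mulgV // invg1 mulg1.
move=> /(_ (groupM zzS (groupVr z1S))) z1;move: oz;rewrite z1 order1 => p1.
by move: p_pr;rewrite -p1.
Qed.
(** H(L × <z>) modulo the Euler class is noetherian by [noeth_multiples]. The Euler class is nonzero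
    on 1 × <z>, hence monic over H(L), and therefore inflation embeds H(L) into this quotient. *)
Lemma noeth_nonabelem : noeth (top A) (zt L) (bt L).
have gY := csh_gstable p_pr sKL z'Z oz'.
have pG := cylinder_pgroup p_pr pL oz.
have [c [W eW]] := euler_exists actM act1 p_pr char_k (@cshI _ z^-1%g) gY pG gamL YG.
have [cN cc cL zW sW] := eW.
have cpx := polygon_complex actM act1 (@cshI _ z^-1%g) cN cc cL gamL gY YG.
have cA' : cocycles Ga (inflA gT A).
 by move=> o /in_inflA[b bA ->];apply/zts0/zts_infl/zts0;apply: cA.
have nM := noeth_multiples (cactM actM) (cact1 act1) cpx cA' zW sW stab_noeth.
set m := (2 * norb gam Y)%N in zW nM;pose W0 := W (set0, set0).
have zW0: zt Ga m W0 := polyT_zt zW.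
have g0G: (1%g, z) \in Ga by rewrite inE /= group1 cycle_id.
have pX n : ((1%g, z) ^+ n)%g = (1%g, (z ^+ n)%g) :> gT * gT.
 by elim: n => // n IHn;rewrite !expgS IHn;congr pair;rewrite /= mulg1.
have og0: #[(1%g, z) : gT * gT]%g = p.
 apply/eqP;rewrite eqn_dvd order_dvdn;apply/andP;split.
  by rewrite pX -oz expg_order.
 by rewrite -oz order_dvdn;have := expg_order ((1%g, z) : gT * gT);rewrite pX => -[->].
have nz := euler_nonzero actM act1 p_pr char_k (@cshI _ z^-1%g) gY eW g0G og0 gamL
 (fun B BY => congr1 (fun B => z^-1 *: B)%g (rcoset1 B)) (csh_order p_pr sKL z'Z oz' z'K).
have Rnz: Res (cyl_sub1 L z) (fcl Ga m W0) != 0.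
 rewrite fcl_Res //;apply/eqP => /fcl0P[|h Hh];first exact: zt_sub (cyl_sub1 L z) zW0.
 apply: nz;exists h => w Pw sz;apply: Hh => //;apply/allP => x /(allP Pw)/cycleP[i ->].
 by rewrite pX inE /= group1 mem_cycle.
have [al [a [al0 Ea]]] := cyl_monic p_pr char_k pL oz (hcl_fcl zW0) Rnz.
have m0: (0 < m)%N.
 have := norb_csh p_pr sKL z'Z oz' z'K;rewrite /m;have : (0 < #|L : K|%g)%N := indexg_gt0 _ _.
 by clear;case: (norb gam Y) => [|n] //;rewrite mul0n => h1 h2;rewrite -h2 in h1.
have om: ~~ odd m by rewrite /m mul2n odd_double.
(* If the inflation of u is y times the Euler class, all coefficients of this product of index at
   least m > 0 vanish; by monic cancellation with N = 0 so does y. *)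
have main n (u : seq gT -> k) : zt L n u -> multiples Ga m W0 n (infl u) -> bt L n u.
 move=> zu /(multiplesP _ _ zW0)[_ [y Hy]].
 rewrite -Infl_fcl // in Hy.
 have [M [v [v0 Ey]]] : tailN (Infl (L := L) z) (Yc k L z) (Zc k p L z) (fun x => x = 0) 0 y.
  apply: (cyl_cancel p_pr char_k pL oz _ _ _ al0 om Ea) => //.
  - by move=> _ _ -> ->;rewrite addr0.
  - by move=> b _ ->;rewrite mulr0.
  rewrite -Hy;exists 1%N, (fun i => if i == 0%N then fcl L n u else 0);split.
   by move=> i le;case: eqP => // e;rewrite e leqNgt m0 in le.
  by rewrite /esum big_ord1 /= /ebase expr0 mulr1 mul1r.
 have y0: y = 0 by rewrite Ey /esum big1 // => i _;rewrite v0 // raddf0 mulr0.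
 rewrite y0 mulr0 in Hy;apply/fcl0P => //.
 apply: (cyl_esum_eq0 p_pr char_k pL oz (M := 1) (u := fun=> fcl L n u) _ (i := 0%N)) => //.
 by rewrite /esum big_ord1 /ebase /= expr0 mulr1 mul1r.
apply: (@noeth_inj k (seq gT -> k^o) (seq (gT * gT) -> k^o) (@infl k gT gT) _ _ _ _ _ _ _ _ _ 0%N 0%N _ _ _ _ _ _ _ _ nM) => //.
- exact: infl_match.
- exact: top_linear.
- exact: gsub_zt.
- exact: gsub_zt.
- exact: (gsub_multiples cpx m W0 cA').
- exact: bt_zt.
- by move=> n u /(multiplesP _ _ zW0)[].
- by move=> n u _;right;exists n.
- by move=> n n' u;rewrite !addn0 => -> zu;apply/zts0/zts_infl/zts0.
by move=> n n' u;rewrite !addn0 => <-;apply: main.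
Qed.
End NonAbelem.

(** * Characters of elementary abelian groups *)

Section Characters.
Variables (p : nat) (gT : finGroupType) (E : {group gT}).
Hypotheses (p_pr : prime p) (aE : (p.-abelem E)%g).
Implicit Types (l : {ffun gT -> 'F_p}).

Definition achar l := forall x y, x \in E -> y \in E -> l (x * y)%g = l x + l y.
Definition cval l (g : gT) : nat := l g.

Lemma cvalP l g : (cval l g < p)%N.
by rewrite /cval -[X in (_ < X)%N](Fp_cast p_pr) ltn_ord. Qed.
Lemma cvalD (a b : 'F_p) : (a + b : 'F_p) = (((a : nat) + (b : nat))%N %% p)%N :> nat.
by rewrite /=;congr (_ %% _)%N;apply: Fp_cast p_pr. Qed.
Lemma cvalM l g h : achar l -> g \in E -> h \in E -> cval l (g * h)%g = ((cval l g + cval l h) %% p)%N.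
by move=> cl gE hE;rewrite /cval cl // cvalD. Qed.
Lemma achar1 l : achar l -> l 1%g = 0.
by move=> cl;have := cl _ _ (group1 E) (group1 E);rewrite mulg1 => /esym/eqP;rewrite -subr_eq0 addrK => /eqP. Qed.
Lemma acharX l g i : achar l -> g \in E -> l (g ^+ i)%g = l g *+ i.
move=> cl gE;elim: i => [|i IH];first by rewrite expg0 achar1.
by rewrite expgS cl ?groupX // IH mulrS.
Qed.
Lemma acharV l g : achar l -> g \in E -> l g^-1%g = - l g.
move=> cl gE;apply/eqP;rewrite -subr_eq0 opprK addrC -cl ?groupV // mulgV achar1 //.
Qed.
Lemma acharD l l' : achar l -> achar l' -> achar [ffun g => l g + l' g].
by move=> cl cl' x y xE yE;rewrite !ffunE cl // cl' // addrACA. Qed.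
Lemma acharB l l' : achar l -> achar l' -> achar [ffun g => l g - l' g].
by move=> cl cl' x y xE yE;rewrite !ffunE cl // cl' // opprD addrACA. Qed.
Definition cker l := [set g in E | l g == 0].
Lemma cker_group_set l : achar l -> group_set (cker l).
move=> cl;apply/group_setP;split;first by rewrite inE group1 achar1.
move=> x y;rewrite !inE => /andP[xE /eqP lx] /andP[yE /eqP ly].
by rewrite groupM // cl // lx ly addr0 eqxx.
Qed.
Definition ckerg l (cl : achar l) := Group (cker_group_set cl).

Lemma achar_elt l : achar l -> (exists2 g, g \in E & l g != 0) -> exists2 e, e \in E & l e = 1.
move=> cl [g gE lg];exists (g ^+ nat_of_ord ((l g)^-1)%R)%g;rewrite ?groupX // acharX // -mulr_natr.
by rewrite natr_Zp mulfV.
Qed.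
Lemma ord_nz e l : achar l -> e \in E -> l e = 1 -> #[e]%g = p.
move=> cl eE le;apply: (abelem_order_p aE eE);apply: contraTneq (oner_neq0 'F_p) => e1.
by rewrite -le e1 achar1 // eqxx.
Qed.
(** Vector space duality: l is the coordinate along x when E is decomposed as the product of <x> and
    a complement K containing D. *)
Lemma achar_exists (D : {group gT}) x : D \subset E -> x \in E -> x \notin D ->
 exists l, [/\ achar l, forall g, g \in D -> l g = 0 & l x = 1].
move=> sDE xE xD;have cEE := abelem_abelian aE.
have ox: #[x]%g = p.
 by apply: (abelem_order_p aE xE);apply: contraNneq xD => ->;apply: group1.
have sXE: (<[x]> \subset E)%g by rewrite cycle_subG.
have TI: <[x]>%g :&: D = 1%g by apply: prime_TIg;rewrite ?cycle_subG // -?[#|_|]/#[x]%g ?ox.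
have nE (A B : {group gT}) : A \subset E -> B \subset E -> (A \subset 'N(B))%g.
 by move=> sA sB;apply: subset_trans (cent_sub B);apply: (centsS sB);apply: (subset_trans sA).
have sDX: (D <*> <[x]> \subset E)%g by rewrite join_subG sDE.
have /splitsP[M /complP[TM eM]] := abelem_splits aE sDX.
have sME: M \subset E by rewrite -eM;apply: mulG_subr.
pose K := (D <*> M)%G.
have sKE: K \subset E by rewrite join_subG sDE.
have KE: (K : {set gT}) = (D * M)%g by rewrite /= norm_joinEr // nE.
have DXE: (D <*> <[x]>)%g = (D * <[x]>)%g by rewrite norm_joinEr // nE.
have cc: (<[x]>%G : {group gT}) \in [complements to K in E]%g.
 apply/complP;split.
  apply/trivgP/subsetP => y /setIP[];rewrite KE => /mulsgP[d m dD mM ->] dmx.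
  have : m \in (D <*> <[x]> :&: M)%g.
   rewrite inE mM andbT DXE -[m](mulKg d) mem_mulg ?groupV //.
  rewrite TM => /set1P em;rewrite em mulg1 in dmx *.
  by rewrite -TI inE dmx.
 rewrite KE -eM /= DXE -!mulgA;congr (_ * _)%g;apply: normC;apply: nE => //.
have nK: (K <| E)%g by rewrite -sub_abelian_normal.
have rM := remgrM cc nK.
pose rx g := remgr K <[x]> g.
have rxX g : g \in E -> exists i : 'I_p, rx g = (x ^+ i)%g.
 move=> gE;have : rx g \in <[x]>%g by apply: mem_remgr;case/complP: cc => _ ->.
 case/cycleP => i ->;exists (Ordinal (ltn_pmod i (prime_gt0 p_pr))) => /=.
 by rewrite -ox expg_mod_order.
pose l := [ffun g => if [pick i : 'I_p | rx g == x ^+ i]%g is Some i then (i : nat)%:R : 'F_p else 0].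
have lE g i : rx g = (x ^+ i)%g -> l g = i%:R.
 move=> e;rewrite ffunE;case: pickP => [j /eqP|/(_ (Ordinal (ltn_pmod i (prime_gt0 p_pr))))];last first.
  by rewrite /= -{1}ox expg_mod_order e eqxx.
 rewrite e => /eqP;rewrite eq_expg_mod_order ox => /eqP ij;apply/val_inj.
 by rewrite /= !val_Fp_nat // ij.
exists l;split.
- move=> g h gE hE;have [i ei] := rxX g gE;have [j ej] := rxX h hE.
 rewrite (lE g i) // (lE h j) // -natrD;apply: lE.
 by rewrite /rx rM // -/(rx g) -/(rx h) ei ej expgD.
- by move=> g gD;rewrite (lE g 0%N) // /rx remgr1 // (subsetP (joing_subl D M)).
- rewrite (lE x 1%N) // /rx expg1;apply: remgr_id;last exact: cycle_id.
 by case/complP: cc.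
Qed.
End Characters.

Lemma frob_comm (R : nzRingType) p (x y : R) s : p \in [pchar R] -> x * y = y * x ->
 (x + y) ^+ (p ^ s) = x ^+ (p ^ s) + y ^+ (p ^ s).
move=> pR xy;elim: s => [|s IH];first by rewrite !expr1.
have cX: GRing.comm (x ^+ (p ^ s)) (y ^+ (p ^ s)) by apply/commrX/commr_sym/commrX.
by rewrite expnSr !exprM IH;have := pFrobenius_autD_comm pR cX;rewrite !pFrobenius_autE.
Qed.
Lemma subr_sol (V : zmodType) (x y z : V) : x + y = z -> x = z - y.
by move=> <-;rewrite addrK. Qed.
(** Carries of a sum of three terms do not depend on the bracketing, which is the cocycle condition
    for the carry; the claim is proved after multiplication by p. *)
Lemma carry_assoc (p g h r gh hr ghr x1 x2 x3 x4 : nat) : (0 < p -> gh + p * x1 = g + h ->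
 hr + p * x2 = h + r -> ghr + p * x3 = gh + r -> ghr + p * x4 = g + hr -> x2 + x4 = x3 + x1)%N.
by move=> p0 *;apply/eqP;rewrite -(eqn_pmul2l p0) !mulnDr;apply/eqP;lia. Qed.
Lemma carry_add (p g h gh g' h' gh' g2 h2 gh2 x y z a b c : nat) : (0 < p -> gh + p * x = g + h ->
 gh' + p * y = g' + h' -> gh2 + p * z = g2 + h2 -> gh2 + p * a = gh + gh' ->
 h2 + p * b = h + h' -> g2 + p * c = g + g' -> z + c + b = x + y + a)%N.
by move=> p0 *;apply/eqP;rewrite -(eqn_pmul2l p0) !mulnDr;apply/eqP;lia. Qed.
Lemma alg_assoc (R : comRingType) (a b c d : R) : a + c = b + d -> - a - (- b - (- c - - d)) = 0.
by move=> e;apply/eqP;rewrite -subr_eq0;apply/eqP;transitivity (b + d - (a + c));[ring|rewrite e subrr].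
Qed.
Lemma alg_add (R : comRingType) (z c b x y a : R) : z + c + b = x + y + a ->
 - z - (- x + - y) = b - (a - c).
by move=> e;apply/eqP;rewrite -subr_eq0;apply/eqP;transitivity (x + y + a - (z + c + b));[ring|rewrite e subrr]. Qed.

(** * Bockstein classes of characters and Euler classes restricting to them *)

Section Beta.
Variables (k : fieldType) (p : nat) (gT : finGroupType) (E : {group gT}).
Hypotheses (p_pr : prime p) (char_k : p \in [pchar k]) (aE : (p.-abelem E)%g).
Implicit Types (l : {ffun gT -> 'F_p}).
Let pE : (p.-group E)%g := abelem_pgroup aE.
Let p_gt0 : (0 < p)%N := prime_gt0 p_pr.

(** Minus the carry cocycle of l, whose class is minus the Bockstein of l. *)
Definition bta l : seq gT -> k := pW0 k p (cval l).
Definition beta l : 'H^*(E, k) := fcl E 2 (bta l).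

Let carry (a b c : nat) : (a < p)%N -> (b < p)%N -> c = ((a + b) %% p)%N -> (c + p * (p <= a + b) = a + b)%N.
move=> ap bp ->;have [le|lt] := leqP p (a + b).
 by rewrite muln1 -(subnK le) modnDr modn_small ?subnK //;lia.
by rewrite muln0 addn0 modn_small.
Qed.
Lemma bta_zt l : achar E l -> zt E 2 (bta l).
move=> cl [|g [|h [|r []]]] // /and4P[gE hE rE _] _;rewrite /= /bta /pW0 /=.
have n1 := carry (cvalP p_pr l g) (cvalP p_pr l h) (cvalM p_pr cl gE hE).
have n2 := carry (cvalP p_pr l h) (cvalP p_pr l r) (cvalM p_pr cl hE rE).
have n3 := carry (cvalP p_pr l (g * h)%g) (cvalP p_pr l r) (cvalM p_pr cl (groupM gE hE) rE).
have n4 := carry (cvalP p_pr l g) (cvalP p_pr l (h * r)%g) (cvalM p_pr cl gE (groupM hE rE)).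
rewrite -mulgA in n3.
have e: ((p <= cval l h + cval l r) + (p <= cval l g + cval l (h * r)%g) =
 (p <= cval l (g * h)%g + cval l r) + (p <= cval l g + cval l h) :> nat)%N.
 exact: carry_assoc p_gt0 n1 n2 n3 n4.
have := congr1 (fun n => n%:R : k) e;rewrite !natrD => {}e.
exact: alg_assoc e.
Qed.
Lemma hcl_beta l : achar E l -> hcl 2 (beta l).
by move=> cl;apply/hcl_fcl/bta_zt. Qed.
Lemma beta_comm l x : achar E l -> beta l * x = x * beta l.
by move=> cl;apply: even_central (hcl_beta cl) _;rewrite sqrrN expr1n. Qed.
(** The carry ep of the pointwise sum l g + l' g, as a 1-cochain, is the homotopy. *)
Lemma betaD l l' : achar E l -> achar E l' -> beta [ffun g => l g + l' g] = beta l + beta l'.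
move=> cl cl';set l2 := [ffun _ => _];have c2: achar E l2 by apply: acharD.
have -> : beta l + beta l' = fcl E 2 (fun w => 1 * bta l w + bta l' w).
 by rewrite fcl_lin ?scale1r //;apply: bta_zt.
apply/fcl_eq;[exact: bta_zt|by apply: zt_lin;apply: bta_zt|].
pose ep g := (p <= cval l g + cval l' g)%N.
have epE g : (cval l2 g + p * ep g = cval l g + cval l' g)%N.
 by apply: carry;rewrite ?cvalP // /cval ffunE cvalD.
exists (fun w => if w is [:: g] then (ep g)%:R else 0) => -[|g [|h []]] // /and3P[gE hE _] _.
rewrite /= /bta /pW0 mul1r.
have n1 := carry (cvalP p_pr l g) (cvalP p_pr l h) (cvalM p_pr cl gE hE).
have n2 := carry (cvalP p_pr l' g) (cvalP p_pr l' h) (cvalM p_pr cl' gE hE).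
have n3 := carry (cvalP p_pr l2 g) (cvalP p_pr l2 h) (cvalM p_pr c2 gE hE).
have := epE g;have := epE h;have := epE (g * h)%g => e1 e2 e3.
have e: ((p <= cval l2 g + cval l2 h) + ep g + ep h = (p <= cval l g + cval l h) + (p <= cval l' g + cval l' h) + ep (g * h)%g :> nat)%N.
 exact: carry_add p_gt0 n1 n2 n3 e1 e2 e3.
have := congr1 (fun n => n%:R : k) e;rewrite !natrD => {}e.
exact: alg_add e.
Qed.
Lemma beta_eq l l' : (forall g, g \in E -> l g = l' g) -> achar E l -> achar E l' -> beta l = beta l'.
move=> e cl cl';apply: eq_fcl;first exact: bta_zt.
by move=> [|g [|h []]] // /and3P[gE hE _] _;rewrite /bta /pW0 /cval !e.
Qed.
Let pA : p \in [pchar 'H^*(E, k)].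
by rewrite !inE p_pr /= -scaler_nat (pcharf0 char_k) scale0r eqxx. Qed.
Lemma betaDX l l' s : achar E l -> achar E l' ->
 beta [ffun g => l g + l' g] ^+ (p ^ s) = beta l ^+ (p ^ s) + beta l' ^+ (p ^ s).
move=> cl cl';apply: etrans (congr1 (fun x : 'H^*(E, k) => x ^+ (p ^ s)) (betaD cl cl')) _.
by apply: (frob_comm _ pA _);apply: beta_comm.
Qed.
Lemma betaBX l l' s : achar E l -> achar E l' ->
 beta [ffun g => l g - l' g] ^+ (p ^ s) = beta l ^+ (p ^ s) - beta l' ^+ (p ^ s).
move=> cl cl';have cB := acharB cl cl';have e := betaDX s cB cl'.
have be: beta [ffun g => [ffun g0 => l g0 - l' g0] g + l' g] = beta l.
 by apply: beta_eq => //;[move=> g gE;rewrite !ffunE subrK|exact: acharD].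
have e' := etrans (esym e) (congr1 (fun x : 'H^*(E, k) => x ^+ (p ^ s)) be).
exact: subr_sol e'.
Qed.
(** The Euler class of the join of the coset polygons of H modulo K = ker l, shifted by e with l e =
    1; there are #|H : E| polygons. E rotates all of them by l, so the restriction to E is a power
    of beta l. If l is trivial on the intersection with E', the cosets K g with g in E' form an
    E'-stable set with at most one vertex in each polygon, and [euler_vanish] applies. *)
Lemma euler_char (H : {group gT}) l : (p.-group H)%g -> E \subset 'Z(H)%g -> achar E l ->
 (exists2 g, g \in E & l g != 0) -> exists f : seq gT -> k,
 [/\ zt H (2 * #|H : E|%g) f, fcl E (2 * #|H : E|%g) f = beta l ^+ #|H : E|%g
  & forall E' : {group gT}, E' \subset H -> (forall g, g \in E :&: E' -> l g = 0) -> bt E' (2 * #|H : E|%g) f].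
move=> pH EZ cl nl;have [e eE le] := achar_elt cl nl.
have oe := ord_nz aE cl eE le.
pose K := ckerg cl;have sKE: K \subset E by apply/subsetP => g;rewrite inE => /andP[].
have sEH: E \subset H := subset_trans EZ (center_sub H).
have sKH := subset_trans sKE sEH.
have eZ := subsetP EZ e eE;have eK: e \notin K by rewrite inE le oner_eq0 andbF.
have cent g h : g \in E -> h \in H -> (h * g = g * h)%g.
 by move=> gE hH;have /setIP[_ /centP cC] := subsetP EZ g gE;rewrite cC.
pose act (B : {set gT}) g := (B :* g)%g.
have actM B g h : act (act B g) h = act B (g * h)%g by rewrite /act rcosetM.
have act1 B : act B 1%g = B by apply: rcoset1.
have gY := csh_gstable p_pr sKH eZ oe.
have gamL g : g \in H -> forall B, csh e (act B g) = act (csh e B) g by move=> _ B;rewrite /act csh_rcoset.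
have YH B g : B \in rcosets K H -> g \in H -> act B g \in rcosets K H by apply: rcosets_stable.
have [c [W eW]] := euler_exists actM act1 p_pr char_k (@cshI _ e) gY pH gamL YH.
have iE n h : h \in H -> iter n (csh e) (K :* h)%g = (K :* (e ^+ n * h))%g.
 move=> hH;elim: n => [|n IH] /=;first by rewrite mul1g.
 by rewrite IH (csh_coset sKH eZ) ?expgS ?mulgA // groupM // groupX // (subsetP sEH).
have iK: #|E : K|%g = p.
 have cE: (<[e]>%g * K)%g = E.
  apply/eqP;rewrite eqEsubset mulG_subG cycle_subG eE sKE /=;apply/subsetP => g gE.
  rewrite -[g](mulKVg (e ^+ cval l g)%g) mem_mulg ?mem_cycle // inE groupM ?groupV ?groupX //=.
  by rewrite cl ?groupV ?groupX // (acharV cl) ?groupX // (acharX _ cl) // le natr_Zp addNr.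
 have TI: <[e]>%g :&: K = 1%g by apply: prime_TIg;rewrite ?cycle_subG // -?[#|_|]/#[e]%g ?oe.
 apply/eqP;rewrite -(eqn_pmul2r (cardG_gt0 K)) mulnC Lagrange // -cE (TI_cardMg TI).
 by rewrite -[#|<[e]>%g|]/#[e]%g oe.
have nN: norb (csh e) (rcosets K H) = #|H : E|%g.
 by apply/eqP;rewrite -(eqn_pmul2r p_gt0) (norb_csh p_pr sKH eZ oe eK) -iK Lagrange_index.
have [cN cc cL zW sW] := eW;rewrite nN in zW.
exists (W (set0, set0));split;first exact: polyT_zt zW.
- rewrite -nN;have [_ _ cL' zW' _] := euler_sub (L' := E) sEH eW.
 apply: (euler_power actM act1 cN cc cL' (@cshI _ e) _ p_gt0 _ _ gY _ _ zW' sW).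
 + by move=> g gE;apply: gamL;apply: (subsetP sEH).
 + by move=> g _;apply: cvalP.
 + by move=> g h gE hE;exact: (cvalM p_pr cl gE hE).
 + exact: (csh_order p_pr sKH eZ oe eK).
 + move=> g B gE /rcosetsP[h hH ->];rewrite iE // /act -rcosetM;apply: rcoset_eqP.
  rewrite mem_rcoset (cent g h gE hH) invMg !mulgA mulgK inE groupM ?groupV ?groupX //=.
  by rewrite cl ?groupV ?groupX // (acharV cl) ?groupX // (acharX _ cl) // le natr_Zp subrr.
move=> E' sE' l0;have [_ _ cL' zW' _] := euler_sub (L' := E') sE' eW;rewrite nN in zW'.
apply: (euler_vanish actM act1 cN cc cL' (V0 := [set act (K : {set gT}) g | g in E']) _ _ _ _ zW').
- by apply/imsetP;exists 1%g;rewrite ?act1.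
- by apply/subsetP => _ /imsetP[g gE' ->];apply/rcosetsP;exists g;rewrite // (subsetP sE').
- by move=> _ h /imsetP[g gE' ->] hE';rewrite actM imset_f // groupM.
move=> _ _ /imsetP[g gE' ->] /imsetP[h hE' ->] /iter_findex;move: (findex _ _ _) => i.
rewrite {1}/act iE ?(subsetP sE') // => /rcoset_eqP;rewrite mem_rcoset inE => /andP[egE].
have iE' : (e ^+ i)%g \in E by rewrite groupX.
have ghE: (g * h^-1)%g \in E by rewrite -[(g * _)%g](mulKg (e ^+ i)%g) groupM ?groupV // mulgA.
rewrite -mulgA cl // (l0 (g * h^-1)%g);last by rewrite inE ghE groupM // groupV.
rewrite addr0 (acharX _ cl) // le => /eqP i0.
have ei: (e ^+ i)%g = 1%g.
 apply/eqP;rewrite -order_dvdn oe;have := congr1 val i0;rewrite /= val_Fp_nat // => /eqP.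
 by rewrite /dvdn.
rewrite /act;apply: rcoset_eqP;rewrite mem_rcoset inE ghE (l0 (g * h^-1)%g) ?eqxx //.
by rewrite inE ghE groupM // groupV.
Qed.
(** In the coset polygons of E modulo ker l, every nonempty cell has stabiliser ker l, and the Euler
    class is a positive power of beta l; so the quotient by that power, and then by beta l, is
    noetherian. *)
Lemma noeth_beta A l (cl : achar E l) : (exists2 g, g \in E & l g != 0) -> cocycles E A ->
 noeth (top A) (zt (ckerg cl)) (bt (ckerg cl)) -> noeth (top A) (zt E) (multiples E 2 (bta l)).
move=> nl cA nK;have [e eE le] := achar_elt cl nl.
have oe := ord_nz aE cl eE le.
pose K := ckerg cl;have sKE: K \subset E by apply/subsetP => g;rewrite inE => /andP[].
have cEE := abelem_abelian aE.
have eZ: e \in 'Z(E)%g by rewrite (center_idP cEE).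
have eK: e \notin K by rewrite inE le oner_eq0 andbF.
have cent g h : g \in E -> h \in E -> (h * g = g * h)%g by move=> gE hE;rewrite (centsP cEE h hE g gE).
pose act (B : {set gT}) g := (B :* g)%g.
have actM B g h : act (act B g) h = act B (g * h)%g by rewrite /act rcosetM.
have act1 B : act B 1%g = B by apply: rcoset1.
have gY := csh_gstable p_pr sKE eZ oe.
have gamL g : g \in E -> forall B, csh e (act B g) = act (csh e B) g by move=> _ B;rewrite /act csh_rcoset.
have YH B g : B \in rcosets K E -> g \in E -> act B g \in rcosets K E by apply: rcosets_stable.
have [c [W eW]] := euler_exists actM act1 p_pr char_k (@cshI _ e) gY pE gamL YH.
have iE n h : h \in E -> iter n (csh e) (K :* h)%g = (K :* (e ^+ n * h))%g.
 move=> hE;elim: n => [|n IH] /=;first by rewrite mul1g.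
 by rewrite IH (csh_coset sKE eZ) ?expgS ?mulgA // groupM // groupX.
have actE g B : g \in E -> B \in rcosets K E -> act B g = iter (cval l g) (csh e) B.
 move=> gE /rcosetsP[h hE ->];rewrite iE // /act -rcosetM;apply: rcoset_eqP.
 rewrite mem_rcoset (cent g h gE hE) invMg !mulgA mulgK inE groupM ?groupV ?groupX //=.
 by rewrite cl ?groupV ?groupX // (acharV cl) ?groupX // (acharX _ cl) // le natr_Zp subrr.
have [cN cc cL zW sW] := eW.
have cpx := polygon_complex actM act1 (@cshI _ e) cN cc cL gamL gY YH.
have nM: noeth (top A) (zt E) (multiples E (2 * norb (csh e) (rcosets K E)) (W (set0, set0))).
 apply: (noeth_multiples (cactM actM) (cact1 act1) cpx cA zW sW) => -[V F] v dq.
 have [h1 h2 h3 h4] := vcellP (csh e) _ _ _ v.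
 have VEY: V :|: F \subset rcosets K E by rewrite subUset h1.
 have [B BVE] : exists x, x \in V :|: F.
  have [VE0|[x xV]] := set_0Vmem (V :|: F);last by exists x.
  by move: dq;have /eqP := VE0;rewrite setU_eq0 /cdim /= => /andP[/eqP-> /eqP->];rewrite cards0.
 rewrite (_ : stab _ _ _ = K :> {set gT}) //;apply/setP => g;rewrite inE.
 have [gE|ngE] := boolP (g \in E);last by rewrite inE (negbTE ngE).
 apply/eqP/idP => [|gK];rewrite /cact /=.
  move=> [eV eF];have gB: act B g \in V :|: F by rewrite -eV -eF -imsetU;apply: imset_f.
  have := h4 _ _ BVE gB;rewrite {1}(actE g B gE (subsetP VEY _ BVE)) fconnect_iter => /(_ isT).
  case/rcosetsP: (subsetP VEY _ BVE) => h hE ->;rewrite /act -rcosetM => /esym/rcoset_eqP.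
  by rewrite mem_rcoset (cent g h gE hE) mulgK.
 have fx D : D \in rcosets K E -> act D g = D.
  case/rcosetsP => h hE ->;rewrite /act -rcosetM;apply: rcoset_eqP.
  by rewrite mem_rcoset (cent g h gE hE) mulgK.
 congr pair;first by rewrite -[RHS]imset_id;apply: eq_in_imset => D /(subsetP h1)/fx.
 by rewrite -[RHS]imset_id;apply: eq_in_imset => D /(subsetP h2)/fx.
have zW0 := polyT_zt zW.
have eP: fcl E (2 * norb (csh e) (rcosets K E)) (W (set0, set0)) = fcl E 2 (pW0 k p (cval l)) ^+ norb (csh e) (rcosets K E).
 apply: (euler_power actM act1 cN cc cL (@cshI _ e) gamL p_gt0 _ _ gY _ _ zW sW).
 + by move=> g _;apply: cvalP.
 + by move=> g h gE hE;exact: (cvalM p_pr cl gE hE).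
 + exact: (csh_order p_pr sKE eZ oe eK).
 + exact: actE.
have [n0 en] : exists n, norb (csh e) (rcosets K E) = n.+1.
 have := norb_csh p_pr sKE eZ oe eK;have : (0 < #|E : K|%g)%N := indexg_gt0 _ _.
 by case: (norb _ _) => [|n];[rewrite mul0n => /[swap] <-|exists n].
rewrite en in zW0 eP nM.
have zb := bta_zt cl.
apply: (noeth_mono (gsub_multiples cpx 2 (bta l) cA) _ _ nM) => // n u /(multiplesP _ _ zW0)[zu [y Hy]].
apply/(multiplesP _ _ zb);split=> //;exists (beta l ^+ n0 * y);apply: etrans Hy _.
by apply: etrans (congr1 (fun x : 'H^*(E, k) => x * y) eP) _;rewrite exprS -mulrA.
Qed.
End Beta.

Lemma lcup_lin (k : fieldType) (gT : finGroupType) m e a (u v : seq gT -> k) w :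
 lcup m e (fun w => a * u w + v w) w = a * lcup m e u w + lcup m e v w.
by rewrite /lcup;case: ifP => _;ring. Qed.
Lemma lcup_tcupA (k : fieldType) (gT : finGroupType) m (e y : seq gT -> k) d b w : lcup m e (tcup d b y) w = tcup d b (lcup m e y) w.
rewrite /lcup /tcup;case: (leqP m (size w)) => le1;case: (leqP d (size w)) => le2 //.
- rewrite size_drop size_takel ?leq_subr //.
 case: (leqP d (size w - m)) => le3;case: (leqP m (size w - d)) => le4;try by [exfalso;lia|rewrite mulr0 mul0r].
 rewrite -mulrA take_takel //;congr (_ * (_ * _)).
  by rewrite take_drop;congr (y (drop _ (take _ _)));lia.
 by rewrite drop_drop;congr (b (drop _ _));lia.
- by rewrite size_drop;case: leqP => [?|_];rewrite ?mulr0 //;exfalso;lia.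
- by rewrite size_takel ?leq_subr //;case: leqP => [?|_];rewrite ?mul0r //;exfalso;lia.
Qed.

(** * Noetherian quotients of H(E) by ideals *)

Section Ideals.
Variables (k : fieldType) (gT : finGroupType) (E : {group gT}).
Implicit Types (A bs : seq (nat * (seq gT -> k))) (x y : 'H^*(E, k)).
Local Notation fc := (@fcl k gT E).

Lemma fcl_tcup n e (b u : seq gT -> k) : zt E e b -> zt E n u ->
 zt E (n + e) (tcup e b u) /\ fc (n + e) (tcup e b u) = fc n u * fc e b.
move=> zb zu;have zl: zt E (n + e) (lcup n u b) by apply: zt_lcup'.
have eq w : size w = (n + e)%N -> tcup e b u w = lcup n u b w.
 by move=> sz;rewrite /tcup /lcup sz leq_addl leq_addr addnK.
have zt' : zt E (n + e) (tcup e b u).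
 move=> w Ew sz;rewrite (dt_tcup _ zb Ew) /tcup;case: leqP => // le;rewrite zu ?mul0r //.
  by apply/allP => z /mem_take;apply: (allP Ew).
 by rewrite size_takel ?leq_subr // sz;lia.
split=> //;apply: etrans (eq_fcl zt' (fun w _ sz => eq w sz)) _;exact: esym (fclM zu zb).
Qed.
(** Positive degrees that are even, unless -1 = 1 in k: the corresponding classes are central. *)
Definition evens A := forall b, List.In b A -> ~~ (odd b.1 && ((-1) != 1 :> k)) /\ (0 < b.1)%N.

Lemma evens_central n e b x : ~~ (odd e && ((-1) != 1 :> k)) -> zt E e b -> hcl n x ->
 fc e b * x = x * fc e b.
move=> ev zb hx;apply: even_central (hcl_fcl zb) _;rewrite -signr_odd.
by move: ev;case: (odd e) => //=;rewrite negbK => /eqP.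
Qed.
Lemma ops_comm_top A B : evens A -> cocycles E A -> (forall n u, bt E n u -> B n u) ->
 ops_comm (top A) (zt E) B.
move=> ev cA sB o o' /in_top[b bA ->] /in_top[b' bA' ->] n u m zu -> /=;apply: sB.
have [z1 e1] := fcl_tcup (cA _ bA) zu;have [z2 e2] := fcl_tcup (cA _ bA') z1.
have [z1' e1'] := fcl_tcup (cA _ bA') zu;have [z2' e2'] := fcl_tcup (cA _ bA) z1'.
have eqn: (n + b'.1 + b.1 = n + b.1 + b'.1)%N by rewrite addnAC.
rewrite eqn in z2' e2';apply/(fcl_eq z2 z2').
apply: etrans e2 _;apply: esym;apply: etrans e2' _.
apply: etrans (congr1 (fun y : 'H^*(E, k) => y * _) e1') _;apply: esym.
apply: etrans (congr1 (fun y : 'H^*(E, k) => y * _) e1) _.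
rewrite -!mulrA;congr (_ * _).
exact: (evens_central (ev _ bA).1 (cA _ bA) (hcl_fcl (cA _ bA'))).
Qed.
Definition cI (I : 'H^*(E, k) -> Prop) n (u : seq gT -> k) := zt E n u /\ I (fc n u).
Definition cmul x := cI (fun z => exists y, z = x * y).

Lemma fcl_scaleD n a (u v : seq gT -> k) : zt E n u -> zt E n v ->
 zt E n (fun w => a * u w + v w) /\ fc n (fun w => a * u w + v w) = a *: fc n u + fc n v.
by move=> zu zv;split;[apply: zt_lin|apply: fcl_lin]. Qed.
Lemma gsub_ideal A (I : 'H^*(E, k) -> Prop) : cocycles E A -> I 0 -> (forall x y, I x -> I y -> I (x + y)) ->
 (forall x y, I x -> I (x * y)) -> gsub (top A) (cI I).
move=> cA I0 ID IM;have gz := gsub_zt cA.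
have IZ a x : I x -> I (a *: x) by move=> Ix;rewrite -[x]mulr1 scalerAr;apply: IM.
split=> [n|n u v [zu Iu] [zv Iv]|n a u [zu Iu]|o n u oA [zu Iu]].
- have z0 := gsub0 gz n;split=> //;rewrite (_ : fc _ _ = 0) //;apply/fcl0P => //.
 by exists (fun=> 0) => w _ _;rewrite dt0.
- split;first exact: (gsubD gz).
 have [_ e] := fcl_scaleD 1 zu zv;rewrite scale1r in e.
 have -> : u + v = (fun w => 1 * u w + v w) by apply/funext => w;rewrite mul1r.
 by rewrite [fc _ _]e;apply: ID.
- split;first exact: (gsubZ gz).
 have [_ e] := fcl_scaleD a zu (gsub0 gz n).
 have -> : a *: u = (fun w => a * u w + (0 : seq gT -> k^o) w) by apply/funext => w;rewrite addr0.
 rewrite [fc _ _]e;apply: ID;first exact: IZ.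
 rewrite (_ : fc _ _ = 0) //;apply/fcl0P;first exact: (gsub0 gz).
 by exists (fun=> 0) => w _ _;rewrite dt0.
have [b bA ->] := in_top oA;have [zt' e] := fcl_tcup (cA _ bA) zu;split=> //.
by rewrite [fc _ _]e;apply: IM.
Qed.
Lemma gsub_cmul A x : cocycles E A -> gsub (top A) (cmul x).
move=> cA;apply: (gsub_ideal (I := fun z => exists y, z = x * y)) => //.
- by exists 0;rewrite mulr0.
- by move=> _ _ [y ->] [z ->];exists (y + z);rewrite mulrDr.
- by move=> _ z [y ->];exists (y * z);rewrite mulrA.
Qed.
Lemma in_top_mem A b : List.In b A -> List.In (b.1, tcup b.1 b.2) (top A).
by elim: A => //= b' A IH [->|/IH];[left|right]. Qed.
(** Modulo xy the ring is an extension of R/(x) by (x)/(xy), and the latter is the image of R/(y)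
    under multiplication by x. *)
Lemma noeth_cmul_mul A x y m : cocycles E A -> hcl m x ->
 noeth (top A) (zt E) (cmul x) -> noeth (top A) (zt E) (cmul y) -> noeth (top A) (zt E) (cmul (x * y)).
move=> cA hx nx ny;have [e ze ex] := hcl_fclP hx.
apply: (@noeth_ext k (seq gT -> k^o) (top A) (zt E) (cmul x) (cmul (x * y))).
- exact: top_linear.
- exact: gsub_cmul.
- exact: gsub_cmul.
- by move=> n u [zu [z ez]];split=> //;exists (y * z);rewrite mulrA.
- pose UT := (seq gT -> k^o : lmodType k).
 apply: (@noeth_surj k UT UT (lcup m e : UT -> UT) _ _ _ _ _ _ _ _ m _ _ _ _ _ ny).
 + move=> a u v;apply/funext => w;change (lcup m e (fun w => a * u w + v w) w = a * lcup m e u w + lcup m e v w).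
  exact: lcup_lin.
 + split=> o /in_top[b bA ->];exists (b.1, tcup b.1 b.2);try exact: in_top_mem bA.
  * by split;[|move=> u;apply/funext => w;exact: lcup_tcupA].
  * by split;[|move=> u;apply/funext => w;exact: lcup_tcupA].
 + exact: gsub_zt.
 + by move=> n u [].
 + move=> n u zu;have zl := zt_lcup' ze zu;rewrite addnC;split=> //.
  by exists (fc n u);rewrite ex;apply: esym;apply: fclM.
 + move=> n u [zu [z ez]];have zl := zt_lcup' ze zu;rewrite addnC;split=> //.
  exists z;apply: etrans (esym (fclM ze zu)) _.
  by rewrite -ex;apply: etrans (congr1 _ ez) _;rewrite mulrA.
 move=> n v [zv [z ez]];have ht := hpr_mul_shift n z hx;rewrite -ez (hcl_fcl zv) /hprs in ht.
 move: ht;case: leqP => [le ht|lt ht];last first.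
  by left;split=> //;exists 0;rewrite mulr0 ht mulr0.
 right;have [u zu eu] := hcl_fclP (hcl_hpr (n - m) z).
 exists (n - m)%N, u;split=> //;first by rewrite subnK.
 have zl: zt E n (lcup m e u) by rewrite -(subnKC le);apply: zt_lcup'.
 have eM: fc n (lcup m e u) = fc n v.
  rewrite ht;apply: esym;apply: etrans (congr1 _ eu) _;rewrite ex.
  by apply: etrans (fclM ze zu) _;rewrite subnKC.
 have zd: zt E n (fun w => -1 * lcup m e u w + v w) by apply: zt_lin.
 have -> : v - (lcup m e : UT -> UT) u = (fun w => -1 * lcup m e u w + v w).
  by apply/funext => w;change (v w - lcup m e u w = -1 * lcup m e u w + v w);rewrite mulN1r addrC.
 split=> //;exists 0;rewrite mulr0;apply: etrans (fcl_lin (-1) zl zv) _.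
 by rewrite scaleN1r;apply/eqP;rewrite addrC subr_eq0;apply/eqP/esym.
- exact: nx.
- by move=> n u [].
- exact: gsub_zt.
Qed.
Lemma cmul1 A : noeth (top A) (zt E) (cmul 1).
by apply: noeth_triv => n u zu;split=> //;exists (fc n u);rewrite mul1r. Qed.
Lemma noeth_cmul_prod A (I : Type) (s : seq I) (F : I -> 'H^*(E, k)) (m : I -> nat) : cocycles E A ->
 (forall i, List.In i s -> hcl (m i) (F i) /\ noeth (top A) (zt E) (cmul (F i))) ->
 noeth (top A) (zt E) (cmul (\prod_(i <- s) F i)).
move=> cA;elim: s => [|i s IH] h;first by rewrite big_nil;apply: cmul1.
rewrite big_cons;have [hi ni] := h i (or_introl erefl).
by apply: noeth_cmul_mul hi ni _ => //;apply: IH => j js;apply: h;right.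
Qed.

Fixpoint inI bs x := if bs is b :: bs' then exists y, inI bs' (x - fc b.1 b.2 * y) else x = 0.

Lemma inI0 bs : inI bs 0.
by elim: bs => //= b bs IH;exists 0;rewrite mulr0 subr0. Qed.
Lemma inID bs x y : inI bs x -> inI bs y -> inI bs (x + y).
elim: bs x y => /= [x y -> ->|b bs IH x y [z Hz] [t Ht]];first by rewrite addr0.
by exists (z + t);rewrite mulrDr opprD addrACA;apply: IH.
Qed.
Lemma inIM bs x y : inI bs x -> inI bs (x * y).
elim: bs x => /= [x ->|b bs IH x [z Hz]];first by rewrite mul0r.
by exists (z * y);rewrite mulrA -mulrBl;apply: IH.
Qed.
Lemma inI_cat bs bs' x y : inI bs x -> inI bs' y -> inI (bs ++ bs') (x + y).
elim: bs x => /= [x -> Iy|b bs IH x [z Hz] Iy];first by rewrite add0r.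
by exists z;rewrite addrAC;apply: IH.
Qed.
Lemma inI_cmul bs x : inI bs x -> forall n u, cmul x n u -> zt E n u /\ inI bs (fc n u).
by move=> Ix n u [zu [y ->]];split=> //;apply: inIM. Qed.
Lemma inI_hpr bs n x : cocycles E bs -> inI bs x -> inI bs (hpr n x).
elim: bs x => /= [x _ ->|b bs IH x cb [z Hz]];first by rewrite raddf0.
have zb := cb b (or_introl erefl).
exists (hprs b.1 n z);rewrite -(hpr_mul_shift n z (hcl_fcl zb)) -raddfB;apply: IH => //.
by move=> b' hb;apply: cb;right.
Qed.
(** Each generator b of the ideal belongs to A and acts as an operator, so [noeth_step] lifts
    noetherianity from the quotient by b, one generator at a time. *)
Lemma noeth_ideal A bs : evens A -> cocycles E A -> (forall b, List.In b bs -> List.In b A) ->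
 noeth (top A) (zt E) (cI (inI bs)) -> noeth (top A) (zt E) (bt E).
move=> ev cA;elim: bs => [|b bs IH] sA nJ.
 apply: noeth_mono nJ => //;first exact: gsub_bt.
 by move=> n u [zu /(fcl0P zu)].
have bA: List.In b A by apply: sA;left.
have {}sA b' : List.In b' bs -> List.In b' A by move=> h;apply: sA;right.
apply: IH => //;have zb := cA _ bA;have [evb b0] := ev _ bA.
have cbs: cocycles E bs by move=> b' /sA/cA.
pose J := cI (inI bs).
have gJ: gsub (top A) J.
 by apply: gsub_ideal => //;[exact: inI0|exact: inID|exact: inIM].
pose t := (b.1, tcup b.1 b.2 : (seq gT -> k^o) -> seq gT -> k^o).
have bJ n u : bt E n u -> J n u.
 by move=> bu;have zu := bt_zt bu;split=> //;rewrite (proj2 (fcl0P zu)) //;apply: inI0.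
have sub: forall o, List.In o (t :: top A) <-> List.In o (top A).
 by move=> o;split=> [[<-|//]|];[apply: in_top_mem|right].
have gsubt N : gsub (top A) N -> gsub (t :: top A) N by apply: gsub_sub => o /sub.
have lin: ops_linear (t :: top A) by move=> o /sub;apply: top_linear.
have com: ops_comm (t :: top A) (zt E) J.
 by move=> o o' /sub h /sub h';apply: (ops_comm_top ev cA bJ h h').
have nS: noeth (t :: top A) (zt E) J.
 apply: (noeth_step lin (gsubt _ (gsub_zt cA)) (gsubt _ gJ) (fun n u h => proj1 h) com b0).
 apply: (noeth_mono (gsub_addop lin (gsubt _ (gsub_zt cA)) (gsubt _ gJ) com) _ _ nJ);first by [].
 move=> n u [zu [y Iy]].
 have Iy' : inI bs (fc n u - fc b.1 b.2 * hprs b.1 n y).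
  have e: hpr n (fc n u - fc b.1 b.2 * y) = fc n u - fc b.1 b.2 * hprs b.1 n y.
   rewrite raddfB /=;congr (_ - _);first exact: hcl_fcl zu.
   exact: hpr_mul_shift (hcl_fcl zb).
  by rewrite -e;apply: inI_hpr.
 have [le|lt] := leqP b.1 n;last first.
  exists 0;first by left.
  have -> : u - t.2 0 = u.
   by rewrite (op_linear0 (lin t (or_introl erefl))) subr0.
  by split=> //;move: Iy';rewrite /hprs leqNgt lt mulr0 subr0.
 move: Iy';rewrite /hprs le;have [v zv ->] := hcl_fclP (hcl_hpr (n - b.1) y) => Iy'.
 exists v;first by right;exists (n - b.1)%N => //=;rewrite subnK.
 have [z1 e1] := fcl_tcup zb zv;rewrite subnK // in z1 e1.
 have -> : u - t.2 v = (fun w => -1 * tcup b.1 b.2 v w + u w).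
  by apply/funext => w;change (u w - tcup b.1 b.2 v w = -1 * tcup b.1 b.2 v w + u w);rewrite mulN1r addrC.
 have [z2 e2] := fcl_scaleD (-1) z1 zu;split=> //.
 have -> : fc n (fun w => -1 * tcup b.1 b.2 v w + u w) = fc n u - fc b.1 b.2 * fc (n - b.1) v.
  apply: etrans e2 _;rewrite scaleN1r addrC;congr (_ - _);apply: etrans e1 _.
  by apply: esym;apply: (evens_central evb zb (hcl_fcl zv)).
 exact: Iy'.
move=> N gN BN NZ;have [||s [sN Ns]] := nS N (gsubt _ gN);[exact: BN|exact: NZ|].
exists s;split=> // n u /Ns;elim=> *;[exact: gen_base|exact: gen_mem|exact: gen_add|exact: gen_scale|].
by apply: gen_op => //;apply/sub.
Qed.
End Ideals.

Lemma Ess_hpr (k : fieldType) (gT : finGroupType) (G : {group gT}) n (x : 'H^*(G, k)) : Ess x -> Ess (hpr n x).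
by move=> Ex L prL;have := hpr_pullback (subg_inclM (proper_sub prL)) n x;rewrite [X in hpr n X](Ex L prL) raddf0 => /esym. Qed.
(** Operators that may be added freely in the search for generators of Ess(G), because they act on
    it as zero. *)
Definition goodb (k : fieldType) (gT : finGroupType) (G : {group gT}) (b : nat * (seq gT -> k)) :=
 [/\ zt G b.1 b.2, (0 < b.1)%N, ~~ odd b.1 & forall x : 'H^*(G, k), Ess x -> fcl G b.1 b.2 * x = 0].

(** By Frobenius reciprocity the product only sees the restrictions of x to the conjugates of H,
    which are proper subgroups. *)
Lemma trf_good (k : fieldType) (gT : finGroupType) (G H : {group gT}) n (a : seq gT -> k) :
 H \proper G -> zt H n a -> (0 < n)%N -> ~~ odd n -> goodb G (n, trf H G a).
move=> prH za n0 on;have sH := proper_sub prH;have zt1 := trf_zt sH za.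
split=> //= x Ex;have [M /(_ M (leqnn M)) ->] := hpr_sum x;rewrite mulr_sumr big1 // => i _.
have [f zf ef] := hcl_fclP (hcl_hpr i x);have Ef := Ess_hpr i Ex;rewrite ef in Ef *.
apply: etrans (fclM zt1 zf) _;apply/(fcl0P (zt_lcup' zt1 zf));apply: trf_mul_bt => // r rG.
have prHr: (H :^ r)%G \proper G.
 by rewrite properEcard /= cardJg (proper_card prH) andbT -(conjGid rG) conjSg.
have := Ef _ prHr;rewrite fcl_Res // => /fcl0P;apply;exact: zt_sub (proper_sub prHr) zf.
Qed.
Lemma conj_pull (k : fieldType) (gT : finGroupType) (E : {group gT}) r : r \in 'N(E)%g ->
 exists c : {rmorphism 'H^*(E, k) -> 'H^*(E, k)}, forall n f, zt E n f ->
 zt E n (fun w => f (map (conjg^~ r^-1%g) w)) /\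
 c (fcl E n f) = fcl E n (fun w => f (map (conjg^~ r^-1%g) w)).
move=> rN;pose phi (u : subg_of E) := subg E (sgval u ^ r^-1)%g.
have inE' (u : subg_of E) : (sgval u ^ r^-1)%g \in E by rewrite memJ_norm ?groupV ?subgP.
have phiM: {morph phi : x y / (x * y)%g}.
 by move=> u v;apply: (can_inj (@sgvalK _ E));rewrite /phi subgK ?inE' // [RHS]/= !subgK ?inE' //;exact: conjMg.
exists (cohomology_pullback phiM) => n f zf.
by apply: fcl_pullback zf => u;rewrite /phi subgK.
Qed.
Lemma prod_zero (R : nzRingType) (I : eqType) (s : seq I) (F : I -> R) i : i \in s -> F i = 0 ->
 \prod_(j <- s) F j = 0.
move=> + Fi;elim: s => // j s IH;rewrite inE big_cons => /orP[/eqP<-|/IH ->].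
 by rewrite Fi mul0r.
by rewrite mulr0.
Qed.
Lemma hcl_prod (k : fieldType) (gT : finGroupType) (I : Type) (s : seq I) (F : I -> cohomology k gT) m :
 (forall i, List.In i s -> hcl m (F i)) -> hcl (size s * m) (\prod_(i <- s) F i).
elim: s => [|i s IH] h;first by rewrite big_nil;apply: hcl1.
rewrite big_cons mulSn;apply: hclM;first by apply: h;left.
by apply: IH => j js;apply: h;right.
Qed.
Lemma InP (T : eqType) (x : T) s : reflect (List.In x s) (x \in s).
elim: s => [|y s IH] /=;first by right.
rewrite inE eq_sym;apply: (iffP orP) => [[/eqP|/IH]|[->|/IH]];by [left|right|left;rewrite eqxx|right].
Qed.
Lemma In_cat (T : Type) (x : T) s t : List.In x (s ++ t) -> List.In x s \/ List.In x t.
exact: List.in_app_or. Qed.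

(** * The inductive step for noncentral elementary abelian subgroups *)

Section Step.
Variables (k : fieldType) (p : nat) (gT : finGroupType) (G C E : {group gT}).
Hypotheses (p_pr : prime p) (char_k : p \in [pchar k]) (pG : (p.-group G)%g) (aE : (p.-abelem E)%g).
Hypotheses (sEG : E \subset G) (sCE : C \subset E) (CZ : C \subset 'Z(G)%g) (nZ : ~~ (E \subset 'Z(G)%g)).
Let H := ('C_G(E))%G.
Let q := #|H : E|%g.
Local Notation chr := {ffun gT -> 'F_p}.
Implicit Types (l : chr) (A : {set gT}).

Let cEE : abelian E := abelem_abelian aE.
Let sHG : H \subset G. Proof. exact: subsetIl. Qed.
Let prH : H \proper G.
rewrite properEneq sHG andbT;apply: contra nZ => /eqP e;apply/subsetP => x xE.
rewrite inE (subsetP sEG) //=;apply/centP => y;rewrite -e => /setIP[_ /centP cy].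
by rewrite /commute cy.
Qed.
Let EZH : E \subset 'Z(H)%g.
apply/subsetP => x xE;rewrite inE /= inE (subsetP sEG) //= (subsetP cEE) //=.
by apply/centP => y /setIP[_ /centP cy];rewrite /commute cy.
Qed.
Let sEH : E \subset H := subset_trans EZH (center_sub H).
Let pH : (p.-group H)%g := pgroupS sHG pG.

Definition gchr l := achar E l /\ exists2 g, g \in E & l g != 0.
Definition cchr l := gchr l /\ forall g, g \in C -> l g = 0.
(** By [euler_char] this is the restriction of a class of the centraliser H of E; since q is a power
    of p, it is additive in l. *)
Definition mu l : 'H^*(E, k) := beta k E l ^+ q.

Let qs : exists s, q = (p ^ s)%N.
by have [|s e] := @p_natP p q;[apply: pnat_dvd (dvdn_indexg _ _) _|exists s]. Qed.
Let q0 : (0 < q)%N. Proof. exact: indexg_gt0. Qed.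
Let F_ex : exists F : chr -> seq gT -> k, forall l, gchr l ->
 [/\ zt H (2 * q) (F l), fcl E (2 * q) (F l) = mu l
  & forall E' : {group gT}, E' \subset H -> (forall g, g \in E :&: E' -> l g = 0) -> bt E' (2 * q) (F l)].
have h l : exists f : seq gT -> k, gchr l -> [/\ zt H (2 * q) f, fcl E (2 * q) f = mu l
  & forall E' : {group gT}, E' \subset H -> (forall g, g \in E :&: E' -> l g = 0) -> bt E' (2 * q) f].
 have [[cl nl]|ng] := pselect (gchr l);last by exists (fun=> 0).
 by have [f Hf] := euler_char p_pr char_k aE pH EZH cl nl;exists f.
by have [F HF] := choice h;exists F.
Qed.
(** The Weyl group N_G(E)/C_G(E), as a set of cosets of H. *)
Definition Wset := [set A in rcosets H G | fingroup.repr A \in 'N(E)%g].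

Let c_ex : exists c : {set gT} -> {rmorphism 'H^*(E, k) -> 'H^*(E, k)}, forall A, A \in Wset ->
 forall n f, zt E n f -> zt E n (fun w => f (map (conjg^~ (fingroup.repr A)^-1%g) w)) /\
 c A (fcl E n f) = fcl E n (fun w => f (map (conjg^~ (fingroup.repr A)^-1%g) w)).
have h A : exists c : {rmorphism 'H^*(E, k) -> 'H^*(E, k)}, A \in Wset ->
 forall n f, zt E n f -> zt E n (fun w => f (map (conjg^~ (fingroup.repr A)^-1%g) w)) /\
 c (fcl E n f) = fcl E n (fun w => f (map (conjg^~ (fingroup.repr A)^-1%g) w)).
 have [AW|nA] := boolP (A \in Wset).
  by have [|c Hc] := @conj_pull k gT E (fingroup.repr A);[by move: AW;rewrite inE => /andP[]|exists c].
 by have [|c _] := @conj_pull k gT E 1%g;[exact: group1|exists c].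
by have [c Hc] := choice h;exists c.
Qed.
(** Mackey's formula. On E only the cosets fixed by E contribute; they correspond to conjugates of E
    contained in H, and a vanishes on all of these except E itself, which leaves a sum over the Weyl
    group. *)
Lemma trf_res (c : {set gT} -> {rmorphism 'H^*(E, k) -> 'H^*(E, k)}) n a :
 (forall A, A \in Wset -> forall n f, zt E n f -> zt E n (fun w => f (map (conjg^~ (fingroup.repr A)^-1%g) w)) /\
 c A (fcl E n f) = fcl E n (fun w => f (map (conjg^~ (fingroup.repr A)^-1%g) w))) -> zt H n a ->
 (forall x, x \in G -> (E :^ x)%G \subset H -> (E :^ x)%g != E -> bt (E :^ x)%G n a) ->
 fcl E n (trf H G a) = \sum_(A in Wset) c A (fcl E n a).
move=> Hc za bad;pose Y := rcosets H G.
pose fx A := [forall g in E, (A :* g)%g == A].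
have zaE := zt_sub sEH za.
have zY: zQ (fun A g => (A :* g)%g) E (fun A => A \in Y) 0 n (trc a).
 move=> A w AY Ew sz;apply: (trc_zQ sHG za) => //.
 by apply/allP => x /(allP Ew)/(subsetP sEG).
have YE A g : A \in Y -> g \in E -> (A :* g)%g \in Y.
 by move=> AY gE;apply: rcosets_stable => //;apply: (subsetP sEG).
have bs := fixed_sum_bt char_k aE YE zY.
have fixP A : A \in Y -> fx A -> (E :^ (fingroup.repr A)^-1)%g \subset H /\
 forall w, all [in E] w -> trc a A w = a (map (conjg^~ (fingroup.repr A)^-1%g) w).
 move=> AY /forall_inP fA;split.
  apply/subsetP => _ /imsetP[g gE ->];have [eA rG] := rcoset_rep sHG AY.
  have := mem_rcoset H (fingroup.repr A) (fingroup.repr A * g)%g.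
  rewrite conjgE invgK mulgA => <-;rewrite -eA.
  have := rcoset_refl H (fingroup.repr A);rewrite -eA => rA.
  have : (fingroup.repr A * g)%g \in (A :* g)%g by rewrite mem_rcoset mulgK.
  by rewrite (eqP (fA g gE)).
 by move=> w Ew;apply: trc_fixed => g gw;apply/eqP/fA/(allP Ew).
have WY A : A \in Wset -> A \in Y /\ fx A.
 rewrite inE => /andP[AY rN];split=> //;apply/forall_inP => g gE;have [eA rG] := rcoset_rep sHG AY.
 rewrite {1}eA [X in _ == X]eA -rcosetM;apply/eqP/rcoset_eqP;rewrite mem_rcoset.
 have : (g ^ (fingroup.repr A)^-1)%g \in E by rewrite memJ_norm ?groupV.
 by rewrite conjgE invgK mulgA => /(subsetP sEH).
have sum_fcl (P : pred {set gT}) (B : {set gT} -> seq gT -> k) : (forall A, P A -> zt E n (B A)) ->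
  zt E n (fun w => \sum_(A | P A) B A w) /\ fcl E n (fun w => \sum_(A | P A) B A w) = \sum_(A | P A) fcl E n (B A).
 move=> zB;elim: (index_enum _) => [|A s [zs es]].
  have z0: zt E n (fun w => \sum_(A <- [::] | P A) B A w).
   by move=> w _ _;rewrite (_ : (fun w => _) = fun=> 0) ?dt0 //;apply/funext => u;rewrite big_nil.
  split=> //;rewrite big_nil;apply/(fcl0P z0);exists (fun=> 0) => w _ _.
  by rewrite dt0 big_nil.
 rewrite [X in _ = X]big_cons;case PA: (P A);last first.
  by rewrite (_ : (fun w => _) = fun w => \sum_(A <- s | P A) B A w) //;apply/funext => w;rewrite big_cons PA.
 rewrite (_ : (fun w => _) = fun w => 1 * B A w + \sum_(A <- s | P A) B A w).
  have [z1 e1] := fcl_scaleD 1 (zB A PA) zs;split=> //.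
  by apply: etrans e1 _;rewrite scale1r es.
 by apply/funext => w;rewrite big_cons PA mul1r.
have zfx A : (A \in Y) && fx A -> zt E n (trc a A).
 move=> /andP[AY /forall_inP fA] w Ew sz;rewrite -(zY A w AY Ew) ?addn0 //.
 by case: w Ew {sz} => //= g w /andP[gE _];rewrite (eqP (fA g gE)).
have [zs es] := sum_fcl _ _ zfx.
have ztr := zt_sub sEG (trf_zt sHG za).
apply: etrans (proj2 (fcl_eq ztr zs) bs) _;apply: etrans es _.
rewrite (bigID (mem Wset)) /= [X in _ + X]big1 ?addr0;last first.
 move=> A /andP[/andP[AY fA] nW];have [sA eA] := fixP A AY fA.
 apply/(fcl0P (zfx A _));first by rewrite AY.
 have [_ rG] := rcoset_rep sHG AY.
 have nE: (E :^ (fingroup.repr A)^-1)%g != E.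
  by apply: contra nW => /eqP e;rewrite inE AY -groupV;apply/normP.
 have b' := bad _ (groupVr rG) sA nE.
 have cM: {in E &, {morph (conjg^~ (fingroup.repr A)^-1%g) : x y / (x * y)%g}} by move=> x y _ _;apply: conjMg.
 have [|h' Hh'] := bt_map_in cM _ b';first by move=> g gE;rewrite memJ_conjg.
 by exists h' => w Ew sz;rewrite eA // -Hh'.
apply: eq_big => [A|A /andP[/andP[AY fA] AW]].
 by apply/andP/idP => [[]//|AW];have [-> ->] := WY A AW.
have [_ eA] := fixP A AY fA;have [zc ->] := Hc A AW n a zaE.
apply: eq_fcl => [|w Ew _];[by apply: zfx;rewrite AY|exact: eA].
Qed.
Definition cchrs : seq chr := [seq l <- enum {: chr} | `[< cchr l >]].
Lemma cchrsP l : l \in cchrs -> cchr l.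
by rewrite mem_filter => /andP[/asboolP]. Qed.
Let avoid (D : {group gT}) : D \subset E -> C \subset D -> (D : {set gT}) != E -> exists2 l, l \in cchrs & forall g, g \in D -> l g = 0.
move=> sDE sCD nDE;have /properP[_ [x xE xD]] : D \proper E by rewrite properEneq nDE.
have [l [cl lD lx]] := achar_exists p_pr aE sDE xE xD;exists l => //.
rewrite mem_filter mem_enum andbT;apply/asboolP;split;last by move=> g /(subsetP sCD)/lD.
by split=> //;exists x;rewrite // lx oner_eq0.
Qed.
Let nCE : (C : {set gT}) != E.
by apply: contra nZ => /eqP <-. Qed.
(** Take the product over all nonzero characters trivial on C of the classes on H with restriction
    mu l. It vanishes on each conjugate E^x in H other than E: the intersection of E and E^x
    contains C and is proper in E, so some of these characters is trivial on it. Multiplied by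
    classes for further characters ls, its transfer restricts to the sum over the Weyl group of the
    conjugates of the product of the mu l. Combinations of such sums with coefficients in H(E)
    isolate the term of the trivial coset, multiplied by differences of conjugate classes mu; these
    differences are themselves of the form mu l, with l trivial on C. *)
Lemma abelem_transfers : exists bs (Lam : seq chr), [/\ forall b, List.In b bs -> goodb (k := k) G b,
 forall l, List.In l Lam -> cchr l & inI bs (\prod_(l <- Lam) mu l)].
have [F HF] := F_ex;have [c Hc] := c_ex.
pose U l : 'H^*(H, k) := fcl H (2 * q) (F l).
have hU l : gchr l -> hcl (2 * q) (U l) by move=> /HF[zF _ _];apply: hcl_fcl.
have RU l : gchr l -> Res sEH (U l) = mu l.
 by move=> gl;have [zF <- _] := HF l gl;apply: fcl_Res.
have hmu l : gchr l -> hcl (2 * q) (mu l) by move=> gl;rewrite -RU //;apply: hcl_pullback;apply: hU.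
have mul l : gchr l -> exists2 f, zt E (2 * q) f & mu l = fcl E (2 * q) f.
 by move=> gl;have [zF <- _] := HF l gl;exists (F l) => //;apply: zt_sub zF.
have eve (x y : 'H^*(E, k)) : hcl (2 * q) x -> x * y = y * x.
 by move=> hx;apply: even_central hx _;rewrite -signr_odd mul2n odd_double.
have [l0 l0C _] : exists2 l, l \in cchrs & forall g, g \in C -> l g = 0 by apply: avoid.
have base ls : (forall l, List.In l ls -> gchr l) -> exists b, goodb (k := k) G b /\
  fcl E b.1 b.2 = \sum_(A in Wset) c A (\prod_(l <- cchrs ++ ls) mu l).
 move=> gls;have gall l : List.In l (cchrs ++ ls) -> gchr l.
  by move=> lin;case: (In_cat lin) => [/InP lC|/gls //];have [] := cchrsP lC.
 have hP := hcl_prod (fun l lin => hU l (gall l lin)).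
 have [a za ea] := hcl_fclP hP;set n := (_ * _)%N in hP za ea.
 have n0: (0 < n)%N.
  by rewrite /n size_cat !muln_gt0 q0 /= andbT addn_gt0;case: (cchrs) l0C.
 have en: ~~ odd n by rewrite /n mulnCA mul2n odd_double.
 exists (n, trf H G a);split;first exact: trf_good.
 have eR: fcl E n a = \prod_(l <- cchrs ++ ls) mu l.
  rewrite -(fcl_Res sEH za) -ea rmorph_prod;elim: (_ ++ _) gall => [|l s IH] gall;first by rewrite !big_nil.
  rewrite !big_cons;congr (_ * _);first by apply: RU;apply: gall;left.
  by apply: IH => j js;apply: gall;right.
 rewrite -eR;apply: (trf_res Hc za) => x xG sEx nEx.
 pose D := (E :&: (E :^ x))%G.
 have [||| l lC lD] := avoid (D := D).
 - exact: subsetIl.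
 - rewrite subsetI sCE /=;apply/subsetP => y yC;have /setIP[yG /centP cy] := subsetP CZ y yC.
  by rewrite mem_conjg conjgE invgK mulgA -(cy x xG) mulgK (subsetP sCE).
 - apply: contra nEx => /eqP/setIidPl sE;by rewrite eq_sym eqEcard sE cardJg /=.
 have zaE' := zt_sub sEx za.
 apply/(fcl0P zaE');rewrite -(fcl_Res sEx za) -ea rmorph_prod.
 apply: (prod_zero (i := l));first by rewrite mem_cat lC.
 have [zF _ vF] := HF l (proj1 (cchrsP lC)).
 apply: etrans (fcl_Res sEx zF) _;apply/(fcl0P (zt_sub sEx zF));exact: vF.
pose nu (v : {set gT} * chr) := c v.1 (mu v.2).
(* The second product vanishes at A as soon as vs contains a pair with first entry A. Expanding it,
   one factor at a time, writes el as a combination of the sums realised in [base]. *)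
pose el ls vs := \sum_(A in Wset) c A (\prod_(l <- cchrs ++ ls) mu l) *
 \prod_(v <- vs) (nu v - c A (mu v.2)).
have elim vs ls : (forall l, List.In l ls -> gchr l) ->
  (forall v, List.In v vs -> v.1 \in Wset /\ gchr v.2) ->
  exists bs, (forall b, List.In b bs -> goodb (k := k) G b) /\ inI bs (el ls vs).
 elim: vs ls => [|v vs IH] ls gls gvs.
  have [b [gb eb]] := base ls gls;exists [:: b];split=> [_ [<-|[]] //|].
  have e0: el ls [::] = fcl E b.1 b.2.
   by rewrite eb;apply: eq_bigr => A _;rewrite big_nil mulr1.
  by exists 1;rewrite /= mulr1 e0 subrr.
 have [vW gv] := gvs v (or_introl erefl).
 have {}gvs w : List.In w vs -> w.1 \in Wset /\ gchr w.2 by move=> h;apply: gvs;right.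
 have [bs1 [g1 I1]] := IH ls gls gvs.
 have [|bs2 [g2 I2]] := IH (rcons ls v.2) _ gvs.
  by move=> l;rewrite -cats1 => lin;case: (In_cat lin) => [/gls//|[<-|[]]].
 exists (bs1 ++ bs2);split;first by move=> b lin;case: (In_cat lin) => [/g1|/g2].
 have hnu: hcl (2 * q) (nu v).
  by have [f zf e] := mul v.2 gv;have [zc ec] := Hc v.1 vW _ _ zf;rewrite /nu e ec;apply: hcl_fcl.
 have -> : el ls (v :: vs) = el ls vs * nu v + el (rcons ls v.2) vs * -1.
  rewrite /el mulr_suml mulr_suml -big_split;apply: eq_bigr => A _ /=.
  have ep: c A (\prod_(l <- cchrs ++ rcons ls v.2) mu l) = c A (\prod_(l <- cchrs ++ ls) mu l) * c A (mu v.2).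
   by rewrite -rcons_cat -cats1 [in LHS]big_cat big_seq1 rmorphM.
  rewrite big_cons ep mulrN1.
  rewrite mulrBl mulrBr (eve (nu v)) // mulrA;congr (_ - _);by rewrite mulrA.
 by apply: inI_cat;apply: inIM.
have HW: (H : {set gT}) \in Wset.
 rewrite inE;apply/andP;split;last by rewrite repr_group group1.
 by apply/rcosetsP;exists 1%g;rewrite ?group1 ?rcoset1.
pose tw A l : chr := [ffun g => l (g ^ (fingroup.repr A)^-1)%g].
have twP A : A \in Wset -> (forall g, g \in E -> (g ^ (fingroup.repr A)^-1)%g \in E).
 by rewrite inE => /andP[_ rN] g gE;rewrite memJ_norm ?groupV.
have ctw A l : A \in Wset -> achar E l -> achar E (tw A l).
 by move=> AW cl x y xE yE;rewrite !ffunE conjMg cl // twP.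
(* A coset A other than H moves some g in E, so a character separating g from its conjugate is
   changed by A. The change is trivial on C, since C is central. *)
have lam_ex A : exists l, A \in Wset -> A != H -> gchr l /\ cchr [ffun g => tw A l g - l g].
 have [AW|nA] := boolP (A \in Wset);last by exists 0.
 have [AH|nH] := eqVneq A H;first by exists 0.
 have AY: A \in rcosets H G by move: AW;rewrite inE => /andP[].
 have [eA rG] := rcoset_rep sHG AY;set r := fingroup.repr A in eA rG.
 have /existsP[g /andP[gE ng]] : [exists g in E, g ^ r^-1 != g]%g.
  rewrite -negb_forall_in;apply: contra nH => /forall_inP fE;rewrite eA;apply/eqP/rcoset_id.
  rewrite inE rG -groupV;apply/centP => y yE;have /eqP e := fE y yE.
  by rewrite /commute -[in LHS]e conjgE invgK !mulgA mulVg mul1g.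
 have gA := twP A AW g gE;pose x := (g ^ r^-1 * g^-1)%g.
 have xE: x \in E by rewrite groupM ?groupV.
 have x1: x \notin (1%G : {group gT}) by rewrite inE -eq_mulgV1.
 have [l [cl _ lx]] := achar_exists p_pr aE (sub1G E) xE x1.
 have dl: l (g ^ r^-1)%g - l g = 1 by rewrite -lx /x (cl _ _ gA (groupVr gE)) (acharV cl gE).
 exists l => _ _;split.
  by split=> //;exists x;rewrite // lx oner_eq0.
 split;first split.
 - by apply: acharB => //;apply: ctw.
 - by exists g;rewrite // !ffunE dl oner_eq0.
 move=> y yC;have /setIP[_ /centP cy] := subsetP CZ y yC;rewrite !ffunE conjgE invgK.
 by rewrite mulgA -[fingroup.repr A]/r -(cy r rG) mulgK subrr.
have [lam Hlam] := choice lam_ex.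
pose WL := enum (Wset :\ (H : {set gT})).
have WLP A : A \in WL -> A \in Wset /\ A != H by rewrite mem_enum in_setD1 => /andP[-> ->].
pose vs := [seq (A, lam A) | A <- WL].
have [||bs [gb Ib]] := elim vs [::];first by [].
 by move=> v /InP/mapP[A AL ->] /=;have [AW nA] := WLP A AL;have [] := Hlam A AW nA.
exists bs, (cchrs ++ [seq [ffun g => tw A (lam A) g - lam A g] | A <- WL]);split=> //.
 move=> l lin;case: (In_cat lin) => [/InP/cchrsP//|/InP/mapP[A AL ->]].
 by have [AW nA] := WLP A AL;have [] := Hlam A AW nA.
suff <- : el [::] vs = \prod_(l <- cchrs ++ [seq [ffun g => tw A (lam A) g - lam A g] | A <- WL]) mu l by [].
have cH l : gchr l -> c H (mu l) = mu l.
 move=> gl;have [f zf ->] := mul l gl;have [zc ->] := Hc _ HW _ _ zf.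
 apply: eq_fcl => // w _ _;congr f;rewrite -[RHS]map_id;apply: eq_map => u.
 by rewrite repr_group invg1 conjg1.
have ctwE A l : A \in Wset -> gchr l -> c A (mu l) = mu (tw A l).
 move=> AW [cl nl];rewrite /mu rmorphXn;congr (_ ^+ _).
 have [zc ->] := Hc A AW _ _ (bta_zt p_pr char_k aE cl);apply: eq_fcl => // -[|g [|h []]] // _ _.
 by rewrite /= /bta /pW0 /cval !ffunE.
rewrite /el (bigD1 (H : {set gT})) //= [X in _ + X]big1 ?addr0;last first.
 move=> A /andP[AW nA];rewrite (prod_zero (i := (A, lam A))) ?mulr0 //.
  by apply: map_f;rewrite mem_enum in_setD1 nA AW.
 by rewrite /nu /= subrr.
rewrite cats0 big_cat;congr (_ * _).
 rewrite rmorph_prod;apply: eq_big_seq => l /cchrsP[gl _];exact: cH.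
rewrite /vs !big_map;apply: eq_big_seq => A AL;have [AW nA] := WLP A AL.
have [gl [[ctl _] _]] := Hlam A AW nA;have [s es] := qs.
rewrite /nu /= cH // ctwE // /mu es;apply: esym;apply: (betaBX p_pr char_k aE s _ (proj1 gl)).
by apply: ctw => //;case: gl.
Qed.
(** The quotient of H(E) by the ideal of bs is a quotient of H(E) modulo the product of the mu l,
    which is filtered by copies of quotients of H(E)/(beta l). These are controlled by ker l, a
    proper subgroup of E that contains C. *)
Lemma noeth_abelem_step : exists bs, (forall b, List.In b bs -> goodb (k := k) G b) /\
 forall A : seq (nat * (seq gT -> k)), (forall b, List.In b bs -> List.In b A) -> evens A -> cocycles E A ->
 (forall K : {group gT}, C \subset K -> K \proper E -> noeth (top A) (zt K) (bt K)) ->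
 noeth (top A) (zt E) (bt E).
have [bs [Lam [gb gL Ib]]] := abelem_transfers;exists bs;split=> // A sA ev cA IH.
apply: (noeth_ideal ev cA sA).
have cbs: cocycles E bs by move=> b /sA/cA.
have gI: gsub (top A) (cI (inI (k := k) (E := E) bs)).
 by apply: gsub_ideal => //;[exact: inI0|exact: inID|exact: inIM].
suff n1 : noeth (top A) (zt E) (cmul (\prod_(l <- Lam) mu l)).
 by apply: (noeth_mono gI _ _ n1);[by []|move=> n u h;exact: (inI_cmul Ib h)].
have nb l : List.In l Lam -> noeth (top A) (zt E) (cmul (beta k E l)).
 move=> /gL[[cl nl] lC];have nM := @noeth_beta k p gT E p_pr char_k aE A l cl nl cA.
 have zb := bta_zt p_pr char_k aE cl.
 apply: (noeth_mono (gsub_cmul _ cA) _ _ (nM _));first by [].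
  by move=> n u /(multiplesP _ _ zb).
 apply: IH.
  by apply/subsetP => g gC;rewrite inE (subsetP sCE) // lC //=.
 apply/properP;split;first by apply/subsetP => g;rewrite inE => /andP[].
 by have [g gE lg] := nl;exists g;rewrite // inE gE.
apply: (noeth_cmul_prod (m := fun=> (2 * q)%N)) => // l lL;have [[cl _] _] := gL l lL.
split;first by apply/hclX/hcl_beta.
rewrite /mu;elim: (q) => [|n IHn];first by rewrite expr0;apply: cmul1.
by rewrite exprS;apply: (noeth_cmul_mul cA (hcl_beta p_pr char_k aE cl) (nb l lL) IHn).
Qed.
End Step.

Lemma noeth_more (k : fieldType) (U : lmodType k) (ops ops' : seq (nat * (U -> U))) Z B :
 (forall o, List.In o ops -> List.In o ops') -> noeth ops Z B -> noeth ops' Z B.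
move=> sub nZ N gN BN NZ;have [|s [sN Ns]] := nZ N _ BN NZ;first by apply: gsub_sub gN => o /sub.
exists s;split=> // n u /Ns;elim=> *;[exact: gen_base|exact: gen_mem|exact: gen_add|exact: gen_scale|].
by apply: gen_op => //;apply: sub.
Qed.

(** * Induction over the subgroups between C and G *)

Section Assembly.
Variables (k : fieldType) (p : nat) (gT : finGroupType) (G C : {group gT}).
Hypotheses (p_pr : prime p) (char_k : p \in [pchar k]) (pG : (p.-group G)%g).
Hypothesis lC : largest_central_abelem p G C.

(** The transfers are collected for all noncentral elementary abelian subgroups containing C before
    the induction on #|L| starts, so that every L is treated over the same operators. *)
Lemma noeth_all (A0 : seq (nat * (seq gT -> k))) : evens A0 -> cocycles G A0 ->
 noeth (top A0) (zt C) (bt C) -> exists bs, (forall b, List.In b bs -> goodb G b) /\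
 noeth (top (A0 ++ bs)) (zt G) (bt G).
move=> ev0 cA0 nC;have [aC CZ Cmax] := lC;have sCG := largest_central_abelem_sub lC.
pose cond (E : {group gT}) := [/\ (p.-abelem E)%g, C \subset E, E \subset G & ~~ (E \subset 'Z(G)%g)].
have hE (E : {group gT}) : exists bs, (forall b, List.In b bs -> goodb (k := k) G b) /\
 (cond E -> forall A : seq (nat * (seq gT -> k)), (forall b, List.In b bs -> List.In b A) -> evens A -> cocycles E A ->
 (forall K : {group gT}, C \subset K -> K \proper E -> noeth (top A) (zt K) (bt K)) ->
 noeth (top A) (zt E) (bt E)).
 have [[aE sCE sEG nZ]|nc] := pselect (cond E);last by exists [::].
 by have [bs [gb H]] := noeth_abelem_step p_pr char_k pG aE sEG sCE CZ nZ;exists bs.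
have [Bs HBs] := choice hE.
pose bs := flatten [seq Bs E | E <- enum {group gT}].
have inbs E b : List.In b (Bs E) -> List.In b bs.
 move=> bE;have : E \in enum {group gT} by rewrite mem_enum.
 rewrite /bs;elim: (enum _) => //= E' s IH;rewrite inE => /orP[/eqP<-|/IH h].
  by apply/List.in_or_app;left.
 by apply/List.in_or_app;right.
have gbs b : List.In b bs -> goodb G b.
 rewrite /bs;elim: (enum _) => //= E' s IH h;case: (In_cat h) => [h'|/IH //].
 by have [g _] := HBs E';apply: g.
exists bs;split=> //;set A := A0 ++ bs.
have evA: evens A.
 by move=> b h;case: (In_cat h) => [/ev0 //|/gbs[_ b0 ob _]];rewrite (negbTE ob).
have cA: cocycles G A by move=> b h;case: (In_cat h) => [/cA0 //|/gbs[]].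
have in0 b : List.In b A0 -> List.In b A by move=> h;apply/List.in_or_app;left.
have intop o : List.In o (top A0) -> List.In o (top A) by move=> /in_top[b /in0 h ->];apply: in_top_mem.
suff main : forall m (L : {group gT}), (#|L| < m)%N -> C \subset L -> L \subset G -> noeth (top A) (zt L) (bt L).
 exact: (main #|G|.+1).
elim=> // m IH L;rewrite ltnS => leL sCL sLG.
have cAL: cocycles L A by move=> b /cA;apply: zt_sub.
have IH' (S' : {group gT}) : C \subset S' -> S' \proper L -> noeth (top A) (zt S') (bt S').
 move=> sC pS;apply: IH => //;first exact: leq_trans (proper_card pS) leL.
 exact: subset_trans (proper_sub pS) sLG.
have pL := pgroupS sLG pG.
have [aL|naL] := boolP (p.-abelem L)%g.
 have [LZ|nZ] := boolP (L \subset 'Z(G)%g).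
  have eLC: L = C by apply/val_inj/eqP;rewrite eqEsubset sCL andbT;apply: Cmax.
  by rewrite eLC;apply: noeth_more nC.
 have [_ step] := HBs L;apply: step => // b bL;apply/List.in_or_app;right;exact: inbs bL.
have CZL: C \subset 'Z(L)%g.
 rewrite subsetI sCL /=;apply: subset_trans CZ _;rewrite /center;apply: subset_trans (subsetIr _ _) _.
 exact: centS.
(* L is not elementary abelian, so its Frattini subgroup is nontrivial and meets the centre, which
   provides z. *)
have Phi1: ('Phi(L) != 1)%g by rewrite (trivg_Phi pL).
have nPhi: ('Phi(L) <| L)%g := Phi_normal L.
have /trivgPn[x0 x0I x01] := meet_center_nil (pgroup_nil pL) nPhi Phi1.
have [z zI oz] : exists2 z, z \in ('Phi(L) :&: 'Z(L))%g & #[z]%g = p.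
 have pI: (p.-group ('Phi(L) :&: 'Z(L)))%g by apply: pgroupS pL;apply: subset_trans (subsetIl _ _) (Phi_sub L).
 have I1: ('Phi(L) :&: 'Z(L) :!=: 1)%g by apply/trivgPn;exists x0.
 have [_ pd _] := pgroup_pdiv pI I1.
 by have [z zI oz] := Cauchy p_pr pd;exists z.
have /setIP[zPhi zZ] := zI.
have zL: z \in L by case/setIP: zZ.
pose D := (C <*> <[z]>)%G.
have cCz: (<[z]> \subset 'C(C))%g.
 rewrite cycle_subG;apply/centP => y yC;have /setIP[_ /centP cy] := subsetP CZL y yC.
 by rewrite /commute (cy z zL).
have aD: (p.-abelem D)%g.
 have := cprod_abelem p (cprodEY cCz);rewrite aC /= => ->.
 by rewrite prime_abelem // -[#|_|]/#[z]%g oz.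
have sZD: (<[z]> \subset D)%g := joing_subr _ _.
(* K complements <z> in C <z>: it avoids z, and each c in C lies in K up to a power of z. *)
have /splitsP[K /complP[TK eK]] := abelem_splits aD sZD.
have sDZ: D \subset 'Z(L)%g by rewrite join_subG CZL cycle_subG.
have sKD: K \subset D by rewrite -eK;apply: mulG_subr.
have sKL: K \subset L := subset_trans sKD (subset_trans sDZ (center_sub L)).
have zK: z \notin K.
 apply/negP => zK;have : z \in (<[z]> :&: K)%g by rewrite inE cycle_id.
 by rewrite TK => /set1P z1;move: oz p_pr;rewrite z1 order1 => <-.
apply: (noeth_nonabelem p_pr char_k pL CZL zZ zPhi oz sKL zK _ cAL IH') => c cC.
have : c \in D by apply: (subsetP (joing_subl C <[z]>%g)).
rewrite -eK => /mulsgP[y u yz uK ec];have /cycleP[i ei] : (y^-1)%g \in <[z]>%g by rewrite groupV.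
exists i;rewrite -ei ec;have uZ := subsetP sDZ u (subsetP sKD u uK).
have -> : (y * u * y^-1)%g = u;last by rewrite inE uK.
case/cycleP: yz => j ->;have /setIP[_ /centP cu] := uZ.
by rewrite -(cu _ (groupX j zL)) mulgK.
Qed.
End Assembly.

(** * From cocycles to classes: finite generation of Ess(G) *)

Section RingGen.
Variables (k : fieldType) (gT : finGroupType) (L : {group gT}).
Implicit Types (A s : seq (nat * (seq gT -> k))).
Local Notation HL := 'H^*(L, k).

Definition zop (T : algType k) (R : seq (nat * T)) : seq (nat * (T -> T)) := [seq (b.1, fun x => x * b.2) | b <- R].
Definition rcls A : seq (nat * HL) := [seq (b.1, fcl L b.1 b.2) | b <- A].
Definition zero_deg (T : algType k) (n : nat) (x : T) := x = 0.

Lemma in_zop (T : algType k) (R : seq (nat * T)) o : List.In o (zop R) <-> exists2 b, List.In b R & o = (b.1, fun x => x * b.2).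
rewrite /zop;elim: R => [|b R IH] /=;first by split=> // -[].
split=> [[<-|/(proj1 IH)[b' bA ->]]|[b' [<-|bA] eo]];[by exists b;[left|]|by exists b';[right|]|by left|].
by right;apply: (proj2 IH);exists b'.
Qed.
Lemma in_rcls A c : List.In c (rcls A) <-> exists2 b, List.In b A & c = (b.1, fcl L b.1 b.2).
rewrite /rcls;elim: A => [|b R IH] /=;first by split=> // -[].
split=> [[<-|/(proj1 IH)[b' bA ->]]|[b' [<-|bA] eo]];[by exists b;[left|]|by exists b';[right|]|by left|].
by right;apply: (proj2 IH);exists b'.
Qed.
Lemma gen_fcl A s n u : cocycles L A -> cocycles L s -> gen (top A) (bt L) s n u ->
 zt L n u /\ gen (zop (rcls A)) (@zero_deg HL) (rcls s) n (fcl L n (u : seq gT -> k)).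
move=> cA cs;have gz := gsub_zt cA.
elim=> {n u} [n u bu|n u us|n u v _ [zu gu] _ [zv gv]|n a u _ [zu gu]|o n u oA _ [zu gu]].
- split;first exact: bt_zt.
 by apply: gen_base;apply/fcl0P => //;apply: bt_zt.
- split;first exact: (cs (n, u)).
 by apply: gen_mem;apply/in_rcls;exists (n, u).
- split;first exact: (gsubD gz).
 have [_ e] := @fcl_scaleD k gT L n 1 u v zu zv;rewrite scale1r in e.
 rewrite (_ : (u + v : seq gT -> k^o) = (fun w => 1 * u w + v w));last by apply/funext => w;rewrite mul1r.
 by rewrite [@fcl k _ _ _ _]e;apply: gen_add.
- split;first exact: (gsubZ gz).
 have [_ e] := @fcl_scaleD k gT L n a u 0 zu (gsub0 gz n).
 rewrite (_ : (a *: u : seq gT -> k^o) = (fun w => a * u w + (0 : seq gT -> k^o) w));last by apply/funext => w;rewrite addr0.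
 rewrite [@fcl k _ _ _ _]e;apply: gen_add;first exact: gen_scale.
 by apply: gen_base;apply/fcl0P;[exact: (gsub0 gz)|exists (fun=> 0) => w _ _;rewrite dt0].
have [b bA ->] := in_top oA;have [zt' e] := @fcl_tcup k gT L n b.1 b.2 u (cA _ bA) zu;split=> //.
rewrite [@fcl k _ _ _ _]e;apply: (@gen_op _ _ _ _ _ (b.1, fun x => x * fcl L b.1 b.2)) => //.
by apply/in_zop;exists (b.1, fcl L b.1 b.2) => //;apply/in_rcls;exists b.
Qed.
Lemma gen_unfcl A (S : seq (nat * HL)) : cocycles L A -> (forall n x, List.In (n, x) S -> hcl n x) ->
 exists s, cocycles L s /\ forall n x, gen (zop (rcls A)) (@zero_deg HL) S n x ->
 forall u, zt L n u -> fcl L n u = x -> gen (top A) (bt L) s n u.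
move=> cA hS.
have [s cs sS] : exists2 s, cocycles L s & forall n x, List.In (n, x) S -> exists2 u, List.In (n, u) s & x = fcl L n u.
 elim: S hS => [|[n x] S IH] hS;first by exists [::].
 have [|s cs sS] := IH;first by move=> m y h;apply: hS;right.
 have [u zu eu] := hcl_fclP (hS n x (or_introl erefl)).
 exists ((n, u) :: s);first by move=> b [<-|/cs].
 move=> m y [[<- <-]|/sS[v vs ->]];first by exists u;[left|].
 by exists v;[right|].
exists s;split=> // n x gx.
have gz := gsub_zt cA;have gb := gsub_bt cA;have gG := @gen_gsub k (seq gT -> k^o) (top A) (bt L) s gb.
have ext m (v v' : seq gT -> k) : zt L m v -> zt L m v' -> fcl L m v = fcl L m v' -> gen (top A) (bt L) s m v' -> gen (top A) (bt L) s m v.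
 move=> zv zv' /(fcl_eq zv zv') bv gv'.
 have -> : v = (fun w => v w - v' w : k^o) + (v' : seq gT -> k^o) by apply/funext => w;change (v w = v w - v' w + v' w);rewrite subrK.
 by apply: gen_add => //;apply: gen_base.
suff h : hcl n x /\ exists2 v, zt L n v /\ fcl L n v = x & gen (top A) (bt L) s n v.
 move=> u zu eu;have [_ [v [zv ev] gv]] := h;exact: (ext n u v zu zv (etrans eu (esym ev)) gv).
elim: gx => {n x} [n x ->|n x xS|n x y _ [hx [u [zu eu] gu]] _ [hy [v [zv ev] gv]]|n a x _ [hx [u [zu eu] gu]]|o n x oA _ [hx [u [zu eu] gu]]].
- split;first by rewrite /hcl raddf0.
 exists (fun=> 0);last exact: (gsub0 gG).
 have z0: zt L n (fun=> 0 : k) by move=> w _ _;rewrite dt0.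
 by split=> //;apply/(fcl0P z0);exists (fun=> 0) => w _ _;rewrite dt0.
- split;first exact: hS.
 by have [u us ->] := sS n x xS;exists u;[split=> //;exact: (cs _ us)|apply: gen_mem].
- split;first exact: hclD.
 exists (fun w => 1 * u w + v w).
  by have [z1 e1] := fcl_scaleD 1 zu zv;split=> //;rewrite e1 scale1r eu ev.
 rewrite (_ : (fun w => _) = (u : seq gT -> k^o) + v);first exact: gen_add.
 by apply/funext => w;rewrite mul1r.
- split;first exact: hclZ.
 exists (fun w => a * u w + 0 * u w).
  have [z0 e0] := fcl_scaleD 0 zu zu.
  have [z1 e1] := fcl_scaleD (a - 1) zu zu.
  rewrite (_ : (fun w => _) = (fun w => (a - 1) * u w + u w));last by apply/funext => w;ring.
  by split=> //;rewrite e1 eu scalerBl scale1r subrK.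
 rewrite (_ : (fun w => _) = a *: (u : seq gT -> k^o));first exact: gen_scale.
 by apply/funext => w;rewrite mul0r addr0.
have [b /in_rcls[c cAc ->] ->] := proj1 (in_zop _ _) oA;have zc := cA _ cAc.
have [z1 e1] := fcl_tcup zc zu;split;first by apply: hclM => //;apply: hcl_fcl.
exists (tcup c.1 c.2 u);first by split=> //;rewrite e1 eu.
exact: (@gen_op k (seq gT -> k^o) (top A) (bt L) s (c.1, tcup c.1 c.2) n u (in_top_mem cAc) gu).
Qed.
End RingGen.

Section EssFg.
Variables (k : fieldType) (p : nat) (gT : finGroupType) (G C : {group gT}).
Hypotheses (p_pr : prime p) (char_k : p \in [pchar k]) (pG : (p.-group G)%g).
Hypothesis lC : largest_central_abelem p G C.

(** Ess(G) is a submodule of the noetherian module H(G), hence finitely generated over A0 and the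
    transfers; as the transfers act by zero on it, A0 alone suffices. *)
Lemma ess_fg A0 : evens A0 -> cocycles (k := k) G A0 -> noeth (top A0) (zt C) (bt C) ->
 exists S : seq (nat * 'H^*(G, k)), (forall n x, List.In (n, x) S -> hcl n x /\ Ess x) /\
 forall n x, hcl n x -> Ess x -> gen (zop (rcls G A0)) (@zero_deg k 'H^*(G, k)) S n x.
move=> ev cA nC;have [bs [gbs nG]] := noeth_all p_pr char_k pG lC ev cA nC.
have [E0 ED EM] := @Ess_ideal k gT G.
have cAb: cocycles G (A0 ++ bs) by move=> b h;case: (In_cat h) => [/cA|/gbs[]].
have gN: gsub (top (A0 ++ bs)) (cI (@Ess k gT G)).
 by apply: gsub_ideal => // x y Ex;have [] := EM y x Ex.
have [||s [sN Ns]] := nG _ gN.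
- move=> n u bu;have zu := bt_zt bu;split=> //;rewrite [@fcl k _ _ _ _](proj2 (@fcl0P k gT G n u zu) bu) //.
- by move=> n u [].
have cs: cocycles G s by move=> [n u] /sN[].
exists (@rcls k gT G s);split.
 by move=> n x /in_rcls[[m u] us [-> ->]] /=;have [zu Eu] := sN _ _ us;split=> //;apply: hcl_fcl.
move=> n x hx Ex;have [u zu eu] := hcl_fclP hx;rewrite eu in Ex *.
suff g : gen (top A0) (bt G) s n u by have [] := gen_fcl cA cs g.
have gu := Ns n u (conj zu Ex).
have {gu} : cI (@Ess k gT G) n u /\ gen (top A0) (bt G) s n u;last by case.
elim: gu => {n u zu eu Ex hx x} [n u bu|n u us|n u v _ [Nu gu] _ [Nv gv]|n a u _ [Nu gu]|o n u oA _ [Nu gu]].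
- split;last exact: gen_base.
 by have zu := bt_zt bu;split=> //;rewrite [@fcl k _ _ _ _](proj2 (@fcl0P k gT G n u zu) bu).
- by split;[exact: sN|exact: gen_mem].
- by split;[exact: (gsubD gN)|exact: gen_add].
- by split;[exact: (gsubZ gN)|exact: gen_scale].
split;first exact: (gsubO gN).
have [b bA eo] := in_top oA;case: (In_cat bA) => [b0|bb].
 by apply: gen_op => //;rewrite eo;apply: in_top_mem.
apply: gen_base;rewrite eo /=;have [zb b0 ob kb] := gbs b bb;have [zu Eu] := Nu.
have [z1 e1] := @fcl_tcup k gT G n b.1 b.2 u zb zu;apply/(fcl0P z1);apply: etrans e1 _.
have ev1: ~~ (odd b.1 && ((-1) != 1 :> k)) by rewrite (negbTE ob).
by rewrite -(evens_central ev1 zb (hcl_fcl zu));apply: kb.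
Qed.
End EssFg.

Lemma coh_ind (k : fieldType) (gT : finGroupType) (L : {group gT}) (P : 'H^*(L, k) -> Prop) : P 0 ->
 (forall x y, P x -> P y -> P (x + y)) -> (forall n f, zt L n f -> P (fcl L n f)) -> forall x, P x.
move=> P0 PD Pf x;have [M /(_ M (leqnn M)) ->] := hpr_sum x;apply: (big_ind P) => // i _.
by have [f zf ->] := hcl_fclP (hcl_hpr i x);apply: Pf.
Qed.

(** * The coaction of a central subgroup of order p *)

Section Xi.
Variables (k : fieldType) (p : nat).
Hypotheses (p_pr : prime p) (char_k : p \in [pchar k]).

(** The Euler class of the polygons into which translation by c divides L; c acts freely on them, so
    it is nonzero on <c>. *)
Lemma eta_exists (gT : finGroupType) (L : {group gT}) c : (p.-group L)%g -> c \in 'Z(L)%g -> #[c]%g = p ->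
 exists m (f : seq gT -> k), [/\ (0 < m)%N, ~~ odd m, zt L m f & ~ bt <[c]>%G m f].
move=> pL cZ oc;pose K := (1%G : {group gT});have sKL: K \subset L := sub1G L.
have cK: c \notin K.
 by apply/negP => /set1P c1;move: oc p_pr;rewrite c1 order1 => <-.
have cL: c \in L by case/setIP: cZ.
pose act (B : {set gT}) g := (B :* g)%g.
have actM B g h : act (act B g) h = act B (g * h)%g by rewrite /act rcosetM.
have act1 B : act B 1%g = B by apply: rcoset1.
have gY := csh_gstable p_pr sKL cZ oc.
have gamL g : g \in L -> forall B, csh c (act B g) = act (csh c B) g by move=> _ B;rewrite /act csh_rcoset.
have YH B g : B \in rcosets K L -> g \in L -> act B g \in rcosets K L by apply: rcosets_stable.
have [s [W eW]] := euler_exists actM act1 p_pr char_k (@cshI _ c) gY pL gamL YH.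
have [cN cc cLL zW sW] := eW.
exists (2 * norb (csh c) (rcosets K L))%N, (W (set0, set0));split.
- have := norb_csh p_pr sKL cZ oc cK;have : (0 < #|L : K|%g)%N := indexg_gt0 _ _.
 by case: (norb _ _) => [|n] //;rewrite mul0n => /[swap] <-.
- by rewrite mul2n odd_double.
- exact: polyT_zt zW.
apply: (euler_nonzero actM act1 p_pr char_k (@cshI _ c) gY eW cL oc gamL) => [B|B];last exact: (csh_order p_pr sKL cZ oc cK).
case/rcosetsP => h hL ->;rewrite (csh_coset sKL cZ) // /act -rcosetM.
by case/setIP: cZ => _ /centP cC;rewrite (cC h hL).
Qed.

Variables (gT : finGroupType) (G : {group gT}).
Hypothesis pG : (p.-group G)%g.

(** A class as in [eta_exists] for G/K, where c still has order p, inflated to G. *)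
Lemma xi_exists (K : {group gT}) c : K \subset 'Z(G)%g -> c \in 'Z(G)%g -> #[c]%g = p -> c \notin K ->
 exists m (f : seq gT -> k), [/\ (0 < m)%N, ~~ odd m, zt G m f, ~ bt <[c]>%G m f
 & forall w w' : seq gT, map (coset K) w = map (coset K) w' -> f w = f w'].
move=> KZ cZ oc cK;have cG: c \in G by case/setIP: cZ.
have sKG := subset_trans KZ (center_sub G).
have nKG: G \subset 'N(K)%g.
 apply: subset_trans (cent_sub K);rewrite centsC;apply: subset_trans KZ _;exact: subsetIr.
have TI: <[c]>%g :&: K = 1%g by apply: prime_TIg;rewrite ?cycle_subG // -?[#|_|]/#[c]%g ?oc.
have inN g : g \in G -> g \in 'N(K)%g by apply: (subsetP nKG).
have cosM g h : g \in G -> h \in G -> coset K (g * h)%g = (coset K g * coset K h)%g.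
 by move=> gG hG;rewrite morphM ?inN.
have cosX i : coset K (c ^+ i)%g = (coset K c ^+ i)%g by rewrite morphX ?inN.
have inj u : u \in <[c]>%g -> coset K u = 1%g -> u = 1%g.
 move=> uc e;have uG: u \in G by apply: (subsetP _ _ uc);rewrite cycle_subG.
 have : u \in <[c]>%g :&: K by rewrite inE uc coset_idr // inN.
 by rewrite TI => /set1P.
have ocb: #[coset K c]%g = p.
 apply/eqP;rewrite eqn_dvd order_dvdn -cosX -{1}oc expg_order morph1 eqxx /= -oc order_dvdn.
 by apply/eqP/inj;rewrite ?mem_cycle // cosX expg_order.
have cbZ: coset K c \in 'Z(G / K)%g.
 rewrite inE mem_quotient //=;apply/centP => _ /morphimP[g gN gG ->].
 by rewrite /commute -!cosM //;case/setIP: cZ => _ /centP ->.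
have [m [f0 [m0 om zf0 nb0]]] := eta_exists (quotient_pgroup K pG) cbZ ocb.
exists m, (fun w => f0 (map (coset K) w));split=> //;last by move=> w w' ->.
 by apply: (zt_map_in (A := G) (pi := coset K) (fun g h gG hG => cosM g h gG hG) _ zf0) => g gG;apply: mem_quotient.
move=> bc;apply: nb0;pose sg x := odflt 1%g [pick u in <[c]> | coset K u == x]%g.
have sgP x : x \in <[coset K c]>%g -> sg x \in <[c]>%g /\ coset K (sg x) = x.
 case/cycleP => i ->;rewrite /sg;case: pickP => [u /andP[uc /eqP]//|/(_ (c ^+ i)%g)].
 by rewrite mem_cycle cosX eqxx.
have cyG u : u \in <[c]>%g -> u \in G by apply/subsetP;rewrite cycle_subG.
have sgM: {in <[coset K c]>%G &, {morph sg : x y / (x * y)%g}}.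
 move=> x y xc yc;have [ux ex] := sgP x xc;have [uy ey] := sgP y yc;have [uxy exy] := sgP _ (groupM xc yc).
 apply/eqP;rewrite eq_mulgV1;apply/eqP/inj;first by rewrite groupM ?groupV ?groupM.
 have gx := cyG _ ux;have gy := cyG _ uy;have gxy := cyG _ uxy.
 have e1: coset K (sg x * sg y)%g = (x * y)%g := etrans (cosM _ _ gx gy) (congr2 _ ex ey).
 apply: etrans (cosM _ _ gxy (groupVr (groupM gx gy))) _;rewrite exy morphV;last by apply: inN;apply: groupM.
 exact: etrans (congr1 (fun z => (x * y * z^-1)%g) e1) (mulgV _).
have [h Hh] := bt_map_in sgM (fun x xc => proj1 (sgP x xc)) bc.
exists h => w cw sz;rewrite -Hh // -map_comp;congr f0;rewrite -[LHS]map_id.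
by apply/eq_in_map => x /(allP cw) xc /=;have [_ ->] := sgP x xc.
Qed.

Section Mu.
Variables (c : gT).
Hypotheses (cZ : c \in 'Z(G)%g) (oc : #[c]%g = p).
Variable L : {group gT}.
Hypotheses (sLG : L \subset G) (cL : c \in L).
Local Notation CL := (cylinder L c).
Local Notation mulm := (fun g : gT * gT => (g.1 * g.2)%g).

Let inCL (u : gT * gT) : u \in CL -> u.1 \in L /\ u.2 \in 'Z(G)%g /\ u.2 \in L.
by rewrite inE => /andP[uL /cycleP[i ->]];rewrite !groupX. Qed.
Let mulmM : {in CL &, {morph mulm : x y / (x * y)%g}}.
move=> [x a] [y b] /inCL[/= xL [aZ aL]] /inCL[/= yL [bZ bL]] /=.
have /setIP[_ /centP ca] := aZ;rewrite -!mulgA;congr (_ * _)%g;rewrite !mulgA;congr (_ * _)%g.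
by rewrite (ca y (subsetP sLG y yL)).
Qed.
Let mulmL u : u \in CL -> mulm u \in L. Proof. by move=> /inCL[? [_ ?]];rewrite groupM. Qed.
Definition muphi (u : subg_of CL) : subg_of L := subg L (mulm (sgval u)).
Lemma muphiM : {morph muphi : x y / (x * y)%g}.
move=> u v;apply: (can_inj (@sgvalK _ L));rewrite /muphi subgK ?mulmL ?subgP //.
by rewrite [RHS]/= !subgK ?mulmL ?subgP // -mulmM ?subgP.
Qed.
(** The coaction, induced by multiplication L × <c> -> L, a homomorphism since c is central. [Io]
    below is the restriction to L × 1; it picks the coefficient of index 0. *)
Definition Mu : 'H^*(L, k) -> 'H^*(CL, k) := cohomology_pullback muphiM.
HB.instance Definition _ := GRing.LRMorphism.on Mu.

Lemma Mu_fcl n f : zt L n f -> zt CL n (fun w => f (map mulm w)) /\ Mu (fcl L n f) = fcl CL n (fun w => f (map mulm w)).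
by move=> zf;apply: fcl_pullback zf => u;rewrite /muphi subgK // mulmL ?subgP. Qed.
Definition iophi (u : subg_of L) : subg_of CL := subg CL (sgval u, 1%g).
Let inl1 (u : subg_of L) : (sgval u, 1%g) \in CL. Proof. by rewrite inE /= subgP group1. Qed.
Lemma iophiM : {morph iophi : x y / (x * y)%g}.
move=> u v;apply: (can_inj (@sgvalK _ CL));rewrite /iophi subgK ?inl1 //.
by rewrite [RHS]/= !subgK ?inl1 //;congr pair;rewrite /= mulg1.
Qed.
Definition Io : 'H^*(CL, k) -> 'H^*(L, k) := cohomology_pullback iophiM.
HB.instance Definition _ := GRing.LRMorphism.on Io.

Lemma Io_fcl n f : zt CL n f -> Io (fcl CL n f) = fcl L n (fun w => f (map (fun g => (g, 1%g)) w)).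
move=> zf;have [|_ e] := @fcl_pullback k _ _ L CL iophi iophiM (fun g => (g, 1%g)) n f _ zf;last exact: e.
by move=> u;rewrite /iophi subgK ?inl1.
Qed.
Lemma Io_Mu x : Io (Mu x) = x.
elim/coh_ind: x => [|x y ex ey|n f zf];first by rewrite !raddf0.
 by rewrite !raddfD /= ex ey.
have [z1 ->] := Mu_fcl zf;apply: etrans (Io_fcl z1) _;congr (fcl _ _ _);apply/funext => w.
by rewrite -map_comp (eq_map (g := id)) ?map_id // => g /=;rewrite mulg1.
Qed.
Lemma Io_Infl x : Io (Infl c x) = x.
elim/coh_ind: x => [|x y ex ey|n f zf];first by rewrite !raddf0.
 by rewrite !raddfD /= ex ey.
rewrite Infl_fcl //;have z1: zt CL n (infl (hT := gT) f) by apply/zts0/zts_infl/zts0.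
apply: etrans (Io_fcl z1) _;congr (fcl _ _ _);apply/funext => w.
by rewrite /infl -map_comp (eq_map (g := id)) ?map_id.
Qed.
Lemma Io_ebase i : (0 < i)%N -> Io (ebase (Yc k L c) (Zc k p L c) i) = 0.
have fx: findex (fun x : gT => c * x)%g 1%g 1%g = 0%N by apply: findex0.
have zz: zt CL 2 (zgen k p c) := zgen_zt k p_pr oc.
have zy: zt CL 1 (ygen k c) := ygen_zt p_pr char_k oc.
have z0 n : zt L n (fun=> 0 : k) by move=> w _ _;rewrite dt0.
have f0 n : fcl L n (fun=> 0 : k) = 0 by apply/(fcl0P (z0 n));exists (fun=> 0) => w _ _;rewrite dt0.
have IZ: Io (Zc k p L c) = 0.
 apply: etrans (Io_fcl zz) _;rewrite -(f0 2);apply: esym;apply: eq_fcl => // -[|g [|h []]] // _ _.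
 by rewrite /= /zgen /pW0 /= fx leqNgt prime_gt0 // oppr0.
have IY: Io (Yc k L c) = 0.
 apply: etrans (Io_fcl zy) _;rewrite -(f0 1);apply: esym;apply: eq_fcl => // -[|g []] // _ _.
 by rewrite /= /ygen /= fx.
case: i => [|[|i]] // _;rewrite /ebase /=;first by rewrite expr0 mulr1.
by rewrite negbK rmorphM rmorphXn /= [X in _ * X]exprS [Io (Zc _ _ _ _)]IZ mul0r mulr0.
Qed.
Lemma Io_esum M u : Io (esum (Infl c) (Yc k L c) (Zc k p L c) M u) = if (0 < M)%N then u 0%N else 0.
case: M => [|M];first by rewrite /esum big_ord0 raddf0.
rewrite /esum big_ord_recl raddfD raddf_sum /= big1 => [|i _];last by rewrite rmorphM /= Io_ebase // mul0r.
by rewrite addr0 /ebase /= expr0 mulr1 mul1r Io_Infl.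
Qed.
End Mu.
End Xi.

(** * Regularity on H(G) and on Ess(G) *)

Section Regular.
Variables (k : fieldType) (p : nat).
Hypotheses (p_pr : prime p) (char_k : p \in [pchar k]).
Variables (gT : finGroupType) (G : {group gT}).
Hypothesis pG : (p.-group G)%g.
Local Notation HG := 'H^*(G, k).

Lemma Res_sub0 (L M : {group gT}) (sLG : L \subset G) (sMG : M \subset G) (x : HG) : L \subset M ->
 Res sMG x = 0 -> Res sLG x = 0.
move=> sLM Mx;have [N /(_ N (leqnn N)) ->] := hpr_sum x;rewrite raddf_sum big1 // => i _.
have e: Res sMG (hpr i x) = 0.
 by have := hpr_pullback (subg_inclM sMG) i x;rewrite [X in hpr i X]Mx raddf0 => /esym.
have [f zf ef] := hcl_fclP (hcl_hpr i x);rewrite ef in e *.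
apply: etrans (fcl_Res sLG zf) _;have := etrans (esym (fcl_Res sMG zf)) e.
move=> /(fcl0P (zt_sub sMG zf))[h Hh];apply/(fcl0P (zt_sub sLG zf));exists h => w Lw sz.
by apply: Hh => //;apply/allP => y /(allP Lw)/(subsetP sLM).
Qed.

Variables (c : gT).
Hypotheses (cZ : c \in 'Z(G)%g) (oc : #[c]%g = p).
Let cG : c \in G. Proof. by case/setIP: cZ. Qed.
Local Notation CG := (cylinder G c).
Local Notation MuG := (Mu (k := k) cZ (subxx G) cG).
Local Notation Ess := (@Ess k gT G).

Let sCyl (L : {group gT}) : L \subset G -> cylinder L c \subset CG.
by move=> sL;apply/subsetP => u;rewrite !inE => /andP[/(subsetP sL) -> ->]. Qed.
Let Res_Infl (L : {group gT}) (sL : L \subset G) (x : HG) : Res (sCyl sL) (Infl c x) = Infl c (Res sL x).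
elim/coh_ind: x => [|x y ex ey|n f zf];first by rewrite !raddf0.
 by rewrite !raddfD /= ex ey.
have z1: zt CG n (infl (hT := gT) f) by apply/zts0/zts_infl/zts0.
rewrite Infl_fcl // fcl_Res // [X in _ = Infl c X]fcl_Res // Infl_fcl //;exact: zt_sub zf.
Qed.
(** A maximal subgroup Mx contains Phi(G), hence c, so the coaction is compatible with restriction
    to Mx. The coefficients of Mu x restrict to those of the coaction of Res x = 0, and the basis is
    free over H(Mx). *)
Lemma mu_ess (x : HG) : c \in 'Phi(G)%g -> Ess x -> exists M u, (forall i, Ess (u i)) /\
 MuG x = esum (Infl c) (Yc k G c) (Zc k p G c) M u.
move=> cPhi Ex;have [M [u eu]] := cyl_gen p_pr char_k pG oc (MuG x).
exists M, (fun i => if (i < M)%N then u i else 0);split;last first.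
 by rewrite eu;apply: eq_bigr => i _;rewrite ltn_ord.
move=> i;case: ltnP => [iM|_];last by have [] := @Ess_ideal k gT G.
move=> L prL;have [eL|[Mx mM sLM]] := maximal_exists (proper_sub prL).
 by exfalso;have := prL;rewrite eL properxx.
have prM := maxgroupp mM;have sMG := proper_sub prM.
apply: (Res_sub0 (sMG := sMG) _ sLM).
have cM: c \in Mx by apply: (subsetP (Phi_sub_max mM)).
have pM := pgroupS sMG pG.
have zz: zt CG 2 (zgen k p c) := zgen_zt k p_pr oc.
have zy: zt CG 1 (ygen k c) := ygen_zt p_pr char_k oc.
have RZ: Res (sCyl sMG) (Zc k p G c) = Zc k p Mx c by apply: fcl_Res.
have RY: Res (sCyl sMG) (Yc k G c) = Yc k Mx c by apply: fcl_Res.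
have RM y : Res (sCyl sMG) (MuG y) = Mu cZ sMG cM (Res sMG y).
 elim/coh_ind: y => [|y y' ey ey'|n f zf];first by rewrite !raddf0.
  by rewrite !raddfD /= ey ey'.
 have [z1 e1] := Mu_fcl cZ (subxx G) cG zf;have [z2 e2] := Mu_fcl cZ sMG cM (zt_sub sMG zf).
 apply: etrans (congr1 _ e1) _;apply: etrans (fcl_Res _ z1) _;apply: esym.
 by apply: etrans (congr1 _ (fcl_Res sMG zf)) _.
have e0: esum (Infl c) (Yc k Mx c) (Zc k p Mx c) M (fun i => Res sMG (u i)) = 0.
 rewrite -[RHS](raddf0 (Mu cZ sMG cM)) -(Ex Mx prM).
 rewrite (_ : proper_sub prM = sMG);last exact: eq_irrelevance.
 apply: etrans _ (RM x);rewrite eu /esum raddf_sum;apply: eq_bigr => j _ /=.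
 rewrite rmorphM /= Res_Infl;congr (_ * _);rewrite /ebase rmorphM rmorphXn /= RZ;congr (_ * _).
 by case: (odd j);rewrite ?RY ?rmorph1.
exact: (cyl_esum_eq0 p_pr char_k pM oc e0 iM).
Qed.

Variables (m : nat) (f : seq gT -> k).
Hypotheses (m0 : (0 < m)%N) (om : ~~ odd m) (zf : zt G m f) (nb : ~ bt <[c]>%G m f).
Let xi : HG := fcl G m f.

(** xi is nonzero on <c>, so Mu xi is nonzero on 1 × <c> and therefore monic. Cancelling it puts the
    coefficients of Mu x in N, and the one of index 0 is x. *)
Lemma reg_gen (N : HG -> Prop) x : N 0 -> (forall x y, N x -> N y -> N (x + y)) -> (forall a x, N x -> N (a * x)) ->
 tailN (Infl c) (Yc k G c) (Zc k p G c) N 0 (MuG xi * MuG x) -> N x.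
move=> N0 ND NM t0;have [z1 e1] := Mu_fcl cZ (subxx G) cG zf.
have nz: Res (cyl_sub1 G c) (MuG xi) != 0.
 rewrite e1 fcl_Res //;apply/eqP => /(fcl0P (zt_sub (cyl_sub1 G c) z1)) b1;apply: nb.
 have pM: {in <[c]>%G &, {morph (fun u : gT => (1%g : gT, u)) : x y / (x * y)%g}}.
  by move=> a b _ _;congr pair;rewrite /= mulg1.
 have [|h Hh] := bt_map_in pM _ b1;first by move=> g gc;rewrite !inE /= eqxx.
 exists h => w cw sz;rewrite -Hh // -map_comp (eq_map (g := id)) ?map_id // => g /=.
 by rewrite mul1g.
have hM: hcl m (MuG xi) by rewrite e1;apply: hcl_fcl.
have [al [a [al0 Ea]]] := cyl_monic p_pr char_k pG oc hM nz.
have [|M [u [Nu eu]]] := cyl_cancel p_pr char_k pG oc N0 ND NM al0 om Ea (x := MuG x).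
 by have [M [u [Nu eu]]] := t0;exists M, u;split=> // i _;apply: Nu.
rewrite -(Io_Mu cZ (subxx G) cG x) eu;have := Io_esum p_pr char_k oc M u.
by move=> ->;case: ifP => // _;apply: Nu.
Qed.
Lemma reg_first x : xi * x = 0 -> x = 0.
move=> e;apply: (reg_gen (N := fun x => x = 0)) => //.
- by move=> _ _ -> ->;rewrite addr0.
- by move=> a _ ->;rewrite mulr0.
by rewrite -rmorphM e raddf0;exists 0%N, (fun=> 0);split=> //;rewrite /esum big_ord0.
Qed.

(** The submodule of H(G) spanned by the products of elements of xs with elements of Ess(G). *)
Fixpoint inE' (xs : seq HG) x := if xs is y :: xs' then exists2 z, Ess z & inE' xs' (x - y * z) else x = 0.

Lemma inE'0 xs : inE' xs 0.
by elim: xs => //= y xs IH;exists 0;[have [] := @Ess_ideal k gT G|rewrite mulr0 subr0]. Qed.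
Lemma inE'D xs x y : inE' xs x -> inE' xs y -> inE' xs (x + y).
have [_ ED _] := @Ess_ideal k gT G.
elim: xs x y => /= [x y -> ->|z xs IH x y [a Ea Ha] [b Eb Hb]];first by rewrite addr0.
by exists (a + b);[exact: ED|rewrite mulrDr opprD addrACA;apply: IH].
Qed.
Lemma inE'M xs a x : (forall y, y \in xs -> forall z, y * z = z * y) -> inE' xs x -> inE' xs (a * x).
have [_ _ EM] := @Ess_ideal k gT G.
elim: xs x => /= [x _ ->|y xs IH x cen [z Ez Hz]];first by rewrite mulr0.
exists (a * z);first by have [] := EM a z Ez.
rewrite mulrA (cen y (mem_head _ _) a) -mulrA -mulrBr;apply: IH => // y' h;apply: cen.
by rewrite inE h orbT.
Qed.
Lemma inE'_mem xs y z : y \in xs -> Ess z -> inE' xs (y * z).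
elim: xs => //= y' xs IH;rewrite inE => /orP[/eqP <-|h] Ez.
 by exists z;rewrite // subrr;apply: inE'0.
by exists 0;[have [] := @Ess_ideal k gT G|rewrite mulr0 subr0;apply: IH].
Qed.
Lemma reg_next xs x : c \in 'Phi(G)%g -> (forall y, y \in xs -> forall z, y * z = z * y) ->
 (forall y, y \in xs -> MuG y = Infl c y) -> (forall y z, y \in xs -> Infl c y * z = z * Infl c y) ->
 inE' xs (xi * x) -> inE' xs x.
move=> cPhi cen Mxs cenI ix;have N0 := inE'0 xs;have ND := @inE'D xs.
have NM a y := @inE'M xs a y cen;apply: reg_gen => //;rewrite -rmorphM.
suff main ys : {subset ys <= xs} -> forall z, inE' ys z ->
  tailN (Infl c) (Yc k G c) (Zc k p G c) (inE' xs) 0 (MuG z) by apply: main ix.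
elim: ys => [|y ys IH] sub z /=.
 by move=> ->;rewrite raddf0;exists 0%N, (fun=> 0);split=> //;rewrite /esum big_ord0.
case=> v Ev Hv;have yx: y \in xs by apply: sub;rewrite inE eqxx.
rewrite -(subrK (y * v) z) raddfD;apply: tailND => //.
 by apply: IH => // y' h;apply: sub;rewrite inE h orbT.
have [M [u [Eu eu]]] := mu_ess cPhi Ev;exists M, (fun i => y * u i);split.
 by move=> i _;apply: inE'_mem.
apply: etrans (rmorphM _ _ _) _;rewrite /= eu Mxs // /esum mulr_sumr;apply: eq_bigr => i _.
by rewrite mulrA (cenI y _ yx) -mulrA;congr (_ * _);exact: esym (rmorphM _ _ _).
Qed.
End Regular.

(** If C meets Phi(G) in index more than p, there are a and b in C independent modulo that
    intersection, and E = <a, b> meets Phi(G) trivially. A complement of the image of E in the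
    elementary abelian group G/Phi(G) lifts to M with E M = G and trivial intersection with E. As E
    is central, it is a direct factor of order p^2. *)
Lemma no_p2_factor (p : nat) (gT : finGroupType) (G C : {group gT}) : prime p -> (p.-group G)%g ->
 ~ has_abelem_p2_factor p G -> (p.-abelem C)%g -> C \subset 'Z(G)%g ->
 exists2 D : {group gT}, D \subset C :&: 'Phi(G)%g & (#|C| <= p * #|D|)%N.
move=> p_pr pG nf aC CZ;exists (C :&: 'Phi(G))%G => //=;set D := (C :&: 'Phi(G))%G.
rewrite leqNgt;apply/negP => lt;apply: nf.
have sCG := subset_trans CZ (center_sub G).
have cC x y : x \in C -> y \in G -> (x * y = y * x)%g.
 by move=> /(subsetP CZ)/setIP[_ /centP cx] /cx.
have ab (x y : gT) : x \in C -> y \in C -> (p.-abelem (<[x]> <*> <[y]>))%g.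
 by move=> xC yC;apply: abelemS aC;rewrite join_subG !cycle_subG xC.
have ord (x : gT) : x \in C -> x != 1%g -> #[x]%g = p by move=> xC;apply: (abelem_order_p aC).
have [a aC' aD] : exists2 a, a \in C & a \notin D.
 apply/subsetPn;apply: contraL lt => sCD;rewrite -leqNgt.
 by apply: leq_trans (subset_leq_card sCD) _;rewrite leq_pmull ?prime_gt0.
have a1: a != 1%g by apply: contraNneq aD => ->;apply: group1.
have oa := ord a aC' a1.
pose D1 := (D <*> <[a]>)%G.
have sD1C: D1 \subset C by rewrite join_subG subsetIl cycle_subG.
have cardD1: (#|D1| <= p * #|D|)%N.
 have nD: (<[a]> \subset 'N(D))%g.
  apply: subset_trans (cent_sub _);rewrite cycle_subG;apply/centP => y /setIP[yC _].
  by rewrite /commute cC // (subsetP sCG).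
 rewrite /= norm_joinEr //;have := mul_cardG D <[a]>%G.
 rewrite -[#|<[a]>%G|]/#[a]%g oa mulnC => ->;by rewrite leq_pmulr ?cardG_gt0.
have [b bC bD1] : exists2 b, b \in C & b \notin D1.
 apply/subsetPn;apply: contraL lt => sC;rewrite -leqNgt.
 exact: leq_trans (subset_leq_card sC) cardD1.
have b1: b != 1%g by apply: contraNneq bD1 => ->;apply: group1.
have ob := ord b bC b1;pose E := (<[a]> <*> <[b]>)%G.
have aE: (p.-abelem E)%g := ab a b aC' bC.
have sEC: E \subset C by rewrite join_subG !cycle_subG aC'.
have sEG := subset_trans sEC sCG.
have TEP: (E :&: 'Phi(G) = 1)%g.
 have cab: (<[b]> \subset 'C(<[a]>))%g.
  by rewrite cycle_subG;apply/centP => y /cycleP[i ->];rewrite /commute cC // (subsetP sCG) // groupX.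
 apply/trivgP/subsetP => x /setIP[];rewrite /= (cent_joinEr cab) => /mulsgP[u v /cycleP[i ->] /cycleP[j ->] ->] xP.
 have xD: (a ^+ i * b ^+ j)%g \in D by rewrite inE xP andbT groupM // groupX.
 have bj: (b ^+ j)%g \in D1.
  rewrite -[(b ^+ j)%g](mulKg (a ^+ i)%g) groupM //;first by rewrite groupV groupX // (subsetP (joing_subr _ _)) ?cycle_id.
  by rewrite (subsetP (joing_subl _ _)).
 have TI1: <[b]>%g :&: D1 = 1%g by apply: prime_TIg;rewrite ?cycle_subG // -?[#|_|]/#[b]%g ?ob.
 have bj1: (b ^+ j)%g = 1%g.
  have : (b ^+ j)%g \in (<[b]> :&: D1)%g by rewrite inE mem_cycle.
  by rewrite TI1 => /set1gP.
 move: xD;rewrite bj1 mulg1 => xD.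
 have TI2: <[a]>%g :&: D = 1%g by apply: prime_TIg;rewrite ?cycle_subG // -?[#|_|]/#[a]%g ?oa.
 have : (a ^+ i)%g \in (<[a]> :&: D)%g by rewrite inE mem_cycle.
 by rewrite TI2.
have nPG: G \subset 'N('Phi(G))%g := normal_norm (Phi_normal G).
have aQ: (p.-abelem (G / 'Phi(G)))%g := Phi_quotient_abelem pG.
have sEQ: (E / 'Phi(G) \subset G / 'Phi(G))%g := quotientS _ sEG.
have /splitsP[Mb /complP[TMb eMb]] := abelem_splits aQ sEQ.
have sMb: Mb \subset (G / 'Phi(G))%g by rewrite -eMb;apply: mulG_subr.
have [M eM sPM sMG] := inv_quotientS (Phi_normal G) sMb.
exists E, M;split=> //.
- have cEM: (M \subset 'C(E))%g.
  by apply/centsP => x xM y yE;rewrite /commute (cC y x) // ?(subsetP sEC) // (subsetP sMG).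
 rewrite dprodE //;last first.
  apply/trivgP/subsetP => x /setIP[xE xM].
  have xG := subsetP sEG x xE;have xN := subsetP nPG x xG.
  have : coset 'Phi(G)%G x \in (E / 'Phi(G) :&: Mb)%g.
   by rewrite inE (mem_quotient _ xE) /= eM (mem_quotient _ xM).
  by rewrite TMb => /set1P /(coset_idr xN) xP;rewrite -TEP inE xE.
 apply/eqP;rewrite eqEsubset mulG_subG sEG sMG /=;apply/subsetP => x xG.
 have : coset 'Phi(G)%G x \in (G / 'Phi(G))%g by apply: mem_quotient.
 rewrite -eMb => /mulsgP[u v /morphimP[y yN yE ->]];rewrite eM => /morphimP[z zN zM ->] exy.
 have yG := subsetP sEG y yE;have zG := subsetP sMG z zM.
 have xN := subsetP nPG x xG.
 have yzN: (y * z)%g \in 'N('Phi(G))%g by rewrite groupM.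
 have e3: coset 'Phi(G)%G x = coset 'Phi(G)%G (y * z)%g by rewrite exy morphM.
 have /rcosetP[h hP ->] := introT (rcoset_kercosetP xN yzN) e3.
 have hG: h \in G := subsetP (Phi_sub G) h hP.
 rewrite mulgA -(cC y h) ?(subsetP sEC) // -mulgA mem_mulg // groupM //;exact: (subsetP sPM).
- have TI3: (<[a]> :&: <[b]> = 1)%g.
  apply: prime_TIg;first by rewrite -[#|_|]/#[a]%g oa.
  rewrite cycle_subG;apply: contra aD => ab';exfalso.
  have : (<[a]> == <[b]>)%g by rewrite eqEcard cycle_subG ab' /= -[#|<[a]>|%g]/#[a]%g -[#|<[b]>|%g]/#[b]%g oa ob.
  move/eqP => eab;case/negP: bD1;apply: (subsetP (joing_subr _ _));rewrite eab cycle_id //.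
 have cab: (<[b]> \subset 'C(<[a]>))%g.
  by rewrite cycle_subG;apply/centP => y /cycleP[i ->];rewrite /commute cC // (subsetP sCG) // groupX.
 by rewrite /= (cent_joinEr cab) (TI_cardMg TI3) -[#|<[a]>|%g]/#[a]%g -[#|<[b]>|%g]/#[b]%g oa ob mulnn.
Qed.

(** * A regular sequence on Ess(G) of length the rank of C *)

Section XiSequence.
Variables (k : fieldType) (p : nat).
Hypotheses (p_pr : prime p) (char_k : p \in [pchar k]).
Variables (gT : finGroupType) (G : {group gT}).
Hypothesis pG : (p.-group G)%g.
Local Notation HG := 'H^*(G, k).

(** K is recorded as any central subgroup containing D: what is used is that f ignores D, so that
    such classes are invariant under the coaction of every c in D. *)
Definition inflated_even (D : {group gT}) (y : HG) : Prop :=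
 exists (K : {group gT}) m f, [/\ [/\ D \subset K, K \subset 'Z(G)%g, (0 < m)%N & ~~ odd m],
  zt G m f, y = fcl G m f &
  forall w w' : seq gT, map (coset K) w = map (coset K) w' -> f w = f w'].

Lemma sign_even m : ~~ odd m -> (-1) ^+ m = 1 :> k.
by move=> om;rewrite -signr_odd (negbTE om). Qed.
Lemma inflated_even_central D y z : inflated_even D y -> y * z = z * y.
by case=> K [m [f [[_ _ _ om] zf -> _]]];apply: (even_central _ (hcl_fcl zf));apply: sign_even.
Qed.
Lemma inflated_even_Infl_central D (y : HG) (c : gT) (z : 'H^*(cylinder G c, k)) : inflated_even D y ->
 Infl c y * z = z * Infl c y.
case=> K [m [f [[_ _ _ om] zf -> _]]].
have z1: zt (cylinder G c) m (infl (hT := gT) f) by apply/zts0/zts_infl/zts0.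
by rewrite Infl_fcl //;apply: (even_central _ (hcl_fcl z1));apply: sign_even.
Qed.
Lemma inflated_even_Mu (D : {group gT}) (y : HG) (c : gT) (cZ : c \in 'Z(G)%g) (cG : c \in G) : c \in D -> inflated_even D y ->
 Mu cZ (subxx G) cG y = Infl c y.
move=> cD [K [m [f [[sDK sKZ _ om] zf -> fK]]]].
have [z1 e1] := Mu_fcl cZ (subxx G) cG zf.
apply: etrans e1 _;apply: esym;apply: etrans (Infl_fcl c zf) _;apply: esym.
apply: (eq_fcl z1) => w Gw _;apply: fK.
rewrite -!map_comp;apply/eq_in_map => u uw /=.
have := allP Gw u uw;rewrite /= inE => /andP[u1 u2].
have cK: u.2 \in K by apply: subsetP u2;rewrite cycle_subG (subsetP sDK).
have nK: G \subset 'N(K)%g.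
 by apply: subset_trans (cent_sub _);rewrite centsC;apply: subset_trans sKZ (subsetIr _ _).
have uN := subsetP nK _ u1;have kN := subsetP (normG K) _ cK.
by rewrite morphM //= (coset_id cK) mulg1.
Qed.

(** A regular sequence on Ess(G), with the last element at the head of the list. *)
Fixpoint regl (xs : seq HG) : Prop := if xs is y :: xs' then
 regl xs' /\ (forall x, inE' xs' (y * x) -> inE' xs' x) else True.

(** D is used up one cyclic factor <c> at a time. The class for c is inflated modulo a complement D'
    of <c> in D, so it is invariant under all elements still to come, which lie in D'. *)
Lemma xi_extend r (D : {group gT}) xs : (p.-abelem D)%g -> D \subset 'Z(G)%g -> D \subset 'Phi(G)%g ->
 #|D| = (p ^ r)%N -> regl xs -> (forall y, y \in xs -> inflated_even D y) ->
 exists ys, [/\ size ys = (r + size xs)%N, regl ys & forall y, y \in ys -> inflated_even 1%G y].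
elim: r D xs => [|r IH] D xs aD DZ DPhi cD rx gx.
 by exists xs;split=> // y /gx;have -> : D = 1%G by apply/val_inj/card1_trivg;rewrite /= cD.
have [c cinD c1] : exists2 c, c \in D & c != 1%g.
 apply/trivgPn;rewrite trivg_card1 cD.
 by rewrite neq_ltn orbC -[1%N]/(p ^ 0)%N ltn_exp2l ?prime_gt1.
have oc: #[c]%g = p := abelem_order_p aD cinD c1.
have cZ: c \in 'Z(G)%g := subsetP DZ c cinD.
have scD: (<[c]> \subset D)%g by rewrite cycle_subG.
have /splitsP[D' /complP[TI eD]] := abelem_splits aD scD.
have sD' : D' \subset D by rewrite -eD;apply: mulG_subr.
have cD' : #|D'| = (p ^ r)%N.
 have := TI_cardMg TI;rewrite eD cD -[#|<[c]>|%g]/#[c]%g oc expnS => /eqP.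
 by rewrite eqn_pmul2l ?prime_gt0 // => /eqP.
have cnD' : c \notin D'.
 by apply: contra c1 => h;apply/eqP/set1gP;rewrite -TI inE cycle_id h.
have D'Z := subset_trans sD' DZ.
have [m [f [m0 om zf nb fK]]] := xi_exists p_pr char_k pG D'Z cZ oc cnD'.
have [||ys [sy ry gy]] := IH D' (fcl G m f :: xs) (abelemS sD' aD) D'Z (subset_trans sD' DPhi) cD'.
- split=> // x;have h := @reg_next _ _ p_pr char_k _ _ pG _ cZ oc m f om zf nb xs x;apply: h.
 + exact: (subsetP DPhi).
 + by move=> y /gx g z;apply: inflated_even_central g.
 + by move=> y /gx;apply: inflated_even_Mu.
 + by move=> y z /gx;apply: inflated_even_Infl_central.
- move=> y;rewrite inE => /orP[/eqP ->|/gx[K [m' [f' [[sK h1 h2 h3] h4 h5 h6]]]]].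
  by exists D', m, f;split.
 by exists K, m', f';split=> //;split=> //;apply: subset_trans sD' sK.
by exists ys;split=> //;rewrite sy /= addnS addSn.
Qed.
(** All of C is reached inside Phi(G) up to one factor of order p. An element c outside D1 is served
    first, by [reg_first], with a class inflated modulo D1. *)
Lemma xi_sequence (C : {group gT}) : ~ has_abelem_p2_factor p G -> (p.-abelem C)%g ->
 C \subset 'Z(G)%g -> exists ys, [/\ size ys = logn p #|C|, regl ys &
  forall y, y \in ys -> inflated_even 1%G y].
move=> nf aC CZ;have pC := abelem_pgroup aC.
have [D1 sD1 leC] := no_p2_factor p_pr pG nf aC CZ.
have sD1C := subset_trans sD1 (subsetIl _ _);have sD1P := subset_trans sD1 (subsetIr _ _).
have [sC|/subsetPn[c cC cD1]] := boolP (C \subset D1).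
 have [|ys [sy ry gy]] := @xi_extend (logn p #|C|) C [::] aC CZ (subset_trans sC sD1P) (card_pgroup pC) I.
  by [].
 by exists ys;split=> //;rewrite sy addn0.
have pD1 := pgroupS sD1C pC;have aD1 := abelemS sD1C aC.
have c1: c != 1%g by apply: contraNneq cD1 => ->;apply: group1.
have oc: #[c]%g = p := abelem_order_p aC cC c1.
have cZ := subsetP CZ c cC;have D1Z := subset_trans sD1C CZ.
have [m [f [m0 om zf nb fK]]] := xi_exists p_pr char_k pG D1Z cZ oc cD1.
have lg: logn p #|C| = (logn p #|D1|).+1.
 apply/eqP;rewrite eqn_leq;apply/andP;split.
  rewrite -(leq_exp2l _ _ (prime_gt1 p_pr)) -(card_pgroup pC) expnS -(card_pgroup pD1);exact: leC.
 rewrite -(ltn_exp2l _ _ (prime_gt1 p_pr)) -(card_pgroup pC) -(card_pgroup pD1).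
 by apply: proper_card;apply/properP;split=> //;exists c.
have [||ys [sy ry gy]] := @xi_extend _ D1 [:: fcl G m f] aD1 D1Z sD1P (card_pgroup pD1).
- split=> [//|x];have h := @reg_first _ _ p_pr char_k _ _ pG _ cZ oc m f om zf nb x;exact: h.
- by move=> y;rewrite inE => /eqP ->;exists D1, m, f;split.
by exists ys;split=> //;rewrite sy addn1 lg.
Qed.
End XiSequence.

(** * Koszul homology and regular elements *)

Section Koszul.
Variables (k : fieldType) (U : lmodType k) (d : nat).
Variables (z : 'I_d -> U -> U) (e : 'I_d -> nat) (pr : nat -> U -> U).
Hypothesis zL : forall j, op_linear (z j).
Hypothesis zC : forall i j x, z i (z j x) = z j (z i x).
Hypothesis prL : forall n, op_linear (pr n).
Local Notation set_d := {set 'I_d}.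
Local Notation cpl := (set_d -> U).

Definition sgn (j : 'I_d) (S : set_d) : k := (-1) ^+ #|[set i in S | (i < j)%N]|.
(** The Koszul differential; #|S| is the homological degree, and the component on S collects those
    on j |: S. *)
Definition bd (f : cpl) : cpl := fun S => \sum_(j | j \notin S) sgn j S *: z j (f (j |: S)).

Lemma z0 j : z j 0 = 0. Proof. exact: op_linear0. Qed.
Lemma zD j x y : z j (x + y) = z j x + z j y.
by have := zL j 1 x y;rewrite !scale1r. Qed.
Lemma zZ j a x : z j (a *: x) = a *: z j x.
by have := zL j a x 0;rewrite z0 !addr0. Qed.
Lemma z_sum j (I : Type) (r : seq I) (P : pred I) (F : I -> U) :
 z j (\sum_(i <- r | P i) F i) = \sum_(i <- r | P i) z j (F i).
by elim/big_rec2: _ => [|i x y _ <-];rewrite ?z0 ?zD. Qed.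
Lemma bdL a f g S : bd (a *: f + g) S = a *: bd f S + bd g S.
rewrite /bd scaler_sumr -big_split;apply: eq_bigr => j _ /=.
by rewrite zL scalerDr !scalerA mulrC.
Qed.
Lemma bdD f g S : bd (f + g) S = bd f S + bd g S.
by have := bdL 1 f g S;rewrite !scale1r. Qed.
Lemma bdB f g S : bd (f - g) S = bd f S - bd g S.
by have := bdL (-1) g f S;rewrite !scaleN1r addrC => ->;rewrite addrC. Qed.
Lemma sgn_add i j (S : set_d) : i \notin S -> i != j -> sgn j (i |: S) = (-1) ^+ (i < j)%N * sgn j S.
move=> iS ij;rewrite /sgn;case: (boolP (i < j)%N) => h.
 rewrite (_ : [set _ in _ | _] = i |: [set t in S | (t < j)%N]);last first.
  by apply/setP => t;rewrite !inE;case: (eqVneq t i) => [->|];rewrite ?h.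
 by rewrite cardsU1 inE (negbTE iS) /= exprD.
rewrite mul1r;congr (_ ^+ #|pred_of_set _|);apply/setP => t;rewrite !inE.
by case: (eqVneq t i) => [->|//];rewrite (negbTE h) !andbF.
Qed.
Lemma bd_bd f S : bd (bd f) S = 0.
pose F i j := (sgn j S * sgn i (j |: S)) *: z j (z i (f (i |: (j |: S)))).
pose A i j := (i \notin S) && (j \notin S) && (i != j).
have -> : bd (bd f) S = \sum_j \sum_(i | A i j) F i j.
 rewrite /bd big_mkcond;apply: eq_bigr => j _;case: ifP => jS;last first.
  by rewrite big_pred0 // => i;rewrite /A jS andbF.
 rewrite z_sum scaler_sumr;apply: eq_big => i;last by rewrite zZ scalerA.
 by rewrite /A jS !inE negb_or andbT andbC.
have -> : \sum_j \sum_(i | A i j) F i j =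
  \sum_j \sum_(i | A i j && (i < j)%N) F i j + \sum_j \sum_(i | A i j && (j < i)%N) F i j.
 rewrite -big_split;apply: eq_bigr => j _;rewrite (bigID (fun i : 'I_d => (i < j)%N)) /=;congr (_ + _).
 apply: eq_bigl => i;rewrite /A -leqNgt ltn_neqAle eq_sym -val_eqE /=.
 by rewrite andbA -[(_ && (j != i)) in RHS]andbA andbb.
rewrite [X in _ + X](exchange_big_dep xpredT) //= -big_split big1 // => j _.
rewrite [X in _ X = _](eq_bigl (fun i => A i j && (i < j)%N));last first.
 by move=> i;rewrite /A (eq_sym j i) (andbC (j \notin S)).
rewrite -[LHS]/(_ + _) -big_split big1 // => i /andP[/andP[/andP[iS jS] ij] lt] /=.
have A1: A j i && (i < j)%N by rewrite /A iS jS eq_sym ij lt.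
rewrite /F (zC j i) (setUCA [set j]) -scalerDl !sgn_add // 1?eq_sym // lt.
rewrite (ltnNge j i) (ltnW lt) /= expr1 expr0 [X in X *: _](_ : _ = 0) ?scale0r //;ring.
Qed.
Lemma bd_z j f S : bd (fun T => z j (f T)) S = z j (bd f S).
by rewrite /bd z_sum;apply: eq_bigr => i _;rewrite zZ zC. Qed.
(** Exterior multiplication by the basis vector j, a homotopy from zero to multiplication by z j. *)
Definition hty (j : 'I_d) (f : cpl) : cpl := fun S =>
 if j \in S then sgn j (S :\ j) *: f (S :\ j) else 0.

Lemma sgn2 j S : sgn j S * sgn j S = 1.
by rewrite /sgn -expr2 sqrr_sign. Qed.
Lemma bd_hty j f S : bd (hty j f) S + hty j (bd f) S = z j (f S).
case: (boolP (j \in S)) => jS;last first.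
 rewrite {2}/hty (negbTE jS) addr0 /bd /hty (bigD1 j) //= setU11 setU1K // zZ scalerA sgn2 scale1r.
 rewrite big1 ?addr0 // => i /andP[iS ij];rewrite in_setU1 (eq_sym j) (negbTE ij) (negbTE jS) /= z0 scaler0 //.
have jS' : j \notin S :\ j by rewrite !inE eqxx.
rewrite {2}/hty jS [bd f _](bigD1 j) //= setD1K // scalerDr scalerA sgn2 scale1r addrCA -[RHS]addr0.
congr (_ + _);rewrite scaler_sumr {1}/bd /hty.
have eP i : (i \notin S :\ j) && (i != j) = (i \notin S).
 by rewrite !inE;case: (eqVneq i j) => [->|] /=;rewrite ?jS ?andbT.
rewrite [X in _ + X](eq_bigl _ _ eP) -big_split big1 // => i iS /=.
have ij: i != j by apply: contraNneq iS => ->.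
rewrite in_setU1 jS orbT (_ : (i |: S) :\ j = i |: (S :\ j));last first.
 by apply/setP => t;rewrite !inE;case: (eqVneq t i) => [->|];rewrite ?ij.
rewrite zZ !scalerA -scalerDl -{1}(setD1K jS) !sgn_add // 1?eq_sym //;last by rewrite !inE negb_and iS orbT.
rewrite (_ : _ + _ = 0) ?scale0r //.
case: (ltngtP i j) => [lt|lt|/val_inj eij];last by rewrite eij eqxx in ij.
 by rewrite expr0 expr1;ring.
by rewrite expr0 expr1;ring.
Qed.
Definition wt (S : set_d) : nat := \sum_(j in S) e j.
(** The basis vector of S has degree [wt S], so a chain of total degree t has components of degree t
    - wt S. *)
Definition hs (w t : nat) x := if (w <= t)%N then pr (t - w) x else 0.
Hypothesis prz : forall n j x, pr (n + e j) (z j x) = z j (pr n x).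
Hypothesis prz0 : forall n j x, (n < e j)%N -> pr n (z j x) = 0.
Hypothesis e0 : forall j, (0 < e j)%N.
Hypothesis prsum : forall x, exists M, forall M', (M <= M')%N -> x = \sum_(n < M') pr n x.
Hypothesis prpr : forall n x, pr n (pr n x) = pr n x.

Lemma hsL w t a x y : hs w t (a *: x + y) = a *: hs w t x + hs w t y.
by rewrite /hs;case: ifP => // _;rewrite ?prL // scaler0 addr0. Qed.
Lemma hs0 w t : hs w t 0 = 0.
by rewrite /hs;case: ifP => // _;apply: op_linear0. Qed.
Lemma hs_idem w t x : hs w t (hs w t x) = hs w t x.
by rewrite /hs;case: leqP => // _;apply: prpr. Qed.
Lemma hs_z j w t x : z j (hs (w + e j) t x) = hs w t (z j x).
rewrite /hs;case: leqP => h1;last first.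
 by rewrite z0;case: leqP => // h2;rewrite prz0 // ltn_subLR.
rewrite (leq_trans (leq_addr _ _) h1) -prz;congr (pr _ _);lia.
Qed.
Definition Pt t (f : cpl) : cpl := fun S => hs (wt S) t (f S).

Lemma bd_Pt t f S : bd (Pt t f) S = hs (wt S) t (bd f S).
have hsum (P : pred 'I_d) (F : 'I_d -> U) :
  hs (wt S) t (\sum_(j | P j) F j) = \sum_(j | P j) hs (wt S) t (F j).
 elim/big_rec2: _ => [|i x y _ <-];first exact: hs0.
 by have := hsL (wt S) t 1 (F i) y;rewrite !scale1r.
rewrite /bd hsum;apply: eq_bigr => j jS;rewrite -[X in _ = hs _ _ X]addr0 hsL hs0 addr0 /Pt.
by rewrite -hs_z /wt (big_setU1 _ jS) /= addnC.
Qed.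
Lemma Pt_sum f : exists M, forall S, f S = \sum_(t < M) Pt t f S.
have [M HM] := choice (fun S => prsum (f S)).
exists (\sum_S (M S + wt S))%N => S;rewrite -(big_mkord xpredT (fun t => Pt t f S)).
have le: (M S + wt S <= \sum_S0 (M S0 + wt S0))%N by rewrite (bigD1 S) //= leq_addr.
rewrite (big_cat_nat (n := wt S)) //=;last by apply: leq_trans le;apply: leq_addl.
rewrite big_nat big1 ?add0r => [|t /andP[_ lt]];last by rewrite /Pt /hs leqNgt lt.
rewrite -{1}[wt S]add0n big_addn big_mkord [LHS](HM S _ (_ : _ <= \sum_S0 (M S0 + wt S0) - wt S)%N);last by lia.
by apply: eq_bigr => i _;rewrite /Pt /hs leq_addl addnK.
Qed.

Variable E : U -> Prop.
Hypotheses (E0 : E 0) (EL : forall a x y, E x -> E y -> E (a *: x + y)) (Ez : forall j x, E x -> E (z j x)).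
Hypothesis Epr : forall n x, E x -> E (pr n x).

Record submod (N : U -> Prop) : Prop := Submod { sm0 : N 0;
 smL : forall a x y, N x -> N y -> N (a *: x + y);smz : forall j x, N x -> N (z j x);
 smpr : forall n x, N x -> N (pr n x);smE : forall x, N x -> E x }.

Lemma smD N x y : submod N -> N x -> N y -> N (x + y).
by move=> hN hx hy;rewrite -[x]scale1r;apply: smL. Qed.
Lemma smZ N a x : submod N -> N x -> N (a *: x).
by move=> hN hx;rewrite -[_ *: _]addr0;apply: smL => //;apply: sm0. Qed.
Lemma smB N x y : submod N -> N x -> N y -> N (x - y).
by move=> hN hx hy;rewrite addrC -scaleN1r;apply: smL. Qed.
Lemma sm_sum N (I : Type) (r : seq I) (P : pred I) (F : I -> U) : submod N -> (forall i, P i -> N (F i)) ->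
 N (\sum_(i <- r | P i) F i).
by move=> hN h;elim/big_rec: _ => [|i x Pi hx];[apply: sm0|apply: smD => //;apply: h]. Qed.
Lemma smE_sub : submod E. Proof. by split. Qed.
Lemma bd_sm N f S : submod N -> (forall T, N (f T)) -> N (bd f S).
by move=> hN h;apply: sm_sum => // j _;apply: smZ => //;apply: smz. Qed.
Lemma hs_sm N w t x : submod N -> N x -> N (hs w t x).
by move=> hN hx;rewrite /hs;case: ifP => _;[apply: smpr|apply: sm0]. Qed.
(** Cycles and boundaries of the Koszul complex of the quotient E/N, represented by chains with
    values in E. *)
Definition cyc (N : U -> Prop) (f : cpl) := (forall S, E (f S)) /\ forall S, N (bd f S).
Definition bdr (N : U -> Prop) (f : cpl) := exists2 g : cpl, forall S, E (g S) & forall S, N (f S - bd g S).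

Lemma bdrL N a f g : submod N -> bdr N f -> bdr N g -> bdr N (a *: f + g).
move=> hN [u Eu Hu] [v Ev Hv];exists (a *: u + v) => S;first exact: EL.
rewrite bdL -[X in X - _]/(a *: f S + g S) (_ : _ - _ = a *: (f S - bd u S) + (g S - bd v S)).
 exact: smL.
by rewrite scalerBr opprD addrACA.
Qed.
Lemma bdr_sm N f : submod N -> (forall S, N (f S)) -> bdr N f.
move=> hN h;exists (fun=> 0) => // S;rewrite (_ : bd _ S = 0) ?subr0 //.
by rewrite /bd big1 // => j _;rewrite z0 scaler0.
Qed.
Lemma eq_bdr N f g : (forall S, f S = g S) -> bdr N f -> bdr N g.
by move=> fg [u Eu Hu];exists u => // S;rewrite -fg. Qed.
Lemma cyc_z N j f : submod N -> cyc N f -> bdr N (fun S => z j (f S)).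
move=> hN [Ef cf];exists (hty j f) => S.
 by rewrite /hty;case: ifP => // _;rewrite -[_ *: _]addr0;apply: EL.
rewrite -bd_hty addrC addKr /hty;case: ifP => _;last exact: sm0.
exact: smZ.
Qed.
Definition zops : seq (nat * (U -> U)) := [seq (e j, z j) | j <- enum 'I_d].
Definition Eh n x := E x /\ pr n x = x.
Hypothesis E_fg : exists S : seq (nat * U), (forall n x, List.In (n, x) S -> Eh n x) /\
 forall n x, Eh n x -> gen zops (fun _ y => y = 0) S n x.

Definition Ehs w n x := E x /\ hs w n x = x.

Lemma in_zops o : List.In o zops -> exists j, o = (e j, z j).
by move=> /List.in_map_iff[j [<- _]];exists j. Qed.
Lemma zops_in j : List.In (e j, z j) zops.
apply/List.in_map_iff;exists j;split=> //.
have : j \in enum 'I_d by rewrite mem_enum.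
elim: (enum _) => //= a s IH;rewrite inE => /orP[/eqP ->|/IH];[by left|by right].
Qed.
Lemma zops_linear : ops_linear zops.
by move=> o /in_zops[j ->];apply: zL. Qed.
Lemma gsub_linear (V : lmodType k) (ops : seq (nat * (V -> V))) (N : nat -> V -> Prop) : (forall n, N n 0) ->
 (forall n a u v, N n u -> N n v -> N n (a *: u + v)) ->
 (forall o n u, List.In o ops -> N n u -> N (n + o.1)%N (o.2 u)) -> gsub ops N.
move=> N0 NL NO;split=> // [n u v hu hv|n a u hu];first by rewrite -[u]scale1r;apply: NL.
by rewrite -[_ *: _]addr0;apply: NL.
Qed.
Lemma gsub_Ehs w : gsub zops (Ehs w).
apply: gsub_linear.
- by move=> n;split;rewrite ?hs0.
- move=> n a u v [Eu Hu] [Ev Hv];split;first exact: EL.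
 by rewrite hsL Hu Hv.
- move=> o n u /in_zops[j ->] [Eu Hu];split;first exact: Ez.
 have [h|h] := leqP w n;last first.
  have u0: u = 0 by rewrite -Hu /hs leqNgt h.
  by rewrite u0 /= z0 hs0.
 move: Hu;rewrite /= /hs h (leq_trans h (leq_addr _ _)) => Hu.
 by rewrite (_ : n + e j - w = (n - w) + e j)%N ?prz ?Hu //;lia.
Qed.
Lemma noeth_Ehs w : noeth zops (Ehs w) (fun _ y => y = 0).
have [S [SE Sg]] := E_fg.
apply: (fg_noeth (s := [seq (b.1 + w, b.2)%N | b <- S])).
- exact: zops_linear.
- exact: gsub_Ehs.
- apply: gsub_linear => [//|n a u v -> ->|o n u /in_zops[j ->] ->];[by rewrite scaler0 addr0|exact: z0].
- by move=> n u ->;split;rewrite ?hs0.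
- by move=> o o' /in_zops[j ->] /in_zops[j' ->] n u m _ _ /=;rewrite zC subrr.
- by move=> o /in_zops[j ->];apply: e0.
- move=> n u /List.in_map_iff[[m v] [[<- <-] /SE[Ev Hv]]];split=> //.
 by rewrite /hs leq_addl addnK.
move=> n u [Eu];rewrite /hs;case: leqP => h Hu;last by rewrite -Hu;apply: gen_base.
have : gen zops (fun _ y => y = 0) S (n - w) u by apply: Sg;split.
rewrite -{2}(subnK h);elim=> [m v ->|m v hv|m v v' _ h1 _ h2|m a v _ h1|o m v ho _ h1].
- exact: gen_base.
- by apply: gen_mem;apply/List.in_map_iff;exists (m, v).
- exact: gen_add.
- exact: gen_scale.
by rewrite addnAC;apply: gen_op.
Qed.
(** By noetherianity the cycles are generated by finitely many homogeneous ones; since every z j is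
    null-homotopic, only the generators themselves contribute to homology, which is thus bounded in
    degree. *)
Lemma cycles_fg N : submod N -> exists t0, forall t f, (t0 < t)%N -> cyc N f ->
 (forall S, hs (wt S) t (f S) = f S) -> bdr N f.
move=> hN.
have nP := @noeth_pointwise k U set_d zops (fun S => Ehs (wt S)) (fun _ _ y => y = 0) zops_linear
 (fun S => gsub_Ehs _) _ _ (fun S => @noeth_Ehs (wt S)).
have [] := nP _ _ (fun t f => (forall S, Ehs (wt S) t (f S)) /\ forall S, N (bd f S)).
- move=> _;apply: gsub_linear => [//|n a u v -> ->|o n u /in_zops[j ->] ->];[by rewrite scaler0 addr0|exact: z0].
- by move=> S n u ->;split;rewrite ?hs0.
- apply: gsub_linear.
 + move=> n;split=> S;first by split;rewrite ?hs0.
  by apply: bd_sm => // T;apply: sm0.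
 + move=> n a u v [h1 h2] [h3 h4];split=> S;first by apply: (gsubD (gsub_Ehs _)) => //;apply: (gsubZ (gsub_Ehs _)).
  by rewrite bdL;apply: smL.
 + move=> o n u /in_pointwise_ops[o' ho' ->] [h1 h2];split=> S /=.
   exact: (gsubO (gsub_Ehs _)).
  by have [j ->] := in_zops ho';rewrite bd_z;apply: smz.
- move=> n u u0;split=> S;first by rewrite u0;split;rewrite ?hs0.
 by apply: bd_sm => // T;rewrite u0;apply: sm0.
- by move=> n u [].
move=> s [sN sg].
exists (\max_(b <- s) b.1)%N => t f lt [Ef cf] hf.
have /sg : (forall S, Ehs (wt S) t (f S)) /\ forall S, N (bd f S) by split.
move=> G;suff [_ [//|le]] : cyc N f /\ (bdr N f \/ (t <= \max_(b <- s) b.1)%N).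
 by rewrite leqNgt lt in le.
elim: G {lt Ef cf hf} => [n u u0|n u hu|n u v _ [cu bu] _ [cv bv]|n a u _ [cu bu]|o n u ho _ [cu bu]].
- split;last by left;apply: bdr_sm => // S;rewrite u0;apply: sm0.
 by split=> S;rewrite ?u0 //;apply: bd_sm => // T;rewrite u0;apply: sm0.
- have [h1 h2] := sN _ _ hu;split;first by split=> S //;have [] := h1 S.
 right;elim: (s) hu => //= b s' IH [->|/IH h];rewrite big_cons ?leq_maxl //.
 by apply: leq_trans h (leq_maxr _ _).
- split.
  by split=> S;[rewrite -[u in u + v]scale1r;apply: EL;[apply: cu.1|apply: cv.1]|rewrite bdD;apply: smD => //;[apply: cu.2|apply: cv.2]].
 case: bu => [bu|];[|by right];case: bv => [bv|];[left|by right].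
 by apply: eq_bdr (bdrL 1 hN bu bv) => S;rewrite scale1r.
- split.
  split=> S;first by rewrite -[_ *: _]addr0;apply: EL => //;apply: cu.1.
  rewrite (_ : bd _ S = a *: bd u S);first by apply: smZ => //;apply: cu.2.
  by rewrite -[a *: u]addr0 bdL [X in _ + X]big1 ?addr0 // => j _;rewrite z0 scaler0.
 case: bu => [bu|];[left|by right].
 rewrite -[a *: u]addr0;apply: bdrL => //;apply: bdr_sm => // S;exact: sm0.
have [o' ho' ->] := in_pointwise_ops ho;have [j ->] := in_zops ho'.
split;last by left;apply: cyc_z.
by split=> S /=;[apply: Ez;apply: cu.1|rewrite bd_z;apply: smz => //;apply: cu.2].
Qed.

Variables (xi : U -> U) (m : nat).
Hypothesis xiL : op_linear xi.
Hypothesis xiz : forall j x, xi (z j x) = z j (xi x).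
Hypothesis xipr : forall n x, pr (n + m) (xi x) = xi (pr n x).
Hypothesis m0 : (0 < m)%N.
Hypothesis Exi : forall x, E x -> E (xi x).

Lemma bd_xi f S : bd (fun T => xi (f T)) S = xi (bd f S).
have xZ a x : xi (a *: x) = a *: xi x by have := xiL a x 0;rewrite (op_linear0 xiL) !addr0.
rewrite /bd;elim/big_rec2: _ => [|j x y _ ->];first by rewrite op_linear0.
by have := xiL 1 (sgn j S *: z j (f (j |: S))) x;rewrite !scale1r xZ xiz.
Qed.
(** xi has positive degree, so a high enough power moves any cycle beyond the bound of
    [cycles_fg]. *)
Lemma iter_xi_bdr N f : submod N -> (forall x, N x -> N (xi x)) -> cyc N f ->
 exists a, bdr N (fun S => iter a xi (f S)).
move=> hN Nxi cf;have [t0 Ht0] := cycles_fg hN;have [M HM] := Pt_sum f.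
have iL a : op_linear (iter a xi).
 by elim: a => [|a IH] c u v //=;rewrite IH xiL.
exists t0.+1;have bt (t : 'I_M) : bdr N (fun S => iter t0.+1 xi (Pt t f S)).
 apply: (Ht0 (t + t0.+1 * m)%N).
 - by apply: leq_trans (leq_addl _ _);rewrite leq_pmulr.
 - have cP: cyc N (Pt t f).
   by split=> S;[apply: hs_sm smE_sub _;apply: cf.1|rewrite bd_Pt;apply: hs_sm => //;apply: cf.2].
  elim: t0.+1 => //= a [IH1 IH2];split=> S;first exact: Exi.
  by rewrite (bd_xi (fun T => iter a xi (Pt t f T)));apply: Nxi.
 move=> S;elim: t0.+1 => [|a IH];first by rewrite addn0 hs_idem.
 rewrite /= -{2}IH mulSn addnCA addnC /hs;case: (leqP _ (_ + a * m)) => h.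
  by rewrite (leq_trans h (leq_addr _ _)) -xipr;congr (pr _ _);lia.
 have -> : iter a xi (Pt t f S) = 0 by rewrite -IH /hs leqNgt h.
 by rewrite op_linear0 // op_linear0 // if_same.
suff : bdr N (\sum_(t < M) (fun S => iter t0.+1 xi (Pt t f S)) : cpl).
 apply: eq_bdr => S;rewrite [in RHS]HM fct_sumE.
 by elim/big_rec2: _ => [|t x y _ ->];[rewrite op_linear0|have := iL t0.+1 1 (Pt t f S) x;rewrite !scale1r].
elim/big_rec: _ => [|t g _ hg];first by apply: bdr_sm => // S;apply: sm0.
by have := bdrL 1 hN (bt t) hg;rewrite scale1r.
Qed.
Definition nz i N := exists f : cpl, [/\ cyc N f, forall S : set_d, #|S| != i -> f S = 0 & ~ bdr N f].

(** Multiplying by xi as long as possible gives a cycle f1 that does not bound while xi f1 = bd g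
    modulo N. Then g is a cycle of degree i + 1 modulo N + xi E. If it bounded there, g = bd h + xi
    y, then xi (f1 + bd y) or xi (f1 - bd y), according to sign, would lie in N, and f1 would bound
    by regularity. *)
Lemma nz_step i N : submod N -> (forall x, N x -> N (xi x)) -> (forall x, E x -> N (xi x) -> N x) ->
 nz i N -> nz i.+1 (fun x => E x /\ exists2 y, E y & N (x - xi y)).
move=> hN Nxi reg [f [cf sf nf]].
have [a0 Ha0] := iter_xi_bdr hN Nxi cf.
have ex: exists a, `[< bdr N (fun S => iter a xi (f S)) >] by exists a0;apply/asboolP.
case: (ex_minnP ex) => [[|a]] /asboolP ba mina;first by case: nf.
(* The exponent in [mina] is minimal, so one factor xi less leaves a chain that does not bound. *)
pose f1 S := iter a xi (f S).
have nf1: ~ bdr N f1 by move=> /asboolP /mina;rewrite ltnn.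
have Ef1 S : E (f1 S) by rewrite /f1;elim: (a) => [|b IH] /=;[apply: cf.1|apply: Exi].
have sf1 (S : set_d) : #|S| != i -> f1 S = 0.
 by move=> /sf;rewrite /f1 => ->;elim: (a) => //= b ->;apply: op_linear0.
have [g Eg Hg] := ba;pose g' (S : set_d) := if #|S| == i.+1 then g S else 0.
have Eg' S : E (g' S) by rewrite /g';case: ifP.
have bg' S : bd g' S = if #|S| == i then bd g S else 0.
 rewrite /bd /g';case: ifP => h.
  by apply: eq_bigr => j jS;rewrite cardsU1 jS add1n eqSS h.
 by rewrite big1 // => j jS;rewrite cardsU1 jS add1n eqSS h z0 scaler0.
have Hg' S : N (xi (f1 S) - bd g' S).
 rewrite bg';case: ifP => h;first exact: Hg.
 by rewrite sf1 ?h // op_linear0 // subr0;apply: sm0.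
exists g';split.
- split=> // S;split;first by apply: bd_sm smE_sub _.
 exists (f1 S) => //;rewrite -opprB -[- _]add0r;apply: smB => //;exact: sm0.
- by move=> S;rewrite /g' => /negbTE ->.
case=> h Eh' Hh.
have Hh' S := (Hh S).2;have [y Hy] : exists y : cpl, forall S, E (y S) /\ N (g' S - bd h S - xi (y S)).
 have Q S : exists y, E y /\ N (g' S - bd h S - xi y) by have [y Ey Ny] := Hh' S;exists y.
 by have [y Hy] := choice Q;exists y.
apply: nf1;exists y => S;first by have [] := Hy S.
have Ebd: E (bd y S) by apply: bd_sm smE_sub _ => T;have [] := Hy T.
apply: reg;first exact: (smB smE_sub).
have : N (bd (fun T => g' T - bd h T - xi (y T)) S) by apply: bd_sm => // T;have [] := Hy T.
rewrite (bdB (fun T => g' T - bd h T) (fun T => xi (y T))) (bdB g' (bd h)) bd_bd subr0 bd_xi => h1.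
have := smD hN (Hg' S) h1;rewrite addrA subrK.
by have := xiL (-1) (bd y S) (f1 S);rewrite !scaleN1r [- _ + _]addrC [- _ + xi _]addrC => ->.
Qed.
Lemma nz_large i N : (d < i)%N -> submod N -> ~ nz i N.
move=> di hN [f [cf sf nf]];apply: nf;apply: bdr_sm => // S;rewrite sf;first exact: sm0.
by rewrite neq_ltn (leq_ltn_trans (max_card _)) // card_ord.
Qed.
End Koszul.

Import -(notations) mpoly.

Lemma In_map_mem (A : eqType) (B : Type) (f : A -> B) (s : seq A) z :
 List.In z (map f s) <-> exists2 b, b \in s & f b = z.
elim: s => [|a s IH] /=;first by split=> // -[].
split=> [[<-|/IH[b bs <-]]|[b]];first by exists a;rewrite ?mem_head.
 by exists b;rewrite // inE bs orbT.
by rewrite inE => /orP[/eqP <-|bs] eb;[left|right;apply/IH;exists b].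
Qed.
Lemma In_nth_ord (B : Type) (z0 : B) (s : seq B) z : List.In z s <-> exists a : 'I_(size s), nth z0 s a = z.
have : s = [seq nth z0 s (nat_of_ord a) | a <- enum 'I_(size s)].
 by rewrite (map_comp (nth z0 s) val) val_enum_ord -/(mkseq _ _) mkseq_nth.
move=> es;rewrite {1}es In_map_mem;split=> [[b _ <-]|[a <-]];[by exists b|exists a => //].
by rewrite mem_enum.
Qed.
Lemma antisym_sum0 (V : zmodType) d (F : 'I_d -> 'I_d -> V) : (forall i j, F i j = - F j i) ->
 (forall i, F i i = 0) -> \sum_j \sum_i F i j = 0.
move=> as_F F0.
have -> : \sum_j \sum_i F i j =
  \sum_(j < d) \sum_(i < d | (i < j)%N) F i j + \sum_(j < d) \sum_(i < d | (j < i)%N) F i j.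
 rewrite -big_split;apply: eq_bigr => j _;rewrite (bigID (fun i : 'I_d => (i < j)%N)) /=;congr (_ + _).
 rewrite (bigD1 j) ?ltnn //= F0 add0r;apply: eq_bigl => i.
 by rewrite -leqNgt ltn_neqAle andbC [in RHS]eq_sym -val_eqE.
rewrite [X in _ + X](exchange_big_dep xpredT) //= -big_split big1 // => j _ /=.
by rewrite -big_split big1 // => i _ /=;rewrite as_F addNr.
Qed.

(** * Freeness from the vanishing of the first Koszul homology *)

Section Free.
Variables (k : fieldType) (T : algType k) (d : nat) (x : 'I_d -> T) (e : 'I_d -> nat).
Variables (pr : nat -> T -> T) (M : T -> Prop).
Hypothesis xC : forall j y, x j * y = y * x j.
Hypothesis prL : forall n a u v, pr n (a *: u + v) = a *: pr n u + pr n v.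
Hypothesis prz : forall n j y, pr (n + e j) (x j * y) = x j * pr n y.
Hypothesis prz0 : forall n j y, (n < e j)%N -> pr n (x j * y) = 0.
Hypothesis e0 : forall j, (0 < e j)%N.
Hypothesis prsum : forall y, exists N, y = \sum_(n < N) pr n y.
Hypothesis prpr : forall m n y, pr m (pr n y) = if m == n then pr n y else 0.
Hypotheses (M0 : M 0) (ML : forall a u v, M u -> M v -> M (a *: u + v)) (Mx : forall j u, M u -> M (x j * u)).
Hypothesis Mpr : forall n u, M u -> M (pr n u).
Local Notation ops := (zops (fun j y => x j * y) e).
Local Notation gn := (gen ops (fun (_ : nat) (y : T) => y = 0)).
Hypothesis M_fg : exists S : seq (nat * T), (forall n y, List.In (n, y) S -> M y /\ pr n y = y) /\
 forall n y, M y -> pr n y = y -> gn S n y.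
Hypothesis H1 : forall f : 'I_d -> T, (forall j, M (f j)) -> \sum_j x j * f j = 0 ->
 exists G : 'I_d -> 'I_d -> T, [/\ forall i j, M (G i j), forall j, f j = \sum_i x i * G i j,
  forall i j, G i j = - G j i & forall i, G i i = 0].

Let pr0 n : pr n 0 = 0.
by have := prL n (-1) 0 0;rewrite !scaleN1r !addNr. Qed.
Let prD n u v : pr n (u + v) = pr n u + pr n v.
by have := prL n 1 u v;rewrite !scale1r. Qed.
Let prZ n a u : pr n (a *: u) = a *: pr n u.
by have := prL n a u 0;rewrite pr0 !addr0. Qed.
Let pr_sum n (I : Type) (r : seq I) (P : pred I) (F : I -> T) :
 pr n (\sum_(i <- r | P i) F i) = \sum_(i <- r | P i) pr n (F i).
by elim/big_rec2: _ => [|i u v _ <-];rewrite ?pr0 ?prD. Qed.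
Let MD u v : M u -> M v -> M (u + v).
by move=> hu hv;rewrite -[u]scale1r;apply: ML. Qed.
Let M_sum (I : Type) (r : seq I) (P : pred I) (F : I -> T) : (forall i, P i -> M (F i)) -> M (\sum_(i <- r | P i) F i).
by move=> h;elim/big_rec: _ => // i u Pi hu;apply: MD => //;apply: h. Qed.
(** The component of lowest possible degree of P(x) y is the constant term of P times y, because the
    x j have positive degree. *)
Lemma mpeval_hom n0 y : pr n0 y = y -> forall P,
 [/\ forall n, gn [:: (n0, y)] n (pr n (mpeval x P * y)), forall n, (n < n0)%N -> pr n (mpeval x P * y) = 0 &
   pr n0 (mpeval x P * y) = cterm P *: y].
move=> hy;elim/mpoly_vX_ind => [|j Q [IH1 IH2 IH3]|a P Q [h1 h2 h3] [h1' h2' h3']].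
- rewrite mpeval1 mul1r cterm1 scale1r;split=> // n;last by rewrite -hy prpr => /ltn_eqF ->.
 rewrite -hy prpr;case: eqP => [->|_];last exact: gen_base.
 by rewrite hy;apply: gen_mem;left.
- rewrite mpevalX // -mulrA ctermX scale0r.
 have lt n : (n <= n0)%N -> pr n (x j * (mpeval x Q * y)) = 0.
  move=> le;case: (leqP (e j) n) => h;last exact: prz0.
  rewrite -(subnK h) prz IH2 ?mulr0 //;have := e0 j;lia.
 split=> [n|n /ltnW|];[|exact: lt|exact: lt].
 case: (leqP (e j) n) => h;last by rewrite prz0 //;apply: gen_base.
 rewrite -(subnK h) prz;apply: (gen_op (o := (e j, fun y => x j * y)));last exact: IH1.
 exact: zops_in.
rewrite mpevalL mulrDl -scalerAl;split=> [n|n lt|];rewrite prL.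
- by apply: gen_add;[apply: gen_scale;apply: h1|apply: h1'].
- by rewrite h2 // h2' // scaler0 addr0.
by rewrite h3 h3' ctermL scalerDl scalerA.
Qed.
Definition gens (S : seq (nat * T)) := (forall n y, List.In (n, y) S -> M y /\ pr n y = y) /\
 forall n y, M y -> pr n y = y -> gn S n y.

Lemma min_gens : exists2 S, gens S & forall S', gens S' -> (size S <= size S')%N.
have [S gS] := M_fg.
have ex: exists r, `[< exists2 S, gens S & size S = r >] by exists (size S);apply/asboolP;exists S.
case: (ex_minnP ex) => r /asboolP[S0 g0 s0] min;exists S0 => // S' g'.
by rewrite s0;apply: min;apply/asboolP;exists S'.
Qed.
Lemma gen_sub S S' n y : (forall m u, List.In (m, u) S -> gn S' m u) -> gn S n y -> gn S' n y.
move=> h;elim=> [m u u0|m u hu|m u v _ h1 _ h2|m a u _ h1|o m u ho _ h1].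
- exact: gen_base.
- exact: h.
- exact: gen_add.
- exact: gen_scale.
exact: gen_op.
Qed.

Section Basis.
Variable S : seq (nat * T).
Hypotheses (gS : gens S) (minS : forall S', gens S' -> (size S <= size S')%N).
Local Notation z0 := (0%N, 0 : T).
Definition elt (a : 'I_(size S)) : T := (nth z0 S a).2.
Definition ev (c : 'I_(size S) -> {mpoly k[d]}) : T := \sum_a mpeval x (c a) * elt a.

Let inS (a : 'I_(size S)) : List.In ((nth z0 S a).1, elt a) S.
by apply/(In_nth_ord z0);exists a;rewrite /elt;case: (nth _ _ _). Qed.
Lemma elt_M a : M (elt a). Proof. by have [] := gS.1 _ _ (inS a). Qed.
Lemma eq_ev c c' : (forall a, c a = c' a) -> ev c = ev c'.
by move=> h;apply: eq_bigr => a _;rewrite h. Qed.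
Lemma evL b c c' : ev (fun a => b *: c a + c' a) = b *: ev c + ev c'.
rewrite /ev scaler_sumr -big_split;apply: eq_bigr => a _ /=.
by rewrite mpevalL mulrDl scalerAl.
Qed.
Lemma ev0 : ev (fun=> 0) = 0.
by rewrite /ev big1 // => a _;rewrite mpeval0 mul0r. Qed.
Lemma evX j c : ev (fun a => vX k j * c a) = x j * ev c.
by rewrite /ev mulr_sumr;apply: eq_bigr => a _;rewrite mpevalX // mulrA. Qed.
Lemma evN c : ev (fun a => - c a) = - ev c.
by have := evL (-1) c (fun=> 0);rewrite ev0 addr0 scaleN1r => <-;apply: eq_ev => a;rewrite scaleN1r addr0. Qed.
Lemma evD c c' : ev (fun a => c a + c' a) = ev c + ev c'.
by have := evL 1 c c';rewrite scale1r => <-;apply: eq_ev => a;rewrite scale1r. Qed.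
Lemma ev_sum (I : finType) (F : I -> 'I_(size S) -> {mpoly k[d]}) :
 ev (fun a => \sum_i F i a) = \sum_i ev (F i).
rewrite /index_enum;elim: (Finite.enum I) => [|i s IH].
 by rewrite big_nil -[RHS]ev0;apply: eq_ev => a;rewrite big_nil.
by rewrite big_cons -IH -evD;apply: eq_ev => a;rewrite big_cons.
Qed.
Lemma ev_M c : M (ev c).
apply: M_sum => a _;elim/mpoly_vX_ind: (c a) => [|j Q IH|b P Q hP hQ].
- by rewrite mpeval1 mul1r;apply: elt_M.
- by rewrite mpevalX // -mulrA;apply: Mx.
by rewrite mpevalL mulrDl -scalerAl;apply: ML.
Qed.
Lemma ev_gen n y : gn S n y -> exists c, y = ev c.
elim=> [m u ->|m u hu|m u v _ [c ->] _ [c' ->]|m b u _ [c ->]|o m u ho _ [c ->]].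
- by exists (fun=> 0);rewrite ev0.
- have [a ea] := (In_nth_ord z0 S (m, u)).1 hu;exists (fun b => if b == a then 1 else 0).
 rewrite /ev (bigD1 a) //= eqxx mpeval1 mul1r big1 ?addr0;first by rewrite /elt ea.
 by move=> b /negbTE ->;rewrite mpeval0 mul0r.
- by exists (fun a => c a + c' a);rewrite evD.
- exists (fun a => b *: c a + 0);by rewrite evL ev0 addr0.
by have [j ->] := in_zops ho;exists (fun a => vX k j * c a);rewrite evX.
Qed.
Lemma ev_surj y : M y -> exists c, y = ev c.
move=> hy;have [N ->] := prsum y.
have h (n : 'I_N) : exists c, pr n y = ev c.
 by apply: (@ev_gen n);apply: gS.2;[apply: Mpr|rewrite prpr eqxx].
have [c hc] := choice h;exists (fun a => \sum_i c i a).
by rewrite ev_sum;apply: eq_bigr => i _;rewrite hc.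
Qed.
(** Otherwise the component of the relation in the degree of the generator a would express a through
    the other generators, against minimality. *)
Lemma rel_cterm c a : ev c = 0 -> cterm (c a) = 0.
move=> rc;apply/eqP;apply: contraT => nz.
pose S' := [seq nth z0 S (nat_of_ord b) | b <- rem a (enum 'I_(size S))].
have [Mhom hgen] := gS;set n0 := (nth z0 S a).1.
have inS' (b : 'I_(size S)) : b != a -> List.In ((nth z0 S b).1, elt b) S'.
 move=> ba;apply/In_map_mem;exists b;last by rewrite /elt;case: (nth _ _ _).
 by rewrite mem_rem_uniq ?enum_uniq // inE ba mem_enum.
have Ha: gn S' n0 (elt a).
 have := congr1 (pr n0) rc;rewrite pr0 /ev pr_sum (bigD1 a) //=.
 have [_ _ ->] := mpeval_hom (Mhom _ _ (inS a)).2 (c a) => /eqP.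
 rewrite addr_eq0 => /eqP /(congr1 (fun t => (cterm (c a))^-1 *: t)).
 rewrite scalerA mulVf // scale1r => ->;apply: gen_scale;rewrite -scaleN1r;apply: gen_scale.
 elim/big_rec: _ => [|b u ba hu];first exact: gen_base.
 apply: gen_add => //;have [h _ _] := mpeval_hom (Mhom _ _ (inS b)).2 (c b).
 by apply: gen_sub (h n0) => m v [[<- <-]|//];apply: gen_mem;apply: inS'.
have : gens S'.
 split=> [n y /In_map_mem[b _ eb]|n y hy hn].
  by apply: Mhom;apply/(In_nth_ord z0);exists b.
 apply: gen_sub (hgen n y hy hn) => m u /(In_nth_ord z0)[b eb].
 have [eba|ba] := eqVneq b a;last by apply: gen_mem;have := inS' b ba;rewrite /elt eb.
 by move: Ha;rewrite /n0 /elt -eba eb.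
move/minS;rewrite size_map size_rem ?mem_enum // size_enum_ord.
by have := ltn_ord a;lia.
Qed.
(** Write c as the sum of the X_j Q_j. The values f j of the Q_j satisfy the sum of x_j f_j = 0, so
    H1 gives f_j as the sum of x_i G_ij with G alternating. Correcting the Q_j by lifts of the G_ij
    turns them into relations P_j without changing c, so c has order one more than the P_j. *)
Lemma rel_ordp n c : ev c = 0 -> forall a, ordp n (c a).
elim: n c => [|n IH] c rc a;first by move=> m;rewrite ltn0.
have [Q HQ] := choice (fun a => divX (rel_cterm a rc)).
pose f j := ev (fun a => Q a j).
have [|G [MG fG asG G0]] := H1 (f := f) (fun j => ev_M _).
 rewrite -[RHS]rc [in RHS](eq_ev HQ) ev_sum;apply: eq_bigr => j _;by rewrite evX.
have [R HR] := choice (fun ij : 'I_d * 'I_d => ev_surj (MG ij.1 ij.2)).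
(* Lifts are taken for i < j and extended by antisymmetry, so that the correction cancels among the
   polynomials and not only after evaluation. *)
pose R' (i j : 'I_d) (a : 'I_(size S)) := if (i < j)%N then R (i, j) a else if (j < i)%N then - R (j, i) a else 0.
have GR i j : G i j = ev (R' i j).
 rewrite /R';case: (ltngtP i j) => [lt|lt|/val_inj ->].
 - exact: HR (i, j).
 - by rewrite evN asG;congr (- _);apply: HR (j, i).
 by rewrite ev0 G0.
have R'as i j b : R' i j b = - R' j i b.
 by rewrite /R';case: (ltngtP i j) => _;rewrite ?opprK ?oppr0.
pose P (j : 'I_d) (a : 'I_(size S)) := Q a j - \sum_i vX k i * R' i j a.
have relP j : ev (P j) = 0.
 rewrite evD evN ev_sum -/(f j) fG;apply/eqP;rewrite subr_eq0;apply/eqP.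
 by apply: eq_bigr => i _;rewrite evX GR.
have -> : c a = \sum_j vX k j * P j a.
 rewrite HQ;apply: etrans (esym (subr0 _)) _.
 rewrite -[X in _ - X = _](antisym_sum0 (F := fun i j => vX k j * (vX k i * R' i j a))).
 - rewrite -sumrB;apply: eq_bigr => j _;by rewrite mulrBr mulr_sumr.
 - by move=> i j;rewrite R'as !mulrN mulrCA.
 - by move=> i;rewrite /R' ltnn !mulr0.
by apply: ordp_sum => j;apply: ordpX;apply: IH.
Qed.
Lemma basis_free : free_fg_module x M.
exists (size S), elt;split=> [|y hy];first exact: elt_M.
have [c ec] := ev_surj hy;exists (finfun c);split.
 by rewrite ec;apply: eq_bigr => a _;rewrite ffunE.
move=> c' ec';apply/ffunP => a;rewrite ffunE;apply/eqP;rewrite -subr_eq0;apply/eqP.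
apply: ordp_all => n;apply: (@rel_ordp n (fun a => c a - c' a)).
by rewrite evD evN -ec {1}ec' subrr.
Qed.
End Basis.

Theorem free_of_syzygies : free_fg_module x M.
by have [S gS minS] := min_gens;apply: basis_free gS minS. Qed.
End Free.

Lemma indep_card (k : fieldType) (V : lmodType k) (I J : finType) (v : I -> V) (w : J -> V) (A : I -> J -> k) :
 (forall i, v i = \sum_j A i j *: w j) ->
 (forall c : I -> k, \sum_i c i *: v i = 0 -> forall i, c i = 0) -> (#|I| <= #|J|)%N.
move=> vA ind;rewrite leqNgt;apply/negP => lt.
pose B : 'M[k]_(#|I|, #|J|) := \matrix_(i, j) A (enum_val i) (enum_val j).
have : kermx B != 0 by rewrite -mxrank_eq0 mxrank_ker subn_eq0 -ltnNge (leq_ltn_trans (rank_leq_col B)).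
case/rowV0Pn => u /sub_kermxP uB /negP;apply;apply/eqP/rowP => i;rewrite mxE.
rewrite -[i]enum_valK;apply: (ind (fun t => u 0 (enum_rank t))).
under eq_bigr => t _ do rewrite vA scaler_sumr.
rewrite exchange_big big1 // => j _ /=.
under eq_bigr => t _ do rewrite scalerA.
rewrite -scaler_suml (_ : \sum_t _ = 0) ?scale0r //.
have e0 := congr1 (fun N : 'rV_#|J| => N 0 (enum_rank j)) uB;rewrite !mxE in e0;rewrite -[RHS]e0.
rewrite (reindex (enum_val (A := I))) /=;last exact: onW_bij (enum_val_bij I).
by apply: eq_bigr => t _;rewrite !mxE enum_rankK enum_valK.
Qed.

(** * Growth of the cohomology of an elementary abelian group *)

Section AbelianGenerators.
Variables (k : fieldType) (p : nat) (gT : finGroupType) (E : {group gT}).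
Hypotheses (p_pr : prime p) (char_k : p \in [pchar k]) (aE : (p.-abelem E)%g).

(** One character for each dimension: H(D) modulo beta l is noetherian by [noeth_beta] and induction
    on ker l, and beta l itself, taken as an operator, lifts this to H(D). *)
Lemma noeth_chars : exists A : seq (nat * (seq gT -> k)), [/\ (size A <= logn p #|E|)%N,
 forall b, List.In b A -> exists2 l, @achar p gT E l & b = (2%N, bta k l) & noeth (top A) (zt E) (bt E)].
suff H n (D : {group gT}) : (#|D| <= n)%N -> D \subset E -> exists A : seq (nat * (seq gT -> k)),
  [/\ (size A <= logn p #|D|)%N,
  forall b, List.In b A -> exists2 l, @achar p gT E l & b = (2%N, bta k l) & noeth (top A) (zt D) (bt D)].
 exact: (H _ E (leqnn _) (subxx _)).
elim: n D => [|n IH] D leD sDE;first by move: leD;rewrite leqNgt cardG_gt0.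
have [D1|/trivgPn[c cD c1]] := eqVneq (D : {set gT}) 1%g.
 exists [::];split=> //;have -> : D = 1%G by apply: val_inj.
 exact: noeth_trivial_group.
have [|l [cl _ lc]] := achar_exists p_pr aE (sub1G E) (subsetP sDE c cD).
 by rewrite inE.
have clD: @achar p gT D l by move=> x y xD yD;apply: cl;apply: (subsetP sDE).
have aD := abelemS sDE aE;have pD := abelem_pgroup aD.
have prK: ckerg clD \proper D.
 apply/properP;split;first by apply/subsetP => g;rewrite inE => /andP[].
 by exists c;rewrite // inE cD lc oner_eq0.
have sK := proper_sub prK.
have [|A' [sA hA nA]] := IH (ckerg clD) _ (subset_trans sK sDE).
 by rewrite -ltnS;apply: leq_trans leD;apply: proper_card.
set A := (2%N, bta k l) :: A';exists A.
have hA2 b : List.In b A -> exists2 l, @achar p gT E l & b = (2%N, bta k l).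
 by case=> [<-|/hA//];exists l.
have cA: cocycles D A.
 move=> b /hA2[l' cl' ->];apply: (bta_zt p_pr char_k aD) => x y xD yD.
 by apply: cl';apply: (subsetP sDE).
have ev: evens A by move=> b /hA2[l' _ ->].
split=> //=.
 apply: leq_ltn_trans sA _;rewrite -(ltn_exp2l _ _ (prime_gt1 p_pr)).
 by rewrite -(card_pgroup (pgroupS sK pD)) -(card_pgroup pD) proper_card.
have nA2: noeth (top A) (zt (ckerg clD)) (bt (ckerg clD)).
 by apply: noeth_more nA => o;right.
have nB := @noeth_beta k p gT D p_pr char_k aD A l clD (ex_intro2 _ _ c cD _) cA nA2.
have {}nB := nB (_ : l c != 0);rewrite lc oner_neq0 in nB;have {}nB := nB isT.
apply: (noeth_ideal (bs := [:: (2%N, bta k l)]) ev cA);first by move=> b [<-|//];left.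
have zb := bta_zt p_pr char_k aD clD.
have gI: gsub (top A) (cI (inI (k := k) (E := D) [:: (2%N, bta k l)])).
 by apply: gsub_ideal => //;[exact: inI0|exact: inID|exact: inIM].
apply: (noeth_mono gI _ _ nB);first by [].
move=> n' u /(multiplesP _ _ zb)[zu [y ey]];split;first exact: zu.
exists y;apply: etrans (congr1 (fun t => t - _) ey) _;exact: subrr.
Qed.
Lemma abelem_gens : exists (r : nat) (b : 'I_r -> 'H^*(E, k)) (S : seq (nat * 'H^*(E, k))),
 [/\ (r <= logn p #|E|)%N, forall j y, b j * y = y * b j &
 forall n y, hcl n y -> exists P : 'I_(size S) -> {mpoly k[r]},
  (forall a, lowdeg n (P a)) /\ y = \sum_a mpeval b (P a) * (nth (0%N, 0) S a).2].
have [A [sA hA nA]] := noeth_chars.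
have cA: cocycles E A by move=> b /hA[l cl ->];apply: (bta_zt p_pr char_k aE cl).
pose b0 : nat * (seq gT -> k) := (0%N, fun=> 0).
pose b (j : 'I_(size A)) : 'H^*(E, k) := fcl E (nth b0 A j).1 (nth b0 A j).2.
have inA (j : 'I_(size A)) : List.In (nth b0 A j) A by apply/(In_nth_ord b0);exists j.
have bC j y : b j * y = y * b j.
 have [l cl e] := hA _ (inA j);rewrite /b e;exact: (beta_comm p_pr char_k aE).
have [||s [sZ sg]] := nA (zt E) (gsub_zt cA);[by move=> n u;apply: bt_zt|by []|].
have cs: @cocycles k gT E s by move=> [n u] h;apply: sZ.
exists (size A), b, (@rcls k gT E s);split=> // n y hy;have [f zf ef] := hcl_fclP hy.
have [_] := @gen_fcl k gT E A s n f cA cs (sg n f zf);rewrite -ef.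
move: (@rcls k gT E s) => S;elim=> [m u ->|m u hu|m u v _ [P [lP ->]] _ [Q [lQ ->]]|m a u _ [P [lP ->]]|o m u ho _ [P [lP ->]]].
- exists (fun=> 0);split=> [a m' _|];first by rewrite mcoeff0.
 by rewrite big1 // => a _;rewrite mpeval0 mul0r.
- have [a ea] := (In_nth_ord (0%N, 0) S (m, u)).1 hu;exists (fun b => if b == a then 1 else 0);split.
  by move=> b';case: eqP => _;[apply: lowdeg1|move=> m' _;rewrite mcoeff0].
 rewrite (bigD1 a) //= eqxx mpeval1 mul1r big1 ?addr0;first by rewrite ea.
 by move=> b' /negbTE ->;rewrite mpeval0 mul0r.
- exists (fun a => 1 *: P a + Q a);split=> [a|];first exact: lowdegL.
 by rewrite -big_split;apply: eq_bigr => a _;rewrite mpevalL scale1r mulrDl.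
- exists (fun i => a *: P i + 0);split=> [i|];first by apply: lowdegL => // m' _;rewrite mcoeff0.
 by rewrite scaler_sumr;apply: eq_bigr => i _;rewrite mpevalL mpeval0 addr0 scalerAl.
have [b1 [ob1 bA]] : exists b1, o = (b1.1, fun x => x * b1.2) /\ List.In b1 (rcls E A).
 by have [b1 [<- h]] := (List.in_map_iff _ _ _).1 ho;exists b1.
have [b2 [e2 h2]] := (List.in_map_iff _ _ _).1 bA;have [j ej] := (In_nth_ord b0 A b2).1 h2.
have eo: o = (2%N, fun x => x * b j).
 have [l cl e] := hA _ h2;rewrite ob1 -e2 /b ej e //.
rewrite eo /=;exists (fun a => vX k j * P a);split=> [a|].
 have h := lowdegX j (lP a);move=> m' lm;apply: h;lia.
by rewrite -bC mulr_sumr;apply: eq_bigr => a _;rewrite mpevalX // mulrA.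
Qed.
(** The N^d monomials in x with exponents below N are linearly independent, yet they lie in the span
    of size S times (D + 1)^r elements with D linear in N, where r is at most the rank of E. For d >
    r this fails for large N. *)
Lemma growth d (x : 'I_d -> 'H^*(E, k)) (e : 'I_d -> nat) : (forall i, hcl (e i) (x i)) ->
 (forall j y, x j * y = y * x j) -> alg_independent x -> (d <= logn p #|E|)%N.
move=> hx xC ind;have [r [b [S [ler bC hS]]]] := abelem_gens;apply: leq_trans ler.
(* As D + 1 <= N (d W + 1), the spanning set has at most K N^r elements; N = K + 1 then contradicts
   N^(r+1) <= K N^r. *)
pose W := (\sum_i e i)%N;pose K := (size S * (d * W).+1 ^ r)%N;pose N := K.+1.
pose D := (d * N * W)%N.
have Hm (m : {ffun 'I_d -> 'I_N}) : exists c : 'I_(size S) * {ffun 'I_r -> 'I_D.+1} -> k,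
  mpeval x (monoX k m) = \sum_j c j *: (mpeval b (monoX k j.2) * (nth (0%N, 0) S j.1).2).
 have [||n le [t let' ht]] := @monoX_ind k d N (fun n Q => exists2 t, (t <= n * W)%N & hcl t (mpeval x Q)) _ _ m.
 - move=> j n Q [t le ht];exists (e j + t)%N.
   by rewrite mulSn leq_add // /W (bigD1 j) //= leq_addr.
  by rewrite mpevalX //;apply: hclM.
 - by exists 0%N => //;rewrite mpeval1;apply: hcl1.
 have [P [lP ->]] := hS _ _ ht.
 have lP' a : lowdeg D (P a).
  move=> m' lm;apply: lP;apply: leq_ltn_trans lm;apply: leq_trans let' _;exact: leq_mul.
 have [c hc] := choice (fun a => lowdeg_mono (lP' a)).
 exists (fun j => c j.1 j.2);rewrite -(pair_big xpredT xpredT (fun a m' =>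
  c a m' *: (mpeval b (monoX k m') * (nth (0%N, 0) S a).2))) /=.
 apply: eq_bigr => a _;rewrite {1}(hc a).
 have mpsum (I : finType) (F : I -> k) (Q : I -> {mpoly k[r]}) :
   mpeval b (\sum_i F i *: Q i) = \sum_i F i *: mpeval b (Q i).
  by elim/big_rec2: _ => [|i u v _ <-];rewrite ?mpeval0 // mpevalL.
 by rewrite mpsum mulr_suml;apply: eq_bigr => m' _;rewrite scalerAl.
have [A hA] := choice Hm.
have := @indep_card k _ _ _ _ _ A hA.
rewrite card_prod !card_ffun !card_ord => card_le.
have {card_le} le : (N ^ d <= size S * D.+1 ^ r)%N.
 apply: card_le => c sc m;apply: (monoX_indep (c := c)) => //;apply: ind.
 rewrite mpeval0 -[RHS]sc;elim/big_rec2: _ => [|i u v _ <-];rewrite ?mpeval0 //.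
 by rewrite mpevalL.
rewrite leqNgt;apply/negP => lt.
have leD: (D.+1 <= N * (d * W).+1)%N.
 by rewrite /D mulnS -addn1 addnC leq_add // mulnAC mulnC.
have : (N ^ r.+1 <= K * N ^ r)%N.
 apply: leq_trans (_ : N ^ d <= _)%N;first exact: leq_pexp2l.
 apply: leq_trans le _;rewrite /K -mulnA leq_mul2l -expnMn [X in (_ <= X ^ _)%N]mulnC;apply/orP;right.
 by case: (r) => // r';rewrite leq_exp2r.
by rewrite expnS leq_pmul2r ?expn_gt0 // ltnn.
Qed.
End AbelianGenerators.

(** * Parameters as central operators *)

Section ParameterSystem.
Variable k : fieldType.

(** A class of degree 0 is a scalar, and a class of odd degree squares to zero unless -1 = 1 in k;
    both are algebraic relations. *)
Lemma indep_degree (H : finGroupType) d (x : 'I_d -> cohomology k H) e i : alg_independent x ->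
 hcl e (x i) -> (0 < e)%N /\ ~~ (odd e && ((-1) != 1 :> k)).
move=> ind hx;split.
 rewrite lt0n;apply/eqP => e0;move: hx;rewrite e0 => /hcl_degree0[a xa].
 apply: (@vX_neq k d i a);apply: ind;rewrite mpeval_vX xa.
 by have := mpevalL x a 1 0;rewrite mpeval0 mpeval1 !addr0 => ->.
apply/negP => /andP[oe n1].
have xx: x i * x i = 0.
 have := hcl_comm hx hx;rewrite -signr_odd oddM oe expr1 scaleN1r => /eqP.
 rewrite -subr_eq0 opprK -[x i * x i]scale1r -scalerDl scaler_eq0 => /orP[|/eqP e1].
  by move=> /eqP e2;case/negP: n1;rewrite eq_sym -subr_eq0 opprK e2.
 by rewrite scale1r e1.
have [P P0 eP] := mpeval_vX2 xx;apply: P0;apply: ind;by rewrite eP mpeval0.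
Qed.
Lemma parity_sign e : ~~ (odd e && ((-1) != 1 :> k)) -> (-1) ^+ e = 1 :> k.
by rewrite negb_and negbK => /orP[/sign_even -> //|/eqP ->];rewrite expr1n. Qed.

Variables (gT : finGroupType) (L : {group gT}) (d : nat).
Local Notation HL := 'H^*(L, k).
Variables (x : 'I_d -> HL) (e : 'I_d -> nat) (f : 'I_d -> seq gT -> k).
Hypotheses (zf : forall i, zt L (e i) (f i)) (xf : forall i, x i = fcl L (e i) (f i)).
Hypotheses (e0 : forall i, (0 < e i)%N) (ev : forall i, ~~ (odd (e i) && ((-1) != 1 :> k))).

Definition parlist : seq (nat * (seq gT -> k)) := [seq (e i, f i) | i <- enum 'I_d].

Lemma par_hcl i : hcl (e i) (x i).
by rewrite xf;apply: hcl_fcl. Qed.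
Lemma par_central i y : x i * y = y * x i.
by apply: even_central (par_hcl i) _;apply: parity_sign. Qed.
Lemma par_evens : evens parlist.
by move=> b /List.in_map_iff[i [<- _]];split;[apply: ev|apply: e0]. Qed.
Lemma par_cocycles : cocycles L parlist.
by move=> b /List.in_map_iff[i [<- _]];apply: zf. Qed.
Lemma par_zop : zop (rcls L parlist) = zops (fun j y => x j * y) e.
rewrite /zop /rcls /parlist /zops -!map_comp;apply: eq_map => i /=;congr pair.
by apply/funext => y;rewrite par_central xf.
Qed.
Lemma par_prz n j y : hpr (n + e j) (x j * y) = x j * hpr n y.
by rewrite addnC;apply: hpr_mul;apply: par_hcl. Qed.
Lemma par_prz0 n j y : (n < e j)%N -> hpr n (x j * y) = 0.
exact: hpr_mul_lt (par_hcl j). Qed.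
Lemma par_prL n (a : k) (u v : HL) : hpr n (a *: u + v) = a *: hpr n u + hpr n v.
exact: hpr_linear. Qed.
(** The given generators need not be homogeneous; their components generate the graded module, and
    [fg_noeth] applies. *)
Lemma fg_noeth_top : fg_module x (fun=> True) -> noeth (top parlist) (zt L) (bt L).
case=> r [g [_ gP]].
have [N HN] := choice (fun a => hpr_sum (g a)).
pose NN := (\sum_a N a)%N;pose I := ('I_r * 'I_NN)%type.
have gN a : g a = \sum_(n < NN) hpr n (g a).
 by apply: HN;rewrite /NN (bigD1 a) //= leq_addr.
pose S : seq (nat * HL) := [seq (nat_of_ord b.2, hpr b.2 (g b.1)) | b <- enum {: I}].
have inS a (n : 'I_NN) : List.In (nat_of_ord n, hpr n (g a)) S.
 by apply/In_map_mem;exists (a, n);rewrite ?mem_enum.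
have hS n y : List.In (n, y) S -> hcl n y.
 by move=> /In_map_mem[b _ [<- <-]];apply: hcl_hpr.
have Sg n y : hcl n y -> gen (zops (fun j y => x j * y) e) (fun _ y => y = 0) S n y.
 move=> hy;have [c ec] := gP y Logic.I;rewrite -hy ec.
 rewrite (_ : hpr n _ = \sum_a \sum_(m < NN) hpr n (mpeval x (c a) * hpr m (g a)));last first.
  rewrite raddf_sum;apply: eq_bigr => a _;rewrite {1}(gN a) mulr_sumr raddf_sum.
  by apply: eq_bigr.
 elim/big_rec: _ => [|a u _ hu];first exact: gen_base.
 apply: gen_add => //;elim/big_rec: _ => [|m v _ hv];first exact: gen_base.
 apply: gen_add => //.
 have [h _ _] := @mpeval_hom k _ d x e (@hpr k _) par_central par_prL par_prz par_prz0 e0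
  (fun m n y => hpr_hpr m n y) m (hpr m (g a)) (hcl_hpr m (g a)) (c a).
 by apply: gen_sub (h n) => m' u' [[<- <-]|//];apply: gen_mem.
have [s [cs sg]] := gen_unfcl par_cocycles hS.
apply: (@fg_noeth k _ (top parlist) (zt L) (bt L) s).
- exact: top_linear.
- exact: gsub_zt par_cocycles.
- exact: gsub_bt par_cocycles.
- by move=> n u;apply: bt_zt.
- by apply: (ops_comm_top par_evens par_cocycles) => n u.
- by move=> o /in_top[b bA ->];have [] := par_evens bA.
- by move=> n u h;exact: (cs _ h).
move=> n u zu;apply: (sg n (fcl L n (u : seq gT -> k))) => //.
by rewrite par_zop;apply: Sg;apply: hcl_fcl.
Qed.
End ParameterSystem.

(** * Vanishing of the first Koszul homology of Ess(G) *)

Section KoszulEss.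
Variables (k : fieldType) (gT : finGroupType) (G : {group gT}) (d : nat).
Local Notation HG := 'H^*(G, k).
Local Notation Ess := (@Ess k gT G).
Variables (x : 'I_d -> HG) (e : 'I_d -> nat).
Hypotheses (hx : forall i, hcl (e i) (x i)) (xC : forall i y, x i * y = y * x i) (e0 : forall i, (0 < e i)%N).
Hypothesis E_fg : exists S : seq (nat * HG), (forall n y, List.In (n, y) S -> Ess y /\ hpr n y = y) /\
 forall n y, Ess y /\ hpr n y = y -> gen (zops (fun j y => x j * y) e) (fun _ y => y = 0) S n y.
Local Notation z := (fun j y => x j * y).
Let U : lmodType k := HG.

Let E0 : Ess 0. Proof. by have [] := @Ess_ideal k gT G. Qed.
Let ED u v : Ess u -> Ess v -> Ess (u + v). Proof. by have [_ h _] := @Ess_ideal k gT G;apply: h. Qed.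
Let EM a u : Ess u -> Ess (a * u). Proof. by have [_ _ h] := @Ess_ideal k gT G;case/(h a u). Qed.
Let EL (a : k) u v : Ess u -> Ess v -> Ess (a *: u + v).
by move=> hu hv;apply: ED => //;rewrite -[u]mul1r scalerAl;apply: EM. Qed.
Lemma inE'_Ess xs y : inE' (G := G) xs y -> Ess y.
elim: xs y => [y ->|b xs IH y [u Eu /IH h]];first exact: E0.
by rewrite -[y](subrK (b * u));apply: ED => //;apply: EM.
Qed.
Lemma inE'_hpr (xs : seq HG) n y : (forall b : HG, b \in xs -> exists m, hcl m b) -> inE' (G := G) xs y -> inE' (G := G) xs (hpr n y).
elim: xs y => [y _ ->|b xs IH y hb [u Eu hu]];first exact: hpr0.
have [m hm] := hb b (mem_head _ _);exists (hprs m n u).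
 by rewrite /hprs;case: ifP => _;[apply: Ess_hpr|exact: E0].
have := IH _ (fun b' h => hb b' (mem_behead (s := b :: xs) h)) hu.
by rewrite raddfB /= (hpr_mul_shift n u hm).
Qed.
Definition good_even (b : HG) := exists m, [/\ (0 < m)%N, hcl m b & forall y, b * y = y * b].

Let mulL (a : HG) : op_linear (fun u : U => a * u : U).
by move=> c u v;rewrite mulrDr scalerAr. Qed.
Lemma inE'_submod xs : (forall b, b \in xs -> good_even b) ->
 submod (U := U) z (@hpr k _) Ess (inE' (G := G) xs).
move=> gx;have cen b : b \in xs -> forall y, b * y = y * b by move=> /gx[m []].
split.
- exact: inE'0.
- move=> a u v hu hv;apply: inE'D => //;rewrite -[u]mul1r scalerAl;exact: inE'M.
- by move=> j u hu;apply: inE'M.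
- by move=> n u;apply: inE'_hpr => b /gx[m [_ h _]];exists m.
exact: inE'_Ess.
Qed.
(** One application of [nz_step] for each element of the regular sequence. *)
Lemma koszul_nz xs : (forall b, b \in xs -> good_even b) -> regl (G := G) xs ->
 nz (U := U) z Ess 1%N (inE' (G := G) [::]) -> nz (U := U) z Ess (size xs).+1 (inE' (G := G) xs).
elim: xs => // b xs IH gx [rx bx] n1.
have gxs b' : b' \in xs -> good_even b' by move=> h;apply: gx;rewrite inE h orbT.
have [m [m0 hm bC]] := gx b (mem_head _ _).
have cen b' : b' \in xs -> forall y, b' * y = y * b' by move=> /gxs[m' []].
have zC i j (y : HG) : x i * (x j * y) = x j * (x i * y) by rewrite mulrA (xC i (x j)) -mulrA.
have bz j (y : HG) : b * (x j * y) = x j * (b * y) by rewrite mulrA (bC (x j)) -mulrA.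
have := @nz_step k U d z e (@hpr k _) (fun j => mulL _) _ (fun n => par_prL n) _ _ e0 (@hpr_sum k _) _
 Ess E0 EL _ _ E_fg (fun y => b * y) m (mulL b) _ _ m0 _ (size xs).+1 (inE' xs) (inE'_submod gxs) _ _ (IH gxs rx n1).
move=> H;suff -> : inE' (G := G) (b :: xs) = (fun y => Ess y /\ exists2 u, Ess u & inE' xs (y - b * u)).
 apply: H.
 - exact: zC.
 - by move=> n j y;rewrite addnC;apply: hpr_mul.
 - by move=> n j y;apply: hpr_mul_lt.
 - by move=> n y;rewrite hpr_hpr eqxx.
 - by move=> j y;apply: EM.
 - by move=> n y;apply: Ess_hpr.
 - exact: bz.
 - by move=> n y;rewrite addnC;apply: hpr_mul.
 - by move=> y;apply: EM.
 - by move=> y;apply: inE'M.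
 by move=> y _;apply: bx.
apply/funext => y;apply/propext;split=> [h|[_ [u Eu h]]];last by exists u.
by split;[exact: inE'_Ess h|case: h => u Eu h;exists u].
Qed.
Lemma koszul_H1 xs : (forall b, b \in xs -> good_even b) -> regl (G := G) xs -> (d <= size xs)%N ->
 forall f : 'I_d -> HG, (forall j, Ess (f j)) -> \sum_j x j * f j = 0 ->
 exists F : 'I_d -> 'I_d -> HG, [/\ forall i j, Ess (F i j), forall j, f j = \sum_i x i * F i j,
  forall i j, F i j = - F j i & forall i, F i i = 0].
move=> gx rx dx f Ef rf.
pose f1 (S : {set 'I_d}) : U := \sum_(j | S == [set j]) f j.
have f1E j : f1 [set j] = f j.
 by rewrite /f1 (big_pred1 j) // => i;rewrite (inj_eq set1_inj) eq_sym.
have f10 (S : {set 'I_d}) : #|S| != 1%N -> f1 S = 0.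
 by move=> S1;rewrite /f1 big_pred0 // => j;apply: contraNF S1 => /eqP ->;rewrite cards1.
have [g Eg Hg] : bdr (U := U) z Ess (inE' (G := G) [::]) f1.
 apply: contrapT => nb;have : nz (U := U) z Ess 1%N (inE' (G := G) [::]).
  exists f1;split=> //;split=> S.
   by rewrite /f1;elim/big_rec: _ => [|j u _ hu];[exact: E0|exact: ED].
  rewrite /= /bd;have [->|/set0Pn[i iS]] := eqVneq S set0.
   rewrite -[RHS]rf;apply: eq_big => [j|j _];first by rewrite inE.
   rewrite setU0 f1E (_ : sgn _ j set0 = 1) ?scale1r // /sgn (_ : [set _ in _ | _] = set0) ?cards0 //.
   by apply/setP => t;rewrite !inE.
  rewrite big1 // => j jS;rewrite f10 ?mulr0 ?scaler0 // cardsU1 jS (cardsD1 i) iS;lia.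
 move/(koszul_nz gx rx);apply: (@nz_large k U d z (@hpr k _) (fun j => mulL _) Ess E0) => //.
 exact: inE'_submod.
(* The components of the bounding 2-chain g, with their Koszul signs, form the alternating
   matrix. *)
pose F (i j : 'I_d) : HG := if i == j then 0 else sgn k i [set j] *: (g (i |: [set j]) : HG).
exists F;split.
- move=> i j;rewrite /F;case: eqP => _;first exact: E0.
 by rewrite -[_ *: _]addr0;apply: EL.
- move=> j;have := Hg [set j];rewrite f1E => /eqP;rewrite subr_eq0 => /eqP ->.
 rewrite /bd [RHS](bigD1 j) //= /F eqxx mulr0 add0r;apply: eq_big => i;first by rewrite inE.
 by rewrite inE => /negbTE ->;rewrite scalerAr.
- move=> i j;rewrite /F eq_sym;case: (eqVneq j i) => [_|ij];first by rewrite oppr0.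
 rewrite setUC -scaleNr;congr (_ *: _).
 have sg (a b : 'I_d) : sgn k a [set b] = (-1) ^+ (b < a)%N.
  rewrite /sgn;congr (_ ^+ _);case: ltnP => h.
   rewrite (_ : [set _ in _ | _] = [set b]) ?cards1 //;apply/setP => t;rewrite !inE.
   by case: eqP => [->|//];rewrite h.
  rewrite (_ : [set _ in _ | _] = set0) ?cards0 //;apply/setP => t;rewrite !inE.
  by case: eqP => [->|//];rewrite ltnNge h.
 rewrite !sg;case: (ltngtP i j) => [_|_|/val_inj eij];first by rewrite opprK.
  by [].
 by rewrite eij eqxx in ij.
by move=> i;rewrite /F eqxx.
Qed.
End KoszulEss.

End Essential.
Import -(notations) mpoly.
Import Essential.

Theorem theorem2 (p : nat) (k : fieldType) (gT : finGroupType) (G C : {group gT})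
    (d : nat) (zeta : 'I_d -> 'H^*(G, k))
    (p_prime : prime p) (char_k : p \in [pchar k]%R) (pG : (p.-group G)%g)
    (G_factor : ~ has_abelem_p2_factor p G)
    (C_largest : largest_central_abelem p G C)
    (zeta_homogeneous : forall i, homogeneous (zeta i))
    (Res_zeta_hsop : hsop (@homogeneous k (subg_of C))
       (fun i => Res (largest_central_abelem_sub C_largest) (zeta i))) :
  free_fg_module zeta (@Ess k gT G).
Proof.
set sCG := largest_central_abelem_sub C_largest in Res_zeta_hsop *.
have [aC CZ _] := C_largest.
have h i : exists nf : nat * (seq gT -> k), zt G nf.1 nf.2 /\ zeta i = fcl G nf.1 nf.2.
  by have [n hn] := (homogeneousP _).1 (zeta_homogeneous i); have [f zf ef] := hcl_fclP hn; exists (n, f).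
have [nf hnf] := choice h; pose e i := (nf i).1; pose f i := (nf i).2.
have zf i : zt G (e i) (f i) := (hnf i).1.
have xf i : zeta i = fcl G (e i) (f i) := (hnf i).2.
pose rz i : 'H^*(C, k) := fcl C (e i) (f i).
have erz : (fun i => Res sCG (zeta i)) = rz.
  by apply/funext => i; apply: etrans (congr1 _ (xf i)) _; exact: (fcl_Res sCG (zf i)).
move: Res_zeta_hsop; rewrite erz => -[_ ind fg].
have zfC i : zt C (e i) (f i) := zt_sub sCG (zf i).
have hrz i : hcl (e i) (rz i) := hcl_fcl (zfC i).
have e0 i : (0 < e i)%N by have [] := indep_degree ind (hrz i).
have ev i : (~~ (odd (e i) && ((-1) != 1 :> k)))%R by have [] := indep_degree ind (hrz i).
have rzf i : rz i = fcl C (e i) (f i) by [].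
(* The finiteness over the parameters of H(C) starts the induction over subgroups. *)
have nC := fg_noeth_top zfC rzf e0 ev fg.
have [S [SE Sg]] := ess_fg p_prime char_k pG C_largest (par_evens e0 ev) (par_cocycles zf) nC.
rewrite (par_zop zf xf ev) in Sg.
(* The number d of parameters is at most the rank of C, which is the length of the regular sequence
   ys obtained next. *)
have led := growth p_prime char_k aC hrz (par_central zfC rzf ev) ind.
have [ys [sy ry gy]] := xi_sequence p_prime char_k pG G_factor aC CZ.
have gy' b : b \in ys -> good_even b.
  move=> /gy ib; have bC := inflated_even_central (y := b) _ ib.
  by case: ib => K [m [f' [[_ _ m0 _] zf' eb _]]]; exists m; split=> //; rewrite eb; apply: hcl_fcl.
have [E0 ED EM] := @Ess_ideal k gT G.
have xC := par_central zf xf ev; have hx := par_hcl zf xf.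
apply: (free_of_syzygies (e := e) (pr := @hpr k _)) => //.
- exact: par_prL.
- exact: par_prz zf xf.
- exact: par_prz0 zf xf.
- by move=> y; have [M hM] := hpr_sum y; exists M; apply: hM.
- by move=> m n y; apply: hpr_hpr.
- move=> a u v hu hv; apply: ED => //; rewrite -[u]GRing.mul1r GRing.scalerAl; by have [] := EM (a%:A)%R u hu.
- by move=> j u hu; have [] := EM (zeta j) u hu.
- by move=> n u; apply: Ess_hpr.
- by exists S; split=> [n y /SE[]|n y Ey hy]; [split|apply: Sg].
apply: (koszul_H1 hx xC e0 _ gy' ry); last by rewrite sy.
by exists S; split=> [n y /SE[]|n y [Ey hy]]; [split|apply: Sg].
Qed.
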